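(* Let $p\in\mathbb{N}$ and assume (A1) and (A2). Suppose the operator $\mathcal{I}-\mathcal{K}$ is injective on $L_2(I_{2\pi}^2)$, $g\in H_p(I_{2\pi}^2)$, $0<b<\min\{\frac{C_0^2}{\sqrt2M_0M_1},\frac{R_0}{2}\}$, and $q>0$ satisfies $qb\ge p/2$. Then there exists a constant $c>0$ such that for all sufficiently large $n$ and every $\varphi\in H_p(I_{2\pi}^2)$, $$\|(\mathcal{I}-\widetilde{\mathcal{K}}_n)\mathcal{P}_n\varphi\|\ge c\,\|\mathcal{P}_n\varphi\|,$$ and $$\|\rho-\tilde\rho_n\|\le c\,N^{-p/2}\ln N\,\|\rho\|_{H_p},$$ where $\rho$ is the solution of $(\mathcal{I}-\mathcal{K})\rho=g$ and $\tilde\rho_n\in X_n$ is the solution of $\tilde\rho_n-\widetilde{\mathcal{K}}_n\tilde\rho_n=\mathcal{P}_ng$ (here $\widetilde{\mathcal{K}}_n$ and $\tilde\rho_n$ depend on $q$).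
   Context: $I_{2\pi}=[0,2\pi)$. Let $\Gamma=[\gamma_0,\gamma_1,\gamma_2]^T:\mathbb{R}^2\to\mathbb{R}^3$ have $2\pi$-biperiodic differentiable components, with $\Gamma|_{I_{2\pi}^2}$ parametrizing the smooth boundary of a bounded open region in $\mathbb{R}^3$ that is $C^\infty$-diffeomorphic to a torus. For $\mathbf{a},\mathbf{b}\in\mathbb{C}^3$, $\mathbf{a}\cdot\mathbf{b}=\sum_ja_jb_j$, $\times$ the usual cross product, $\|\mathbf{a}\|_2=(\sum_j|a_j|^2)^{1/2}$; for matrices $\|\cdot\|_2$ is the induced operator norm. Kernel $K(\boldsymbol\theta,\boldsymbol\eta)=-\frac{1}{2\pi}\frac{(\Gamma(\boldsymbol\theta)-\Gamma(\boldsymbol\eta))\cdot(\frac{\partial\Gamma}{\partial\eta_0}\times\frac{\partial\Gamma}{\partial\eta_1})(\boldsymbol\eta)}{\|\Gamma(\boldsymbol\theta)-\Gamma(\boldsymbol\eta)\|_2^3}$; $(\mathcal{K}\varphi)(\boldsymbol\theta)=\int_{I_{2\pi}^2}K(\boldsymbol\theta,\boldsymbol\eta)\varphi(\boldsymbol\eta)d\boldsymbol\eta$ on $L_2(I_{2\pi}^2)$, norm $\|\cdot\|$, inner product $\langle f,g\rangle=\int f\bar g$; $\mathcal{I}$ is the identity. For $\mathbf{k}=[k_0,k_1]\in\mathbb{Z}^2$, $e_{\mathbf{k}}(\boldsymbol\theta)=\frac{1}{2\pi}e^{i(k_0\theta_0+k_1\theta_1)}$, $\|\mathbf{k}\|_1=|k_0|+|k_1|$,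 $\hat\varphi_{\mathbf{k}}=\langle\varphi,e_{\mathbf{k}}\rangle$, $K_{\mathbf{k},\mathbf{l}}=\langle\mathcal{K}e_{\mathbf{l}},e_{\mathbf{k}}\rangle$. For $n\in\mathbb{N}$: $N=(2n+1)^2$, $X_n=\mathrm{span}\{e_{\mathbf{k}}:\mathbf{k}\in\{-n,\dots,n\}^2\}$, $\mathcal{P}_n$ the orthogonal projection onto $X_n$; $\widetilde K_{\mathbf{k},\mathbf{l}}=K_{\mathbf{k},\mathbf{l}}$ if $\|\mathbf{k}-\mathbf{l}\|_1\le q\ln N$ and $0$ otherwise; $\widetilde{\mathcal{K}}_n$ is the integral operator with kernel $\sum_{\mathbf{k},\mathbf{l}\in\{-n,\dots,n\}^2}\widetilde K_{\mathbf{k},\mathbf{l}}e_{\mathbf{k}}(\boldsymbol\theta)\overline{e_{\mathbf{l}}(\boldsymbol\phi)}$. For $p\in\mathbb{N}$, $H_p(I_{2\pi}^2)=\{\varphi\in L_2(I_{2\pi}^2):\|\varphi\|_{H_p}<\infty\}$ with $\|\varphi\|_{H_p}=\big(\sum_{\mathbf{k}\in\mathbb{Z}^2}(1+k_0^2+k_1^2)^p|\hat\varphi_{\mathbf{k}}|^2\big)^{1/2}$. For $\boldsymbol\theta\in\mathbb{R}^2$, $\zeta(\boldsymbol\theta)=\sqrt{\mathrm{dist}(\theta_0,2\pi\mathbb{Z})^2+\mathrm{dist}(\theta_1,2\pi\mathbb{Z})^2}$; $\mathbb{W}(r)=\{z\in\mathbb{C}:|\mathrm{Im}\,z|<r\}$.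 (A1): there is $C_0>0$ with $\|\Gamma(\boldsymbol\theta)-\Gamma(\boldsymbol\eta)\|_2\ge C_0\zeta(\boldsymbol\theta-\boldsymbol\eta)$ for all $\boldsymbol\theta,\boldsymbol\eta\in I_{2\pi}^2$. (A2): there is $R_0>0$ such that each $\gamma_j$ extends analytically to the closure of $\mathbb{W}(R_0)^2\subset\mathbb{C}^2$. With $D\gamma_j$ the complex gradient, $\mathbf{H}_j$ the complex Hessian, $\mathrm{Re}(\mathbf{z})=[\mathrm{Re}\,z_0,\mathrm{Re}\,z_1]$: $M_{0,j}=\sup_{\mathbf{z}\in\mathbb{W}(R_0)^2}\|D\gamma_j(\mathbf{z})+D\gamma_j(\mathrm{Re}(\mathbf{z}))\|_2$, $M_{1,j}=\sup_{\mathbf{z}\in\mathbb{W}(R_0)^2}\|\mathbf{H}_j(\mathbf{z})\|_2$, $M_0=(\sum_jM_{0,j}^2)^{1/2}$, $M_1=(\sum_jM_{1,j}^2)^{1/2}$. *)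

(* Defs.v *)
From HB Require Import structures.
From mathcomp Require Import all_boot all_order all_algebra.
From mathcomp Require Import all_classical all_reals all_analysis.
From mathcomp Require Import complex.
Set Implicit Arguments.
Unset Strict Implicit.
Unset Printing Implicit Defensive.
Import Order.TTheory GRing.Theory Num.Theory.
Import numFieldNormedType.Exports.
Local Open Scope classical_set_scope.
Local Open Scope ring_scope.

Section Defs.
Variable R : realType.
Local Notation C := (R[i]).

Definition toC (x : R) : C := Complex x 0.
Definition cabs2 (z : C) : R := complex.Re z ^+ 2 + complex.Im z ^+ 2.
Definition cexpi (x : R) : C := Complex (cos x) (sin x).

Definition I2 : set (R * R) := `[0, 2 * pi[ `*` `[0, 2 * pi[.
Definition mu2 := (@lebesgue_measure R \x @lebesgue_measure R)%E.

Definition cint (f : R * R -> C) : C :=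
  Complex (Rintegral mu2 I2 (fun x => complex.Re (f x)))
          (Rintegral mu2 I2 (fun x => complex.Im (f x))).

Definition cinner (f g : R * R -> C) : C := cint (fun x => f x * conjc (g x)).

Definition inL2 (f : R * R -> C) : Prop :=
  [/\ measurable_fun I2 (fun x => complex.Re (f x)),
      measurable_fun I2 (fun x => complex.Im (f x)) &
      (\int[mu2]_(x in I2) (cabs2 (f x))%:E < +oo)%E].

Definition L2norm (f : R * R -> C) : R :=
  Num.sqrt (Rintegral mu2 I2 (fun x => cabs2 (f x))).

Definition L2zero (f : R * R -> C) : Prop :=
  (\int[mu2]_(x in I2) (cabs2 (f x))%:E = 0)%E.

Definition ebasis (k : int * int) (t : R * R) : C :=
  toC ((2 * pi)^-1) * cexpi (k.1%:~R * t.1 + k.2%:~R * t.2).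

Definition fcoef (phi : R * R -> C) (k : int * int) : C := cinner phi (ebasis k).

Definition Hp_weight (p : nat) (k : int * int) : R :=
  (1 + (k.1%:~R) ^+ 2 + (k.2%:~R) ^+ 2) ^+ p.

Definition Hp_sum (p : nat) (phi : R * R -> C) : \bar R :=
  (\esum_(k in [set: int * int]) ((Hp_weight p k * cabs2 (fcoef phi k))%:E))%E.

Definition inHp (p : nat) (phi : R * R -> C) : Prop :=
  inL2 phi /\ (Hp_sum p phi < +oo)%E.

Definition Hp_norm (p : nat) (phi : R * R -> C) : \bar R :=
  if (Hp_sum p phi < +oo)%E then (Num.sqrt (fine (Hp_sum p phi)))%:E else (+oo)%E.

Definition Nn (n : nat) : nat := (2 * n + 1)%N.
Definition NN (n : nat) : nat := (Nn n ^ 2)%N.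
(* the index i : 'I_(2n+1) stands for the integer i - n in {-n,...,n} *)
Definition idx (n : nat) (i : 'I_(Nn n)) : int := (i%:Z - n%:Z)%R.

Definition Pn (n : nat) (phi : R * R -> C) (t : R * R) : C :=
  \sum_(i < Nn n) \sum_(j < Nn n)
     fcoef phi (idx i, idx j) * ebasis (idx i, idx j) t.

Definition inXn (n : nat) (f : R * R -> C) : Prop :=
  exists a : 'I_(Nn n) -> 'I_(Nn n) -> C,
    forall t, f t = \sum_(i < Nn n) \sum_(j < Nn n) a i j * ebasis (idx i, idx j) t.

Definition dot3 (u v : 'rV[R]_3) : R := \sum_(i < 3) u 0 i * v 0 i.
Definition cross3 (u v : 'rV[R]_3) : 'rV[R]_3 :=
  \row_(i < 3)
    (if i == 0 then u 0 1 * v 0 2 - u 0 2 * v 0 1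
     else if i == 1 then u 0 2 * v 0 0 - u 0 0 * v 0 2
     else u 0 0 * v 0 1 - u 0 1 * v 0 0).
Definition vnorm3 (u : 'rV[R]_3) : R := Num.sqrt (dot3 u u).

Definition dGamma0 (G : R * R -> 'rV[R]_3) (t : R * R) : 'rV[R]_3 :=
  'D_((1 : R), (0 : R)) G t.
Definition dGamma1 (G : R * R -> 'rV[R]_3) (t : R * R) : 'rV[R]_3 :=
  'D_((0 : R), (1 : R)) G t.

Definition Kker (G : R * R -> 'rV[R]_3) (t e : R * R) : R :=
  - (2 * pi)^-1 *
  (dot3 (G t - G e) (cross3 (dGamma0 G e) (dGamma1 G e)) / (vnorm3 (G t - G e)) ^+ 3).

Definition intop (Kern : R * R -> R * R -> C) (phi : R * R -> C) (t : R * R) : C :=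
  cint (fun e => Kern t e * phi e).

Definition Kop (G : R * R -> 'rV[R]_3) : (R * R -> C) -> R * R -> C :=
  intop (fun t e => toC (Kker G t e)).

Definition Kmat (G : R * R -> 'rV[R]_3) (k l : int * int) : C :=
  cinner (Kop G (ebasis l)) (ebasis k).

Definition Ktilde_coef (G : R * R -> 'rV[R]_3) (q : R) (n : nat) (k l : int * int) : C :=
  if ((`|k.1 - l.1| + `|k.2 - l.2|)%:~R <= q * ln ((NN n)%:R : R))
  then Kmat G k l else 0.

Definition Ktilde_kernel (G : R * R -> 'rV[R]_3) (q : R) (n : nat) (t s : R * R) : C :=
  \sum_(i < Nn n) \sum_(j < Nn n) \sum_(i' < Nn n) \sum_(j' < Nn n)
    Ktilde_coef G q n (idx i, idx j) (idx i', idx j') *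
    ebasis (idx i, idx j) t * conjc (ebasis (idx i', idx j') s).

Definition Ktilde (G : R * R -> 'rV[R]_3) (q : R) (n : nat) :
  (R * R -> C) -> R * R -> C := intop (Ktilde_kernel G q n).

Definition dist2piZ (x : R) : R :=
  inf [set `|x - 2 * pi * m%:~R| | m in [set: int]].
Definition zeta (t : R * R) : R := Num.sqrt (dist2piZ t.1 ^+ 2 + dist2piZ t.2 ^+ 2).

Definition assumption_A1 (G : R * R -> 'rV[R]_3) (C0 : R) : Prop :=
  0 < C0 /\
  forall t e, I2 t -> I2 e ->
    C0 * zeta (t.1 - e.1, t.2 - e.2) <= vnorm3 (G t - G e).

Definition strip (r : R) : set C^o := [set z | `|complex.Im z| < r].
Definition strip2 (r : R) : set (C^o * C^o) := strip r `*` strip r.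

(* F : C^2 -> C is an analytic extension of gam : R^2 -> R to the closure of
   W(r)^2: F is holomorphic (complex Frechet differentiable) on an open set
   containing the closure of W(r)^2 and agrees with gam on R^2 *)
Definition analytic_ext (r : R) (gam : R * R -> R) (F : C^o * C^o -> C^o) : Prop :=
  exists U : set (C^o * C^o),
    [/\ open U, closure (strip2 r) `<=` U,
        (forall z, U z -> differentiable F z) &
        forall x : R * R, F (toC x.1, toC x.2) = toC (gam x)].

Definition cd0 (F : C^o * C^o -> C^o) : C^o * C^o -> C^o := 'D_((1 : C), (0 : C)) F.
Definition cd1 (F : C^o * C^o -> C^o) : C^o * C^o -> C^o := 'D_((0 : C), (1 : C)) F.
Definition cpartial (a : 'I_2) (F : C^o * C^o -> C^o) : C^o * C^o -> C^o :=
  if a == 0 then cd0 F else cd1 F.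

Definition reP (z : C^o * C^o) : C^o * C^o := (toC (complex.Re z.1), toC (complex.Re z.2)).

Definition cvnorm (v : 'cV[C]_2) : R := Num.sqrt (\sum_(i < 2) cabs2 (v i 0)).
Definition opnorm2 (H : 'M[C]_2) : R :=
  sup [set cvnorm (H *m v) | v in [set v : 'cV[C]_2 | cvnorm v = 1]].

Definition cgrad (F : C^o * C^o -> C^o) (z : C^o * C^o) : 'cV[C]_2 :=
  \col_(a < 2) (cpartial a F z : C).
Definition chess (F : C^o * C^o -> C^o) (z : C^o * C^o) : 'M[C]_2 :=
  \matrix_(a < 2, b < 2) (cpartial a (cpartial b F) z : C).

Definition M0j (r : R) (F : C^o * C^o -> C^o) : R :=
  sup [set cvnorm (cgrad F z + cgrad F (reP z)) | z in strip2 r].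
Definition M1j (r : R) (F : C^o * C^o -> C^o) : R :=
  sup [set opnorm2 (chess F z) | z in strip2 r].
Definition M0 (r : R) (F : 'I_3 -> C^o * C^o -> C^o) : R :=
  Num.sqrt (\sum_(j < 3) M0j r (F j) ^+ 2).
Definition M1 (r : R) (F : 'I_3 -> C^o * C^o -> C^o) : R :=
  Num.sqrt (\sum_(j < 3) M1j r (F j) ^+ 2).

Definition biperiodic (G : R * R -> 'rV[R]_3) : Prop :=
  forall t : R * R, G (t.1 + 2 * pi, t.2) = G t /\ G (t.1, t.2 + 2 * pi) = G t.

Definition iterD (V W : normedModType R) (vs : seq V) (f : V -> W) : V -> W :=
  foldr (fun v g => 'D_v g) f vs.
Definition smooth_on (V W : normedModType R) (U : set V) (f : V -> W) : Prop :=
  forall vs : seq V,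
    (forall x, U x -> {for x, continuous (iterD vs f)}) /\
    (forall v x, U x -> derivable (iterD vs f) x v).

Definition diffeomorphic3 (A B : set 'rV[R]_3) : Prop :=
  exists f g : 'rV[R]_3 -> 'rV[R]_3,
    [/\ (forall x, A x -> B (f x)), (forall y, B y -> A (g y)),
        (forall x, A x -> g (f x) = x), (forall y, B y -> f (g y) = y) &
        smooth_on A f /\ smooth_on B g].

Definition solid_torus : set 'rV[R]_3 :=
  [set x | (Num.sqrt (x 0 0 ^+ 2 + x 0 1 ^+ 2) - 2) ^+ 2 + x 0 2 ^+ 2 < 1].

(* Gamma|_{I^2} parametrizes the (smooth) boundary of a bounded open region
   that is C^oo-diffeomorphic to a (solid) torus *)
Definition torus_boundary (G : R * R -> 'rV[R]_3) : Prop :=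
  exists Omega : set 'rV[R]_3,
    [/\ open Omega, bounded_set Omega, diffeomorphic3 solid_torus Omega,
        closure Omega `\` Omega = G @` I2 &
        forall t e, I2 t -> I2 e -> G t = G e -> t = e].

End Defs.

(* Main.v *)
(* The kernel extends holomorphically in a common shift of both arguments: in
   K(t, t + s) replace t by t + i y. By (A1), (A2) and the mean value theorem,
   the real part of the squared distance stays above
   (C0^2 - sqrt 2 b' M0 M1) |s|^2 when |y_j| <= b', so the extended kernel is
   bounded by a constant over |s|. Shifting the contours in t then gives
   |K_{k,l}| <= V exp(-b' |k - l|_1) for every b' below the critical width, and
   we fix b < b'. The Riemann-Lebesgue lemma in s shows moreover that
   K_{l+m,l} -> 0 as l -> oo.
   In l^2 the equation becomes an infinite system I - A. Exponential decay
   and Schur's test control the truncation by exp(-b q ln N) <= N^(-p/2), while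
   compactness and injectivity give the uniform lower bound for the truncated
   sections. The error estimate follows by applying the lower bound to the
   difference of the Fourier coefficients of rho and rho_n, whose residual is
   estimated by Schur's test and by the H_p tail of rho. *)

Require Import Defs.
From HB Require Import structures.
From mathcomp Require Import all_boot all_order all_algebra.
From mathcomp Require Import all_classical all_reals all_analysis.
From mathcomp Require Import measurable_realfun lebesgue_integral_fubini.
From mathcomp Require Import complex ring lra zify.
Import Order.TTheory GRing.Theory Num.Theory.
Import numFieldNormedType.Exports.
Local Open Scope classical_set_scope.
Local Open Scope ring_scope.
Import Normc.
Set Implicit Arguments.
Unset Strict Implicit.
Unset Printing Implicit Defensive.

(** * Complex integrals on the torus *)

(** The constants come from one factorization. If d is the real increment of a component of Gamma
    and A its continuation to z, then A^2 - d^2 = (A - d)(A + d). The sum is controlled by the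
    gradients at z and at Re z, whence the two gradients in M0; the difference by the Hessian times
    |Im z| <= sqrt 2 b', whence M1 and the factor sqrt 2. The strict inequality b < b' matters: the
    surplus b' - b pays for summing the tail over |m|_1 > q ln N, so no power of ln N is lost. The
    error is bounded without the logarithm, which enters only as a factor at least 1. Off-diagonal
    decay alone does not make A compact, since the identity decays too. Entries tending to 0 along
    each diagonal make the column sums vanish at infinity, and in Schur's test the product of row
    and column bounds counts, so small columns suffice. M0, M1 and the numerator involve derivatives
    of the extensions, which are only assumed complex differentiable. Cauchy's theory must therefore
    show that these derivatives are again holomorphic, and an identity theorem carries periodicity
    from the reals to the strip. *)

Section measures.
Variable R : realType.
Local Notation leb := (@lebesgue_measure R).
Local Notation TR := (measurableTypeR R).

Definition per_itv : set TR := `[0, 2 * pi[%classic.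
Lemma measurable_per_itv : measurable per_itv. Proof. exact: measurable_itv. Qed.

(* Lebesgue measure restricted to one period, but defined on all subsets of R, so that integrals over the torus are integrals over setT against a finite measure. *)
Definition mu_per : set TR -> \bar R := fun X => leb (X `&` per_itv).
HB.instance Definition _ := Measure.copy mu_per (mrestr leb measurable_per_itv).

Lemma pi2_gt0 : 0 < 2 * pi :> R.
Proof. by rewrite mulr_gt0 ?pi_gt0. Qed.

Lemma m1T : mu_per setT = (2 * pi)%:E.
Proof.
by rewrite /mu_per setTI /per_itv lebesgue_measure_itv/= lte_fin pi2_gt0 sube0.
Qed.

Let m1_fin : fin_num_fun mu_per.
Proof.
move=> A mA; rewrite ge0_fin_numE ?measure_ge0//.
apply: (@le_lt_trans _ _ (mu_per setT)); last by rewrite m1T ltry.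
by apply: le_measure => //; rewrite inE.
Qed.
HB.instance Definition _ := @Measure_isFinite.Build _ _ _ mu_per m1_fin.

Definition mu_per2 : set (TR * TR) -> \bar R := (mu_per \x mu_per)%E.
HB.instance Definition _ := Measure.on mu_per2.

Lemma mIT : mu_per2 setT = ((2 * pi) * (2 * pi))%:E.
Proof. by rewrite /mu_per2 -setXTT product_measure1E// EFinM; congr (_ * _)%E; exact: m1T. Qed.

Let mI_fin : fin_num_fun mu_per2.
Proof.
move=> A mA; rewrite ge0_fin_numE ?measure_ge0//.
apply: (@le_lt_trans _ _ (mu_per2 setT)); last by rewrite mIT ltry.
by apply: le_measure => //; rewrite inE.
Qed.
HB.instance Definition _ := @Measure_isFinite.Build _ _ _ mu_per2 mI_fin.

Lemma measurable_I2 : measurable ((@I2 R) : set (TR * TR)).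
Proof. by apply: measurableX; exact: measurable_itv. Qed.

(** The product of the restrictions and the restriction of the product agree on rectangles, hence on
    all measurable sets. *)
Lemma mIE (A : set (TR * TR)) : measurable A -> mu_per2 A = (leb \x leb)%E (A `&` (@I2 R)).
Proof.
move=> mA; rewrite /mu_per2.
rewrite (@product_measure_unique _ _ _ _ _ mu_per mu_per (mrestr (leb \x leb)%E measurable_I2))//.
move=> X Y mX mY; rewrite /mrestr /=.
have mXI : measurable (X `&` per_itv) by apply: measurableI => //; exact: measurable_per_itv.
have mYI : measurable (Y `&` per_itv) by apply: measurableI => //; exact: measurable_per_itv.
have H := product_measure1E leb leb mXI mYI.
by rewrite setXI in H; exact: H.
Qed.

Lemma integral_mu2 (f : R * R -> \bar R) :
  (\int[@mu2 R]_(x in (@I2 R)) f x = \int[mu_per2]_x (f \_ (@I2 R)) x)%E.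
Proof.
rewrite /mu2 -integral_mkcond; apply: eq_measure_integral => A mA AI.
by rewrite [RHS]mIE// setIidl.
Qed.

Lemma mu_per2_I2C : mu_per2 (~` (@I2 R)) = 0%E.
Proof. by rewrite mIE ?setICl ?measure0//; apply: measurableC; exact: measurable_I2. Qed.

Lemma ae_I2 : {ae mu_per2, forall x, (@I2 R) x}.
Proof.
by exists (~` (@I2 R)); split; [apply: measurableC; exact: measurable_I2|exact: mu_per2_I2C|].
Qed.

End measures.

Section cplx.
Variable R : realType.
Local Notation C := (R[i]).
Implicit Types z w : C.

Lemma normcE z : normc z = Num.sqrt (complex.Re z ^+ 2 + complex.Im z ^+ 2).
Proof. by case: z. Qed.
Lemma normc_ge0 z : 0 <= normc z. Proof. by rewrite normcE sqrtr_ge0. Qed.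
Lemma cabs2E z : cabs2 z = normc z ^+ 2.
Proof. by rewrite normcE sqr_sqrtr// addr_ge0 ?sqr_ge0. Qed.
Lemma Re_le_normc z : `|complex.Re z| <= normc z.
Proof. by rewrite normcE -sqrtr_sqr ler_sqrt ?addr_ge0 ?sqr_ge0// lerDl sqr_ge0. Qed.
Lemma Im_le_normc z : `|complex.Im z| <= normc z.
Proof. by rewrite normcE -sqrtr_sqr ler_sqrt ?addr_ge0 ?sqr_ge0// lerDr sqr_ge0. Qed.
Lemma normc_leD z : normc z <= `|complex.Re z| + `|complex.Im z|.
Proof.
rewrite normcE -(@ler_pXn2r _ 2) ?nnegrE ?sqrtr_ge0 ?addr_ge0//.
rewrite sqr_sqrtr ?addr_ge0 ?sqr_ge0// sqrrD !real_normK ?num_real//.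
by rewrite -addrA [leRHS](_ : _ = complex.Re z ^+ 2 + complex.Im z ^+ 2 + `|complex.Re z| * `|complex.Im z| *+ 2); [rewrite lerDl mulrn_wge0 ?mulr_ge0|ring].
Qed.
Lemma ler_normcD z w : normc (z + w) <= normc z + normc w.
Proof. exact: (@le_normcD R). Qed.
Lemma normcN z : normc (- z) = normc z. Proof. exact: (@normcN R). Qed.
Lemma ler_normcB z w : normc (z - w) <= normc z + normc w.
Proof. by rewrite -(normcN w) ler_normcD. Qed.
Lemma distcC z w : normc (z - w) = normc (w - z).
Proof. by rewrite -normcN opprB. Qed.
Lemma normc_toC (x : R) : normc (toC x) = `|x|.
Proof. by rewrite /= expr0n addr0 sqrtr_sqr. Qed.
Lemma normc_cexpi (x : R) : normc (cexpi x) = 1.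
Proof. by rewrite /= cos2Dsin2 sqrtr1. Qed.
Lemma normcJ z : normc (conjc z) = normc z.
Proof. by case: z => a b /=; rewrite sqrrN. Qed.
Lemma normcX z n : normc (z ^+ n) = normc z ^+ n.
Proof. by elim: n => [|n IH]; rewrite ?expr0 ?normc1// !exprS normcM IH. Qed.
Lemma normc_eq0 z : (normc z == 0) = (z == 0).
Proof.
by apply/eqP/eqP => [/eq0_normc//|->]; rewrite normcE /= expr0n addr0 sqrtr0.
Qed.
Lemma normc0 : normc (0 : C) = 0. Proof. by apply/eqP; rewrite normc_eq0. Qed.
Lemma normc_gt0 z : (0 < normc z) = (z != 0).
Proof. by rewrite lt_def normc_eq0 normc_ge0 andbT. Qed.
Lemma normcBsum z w : normc z - normc w <= normc (z - w).
Proof. by rewrite lerBlDr (le_trans _ (ler_normcD _ _))// subrK. Qed.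
Lemma ler_normc_sum (I : Type) (s : seq I) (P : pred I) (F : I -> C) :
  normc (\sum_(i <- s | P i) F i) <= \sum_(i <- s | P i) normc (F i).
Proof.
elim/big_rec2 : _ => [|i y x _ h]; first by rewrite normc0.
by rewrite (le_trans (ler_normcD _ _))// lerD2l.
Qed.

Lemma toCD (x y : R) : toC (x + y) = toC x + toC y.
Proof. by apply/eqP; rewrite eq_complex /= addr0 !eqxx. Qed.
Lemma toCN (x : R) : toC (- x) = - toC x.
Proof. by apply/eqP; rewrite eq_complex /= oppr0 !eqxx. Qed.
Lemma toCB (x y : R) : toC (x - y) = toC x - toC y.
Proof. by rewrite toCD toCN. Qed.
Lemma toCM (x y : R) : toC (x * y) = toC x * toC y.
Proof. by apply/eqP; rewrite eq_complex /= !(mulr0,mul0r,subr0,addr0) !eqxx. Qed.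
Lemma toC0 : toC 0 = 0 :> C. Proof. by []. Qed.
Lemma toC1 : toC 1 = 1 :> C. Proof. by []. Qed.
Lemma toCX (x : R) n : toC (x ^+ n) = toC x ^+ n.
Proof. by elim: n => [|n IH]; rewrite ?expr0// !exprS toCM IH. Qed.
Lemma toCV (x : R) : toC x^-1 = (toC x)^-1.
Proof. exact: (fmorphV (real_complex R) x). Qed.
Lemma toC_sum (I : Type) (s : seq I) (P : pred I) (F : I -> R) :
  toC (\sum_(i <- s | P i) F i) = \sum_(i <- s | P i) toC (F i).
Proof. by elim/big_rec2 : _ => // i y x _ <-; rewrite toCD. Qed.
Lemma ReD z w : complex.Re (z + w) = complex.Re z + complex.Re w.
Proof. by case: z; case: w. Qed.
Lemma ImD z w : complex.Im (z + w) = complex.Im z + complex.Im w.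
Proof. by case: z; case: w. Qed.
Lemma ReN z : complex.Re (- z) = - complex.Re z. Proof. by case: z. Qed.
Lemma ImN z : complex.Im (- z) = - complex.Im z. Proof. by case: z. Qed.
Lemma ReM z w : complex.Re (z * w) = complex.Re z * complex.Re w - complex.Im z * complex.Im w.
Proof. by case: z; case: w. Qed.
Lemma ImM z w : complex.Im (z * w) = complex.Re z * complex.Im w + complex.Im z * complex.Re w.
Proof. by case: z => a b; case: w => c d /=; ring. Qed.
Lemma ReJ z : complex.Re (conjc z) = complex.Re z. Proof. by case: z. Qed.
Lemma ImJ z : complex.Im (conjc z) = - complex.Im z. Proof. by case: z. Qed.
Lemma complexP z w : complex.Re z = complex.Re w -> complex.Im z = complex.Im w -> z = w.
Proof. by case: z; case: w => a b c d /= -> ->. Qed.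
Lemma Re_sum (I : Type) (s : seq I) (P : pred I) (F : I -> C) :
  complex.Re (\sum_(i <- s | P i) F i) = \sum_(i <- s | P i) complex.Re (F i).
Proof. by elim/big_rec2 : _ => // i y x _ <-; rewrite ReD. Qed.
Lemma mulcJ z : z * conjc z = toC (normc z ^+ 2).
Proof.
by apply: complexP; rewrite ?ReM ?ImM ReJ ImJ -cabs2E /cabs2 /=; ring.
Qed.

Lemma cexpiD (x y : R) : cexpi (x + y) = cexpi x * cexpi y.
Proof. by apply: complexP; rewrite ?ReM ?ImM /= ?cosD ?sinD; ring. Qed.
Lemma cexpi0 : cexpi 0 = 1 :> C. Proof. by rewrite /cexpi cos0 sin0. Qed.
Lemma cexpiN (x : R) : cexpi (- x) = conjc (cexpi x).
Proof. by rewrite /cexpi cosN sinN. Qed.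

End cplx.

(** * Complex-valued measurable and integrable functions *)

Section cintegral.
Context d (T : measurableType d) (R : realType) (mu : {measure set T -> \bar R}).
Variables (D : set T) (mD : measurable D).
Local Notation C := (R[i]).
Implicit Types f g : T -> C.

Definition cmeasurable (f : T -> C) := measurable_fun D (fun x => complex.Re (f x)) /\
  measurable_fun D (fun x => complex.Im (f x)).
Definition cintegrable (f : T -> C) :=
  mu.-integrable D (fun x => (complex.Re (f x))%:E) /\
  mu.-integrable D (fun x => (complex.Im (f x))%:E).
Definition cintg (f : T -> C) : C :=
  Complex (Rintegral mu D (fun x => complex.Re (f x))) (Rintegral mu D (fun x => complex.Im (f x))).

Lemma cmeasD f g : cmeasurable f -> cmeasurable g -> cmeasurable (fun x => f x + g x).
Proof.
move=> [fr fi] [gr gi]; split.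
- by apply: (eq_measurable_fun _ _ (measurable_funD fr gr)) => x _; rewrite ReD.
- by apply: (eq_measurable_fun _ _ (measurable_funD fi gi)) => x _; rewrite ImD.
Qed.
Lemma cmeasN f : cmeasurable f -> cmeasurable (fun x => - f x).
Proof.
move=> [fr fi]; split.
- by apply: (eq_measurable_fun _ _ (measurable_funN fr)) => x _; rewrite ReN.
- by apply: (eq_measurable_fun _ _ (measurable_funN fi)) => x _; rewrite ImN.
Qed.
Lemma cmeasB f g : cmeasurable f -> cmeasurable g -> cmeasurable (fun x => f x - g x).
Proof. by move=> ? ?; apply: cmeasD => //; exact: cmeasN. Qed.
Lemma cmeasM f g : cmeasurable f -> cmeasurable g -> cmeasurable (fun x => f x * g x).
Proof.
move=> [fr fi] [gr gi]; split.
- by apply: (eq_measurable_fun _ _ (measurable_funB (measurable_funM fr gr) (measurable_funM fi gi))) => x _; rewrite ReM.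
- by apply: (eq_measurable_fun _ _ (measurable_funD (measurable_funM fr gi) (measurable_funM fi gr))) => x _; rewrite ImM.
Qed.
Lemma cmeasJ f : cmeasurable f -> cmeasurable (fun x => conjc (f x)).
Proof.
move=> [fr fi]; split.
- by apply: (eq_measurable_fun _ _ fr) => x _; rewrite ReJ.
- by apply: (eq_measurable_fun _ _ (measurable_funN fi)) => x _; rewrite ImJ.
Qed.
Lemma cmeasurable_cst c : cmeasurable (fun=> c).
Proof. by split; exact: measurable_cst. Qed.
Lemma cmeasurable_toC (f : T -> R) : measurable_fun D f -> cmeasurable (fun x => toC (f x)).
Proof. by move=> mf; split => //=; exact: measurable_cst. Qed.
Lemma cmeasurable_sum (I : Type) (s : seq I) (F : I -> T -> C) :
  (forall i, cmeasurable (F i)) -> cmeasurable (fun x => \sum_(i <- s) F i x).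
Proof.
move=> mF; elim: s => [|i s IH].
  by rewrite (_ : (fun _ => _) = fun=> 0); [exact: cmeasurable_cst|apply/funext => x; rewrite big_nil].
rewrite (_ : (fun _ => _) = fun x => F i x + \sum_(j <- s) F j x); first exact: cmeasD.
by apply/funext => x; rewrite big_cons.
Qed.
Lemma measurable_normc f : cmeasurable f -> measurable_fun D (fun x => normc (f x)).
Proof.
move=> [mr mi].
have ms : measurable_fun [set: R] (@Num.sqrt R).
  exact: continuous_measurable_fun (@sqrt_continuous R).
have := measurableT_comp ms (measurable_funD (measurable_funX 2 mr) (measurable_funX 2 mi)).
by apply: eq_measurable_fun => x _; rewrite normcE.
Qed.

Lemma cintegrable_cmeasurable f : cintegrable f -> cmeasurable f.
Proof. by move=> [/measurable_int/measurable_EFinP ? /measurable_int/measurable_EFinP ?]. Qed.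

Lemma le_cintegrable f (h : T -> R) : cmeasurable f ->
  mu.-integrable D (EFin \o h) -> (forall x, D x -> normc (f x) <= h x) -> cintegrable f.
Proof.
move=> [mr mi] ih hf; split; apply: le_integrable ih => //; try exact/measurable_EFinP.
- move=> x Dx; rewrite /= lee_fin; apply: (le_trans _ (ler_norm _)).
  exact: le_trans (Re_le_normc (f x)) (hf _ Dx).
- move=> x Dx; rewrite /= lee_fin; apply: (le_trans _ (ler_norm _)).
  exact: le_trans (Im_le_normc (f x)) (hf _ Dx).
Qed.

Lemma integrable_normc f : cintegrable f -> mu.-integrable D (fun x => (normc (f x))%:E).
Proof.
move=> /[dup] /cintegrable_cmeasurable mf [ir ii].
have ih : mu.-integrable D (fun x => (`|complex.Re (f x)|%:E + `|complex.Im (f x)|%:E)%E).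
  exact: (integrableD mD (integrable_abse ir) (integrable_abse ii)).
apply: le_integrable ih => //; first exact/measurable_EFinP/measurable_normc.
move=> x Dx; rewrite /= lee_fin ger0_norm ?normc_ge0// ger0_norm ?addr_ge0//.
exact: normc_leD.
Qed.

Lemma cintegrableP f : cmeasurable f -> (\int[mu]_(x in D) (normc (f x))%:E < +oo)%E -> cintegrable f.
Proof.
move=> mf h; apply: (@le_cintegrable _ (fun x => normc (f x))) => //.
apply/integrableP; split; first exact/measurable_EFinP/measurable_normc.
by under eq_integral do rewrite /= ger0_norm ?normc_ge0//.
Qed.

Lemma cintegrableD f g : cintegrable f -> cintegrable g -> cintegrable (fun x => f x + g x).
Proof.
move=> [a b] [a' b']; split.
- by apply: (eq_integrable mD _ _ _ (integrableD mD a a')) => // x _; rewrite /= ReD.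
- by apply: (eq_integrable mD _ _ _ (integrableD mD b b')) => // x _; rewrite /= ImD.
Qed.
Lemma cintegrableN f : cintegrable f -> cintegrable (fun x => - f x).
Proof.
move=> [a b]; split.
- by apply: (eq_integrable mD _ _ _ (integrableN a)) => // x _; rewrite /= ReN.
- by apply: (eq_integrable mD _ _ _ (integrableN b)) => // x _; rewrite /= ImN.
Qed.
Lemma cintegrableB f g : cintegrable f -> cintegrable g -> cintegrable (fun x => f x - g x).
Proof. by move=> ? ?; apply: cintegrableD => //; exact: cintegrableN. Qed.
Lemma cintegrable0 : cintegrable (fun=> 0).
Proof. by split; exact: integrable0. Qed.
Lemma cintegrable_sum (I : Type) (s : seq I) (F : I -> T -> C) :
  (forall i, cintegrable (F i)) -> cintegrable (fun x => \sum_(i <- s) F i x).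
Proof.
move=> mF; elim: s => [|i s IH].
  by rewrite (_ : (fun _ => _) = fun=> 0); [exact: cintegrable0|apply/funext => x; rewrite big_nil].
rewrite (_ : (fun _ => _) = fun x => F i x + \sum_(j <- s) F j x); first exact: cintegrableD.
by apply/funext => x; rewrite big_cons.
Qed.
Lemma cintegrableM f g (M : R) : cintegrable f -> cmeasurable g ->
  (forall x, D x -> normc (g x) <= M) -> cintegrable (fun x => f x * g x).
Proof.
move=> /[dup] /cintegrable_cmeasurable mf iF mg gM.
apply: (@le_cintegrable _ (fun x => M * normc (f x))).
- exact: cmeasM.
- by apply: (eq_integrable mD _ _ _ (integrableZl mD M (integrable_normc iF))).
- by move=> x Dx; rewrite normcM mulrC ler_wpM2r ?normc_ge0// gM.
Qed.
Lemma cintegrableZ c f : cintegrable f -> cintegrable (fun x => c * f x).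
Proof.
move=> iF; rewrite (_ : (fun _ => _) = fun x => f x * c); last by apply/funext => x; rewrite mulrC.
by apply: (@cintegrableM f (fun=> c) (normc c)) => //; exact: cmeasurable_cst.
Qed.
Lemma cintegrableJ f : cintegrable f -> cintegrable (fun x => conjc (f x)).
Proof.
move=> [a b]; split.
- by apply: (eq_integrable mD _ _ _ a) => // x _; rewrite /= ReJ.
- by apply: (eq_integrable mD _ _ _ (integrableN b)) => // x _; rewrite /= ImJ.
Qed.

Lemma eq_cintg f g : {in D, f =1 g} -> cintg f = cintg g.
Proof. by move=> fg; congr Complex; apply: eq_Rintegral => x /fg ->. Qed.

Lemma cID f g : cintegrable f -> cintegrable g -> cintg (fun x => f x + g x) = cintg f + cintg g.
Proof.
move=> [a b] [a' b']; apply: complexP; rewrite ?ReD ?ImD /=.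
- by rewrite -RintegralD//; apply: eq_Rintegral => x _; rewrite ReD.
- by rewrite -RintegralD//; apply: eq_Rintegral => x _; rewrite ImD.
Qed.
Lemma cIZ c f : cintegrable f -> cintg (fun x => c * f x) = c * cintg f.
Proof.
move=> [a b]; apply: complexP; rewrite ?ReM ?ImM /=.
- rewrite -!RintegralZl// -RintegralB//; last 2 first.
  + exact: (integrableZl mD _ a).
  + exact: (integrableZl mD _ b).
  by apply: eq_Rintegral => x _; rewrite ReM.
- rewrite -!RintegralZl// -RintegralD//; last 2 first.
  + exact: (integrableZl mD _ b).
  + exact: (integrableZl mD _ a).
  by apply: eq_Rintegral => x _; rewrite ImM.
Qed.
Lemma cIN f : cintegrable f -> cintg (fun x => - f x) = - cintg f.
Proof.
by move=> iF; rewrite -mulN1r -cIZ//; apply: eq_cintg => x _; rewrite mulN1r.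
Qed.
Lemma cIB f g : cintegrable f -> cintegrable g -> cintg (fun x => f x - g x) = cintg f - cintg g.
Proof. by move=> fi gi; rewrite cID ?cIN//; exact: cintegrableN. Qed.
Lemma cI0 : cintg (fun=> 0) = 0.
Proof. by apply: complexP; rewrite /= /Rintegral integral0. Qed.
Lemma cintg_sum (I : Type) (s : seq I) (F : I -> T -> C) :
  (forall i, cintegrable (F i)) -> cintg (fun x => \sum_(i <- s) F i x) = \sum_(i <- s) cintg (F i).
Proof.
move=> iF; elim: s => [|i s IH].
  by rewrite big_nil -[RHS]cI0; apply: eq_cintg => x _; rewrite big_nil.
rewrite big_cons -IH -cID//; last exact: cintegrable_sum.
by apply: eq_cintg => x _; rewrite big_cons.
Qed.
Lemma cIJ f : cintegrable f -> cintg (fun x => conjc (f x)) = conjc (cintg f).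
Proof.
move=> [a b]; apply: complexP; rewrite ?ReJ ?ImJ /=.
- by apply: eq_Rintegral => x _; rewrite ReJ.
- by rewrite -mulN1r -RintegralZl//; apply: eq_Rintegral => x _; rewrite ImJ mulN1r.
Qed.

(** The unit [u] rotates the integral onto the positive real axis; then only the real part of
    [u * f] counts, and it is at most [normc (f x)]. *)
Lemma normc_cintg f : cintegrable f -> normc (cintg f) <= Rintegral mu D (fun x => normc (f x)).
Proof.
move=> iF; have [->|n0] := eqVneq (cintg f) 0.
  by rewrite normc0 Rintegral_ge0// => x _; exact: normc_ge0.
have np : 0 < normc (cintg f) by rewrite normc_gt0.
pose u := toC (normc (cintg f))^-1 * conjc (cintg f).
have nu : normc u = 1.
  by rewrite normcM normc_toC normcJ gtr0_norm ?invr_gt0// mulVf// gt_eqF.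
have uE : u * cintg f = toC (normc (cintg f)).
  rewrite /u -mulrA (mulrC (conjc _)) mulcJ -toCM expr2 mulrA mulVf ?mul1r// gt_eqF//.
have -> : normc (cintg f) = complex.Re (cintg (fun x => u * f x)) by rewrite cIZ// uE.
rewrite /=; apply: le_Rintegral => //.
- exact: (cintegrableZ u iF).1.
- exact: integrable_normc.
- move=> x Dx; apply: (le_trans (ler_norm _)).
  by apply: (le_trans (Re_le_normc (u * f x))); rewrite normcM nu mul1r.
Qed.

Lemma normc_cintg_le f (h : T -> R) : cmeasurable f -> mu.-integrable D (EFin \o h) ->
  (forall x, D x -> normc (f x) <= h x) -> normc (cintg f) <= Rintegral mu D h.
Proof.
move=> mf ih fh; have iF := le_cintegrable mf ih fh.
by rewrite (le_trans (normc_cintg iF))// le_Rintegral//; exact: integrable_normc.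
Qed.

Lemma ae_eq_cintg f g : cmeasurable f -> cmeasurable g -> ae_eq mu D f g -> cintg f = cintg g.
Proof.
move=> [mf1 mf2] [mg1 mg2] fg; congr Complex; congr fine; apply: ae_eq_integral => //;
  try exact/measurable_EFinP; apply: filterS fg => x + Dx => /(_ Dx) -> //.
Qed.
End cintegral.

(** * Fubini's theorem for finite measures *)

Section fubini.
Context d1 d2 (T1 : measurableType d1) (T2 : measurableType d2) (R : realType).
Variables (n1 : {finite_measure set T1 -> \bar R}) (n2 : {finite_measure set T2 -> \bar R}).
Local Notation C := (R[i]).

(** On a null set of [x] the inner integral may fail to be finite, and [Rintegral] then has a
    default value. The almost everywhere equality with the extended inner integral gives both
    integrability and the value. *)
Lemma Rfubini (f : T1 * T2 -> R) :
  (n1 \x n2)%E.-integrable setT (EFin \o f) ->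
  n1.-integrable setT (EFin \o (fun x => Rintegral n2 setT (fun y => f (x, y)))) /\
  Rintegral (n1 \x n2)%E setT f = Rintegral n1 setT (fun x => Rintegral n2 setT (fun y => f (x, y))).
Proof.
move=> fi; have iF := integrable_fubini_F fi.
have mF : measurable_fun setT (fun x => Rintegral n2 setT (fun y => f (x, y))).
  have := measurableT_comp (@fine_measurable R setT measurableT) (measurable_fubini_F fi).
  by [].
have iG : n1.-integrable setT (EFin \o (fun x => Rintegral n2 setT (fun y => f (x, y)))).
  apply: le_integrable iF => //; first exact/measurable_EFinP.
  move=> x _ /=; rewrite /Rintegral /fubini_F.
  by case: (\int[n2]_y (f (x, y))%:E)%E => [r| |]; rewrite /= ?lee_fin// normr0 leey.
split=> //; rewrite /Rintegral -integral12_prod_meas1//; congr fine.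
apply: ae_eq_integral; [by []|exact: (measurable_fubini_F fi)|exact/measurable_EFinP|].
apply: filterS (integrable_ae measurableT iF) => x h _.
by rewrite /= fineK//; exact: h.
Qed.

Lemma Rfubini_swap (f : T1 * T2 -> R) :
  (n1 \x n2)%E.-integrable setT (EFin \o f) ->
  n2.-integrable setT (EFin \o (fun y => Rintegral n1 setT (fun x => f (x, y)))) /\
  Rintegral (n1 \x n2)%E setT f = Rintegral n2 setT (fun y => Rintegral n1 setT (fun x => f (x, y))).
Proof.
move=> fi.
have iF : n2.-integrable setT (fubini_G n1 (EFin \o f)).
  apply/integrableP; split; first exact: measurable_fubini_G fi.
  have mf := measurable_int _ fi.
  apply: le_lt_trans ((integrable21ltyP n1 n2 mf).1 fi).
  apply: ge0_le_integral => //.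
  - by apply: measurableT_comp => //; exact: measurable_fubini_G fi.
  - apply: (measurable_fun_fubini_tonelli_G (abse \o (EFin \o f))) => //=.
    exact: measurableT_comp.
  - move=> y _; apply: le_abse_integral => //.
    exact: measurable_fun_pair1 mf.
have mF : measurable_fun setT (fun y => Rintegral n1 setT (fun x => f (x, y))).
  have := measurableT_comp (@fine_measurable R setT measurableT) (measurable_fubini_G fi).
  by [].
have iG : n2.-integrable setT (EFin \o (fun y => Rintegral n1 setT (fun x => f (x, y)))).
  apply: le_integrable iF => //; first exact/measurable_EFinP.
  move=> x _ /=; rewrite /Rintegral /fubini_G.
  by case: (\int[n1]_y (f (y, x))%:E)%E => [r| |]; rewrite /= ?lee_fin// normr0 leey.
split=> //; rewrite /Rintegral -integral21_prod_meas1//; congr fine.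
apply: ae_eq_integral; [by []|exact: (measurable_fubini_G fi)|exact/measurable_EFinP|].
apply: filterS (integrable_ae measurableT iF) => x h _.
by rewrite /= fineK//; exact: h.
Qed.

Lemma cfubini (f : T1 * T2 -> C) : cintegrable (n1 \x n2)%E setT f ->
  cintegrable n1 setT (fun x => cintg n2 setT (fun y => f (x, y))) /\
  cintg (n1 \x n2)%E setT f = cintg n1 setT (fun x => cintg n2 setT (fun y => f (x, y))).
Proof.
move=> [a b]; have [ia ea] := Rfubini a; have [ib eb] := Rfubini b.
by split; [split|congr Complex].
Qed.

Lemma cfubini_swap (f : T1 * T2 -> C) : cintegrable (n1 \x n2)%E setT f ->
  cintegrable n2 setT (fun y => cintg n1 setT (fun x => f (x, y))) /\
  cintg (n1 \x n2)%E setT f = cintg n2 setT (fun y => cintg n1 setT (fun x => f (x, y))).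
Proof.
move=> [a b]; have [ia ea] := Rfubini_swap a; have [ib eb] := Rfubini_swap b.
by split; [split|congr Complex].
Qed.

Lemma cintegrable_prod12 (f : T1 * T2 -> C) : cmeasurable setT f ->
  (\int[n1]_x \int[n2]_y (normc (f (x, y)))%:E < +oo)%E -> cintegrable (n1 \x n2)%E setT f.
Proof.
move=> mf h; apply: cintegrableP => //; rewrite fubini_tonelli1//.
- exact/measurable_EFinP/measurable_normc.
- by move=> x; rewrite lee_fin normc_ge0.
Qed.
Lemma cintegrable_prod21 (f : T1 * T2 -> C) : cmeasurable setT f ->
  (\int[n2]_y \int[n1]_x (normc (f (x, y)))%:E < +oo)%E -> cintegrable (n1 \x n2)%E setT f.
Proof.
move=> mf h; apply: cintegrableP => //; rewrite fubini_tonelli2//.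
- exact/measurable_EFinP/measurable_normc.
- by move=> x; rewrite lee_fin normc_ge0.
Qed.
End fubini.

(** * Measurability of continuous functions of two variables *)

Section continuous_meas.
Variable R : realType.
Local Notation TR := (measurableTypeR R).

(** [A] is the union of the rational open rectangles that it contains. They are enumerated through
    [unpickle]; every other code contributes the empty set. *)
Lemma open_measurable2 (A : set (R * R)) : open A -> measurable (A : set (TR * TR)).
Proof.
move=> oA.
pose B (q : (rat * rat) * (rat * rat)) : set (TR * TR) :=
  `]ratr q.1.1 : R, ratr q.1.2[%classic `*` `]ratr q.2.1 : R, ratr q.2.2[%classic.
pose F (n : nat) := match @unpickle ((rat * rat) * (rat * rat))%type n with
  | Some q => if `[< B q `<=` A >] then B q else set0 | None => set0 end.
have -> : A = \bigcup_n F n.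
  apply/seteqP; split => [[x y] Axy|p [n _]]; last first.
    by rewrite /F; case: unpickle => // q; case: ifPn => // /asboolP; exact.
  have /nbhs_ballP[e /= e0 be] : nbhs (x, y) A by exact: open_nbhs_nbhs.
  have rat_in (z : R) : exists q : rat * rat, ratr q.1 < z < ratr q.2 /\ ratr q.2 - ratr q.1 < e.
    have e2 : 0 < e / 2 by rewrite divr_gt0.
    have [q1 q1P] := @rat_in_itvoo R (z - e / 2) z ltac:(lra).
    have [q2 q2P] := @rat_in_itvoo R z (z + e / 2) ltac:(lra).
    exists (q1, q2) => /=; move: q1P q2P; rewrite !in_itv /= => /andP[a b] /andP[c d].
    by rewrite b c; split => //; lra.
  have [qx [/andP[qx1 qx2] qx3]] := rat_in x; have [qy [/andP[qy1 qy2] qy3]] := rat_in y.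
  exists (pickle (qx, qy)); first exact: I.
  rewrite /F (pickleK (qx, qy)).
  have -> : `[< B (qx, qy) `<=` A >].
    apply/asboolP => -[u v] [/= ]; rewrite !in_itv /= => /andP[u1 u2] /andP[sing_majorant v2].
    apply: be; split; rewrite /ball /= ltr_norml; apply/andP; split; lra.
  rewrite /B /=; split => /=; apply/andP; split; rewrite bnd_simp //.
apply: bigcupT_measurable => n; rewrite /F; case: unpickle => // q; case: ifP => // _.
by apply: measurableX; exact: measurable_itv.
Qed.

Lemma continuous_measurable2 (f : R * R -> R) : continuous f ->
  measurable_fun (setT : set (TR * TR)) (fun x => f x).
Proof.
move=> /continuousP cf; apply: (measurability _ (RGenOpens.measurableE R)).
move=> _ [_ [a [b ->] <-]]; rewrite setTI; apply: open_measurable2.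
exact/cf/interval_open.
Qed.

Lemma measurable_fun_mu_per (f : R -> R) : continuous f -> measurable_fun (setT : set TR) (fun x => f x).
Proof. by move=> cf; exact: (continuous_measurable_fun cf). Qed.

End continuous_meas.

(** * Translation invariance of integrals of periodic functions *)

Section periodic.
Variable R : realType.
Local Notation leb := (@lebesgue_measure R).
Local Notation TR := (measurableTypeR R).
Local Notation C := (R[i]).

Lemma ge0_integral_mu_per (f : TR -> \bar R) : (forall x, 0 <= f x)%E ->
  measurable_fun setT f ->
  (\int[@mu_per R]_x f x = \int[leb]_(x in @per_itv R) f x)%E.
Proof.
move=> f0 mf.
transitivity (\int[@mu_per R]_(x in @per_itv R) f x)%E; last first.
  by apply: eq_measure_integral => A mA AI; transitivity (leb (A `&` @per_itv R)); [by []|congr (leb _); exact: setIidl].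
rewrite [RHS]integral_mkcond; apply: ge0_ae_eq_integral => //.
- by apply/(measurable_restrictT _ _).1 => //; [exact: measurable_per_itv|exact: measurable_funTS].
- by move=> x _; rewrite patchE; case: ifPn.
- exists (~` @per_itv R); split.
  + by apply: measurableC; exact: measurable_per_itv.
  + by rewrite [LHS](_ : _ = leb (~` @per_itv R `&` @per_itv R))// setICl measure0.
  + move=> x /= h; rewrite /setC /mkset => Ix; apply: h => _; by rewrite patchE mem_set.
Qed.

Lemma leb_shift (a : R) (A : set TR) : measurable A ->
  pushforward leb (fun x : TR => (x + a : TR)) A = leb A.
Proof.
move=> mA; apply/esym/lebesgue_measure_unique => //=.
  exact: measurable_funD.
move=> _ _ [[b c]] _ <-.
rewrite /pushforward (_ : _ @^-1` _ = `]b - a, c - a]%classic); last first.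
  by apply/seteqP; split => x /=; rewrite !in_itv /= ltrBlDr lerBrDr.
rewrite !lebesgue_measure_itv/= !lte_fin ltrD2r; case: ifP => // _; rewrite -!EFinB; congr EFin; ring.
Qed.

Lemma ge0_integral_shift (a b c : R) (f : TR -> \bar R) : (forall x, 0 <= f x)%E ->
  measurable_fun setT f ->
  (\int[leb]_(x in `[(b + a)%R, (c + a)%R[) f x = \int[leb]_(x in `[b, c[) f (x + a)%R)%E.
Proof.
move=> f0 mf.
have ms : measurable_fun setT (fun x : TR => (x + a : TR)).
  exact: measurable_funD.
have := @ge0_integral_pushforward _ _ _ _ _ _ ms leb `[b + a, c + a[%classic f
   (measurable_itv _) (measurable_funTS mf) (fun y _ => f0 y).
rewrite (_ : _ @^-1` _ = `[b, c[%classic); last first.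
  by apply/seteqP; split => x /=; rewrite !in_itv /= lerD2r ltrD2r.
move=> <-; apply: eq_measure_integral => A mA _; exact/esym/leb_shift.
Qed.

Lemma ge0_integral_itv_split (a b c : R) (f : TR -> \bar R) : a <= b -> b <= c ->
  (forall x, 0 <= f x)%E -> measurable_fun setT f ->
  (\int[leb]_(x in `[a, c[) f x = \int[leb]_(x in `[a, b[) f x + \int[leb]_(x in `[b, c[) f x)%E.
Proof.
move=> ab bc f0 mf.
rewrite (@itv_bndbnd_setU _ _ _ (BLeft b)) ?bnd_simp//.
have mu_per : measurable (`[a, b[%classic : set TR) := measurable_itv _.
have m2 : measurable (`[b, c[%classic : set TR) := measurable_itv _.
apply: (ge0_integral_setU leb mu_per m2) => //; first exact: measurable_funTS.
apply/disj_setPS => x [/=]; rewrite !in_itv /= => /andP[_ h] /andP[h' _].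
by move: h; rewrite ltNge h'.
Qed.

(** Cut the translated period at [2 * pi] and move the right piece back by one period; the two
    pieces then fill the original period. *)
Lemma ge0_periodic_mu_per (f : TR -> \bar R) (a : R) : 0 <= a < 2 * pi ->
  (forall x, 0 <= f x)%E -> measurable_fun setT f ->
  (forall x : R, f (x + 2 * pi) = f x) ->
  (\int[@mu_per R]_x f (x + a)%R = \int[@mu_per R]_x f x)%E.
Proof.
move=> /andP[a0 a2] f0 mf pf.
have ms : measurable_fun setT (fun x : TR => (x + a : TR)).
  exact: measurable_funD.
rewrite ge0_integral_mu_per//; last exact: measurableT_comp mf ms.
rewrite ge0_integral_mu_per// /per_itv -ge0_integral_shift// add0r.
rewrite (@ge0_integral_itv_split a (2 * pi))//; [|exact: ltW|by rewrite lerDl].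
rewrite [RHS](@ge0_integral_itv_split 0 a)//; [|exact: ltW].
rewrite addeC; congr (_ + _)%E.
rewrite -{1}(add0r (2 * pi)) (addrC (2 * pi) a) ge0_integral_shift//.
by apply: eq_integral => x _; rewrite pf.
Qed.

Lemma periodic_mu_per (f : TR -> R) (a : R) : 0 <= a < 2 * pi ->
  measurable_fun setT f -> (forall x : R, f (x + 2 * pi) = f x) ->
  Rintegral (@mu_per R) setT (fun x => f (x + a)) = Rintegral (@mu_per R) setT f.
Proof.
move=> ha mf pf; rewrite /Rintegral; congr fine.
have mf' : measurable_fun setT (EFin \o f) by exact/measurable_EFinP.
rewrite integralE [RHS]integralE; congr (_ - _)%E.
- have pp (x : R) : (EFin \o f)^\+%E (x + 2 * pi) = (EFin \o f)^\+%E x by rewrite !funeposE /= pf.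
  transitivity (\int[@mu_per R]_x (EFin \o f)^\+%E (x + a)%R)%E; last first.
    exact: (ge0_periodic_mu_per ha (@funepos_ge0 _ _ _) (measurable_funepos mf') pp).
  by apply: eq_integral => x _; rewrite !funeposE.
- have pp (x : R) : (EFin \o f)^\-%E (x + 2 * pi) = (EFin \o f)^\-%E x by rewrite !funenegE /= pf.
  transitivity (\int[@mu_per R]_x (EFin \o f)^\-%E (x + a)%R)%E; last first.
    exact: (ge0_periodic_mu_per ha (@funeneg_ge0 _ _ _) (measurable_funeneg mf') pp).
  by apply: eq_integral => x _; rewrite !funenegE.
Qed.

Definition biper (T : Type) (f : R * R -> T) :=
  forall x : R * R, f (x.1 + 2 * pi, x.2) = f x /\ f (x.1, x.2 + 2 * pi) = f x.
Definition shift2 (a x : R * R) : R * R := (x.1 + a.1, x.2 + a.2).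

Lemma measurable_shift2 (a : R * R) : measurable_fun (setT : set (TR * TR)) (fun x : TR * TR => (shift2 a x : TR * TR)).
Proof.
apply: measurable_fun_pair => /=; apply: measurable_funD => //.
Qed.

Lemma ge0_periodic_mu_per2 (f : TR * TR -> \bar R) (a : R * R) : @I2 R a ->
  (forall x, 0 <= f x)%E -> measurable_fun setT f -> biper f ->
  (\int[@mu_per2 R]_x f (shift2 a x) = \int[@mu_per2 R]_x f x)%E.
Proof.
move=> [/= ]; rewrite !in_itv /= => a1 a2 f0 mf pf.
have ms : measurable_fun setT (fun x : TR => (x + a.1 : TR)).
  exact: measurable_funD.
rewrite /mu_per2 fubini_tonelli1//; last exact: (measurableT_comp mf (measurable_shift2 a)).
rewrite [RHS]fubini_tonelli1//.
transitivity (\int[@mu_per R]_x fubini_F (@mu_per R) f (x + a.1)%R)%E.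
  apply: eq_integral => x _; rewrite /fubini_F /shift2 /=.
  apply: (@ge0_periodic_mu_per (fun y => f (x + a.1, y)) a.2) => //.
    exact: (measurableT_comp mf (pair1_measurable (x + a.1))).
  by move=> y; exact: (pf (x + a.1, y)).2.
apply: ge0_periodic_mu_per => //.
- by move=> x; exact: integral_ge0.
- exact: measurable_fun_fubini_tonelli_F.
- by move=> x; apply: eq_integral => y _; exact: (pf (x, y)).1.
Qed.

Lemma periodic_mu_per2 (f : TR * TR -> R) (a : R * R) : @I2 R a ->
  measurable_fun setT f -> biper f ->
  Rintegral (@mu_per2 R) setT (fun x => f (shift2 a x)) = Rintegral (@mu_per2 R) setT f.
Proof.
move=> ha mf pf; rewrite /Rintegral; congr fine.
have mf' : measurable_fun setT (EFin \o f) by exact/measurable_EFinP.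
rewrite integralE [RHS]integralE; congr (_ - _)%E.
- have pp : biper (EFin \o f)^\+%E by move=> x; rewrite !funeposE /=; have [-> ->] := pf x.
  transitivity (\int[@mu_per2 R]_x (EFin \o f)^\+%E (shift2 a x))%E; last first.
    exact: (ge0_periodic_mu_per2 ha (@funepos_ge0 _ _ _) (measurable_funepos mf') pp).
  by apply: eq_integral => x _; rewrite !funeposE.
- have pp : biper (EFin \o f)^\-%E by move=> x; rewrite !funenegE /=; have [-> ->] := pf x.
  transitivity (\int[@mu_per2 R]_x (EFin \o f)^\-%E (shift2 a x))%E; last first.
    exact: (ge0_periodic_mu_per2 ha (@funeneg_ge0 _ _ _) (measurable_funeneg mf') pp).
  by apply: eq_integral => x _; rewrite !funenegE.
Qed.

Lemma cperiodic_mu_per (f : TR -> C) (a : R) : 0 <= a < 2 * pi ->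
  cmeasurable setT f -> (forall x : R, f (x + 2 * pi) = f x) ->
  cintg (@mu_per R) setT (fun x => f (x + a)) = cintg (@mu_per R) setT f.
Proof.
move=> ha [mr mi] pf; congr Complex.
- by rewrite -(periodic_mu_per ha mr)// => x; rewrite pf.
- by rewrite -(periodic_mu_per ha mi)// => x; rewrite pf.
Qed.

Lemma cperiodic_mu_per2 (f : TR * TR -> C) (a : R * R) : @I2 R a ->
  cmeasurable setT f -> biper f ->
  cintg (@mu_per2 R) setT (fun x => f (shift2 a x)) = cintg (@mu_per2 R) setT f.
Proof.
move=> ha [mr mi] pf; congr Complex.
- by rewrite -(periodic_mu_per2 ha mr)// => x; have [-> ->] := pf x.
- by rewrite -(periodic_mu_per2 ha mi)// => x; have [-> ->] := pf x.
Qed.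
End periodic.

(** * Fourier series of square integrable functions *)

Section fourier.
Variable R : realType.
Local Notation leb := (@lebesgue_measure R).
Local Notation TR := (measurableTypeR R).
Local Notation C := (R[i]).
Local Notation mu_per2 := (@mu_per2 R).
Local Notation mu_per := (@mu_per R).
Implicit Types (f g : R * R -> C) (k l : int * int).

Lemma conjcM (z w : C) : conjc (z * w) = conjc z * conjc w.
Proof. exact: (rmorphM (@conjc R)). Qed.
Lemma conjc_toC (x : R) : conjc (toC x) = toC x.
Proof. by apply: complexP => //=; rewrite oppr0. Qed.

Lemma measurable_cos (f : TR * TR -> R) : measurable_fun setT f -> measurable_fun setT (fun x => cos (f x)).
Proof.
move=> mf; apply: (measurableT_comp _ mf).
exact: (continuous_measurable_fun (@continuous_cos R)).
Qed.
Lemma measurable_sin (f : TR * TR -> R) : measurable_fun setT f -> measurable_fun setT (fun x => sin (f x)).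
Proof.
move=> mf; apply: (measurableT_comp _ mf).
exact: (continuous_measurable_fun (@continuous_sin R)).
Qed.

Lemma cmeasurable_cexpi1 (a : R) : cmeasurable (setT : set TR) (fun x : TR => cexpi (a * x)).
Proof.
split => /=.
- by apply: (measurableT_comp (continuous_measurable_fun (@continuous_cos R))); exact: measurable_funM.
- by apply: (measurableT_comp (continuous_measurable_fun (@continuous_sin R))); exact: measurable_funM.
Qed.

Lemma cmeasurable_ebasis k : cmeasurable (setT : set (TR * TR)) (ebasis k).
Proof.
apply: cmeasM; first exact: cmeasurable_cst.
have m : measurable_fun (setT : set (TR * TR)) (fun t : TR * TR => (k.1%:~R * t.1 + k.2%:~R * t.2)%R : R).
  by apply: measurable_funD; apply: measurable_funM.
by split => /=; [exact: measurable_cos|exact: measurable_sin].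
Qed.

Lemma cintegrable_bounded d (T : measurableType d) (mu : {finite_measure set T -> \bar R})
  (f : T -> C) (M : R) : cmeasurable setT f -> (forall x, normc (f x) <= M) -> cintegrable mu setT f.
Proof.
move=> mf fM; apply: (@le_cintegrable _ _ _ _ _ _ _ (fun=> M)) => //.
exact: finite_measure_integrable_cst.
Qed.

Lemma cintg_cst d (T : measurableType d) (mu : {finite_measure set T -> \bar R}) (c : C) :
  cintg mu setT (fun=> c) = toC (fine (mu setT)) * c.
Proof.
by apply: complexP; rewrite ?ReM ?ImM /= Rintegral_cst// ?mul0r ?subr0 ?addr0 mulrC.
Qed.

Lemma cexpi_pi : cexpi pi = -1 :> C.
Proof. by apply: complexP; rewrite /= ?cospi ?sinpi// oppr0. Qed.

Lemma cexpi_2piZ (j : int) : cexpi (j%:~R * (2 * pi)) = 1 :> C.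
Proof.
have nat_case (n : nat) : cexpi (n%:R * (2 * pi)) = 1 :> C.
  elim: n => [|n IH]; first by rewrite mul0r cexpi0.
  rewrite -addn1 natrD mulrDl mul1r cexpiD IH mul1r.
  have -> : 2 * pi = pi + pi :> R by ring.
  by rewrite cexpiD cexpi_pi mulrNN mulr1.
case: j => n; first exact: nat_case.
rewrite NegzE intrN mulNr cexpiN; have -> := nat_case n.+1.
by apply: complexP => //=; rewrite oppr0.
Qed.

(** For [j != 0] a translation by pi / |j| reverses the sign of the integrand, while periodicity
    leaves the integral unchanged; so the integral is its own opposite. *)
Lemma cintg_cexpi (j : int) : cintg mu_per setT (fun x : TR => cexpi (j%:~R * x)) = if j == 0 then toC (2 * pi) else 0.
Proof.
case: eqP => [->|/eqP j0].
  rewrite (_ : (fun _ => _) = fun=> 1); last by apply/funext => x; rewrite mul0r cexpi0.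
  by rewrite cintg_cst mulr1 -[fine _]/(fine (mu_per setT)) m1T.
have bi (a : R) : cintegrable mu_per setT (fun x : TR => cexpi (a * x)).
  by apply: (@cintegrable_bounded _ _ _ _ 1); [exact: cmeasurable_cexpi1|move=> x; rewrite normc_cexpi].
pose a : R := pi / `|j|%:~R.
have jp : 1 <= `|j|%:~R :> R by rewrite -[1]/(1%:~R) ler_int -gtz0_ge1 normr_gt0.
have pi0 := @pi_gt0 R.
have a0 : 0 <= a < 2 * pi.
  rewrite divr_ge0 ?(ltW pi0) ?(le_trans ler01)//=.
  rewrite ltr_pdivrMr ?(lt_le_trans ltr01)//; nra.
have ja : cexpi (j%:~R * a) = -1 :> C.
  rewrite /a; have nz : `|j|%:~R != 0 :> R by rewrite gt_eqF// (lt_le_trans ltr01).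
  have [jn|jn] := leP 0 j.
    by move: nz; rewrite ger0_norm// => nz; rewrite mulrCA divff// mulr1 cexpi_pi.
  move: nz; rewrite ltr0_norm// => nz.
  have je : j%:~R = - (- j)%:~R :> R by rewrite intrN opprK.
  have -> : j%:~R * (pi / (- j)%:~R) = - pi :> R by rewrite je mulNr mulrCA divff// mulr1.
  rewrite cexpiN cexpi_pi; apply: complexP => //=; ring.
have := @cperiodic_mu_per R (fun x => cexpi (j%:~R * x)) a a0 (cmeasurable_cexpi1 _).
have per (x : R) : cexpi (j%:~R * (x + 2 * pi)) = cexpi (j%:~R * x) :> C.
  by rewrite mulrDr cexpiD cexpi_2piZ mulr1.
move=> /(_ per) H.
have e : cintg mu_per setT (fun x : TR => cexpi (j%:~R * (x + a))) = - cintg mu_per setT (fun x : TR => cexpi (j%:~R * x)).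
  rewrite -mulN1r -cIZ//; apply: eq_cintg => x _.
  by rewrite mulrDr cexpiD ja mulrC.
rewrite e in H; move: H.
case: (cintg _ _ _) => u v [hu hv]; apply: complexP => /=; lra.
Qed.

Lemma cintg_prod (u v : TR -> C) (M N : R) : cmeasurable setT u -> cmeasurable setT v ->
  (forall x, normc (u x) <= M) -> (forall x, normc (v x) <= N) ->
  cintg mu_per2 setT (fun t : TR * TR => u t.1 * v t.2) = cintg mu_per setT u * cintg mu_per setT v.
Proof.
move=> mu mv uM vN.
have m1' : cmeasurable (setT : set (TR * TR)) (fun t => u t.1).
  by case: mu => a b; split; [exact: (measurableT_comp a)|exact: (measurableT_comp b)].
have m2' : cmeasurable (setT : set (TR * TR)) (fun t => v t.2).
  by case: mv => a b; split; [exact: (measurableT_comp a)|exact: (measurableT_comp b)].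
have iU : cintegrable mu_per setT u by exact: cintegrable_bounded uM.
have iV : cintegrable mu_per setT v by exact: cintegrable_bounded vN.
have iUV : cintegrable (mu_per \x mu_per)%E setT (fun t : TR * TR => u t.1 * v t.2).
  apply: (@cintegrable_bounded _ _ mu_per2 _ (M * N)); first exact: cmeasM.
  by move=> x; rewrite normcM ler_pM ?normc_ge0.
have [_ ->] := cfubini iUV.
rewrite [RHS]mulrC -cIZ//; apply: eq_cintg => x _ /=.
by rewrite cIZ// mulrC.
Qed.

Lemma ebasisE k (t : R * R) : ebasis k t = toC (2 * pi)^-1 * (cexpi (k.1%:~R * t.1) * cexpi (k.2%:~R * t.2)).
Proof. by rewrite /ebasis cexpiD. Qed.
Lemma normc_ebasis k t : normc (ebasis k t : C) = (2 * pi)^-1.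
Proof.
rewrite /ebasis normcM normc_cexpi normc_toC mulr1 ger0_norm// invr_ge0 ltW// pi2_gt0//.
Qed.

Lemma cintg_eeJ k l : cintg mu_per2 setT (fun t : TR * TR => ebasis k t * conjc (ebasis l t)) = if k == l then 1 else 0.
Proof.
pose u j := fun x : TR => cexpi (j%:~R * x) : C.
transitivity (cintg mu_per2 setT (fun t : TR * TR => toC ((2 * pi)^-1 * (2 * pi)^-1) * (u (k.1 - l.1) t.1 * u (k.2 - l.2) t.2))).
  apply: eq_cintg => t _; rewrite /ebasis conjcM conjc_toC -cexpiN toCM /u.
  rewrite mulrACA; congr (_ * _); rewrite -!cexpiD; congr cexpi; rewrite !intrB; ring.
have mu j : cmeasurable setT (u j) by exact: cmeasurable_cexpi1.
have bu j x : normc (u j x) <= 1 by rewrite normc_cexpi.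
have iU : cintegrable mu_per2 setT (fun t : TR * TR => u (k.1 - l.1) t.1 * u (k.2 - l.2) t.2).
  apply: (@cintegrable_bounded _ _ mu_per2 _ 1); last by move=> x; rewrite normcM !normc_cexpi mulr1.
  apply: cmeasM.
  - by case: (mu (k.1 - l.1)) => a b; split; [exact: (measurableT_comp a)|exact: (measurableT_comp b)].
  - by case: (mu (k.2 - l.2)) => a b; split; [exact: (measurableT_comp a)|exact: (measurableT_comp b)].
rewrite cIZ// (@cintg_prod _ _ 1 1)// /u !cintg_cexpi !subr_eq0.
have -> : (k == l) = (k.1 == l.1) && (k.2 == l.2) by [].
have p0 : 2 * pi != 0 :> R by rewrite gt_eqF// pi2_gt0.
case: eqP => _; last by rewrite mul0r mulr0.
case: eqP => _; last by rewrite !mulr0.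
have pn : pi != 0 :> R by rewrite gt_eqF// pi_gt0.
by rewrite -!toCM -[RHS]/(toC 1); congr toC; rewrite mulrACA !mulVf// mulr1.
Qed.

Definition inL2m (f : R * R -> C) := cmeasurable (setT : set (TR * TR)) f /\
  mu_per2.-integrable setT (fun x => (normc (f x) ^+ 2)%:E).
Definition sqnorm (f : R * R -> C) : R := Rintegral mu_per2 setT (fun x => normc (f x) ^+ 2).
Definition fcoeff (f : R * R -> C) k : C := cintg mu_per2 setT (fun x => f x * conjc (ebasis k x)).

Lemma sqnorm_ge0 f : 0 <= sqnorm f. Proof. by apply: Rintegral_ge0 => x _; exact: sqr_ge0. Qed.

Lemma inL2m_bounded f (M : R) : cmeasurable setT f -> (forall x, normc (f x) <= M) -> inL2m f.
Proof.
move=> mf fM; split => //.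
apply: (@le_integrable _ _ _ _ _ _ _ (fun=> (M ^+ 2)%:E)) => //.
- exact/measurable_EFinP/measurable_funX/measurable_normc.
- move=> x _; rewrite /= lee_fin !ger0_norm ?sqr_ge0// ler_pXn2r ?nnegrE ?normc_ge0//.
  exact: le_trans (normc_ge0 _) (fM x).
- exact: finite_measure_integrable_cst.
Qed.
Lemma inL2m_ebasis k : inL2m (ebasis k).
Proof. by apply: (@inL2m_bounded _ (2 * pi)^-1); [exact: cmeasurable_ebasis|move=> x; rewrite normc_ebasis]. Qed.

Lemma inL2mD f g : inL2m f -> inL2m g -> inL2m (fun x => f x + g x).
Proof.
move=> [mf iF] [mg ig]; have mh := cmeasD mf mg; split => //.
have ih : mu_per2.-integrable setT (fun x => ((2%:E * (normc (f x) ^+ 2)%:E) + (2%:E * (normc (g x) ^+ 2)%:E))%E).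
  by apply: integrableD => //; exact: integrableZl.
apply: le_integrable ih => //; first exact/measurable_EFinP/measurable_funX/measurable_normc.
move=> x _; rewrite /= lee_fin ger0_norm ?sqr_ge0// (le_trans _ (ler_norm _))//.
have := ler_normcD (f x) (g x); have := normc_ge0 (f x + g x).
have := sqr_ge0 (normc (f x) - normc (g x)); nra.
Qed.
Lemma inL2mM f g (M : R) : inL2m f -> cmeasurable setT g -> (forall x, normc (g x) <= M) ->
  inL2m (fun x => g x * f x).
Proof.
move=> [mf iF] mg gM; have mh := cmeasM mg mf; split => //.
apply: le_integrable (integrableZl _ (M ^+ 2) iF) => //; first exact/measurable_EFinP/measurable_funX/measurable_normc.
move=> x _; rewrite /= lee_fin ger0_norm ?sqr_ge0// (le_trans _ (ler_norm _))//.
rewrite normcM exprMn ler_wpM2r ?sqr_ge0// ler_pXn2r ?nnegrE ?normc_ge0//.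
exact: le_trans (normc_ge0 _) (gM x).
Qed.
Lemma inL2mZ c f : inL2m f -> inL2m (fun x => c * f x).
Proof. by move=> hf; apply: (@inL2mM _ (fun=> c) (normc c)) => //; exact: cmeasurable_cst. Qed.
Lemma inL2mN f : inL2m f -> inL2m (fun x => - f x).
Proof.
move=> /(inL2mZ (-1)); rewrite (_ : (fun _ => _) = fun x => - f x)//.
by apply/funext => x; rewrite mulN1r.
Qed.
Lemma inL2mB f g : inL2m f -> inL2m g -> inL2m (fun x => f x - g x).
Proof. by move=> hf hg; apply: inL2mD => //; exact: inL2mN. Qed.
Lemma inL2m0 : inL2m (fun=> 0).
Proof. by apply: (@inL2m_bounded _ 0); [exact: cmeasurable_cst|move=> x; rewrite normc0]. Qed.
Lemma inL2m_sum (I : Type) (s : seq I) (F : I -> R * R -> C) :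
  (forall i, inL2m (F i)) -> inL2m (fun x => \sum_(i <- s) F i x).
Proof.
move=> mF; elim: s => [|i s IH].
  by rewrite (_ : (fun _ => _) = fun=> 0); [exact: inL2m0|apply/funext => x; rewrite big_nil].
rewrite (_ : (fun _ => _) = fun x => F i x + \sum_(j <- s) F j x); first exact: inL2mD.
by apply/funext => x; rewrite big_cons.
Qed.

Lemma inL2m_cintegrable f : inL2m f -> cintegrable mu_per2 setT f.
Proof.
move=> [mf iF].
have i1 : mu_per2.-integrable setT (cst 1%:E) by exact: finite_measure_integrable_cst.
have ih := integrableD measurableT i1 iF.
apply: (@le_cintegrable _ _ _ mu_per2 setT measurableT f (fun x => 1 + normc (f x) ^+ 2)) => //.
by move=> x _; have := sqr_ge0 (normc (f x) - 1); nra.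
Qed.
Lemma inL2m_mulJ f g : inL2m f -> inL2m g -> cintegrable mu_per2 setT (fun x => f x * conjc (g x)).
Proof.
move=> [mf iF] [mg ig]; have ih := integrableD measurableT iF ig.
apply: (@le_cintegrable _ _ _ mu_per2 setT measurableT (fun x => f x * conjc (g x)) (fun x => normc (f x) ^+ 2 + normc (g x) ^+ 2)) => //.
  by apply: cmeasM => //; exact: cmeasJ.
move=> x _; rewrite normcM normcJ.
by have := sqr_ge0 (normc (f x) - normc (g x)); have := normc_ge0 (f x); have := normc_ge0 (g x); nra.
Qed.

(** Integrate |z| <= t + |z|^2 / t over the torus, of area 4 pi^2, and take for [t] the square root
    of [sqnorm f], or arbitrarily small [t] if that vanishes. The factor 4 pi^2 + 1 is rounded up to
    7 pi^2, which is ample since only convergence is at stake. *)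
Lemma L1_le_L2 f : inL2m f -> Rintegral mu_per2 setT (fun x => normc (f x)) <= 7 * pi ^+ 2 * Num.sqrt (sqnorm f).
Proof.
move=> hf; have [mf iF] := hf; have iN := integrable_normc measurableT (inL2m_cintegrable hf).
have key (t : R) : 0 < t -> Rintegral mu_per2 setT (fun x => normc (f x)) <= 4 * pi ^+ 2 * t + sqnorm f / t.
  move=> t0.
  have i1 : mu_per2.-integrable setT (EFin \o (fun=> t)) by exact: finite_measure_integrable_cst.
  have i2 := integrableZl measurableT t^-1 iF.
  have -> : 4 * pi ^+ 2 * t + sqnorm f / t = Rintegral mu_per2 setT (fun x => t + t^-1 * normc (f x) ^+ 2).
    rewrite RintegralD// RintegralZl// Rintegral_cst// -[fine _]/(fine (mu_per2 setT)) mIT /=.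
    by rewrite [t^-1 * _]mulrC; congr (_ + _); ring.
  apply: le_Rintegral => //; first exact: (integrableD measurableT i1 i2).
  move=> x _; set z := normc _.
  rewrite -(ler_pM2l t0) mulrDr mulrA mulfV ?gt_eqF// mul1r.
  have := sqr_ge0 (z - t); have : 0 <= z by exact: normc_ge0.
  nra.
have pp : 1 <= pi ^+ 2 :> R.
  have := @pi_ge2 R; nra.
have [s0|s0] := eqVneq (sqnorm f) 0.
  rewrite s0 sqrtr0 mulr0; apply/ler_addgt0Pl => e e0; rewrite addr0.
  have p4 : 0 < 4 * pi ^+ 2 :> R by lra.
  have := key (e / (4 * pi ^+ 2)) (divr_gt0 e0 p4).
  by rewrite s0 mul0r addr0 mulrC divfK// gt_eqF.
have sp : 0 < sqnorm f by rewrite lt_def s0 sqnorm_ge0.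
have rp : 0 < Num.sqrt (sqnorm f) by rewrite sqrtr_gt0.
apply: le_trans (key _ rp) _.
have -> : sqnorm f / Num.sqrt (sqnorm f) = Num.sqrt (sqnorm f).
  by rewrite -{1}(sqr_sqrtr (ltW sp)) expr2 mulfK// gt_eqF.
nra.
Qed.

Lemma fcE f k : cintegrable mu_per2 setT f -> cintegrable mu_per2 setT (fun x => f x * conjc (ebasis k x)).
Proof.
move=> iF; apply: (@cintegrableM _ _ _ _ _ _ _ _ (2 * pi)^-1) => //.
  by apply: cmeasJ; exact: cmeasurable_ebasis.
by move=> x _; rewrite normcJ normc_ebasis.
Qed.
End fourier.
#[global] Arguments normc : simpl never.
#[global] Arguments fcoeff : simpl never.
#[global] Arguments cintg : simpl never.
#[global] Arguments ebasis : simpl never.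
#[global] Arguments toC : simpl never.
#[global] Arguments cexpi : simpl never.
#[global] Arguments sqnorm : simpl never.

(** * Square boxes of frequencies *)

Section box.
Definition box (n : nat) : seq (int * int) :=
  [seq (idx i, idx j) | i <- enum 'I_(Nn n), j <- enum 'I_(Nn n)].

Lemma idx_inj n : injective (@idx n).
Proof.
move=> i j /eqP; rewrite /idx (inj_eq (addIr _)) => /eqP [] h; exact: val_inj.
Qed.

Lemma box_uniq n : uniq (box n).
Proof.
apply: allpairs_uniq; rewrite ?enum_uniq// => -[i j] [i' j'] _ _ /= [h1 h2].
by rewrite (idx_inj h1) (idx_inj h2).
Qed.

Lemma idxP n (z : int) : reflect (exists i : 'I_(Nn n), z = idx i) (`|z| <= n%:Z).
Proof.
apply: (iffP idP) => [h|[i ->]].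
  have hz : - n%:Z <= z /\ z <= n%:Z by apply/andP; rewrite -ler_norml.
  have hn : (absz (z + n%:Z)%R < Nn n)%N by rewrite /Nn; lia.
  exists (Ordinal hn); rewrite /idx /=; lia.
move: i => [i /= h]; rewrite /idx /=; move: h; rewrite /Nn => h; rewrite ler_norml.
rewrite lerBrDr addNr lerBlDr -PoszD !lez_nat leq0n /=; lia.
Qed.

Lemma mem_box n (k : int * int) : (k \in box n) = (`|k.1| <= n%:Z) && (`|k.2| <= n%:Z).
Proof.
case: k => k1 k2 /=; apply/allpairsP/andP => [[[i j] /= [_ _ [-> ->]]]|[/idxP[i ->] /idxP[j ->]]].
  by split; apply/idxP; [exists i|exists j].
by exists (i, j); rewrite !mem_enum.
Qed.

Lemma box_sub m n : (m <= n)%N -> {subset box m <= box n}.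
Proof.
move=> mn k; rewrite !mem_box => /andP[a b].
have h : m%:Z <= n%:Z by rewrite lez_nat.
by rewrite (le_trans a h) (le_trans b h).
Qed.

Lemma sum_box (V : nmodType) n (F : int * int -> V) :
  \sum_(i < Nn n) \sum_(j < Nn n) F (idx i, idx j) = \sum_(k <- box n) F k.
Proof.
by rewrite /box big_allpairs_dep big_enum; apply: eq_bigr => i _; rewrite big_enum.
Qed.

Lemma in_big_box (s : seq (int * int)) : exists n, {subset s <= box n}.
Proof.
elim: s => [|k s [n hn]]; first by exists 0%N.
exists (maxn n (maxn `|k.1|%N `|k.2|%N)) => l; rewrite in_cons => /predU1P[->|/hn]; last first.
  by apply: box_sub; rewrite leq_maxl.
rewrite mem_box; apply/andP; split; lia.
Qed.
End box.

(** * Orthogonality and Bessel's inequality *)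

Section pyth.
Variable R : realType.
Local Notation TR := (measurableTypeR R).
Local Notation C := (R[i]).
Local Notation mu_per2 := (@mu_per2 R).
Local Notation mu_per := (@mu_per R).
Implicit Types (f g : R * R -> C) (k l : int * int) (s : seq (int * int)).

Lemma conjcB (z w : C) : conjc (z - w) = conjc z - conjc w.
Proof. exact: (rmorphB (@conjc R)). Qed.
Lemma cintg_toC d (T : measurableType d) (mu : {measure set T -> \bar R}) (D : set T) (h : T -> R) :
  cintg mu D (fun x => toC (h x)) = toC (Rintegral mu D h).
Proof. by apply: complexP => //=; rewrite /Rintegral integral0. Qed.

Lemma sqE f : toC (sqnorm f) = cintg mu_per2 setT (fun x => f x * conjc (f x)).
Proof. by rewrite -cintg_toC; apply: eq_cintg => x _; rewrite mulcJ. Qed.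

Lemma fcB f g k : cintegrable mu_per2 setT f -> cintegrable mu_per2 setT g ->
  fcoeff (fun x => f x - g x) k = fcoeff f k - fcoeff g k.
Proof.
move=> fi gi; rewrite /fcoeff -cIB//; try exact: fcE.
by apply: eq_cintg => x _; rewrite mulrBl.
Qed.
Lemma fcZ c f k : cintegrable mu_per2 setT f -> fcoeff (fun x => c * f x) k = c * fcoeff f k.
Proof.
move=> fi; rewrite /fcoeff -cIZ//; last exact: fcE.
by apply: eq_cintg => x _; rewrite mulrA.
Qed.
Lemma fcoeff_sum (I : Type) (r : seq I) (F : I -> R * R -> C) k :
  (forall i, cintegrable mu_per2 setT (F i)) ->
  fcoeff (fun x => \sum_(i <- r) F i x) k = \sum_(i <- r) fcoeff (F i) k.
Proof.
move=> iF; rewrite /fcoeff -cintg_sum//; last by move=> i; exact: fcE.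
by apply: eq_cintg => x _; rewrite mulr_suml.
Qed.
Lemma fcoeff_ebasis k l : fcoeff (ebasis l) k = (if l == k then 1 else 0 : C).
Proof. exact: cintg_eeJ. Qed.
Lemma cint_ebasis k : cintegrable mu_per2 setT (ebasis k : _ -> C).
Proof. exact/inL2m_cintegrable/inL2m_ebasis. Qed.

(** Expand the square and complete it in the variable [c]. The computation takes place in the
    complex numbers, where the cross terms are Fourier coefficients, and is read back through the
    injectivity of [toC]. *)
Lemma sqnorm_sub1 f c k : inL2m f ->
  sqnorm (fun x => f x - c * ebasis k x) = sqnorm f - normc (fcoeff f k) ^+ 2 + normc (fcoeff f k - c) ^+ 2.
Proof.
move=> hf; have he := inL2mZ c (@inL2m_ebasis R k).
have i1 := inL2m_mulJ hf hf; have i2 := inL2m_mulJ hf he.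
have i3 := inL2m_mulJ he hf; have i4 := inL2m_mulJ he he.
suff : toC (sqnorm (fun x => f x - c * ebasis k x)) = toC (sqnorm f - normc (fcoeff f k) ^+ 2 + normc (fcoeff f k - c) ^+ 2).
  by case.
rewrite sqE.
transitivity (cintg mu_per2 setT (fun x => (f x * conjc (f x) - f x * conjc (c * ebasis k x)) -
   (c * ebasis k x * conjc (f x) - (c * ebasis k x) * conjc (c * ebasis k x)))).
  apply: eq_cintg => x _; rewrite conjcB; ring.
have e2 : cintg mu_per2 setT (fun x => f x * conjc (c * ebasis k x)) = conjc c * fcoeff f k.
  rewrite /fcoeff -cIZ//; last exact/fcE/inL2m_cintegrable.
  by apply: eq_cintg => x _; rewrite conjcM; ring.
have e3 : cintg mu_per2 setT (fun x => c * ebasis k x * conjc (f x)) = c * conjc (fcoeff f k).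
  rewrite /fcoeff -cIJ//; last exact/fcE/inL2m_cintegrable.
  rewrite -cIZ//; last exact/cintegrableJ/fcE/inL2m_cintegrable.
  by apply: eq_cintg => x _; rewrite conjcM conjcK; ring.
have e4 : cintg mu_per2 setT (fun x => c * ebasis k x * conjc (c * ebasis k x)) = c * conjc c.
  rewrite -[RHS]mulr1 -(_ : fcoeff (ebasis k) k = 1); last by rewrite fcoeff_ebasis eqxx.
  rewrite /fcoeff -cIZ//; last exact/fcE/cint_ebasis.
  by apply: eq_cintg => x _; rewrite conjcM; ring.
have j12 := cintegrableB measurableT i1 i2; have j34 := cintegrableB measurableT i3 i4.
rewrite (cIB measurableT j12 j34) (cIB measurableT i1 i2) (cIB measurableT i3 i4) e2 e3 e4 -sqE.
rewrite toCD toCB -!mulcJ conjcB; ring.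
Qed.

Definition trig_poly s (c : int * int -> C) (x : R * R) : C := \sum_(k <- s) c k * ebasis k x.

Lemma inL2m_trig_poly s c : inL2m (trig_poly s c).
Proof. by apply: inL2m_sum => k; apply: inL2mZ; exact: inL2m_ebasis. Qed.

Lemma fcoeff_trig_poly s c k : uniq s -> fcoeff (trig_poly s c) k = if k \in s then c k else 0.
Proof.
move=> us; rewrite fcoeff_sum; last by move=> i; apply/inL2m_cintegrable/inL2mZ/inL2m_ebasis.
under eq_bigr do rewrite (fcZ _ _ (cint_ebasis _)) fcoeff_ebasis.
case: ifPn => ks.
  rewrite (bigD1_seq k)//= eqxx mulr1 big1 ?addr0// => i /negbTE ->.
  by rewrite mulr0.
rewrite big_seq big1// => i si; case: eqP => [e|_]; last by rewrite mulr0.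
by move: ks; rewrite -e si.
Qed.

(** By orthonormality, removing one basis function leaves the other coefficients alone, so the
    one-term identity iterates. This is the single source of Bessel's inequality ([c] the
    coefficients of [f]), of the norm of a trigonometric polynomial ([f] zero) and of the remainder
    in Parseval's identity. *)
Lemma sqnorm_sub_trig_poly s c f : uniq s -> inL2m f ->
  sqnorm (fun x => f x - trig_poly s c x) =
  sqnorm f - \sum_(k <- s) normc (fcoeff f k) ^+ 2 + \sum_(k <- s) normc (fcoeff f k - c k) ^+ 2.
Proof.
elim: s f => [|k s IH] f /=.
  move=> _ _; rewrite !big_nil subr0 addr0; congr sqnorm; apply/funext => x.
  by rewrite /trig_poly big_nil subr0.
move=> /andP[ks us] hf.
have he := inL2mZ (c k) (@inL2m_ebasis R k).
have -> : (fun x => f x - trig_poly (k :: s) c x) = (fun x => (f x - c k * ebasis k x) - trig_poly s c x).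
  by apply/funext => x; rewrite /trig_poly big_cons opprD addrA.
rewrite (IH _ us (inL2mB hf he)).
rewrite sqnorm_sub1// !big_cons.
have e l : l \in s -> fcoeff (fun x => f x - c k * ebasis k x) l = fcoeff f l.
  move=> ls; rewrite fcB; [|exact: inL2m_cintegrable|exact: inL2m_cintegrable].
  rewrite (fcZ _ _ (cint_ebasis _)) fcoeff_ebasis.
  case: eqP => [kl|_]; last by rewrite mulr0 subr0.
  by move: ks; rewrite kl ls.
have -> : \sum_(l <- s) normc (fcoeff (fun x => f x - c k * ebasis k x) l) ^+ 2 = \sum_(l <- s) normc (fcoeff f l) ^+ 2.
  by apply: eq_big_seq => l ls; rewrite e.
have -> : \sum_(l <- s) normc (fcoeff (fun x => f x - c k * ebasis k x) l - c l) ^+ 2 = \sum_(l <- s) normc (fcoeff f l - c l) ^+ 2.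
  by apply: eq_big_seq => l ls; rewrite e.
ring.
Qed.

Lemma bessel s f : uniq s -> inL2m f -> \sum_(k <- s) normc (fcoeff f k) ^+ 2 <= sqnorm f.
Proof.
move=> us hf; have := sqnorm_sub_trig_poly (fcoeff f) us hf; rewrite [X in _ + X]big1; last first.
  by move=> k _; rewrite subrr normc0 expr0n.
by rewrite addr0 => e; rewrite -subr_ge0 -e sqnorm_ge0.
Qed.

Lemma sqnorm_trig_poly s c : uniq s -> sqnorm (trig_poly s c) = \sum_(k <- s) normc (c k) ^+ 2.
Proof.
move=> us; have := sqnorm_sub_trig_poly c us (@inL2m0 R).
have z k : fcoeff (fun=> 0) k = 0 :> C.
  by rewrite /fcoeff -[RHS](cI0 mu_per2 setT); apply: eq_cintg => x _; rewrite mul0r.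
have -> : sqnorm (fun x => 0 - trig_poly s c x) = sqnorm (trig_poly s c).
  by apply: eq_Rintegral => x _; rewrite sub0r normcN.
have -> : sqnorm (fun=> 0 : C) = 0.
  by rewrite /sqnorm /Rintegral integral0_eq// => x _; rewrite normc0 expr0n.
rewrite big1 => [->|k _]; last by rewrite z normc0 expr0n.
by rewrite subrr add0r; apply: eq_bigr => k _; rewrite z sub0r normcN.
Qed.

Lemma normc_fcoeff_le f k : inL2m f -> normc (fcoeff f k) ^+ 2 <= sqnorm f.
Proof.
by move=> hf; have := @bessel [:: k] f erefl hf; rewrite big_seq1.
Qed.
End pyth.

(** * Dominated convergence for complex integrals *)

Section dct.
Context d (T : measurableType d) (R : realType) (mu : {measure set T -> \bar R}).
Local Notation C := (R[i]).

Lemma normc_cintg_le_ae (f : T -> C) (h : T -> R) : cintegrable mu setT f ->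
  mu.-integrable setT (EFin \o h) -> {ae mu, forall x, normc (f x) <= h x} ->
  normc (cintg mu setT f) <= Rintegral mu setT h.
Proof.
move=> iF ih fh; apply: le_trans (normc_cintg measurableT iF) _.
have iN := integrable_normc measurableT iF.
rewrite -lee_fin /Rintegral.
rewrite !fineK ?integrable_fin_num//.
have <- : (\int[mu]_x `|(h x)%:E| = \int[mu]_x (h x)%:E)%E.
  apply: ae_eq_integral => //; try exact: measurable_int ih.
    by apply: measurableT_comp => //; exact: measurable_int ih.
  apply: filterS fh => x hx _ /=.
  by rewrite ger0_norm// (le_trans (normc_ge0 _) hx).
apply: ae_ge0_le_integral => //.
- by move=> x _; rewrite lee_fin normc_ge0.
- exact: measurable_int iN.
- by apply: measurableT_comp => //; exact: measurable_int ih.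
- by apply: filterS fh => x hx _ /=; rewrite lee_fin (le_trans hx)// ler_norm.
Qed.

(** Dominated convergence is applied to the real functions [normc (f_ n x - f x)], with majorant
    [2 * g]; the limit inherits the bound [g] almost everywhere from the sequence. *)
Lemma cintg_dct (f_ : nat -> T -> C) (f : T -> C) (g : T -> R) :
  (forall n, cmeasurable setT (f_ n)) -> cmeasurable setT f ->
  mu.-integrable setT (EFin \o g) ->
  {ae mu, forall x, forall e, 0 < e -> exists N, forall n, (N <= n)%N -> normc (f_ n x - f x) <= e} ->
  {ae mu, forall x, forall n, normc (f_ n x) <= g x} ->
  cintegrable mu setT f /\
  forall e, 0 < e -> exists N, forall n, (N <= n)%N -> normc (cintg mu setT (f_ n) - cintg mu setT f) <= e.
Proof.
move=> mf_ mf ig fcoeff fb.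
have fb' : {ae mu, forall x, normc (f x) <= g x}.
  apply: filterS2 fcoeff fb => x hc hb; apply/ler_addgt0Pl => e e0.
  have [N /(_ N (leqnn _)) h] := hc e e0.
  rewrite -[f x](subrK (f_ N x)) (le_trans (ler_normcD _ _))// lerD//.
  by rewrite distcC.
have key (h : T -> C) : cmeasurable setT h -> {ae mu, forall x, normc (h x) <= g x} -> cintegrable mu setT h.
  move=> mh hb; apply: cintegrableP => //.
  apply: (@le_lt_trans _ _ (\int[mu]_x `|(g x)%:E|)%E); last by have /integrableP[_] := ig.
  apply: ae_ge0_le_integral => //.
  - by move=> x _; rewrite lee_fin normc_ge0.
  - exact/measurable_EFinP/measurable_normc.
  - by apply: measurableT_comp => //; exact: measurable_int ig.
  - by apply: filterS hb => x hx _ /=; rewrite lee_fin (le_trans hx)// ler_norm.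
have iF := key f mf fb'.
have iFn n : cintegrable mu setT (f_ n) by apply: key => //; apply: filterS fb.
split=> // e e0.
pose h n x := (normc (f_ n x - f x))%:E.
have mh n : measurable_fun setT (h n) by exact/measurable_EFinP/measurable_normc/cmeasB.
have hc : {ae mu, forall x, setT x -> h ^~ x @ \oo --> 0%E}.
  apply: filterS fcoeff => x hx _; apply/fine_cvgP; split; first exact: nearW.
  apply/cvgrPdist_le => /= e' e'0; have [N HN] := hx e' e'0.
  by exists N => // n /= Nn; rewrite sub0r normrN ger0_norm ?normc_ge0// HN.
have hb : {ae mu, forall x, forall n : nat, setT x -> (`|h n x| <= 2%:E * (g x)%:E)%E}.
  apply: filterS2 fb fb' => x h1 h2 n _; rewrite /h /= lee_fin ger0_norm ?normc_ge0//.
  by rewrite (le_trans (ler_normcB _ _))// mulr2n mulrDl mul1r lerD.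
have [_ _ H] := dominated_convergence measurableT mh (measurable_cst (0%E : \bar R)) hc (integrableZl measurableT 2 ig) hb.
rewrite integral0 in H.
move/fine_cvgP : H => [_ /cvgrPdist_le /(_ e e0) [N _ HN]].
exists N => n Nn; rewrite -cIB//.
apply: le_trans (normc_cintg measurableT (cintegrableB measurableT (iFn n) iF)) _.
have := HN n Nn; rewrite sub0r normrN /= => h1.
exact: le_trans (ler_norm _) h1.
Qed.
End dct.

(** * A trigonometric approximate identity *)

Section kernelQ.
Variable R : realType.
Local Notation TR := (measurableTypeR R).
Local Notation C := (R[i]).
Local Notation mu_per := (@mu_per R).

(* Its normalization by cQ is an approximate identity made of trigonometric polynomials. *)
Definition Q (m : nat) (t : R) : R := ((1 + cos t) / 2) ^+ m.
Definition cQ (m : nat) : R := Rintegral mu_per setT (fun t : TR => Q m t).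

Lemma Q_ge0 m t : 0 <= Q m t.
Proof. by apply: exprn_ge0; have := cos_geN1 t; lra. Qed.
Lemma Q_le1 m t : Q m t <= 1.
Proof. by apply: exprn_ile1; have := cos_geN1 t; have := cos_le1 t; lra. Qed.
Lemma measurable_Q m (f : TR -> R) : measurable_fun setT f -> measurable_fun setT (fun t => Q m (f t)).
Proof.
move=> mf; have mc := measurableT_comp (continuous_measurable_fun (@continuous_cos R)) mf.
have h := measurable_funX m (measurable_funM (measurable_funD (measurable_cst (1 : R)) mc) (measurable_cst (2^-1 : R))).
by apply: (eq_measurable_fun _ _ h).
Qed.
Lemma integrable_Q m (f : TR -> R) : measurable_fun setT f ->
  mu_per.-integrable setT (EFin \o (fun t => Q m (f t))).
Proof.
move=> mf; apply: (@le_integrable _ _ _ mu_per setT measurableT _ (fun=> 1%:E)) => //.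
- by have /measurable_EFinP := measurable_Q m mf.
- by move=> x _; rewrite /= lee_fin normr1 ger0_norm ?Q_ge0// Q_le1.
- exact: finite_measure_integrable_cst.
Qed.

Lemma Qper m t : Q m (t + 2 * pi) = Q m t.
Proof. by rewrite /Q (_ : 2 * pi = pi *+ 2) ?cosD2pi//; ring. Qed.
Lemma QN m t : Q m (- t) = Q m t. Proof. by rewrite /Q cosN. Qed.

Lemma cos_le_of_le (x y : R) : 0 <= x -> x <= y -> y <= pi -> cos y <= cos x.
Proof.
move=> x0; rewrite le_eqVlt => /predU1P[->//|xy] yp.
rewrite ltW// ltr_cos ?in_itv /=//; apply/andP; split; lra.
Qed.

Lemma cQ_shift m t : 0 <= t < 2 * pi -> Rintegral mu_per setT (fun s : TR => Q m (t - s)) = cQ m.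
Proof.
move=> /andP[t0 t2]; have [->|tn] := eqVneq t 0.
  by apply: eq_Rintegral => s _; rewrite sub0r QN.
have a2 : 0 <= 2 * pi - t < 2 * pi by rewrite subr_ge0 (ltW t2)/= gtrBl lt_def tn.
have mQ : measurable_fun (setT : set TR) (fun s : TR => Q m s) by exact: measurable_Q.
rewrite /cQ -(periodic_mu_per a2 mQ); last by move=> x; exact: Qper.
by apply: eq_Rintegral => s _; rewrite -QN -Qper; congr Q; ring.
Qed.

(** On [0, d / 2] the kernel is at least its value at d / 2. So the total mass decays no faster than
    ((1 + cos (d / 2)) / 2)^m, whereas at distance at least d from 0 modulo the period the kernel is
    at most ((1 + cos d) / 2)^m, with a strictly smaller base. *)
Lemma cQ_lb m (d : R) : 0 < d -> d <= pi -> d / 2 * ((1 + cos (d / 2)) / 2) ^+ m <= cQ m.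
Proof.
move=> d0 dpi.
set q := (1 + cos (d / 2)) / 2.
pose A : set TR := `[0, d / 2]%classic.
have mA : measurable A by exact: measurable_itv.
have m1A : mu_per A = (d / 2)%:E.
  transitivity (@lebesgue_measure R A).
    congr (lebesgue_measure _); apply: setIidl => x; rewrite /A /per_itv /= !in_itv /= => /andP[-> h] /=.
    by rewrite (le_lt_trans h)//; lra.
  by rewrite lebesgue_measure_itv /= lte_fin ifT ?sube0//; lra.
have iA : mu_per.-integrable setT (EFin \o (\1_A : TR -> R)) by exact: integrable_indic.
have -> : d / 2 * q ^+ m = Rintegral mu_per setT (fun x => q ^+ m * \1_A x).
  by rewrite RintegralZl// /Rintegral integral_indic// setIT /= -[(FiniteMeasure.sort _) _]/(mu_per A) m1A mulrC.
apply: le_Rintegral => //; [exact: (integrableZl measurableT (q ^+ m) iA)|exact: integrable_Q|].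
move=> x _; rewrite indicE; case: (boolP (x \in A)) => [|_]; last by rewrite mulr0 Q_ge0.
rewrite inE /A /= in_itv /= => /andP[x0 xd]; rewrite mulr1 /Q.
have h : cos (d / 2) <= cos x by apply: cos_le_of_le; lra.
have := cos_geN1 (d / 2) => h'.
by apply: lerXn2r; rewrite ?nnegrE /q; lra.
Qed.

Lemma cQ_gt0 m : 0 < cQ m.
Proof.
apply: lt_le_trans (@cQ_lb m 1 _ _); rewrite ?ltr01//; last by have := @pi_ge2 R; lra.
have h : 0 < cos (1 / 2) :> R by apply: cos_gt0_pihalf; have := @pi_ge2 R; lra.
by rewrite mulr_gt0 ?exprn_gt0//; lra.
Qed.

Lemma geo_small (K r e : R) : 0 <= r < 1 -> 0 < e -> 0 <= K -> exists N : nat, forall m, (N <= m)%N -> K * r ^+ m <= e.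
Proof.
move=> /andP[r0 r1] e0 K0.
have r1' : `|r| < 1 by rewrite ger0_norm.
have K1 : 0 < K + 1 by lra.
have := @cvg_expr R r r1'; move/cvgrPdist_le => /(_ (e / (K + 1)) (divr_gt0 e0 K1)) [N _ HN].
exists N => m Nm; have := HN m Nm; rewrite sub0r normrN ger0_norm ?exprn_ge0// => h.
apply: (@le_trans _ _ ((K + 1) * r ^+ m)); first by rewrite ler_wpM2r ?exprn_ge0//; lra.
by rewrite mulrC -ler_pdivlMr.
Qed.

(** Within distance [d] of [t] continuity gives half of [e] times the mass; farther away the kernel
    is at most [q1 ^+ m], negligible against the mass because q1 < q2. *)
Lemma approx_identity (g : TR -> C) (M t : R) : cmeasurable setT g -> (forall s, normc (g s) <= M) ->
  0 < t < 2 * pi ->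
  (forall e, 0 < e -> exists2 d, 0 < d & forall s, `|s - t| < d -> normc (g s - g t) <= e) ->
  forall e, 0 < e -> exists N : nat, forall m, (N <= m)%N ->
   normc (toC (cQ m)^-1 * cintg mu_per setT (fun s : TR => g s * toC (Q m (t - s))) - g t) <= e.
Proof.
move=> mg gM /andP[t0 t2] gc e e0.
have M0 : 0 <= M by exact: le_trans (normc_ge0 _) (gM 0).
have e2 : 0 < e / 2 by rewrite divr_gt0.
have [d' d'0 Hd'] := gc _ e2.
have p0 := @pi_gt0 R.
(* Besides continuity, [d] ensures that the interval of radius [d] around [t] stays inside the
   period, so that no other point of the period comes closer than [d] to [t] modulo [2 * pi], and
   that the cosine decreases on [0, d]. *)
pose d := Num.min (Num.min d' t) (Num.min (2 * pi - t) pi).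
have d0 : 0 < d by rewrite /d !lt_min d'0 t0 p0 subr_gt0 t2.
have [[dd' dt] [d2t dpi]] : (d <= d' /\ d <= t) /\ (d <= 2 * pi - t /\ d <= pi).
  by rewrite /d !ge_min !lexx ?orbT.
pose q1 := (1 + cos d) / 2; pose q2 := (1 + cos (d / 2)) / 2.
have q10 : 0 <= q1 by rewrite /q1; have := cos_geN1 d; lra.
have q12 : q1 < q2.
  have : cos d < cos (d / 2) by rewrite ltr_cos ?in_itv /=; [lra|apply/andP; split; lra..].
  by rewrite /q1 /q2; lra.
have q20 : 0 < q2 by lra.
have r01 : 0 <= q1 / q2 < 1 by rewrite divr_ge0 ?(ltW q20)//= ltr_pdivrMr// mul1r.
(* The far part is at most 2 M q1^m times the length 2 pi, and the mass is at least (d / 2) q2^m;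
   the quotient is (8 pi M / d) (q1 / q2)^m. *)
have K0 : 0 <= 8 * pi * M / d by rewrite divr_ge0 ?(ltW d0)// mulr_ge0// mulr_ge0// ltW.
have [N HN] := geo_small r01 e2 K0.
exists N => m Nm.
have tI : 0 <= t < 2 * pi by rewrite (ltW t0) t2.
have msub : measurable_fun (setT : set TR) (fun s : TR => (t - s)%R : TR) by exact: measurable_funB.
have mQ : cmeasurable (setT : set TR) (fun s : TR => toC (Q m (t - s))) by apply: cmeasurable_toC; exact: (measurable_Q m msub).
have bQ (s : TR) : normc (toC (Q m (t - s))) <= 1 by rewrite normc_toC ger0_norm ?Q_ge0// Q_le1.
have iQ : mu_per.-integrable setT (EFin \o (fun s : TR => Q m (t - s))) := integrable_Q m msub.
have cp := cQ_gt0 m.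
have i1 : cintegrable mu_per setT (fun s : TR => g s * toC (Q m (t - s))).
  apply: (@cintegrable_bounded _ _ _ mu_per _ (M * 1)); first exact: cmeasM.
  by move=> x; rewrite normcM ler_pM ?normc_ge0.
have i2 : cintegrable mu_per setT (fun s : TR => g t * toC (Q m (t - s))).
  apply: (@cintegrable_bounded _ _ _ mu_per _ (M * 1)); first by apply: cmeasM => //; exact: cmeasurable_cst.
  by move=> x; rewrite normcM ler_pM ?normc_ge0.
have i3 : cintegrable mu_per setT (fun s : TR => toC (Q m (t - s))) by exact: cintegrable_bounded bQ.
have -> : toC (cQ m)^-1 * cintg mu_per setT (fun s : TR => g s * toC (Q m (t - s))) - g t =
   toC (cQ m)^-1 * cintg mu_per setT (fun s : TR => g s * toC (Q m (t - s)) - g t * toC (Q m (t - s))).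
  rewrite cIB// (cIZ _ _ i3)// cintg_toC cQ_shift// mulrBr; congr (_ - _).
  by rewrite mulrCA -toCM mulVf ?mulr1// gt_eqF.
rewrite normcM normc_toC ger0_norm ?invr_ge0 ?(ltW cp)// mulrC ler_pdivrMr//.
have ih : mu_per.-integrable setT (EFin \o (fun s : TR => e / 2 * Q m (t - s) + 2 * M * q1 ^+ m)).
  have ic : mu_per.-integrable setT (EFin \o (fun _ : TR => 2 * M * q1 ^+ m)) by exact: finite_measure_integrable_cst.
  by apply: (eq_integrable measurableT _ _ _ (integrableD measurableT (integrableZl measurableT (e / 2) iQ) ic)).
apply: le_trans (normc_cintg_le_ae (cintegrableB measurableT i1 i2) ih _) _.
  exists (~` @per_itv R); split.
  - by apply: measurableC; exact: measurable_per_itv.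
  - by rewrite [LHS](_ : _ = lebesgue_measure (~` @per_itv R `&` @per_itv R))// setICl measure0.
  - move=> s /= h; rewrite /setC /mkset => Is; apply: h; move: Is; rewrite /per_itv /= in_itv /= => /andP[s0 s2].
    rewrite -mulrBl normcM normc_toC ger0_norm ?Q_ge0//.
    have MQ : 0 <= 2 * M * q1 ^+ m by rewrite mulr_ge0 ?exprn_ge0// mulr_ge0.
    have [st|st] := ltP `|s - t| d.
      rewrite (@le_trans _ _ (e / 2 * Q m (t - s)))//; last by rewrite lerDl.
      by rewrite ler_wpM2r ?Q_ge0// Hd'// (lt_le_trans st).
    apply: (@le_trans _ _ (2 * M * q1 ^+ m)); last by rewrite lerDr mulr_ge0 ?Q_ge0// ltW.
    apply: ler_pM; rewrite ?normc_ge0 ?Q_ge0//.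
      by rewrite (le_trans (ler_normcB _ _))// mulr2n mulrDl mul1r lerD.
    have hc : cos (t - s) <= cos d.
      rewrite -cos_norm distrC; have [hp|hp] := leP `|s - t| pi; first exact: cos_le_of_le (ltW d0) st hp.
      have -> : cos `|s - t| = cos (2 * pi - `|s - t|).
        by rewrite -[LHS]cosN -[LHS]cosD2pi; congr cos; ring.
      apply: cos_le_of_le; rewrite ?(ltW d0)//; last lra.
      move: hp; have [h1|h1] := leP 0 (s - t); [rewrite ger0_norm//|rewrite ltr0_norm//]; lra.
    by have := cos_geN1 (t - s) => h'; apply: lerXn2r; rewrite ?nnegrE /q1; lra.
have e1 : Rintegral mu_per setT (fun s : TR => e / 2 * Q m (t - s)) = e / 2 * cQ m.
  by rewrite (RintegralZl (e / 2) measurableT iQ) cQ_shift.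
have e3 : Rintegral mu_per setT (fun _ : TR => 2 * M * q1 ^+ m) = 2 * M * q1 ^+ m * (2 * pi).
  by rewrite Rintegral_cst// -[fine _]/(fine (mu_per setT)) m1T.
rewrite RintegralD//; [|exact: (integrableZl measurableT (e / 2) iQ)|exact: finite_measure_integrable_cst].
rewrite e1 e3.
have -> : e * cQ m = e / 2 * cQ m + e / 2 * cQ m by field.
rewrite lerD2l.
have hl := cQ_lb m d0 dpi; have := HN m Nm; rewrite expr_div_n => hr.
have qm : 0 < q2 ^+ m by rewrite exprn_gt0.
apply: (@le_trans _ _ (e / 2 * (d / 2 * q2 ^+ m))); last by rewrite ler_pM2l.
have -> : 2 * M * q1 ^+ m * (2 * pi) = (8 * pi * M / d * (q1 ^+ m / q2 ^+ m)) * (d / 2 * q2 ^+ m).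
  by field; rewrite !gt_eqF.
by rewrite ler_wpM2r// mulr_ge0 ?(ltW qm)//; lra.
Qed.

(** [S] lists pairs of a coefficient and a frequency, repetitions allowed. The base (1 + cos u) / 2
    has the frequencies 0, 1, -1 with weights 1/2, 1/4, 1/4, and powers multiply the lists. *)
Lemma Q_trig m : exists S : seq (C * int), forall u, toC (Q m u) = \sum_(p <- S) p.1 * cexpi (p.2%:~R * u).
Proof.
elim: m => [|m [S HS]].
  exists [:: (1, 0)] => u; rewrite big_seq1 mul0r cexpi0 mulr1 /Q expr0 toC1//.
pose B : seq (C * int) := [:: (toC (1 / 2), 0); (toC (1 / 4), 1); (toC (1 / 4), -1)].
have HB u : toC ((1 + cos u) / 2) = \sum_(p <- B) p.1 * cexpi (p.2%:~R * u).
  have e0 : (0 : int)%:~R = 0 :> R by [].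
  have e1 : (1 : int)%:~R = 1 :> R by [].
  have e2 : (-1 : int)%:~R = - 1 :> R by rewrite intrN.
  rewrite /B !big_cons big_nil.
  rewrite -[RHS]/(toC (1 / 2) * cexpi ((0 : int)%:~R * u) + (toC (1 / 4) * cexpi ((1 : int)%:~R * u) + (toC (1 / 4) * cexpi ((-1 : int)%:~R * u) + 0))).
  rewrite e0 e1 e2 mul0r cexpi0 (mul1r u) mulN1r cexpiN.
  by apply: complexP; rewrite ?(ReD, ImD, ReM, ImM, ReJ, ImJ) /toC /cexpi /=; [field|ring].
exists [seq (p.1 * p'.1, p.2 + p'.2) | p <- B, p' <- S] => u.
rewrite {1}/Q exprS toCM HB -/(Q m u) HS big_allpairs_dep /= mulr_suml.
apply: eq_bigr => p _; rewrite mulr_sumr; apply: eq_bigr => p' _ /=.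
by rewrite intrD mulrDl cexpiD; ring.
Qed.
End kernelQ.

(** * Integrable functions are determined by their Fourier coefficients *)

Section dynkin.
Variable R : realType.
Local Notation TR := (measurableTypeR R).
Local Notation C := (R[i]).
Local Notation mu_per2 := (@mu_per2 R).
Local Notation mu_per := (@mu_per R).

Lemma cmeasurable_fst (u : TR -> C) : cmeasurable setT u -> cmeasurable (setT : set (TR * TR)) (fun t => u t.1).
Proof. by case=> a b; split; [exact: (measurableT_comp a measurable_fst)|exact: (measurableT_comp b measurable_fst)]. Qed.
Lemma cmeasurable_snd (u : TR -> C) : cmeasurable setT u -> cmeasurable (setT : set (TR * TR)) (fun t => u t.2).
Proof. by case=> a b; split; [exact: (measurableT_comp a measurable_snd)|exact: (measurableT_comp b measurable_snd)]. Qed.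

Lemma normc_indic (T : Type) (A : set T) x : normc (toC (\1_A x : R)) <= 1.
Proof. by rewrite normc_toC indicE; case: (_ \in _); rewrite ?normr1// normr0 ler01. Qed.

Lemma cmeasurable_indic d (T : measurableType d) (A : set T) : measurable A ->
  cmeasurable setT (fun x => toC (\1_A x : R)).
Proof. by move=> mA; apply: cmeasurable_toC; exact: measurable_indic. Qed.

Lemma sum_indic_trivIset (T : Type) (F : (set T)^nat) (j n : nat) x :
  trivIset setT F -> F j x -> \sum_(0 <= k < n) (\1_(F k) x : R) = ((j < n)%N)%:R.
Proof.
move=> tF Fj.
have e k : \1_(F k) x = (k == j)%:R :> R.
  rewrite indicE; case: eqP => [->|kj]; first by rewrite mem_set.
  rewrite memNset// => Fk; apply: kj; apply: (tF k j) => //; by exists x.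
under eq_bigr do rewrite e.
have [jn|nj] := ltnP j n.
  rewrite (bigD1_seq j) ?mem_index_iota ?iota_uniq//= eqxx big1 ?addr0// => i /negbTE ->.
  by [].
rewrite big_nat big1// => i /andP[_ ij]; case: eqP => // ej.
by move: ij; rewrite ej ltnNge nj.
Qed.

(** The sets [A] for which [h] integrates to 0 over the preimage of [A] under [phi] form a Dynkin
    system: the vanishing total integral gives complements, and dominated convergence with majorant
    |h| gives disjoint unions. It contains the pi-system [G], hence everything generated by it. *)
Lemma dynkin_cintg d' (T' : measurableType d') (h : TR * TR -> C) (phi : TR * TR -> T') (G : set (set T')) :
  measurable_fun setT phi -> @measurable _ T' = <<s G >> -> setI_closed G ->
  cintegrable mu_per2 setT h -> cintg mu_per2 setT h = 0 ->
  (forall A, G A -> cintg mu_per2 setT (fun x => h x * toC (\1_A (phi x))) = 0) ->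
  forall A, measurable A -> cintg mu_per2 setT (fun x => h x * toC (\1_A (phi x))) = 0.
Proof.
move=> mphi GE GI ih h0 hG A; rewrite {1}GE; move: A.
have mind (A : set T') : measurable A -> cmeasurable setT (fun x => toC (\1_A (phi x) : R)).
  by move=> mA; apply: cmeasurable_toC; exact: (measurableT_comp (@measurable_indic _ _ R setT A mA) mphi).
have ihA (A : set T') : measurable A -> cintegrable mu_per2 setT (fun x => h x * toC (\1_A (phi x))).
  move=> mA; apply: (@cintegrableM _ _ _ mu_per2 setT measurableT _ _ 1) => //; first exact: mind.
  by move=> x _; exact: normc_indic.
apply: (dynkin_induction GE GI).
- by rewrite -[RHS]h0; apply: eq_cintg => x _; rewrite indicT mulr1.
- exact: hG.
- move=> S mS PS; rewrite -[RHS](subrr 0) -{1}h0 -PS -cIB//; last exact: ihA.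
  apply: eq_cintg => x _; rewrite !indicE in_setC.
  by case: (_ \in _); rewrite /= ?mulr0 ?mulr1 ?subrr ?subr0.
- move=> F mF tF PF.
  have mU : measurable (\bigcup_k F k) by exact: bigcupT_measurable.
  pose f_ n x := \sum_(k <- index_iota 0 n) h x * toC (\1_(F k) (phi x) : R).
  have f_E n x : f_ n x = h x * toC (\sum_(0 <= k < n) (\1_(F k) (phi x) : R)).
    by rewrite /f_ -mulr_sumr toC_sum.
  have mf_ n : cmeasurable setT (f_ n).
    by apply: cmeasurable_sum => k; apply: cintegrable_cmeasurable (ihA _ (mF k)).
  have z n : cintg mu_per2 setT (f_ n) = 0.
    rewrite cintg_sum//; last by move=> k; exact: ihA.
    by rewrite big1.
  have Ucase x : (exists j, F j (phi x)) \/ (forall j, ~ F j (phi x)).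
    have [[j Fj]|/forallNP nF] := pselect (exists j, F j (phi x)); [left; by exists j|by right].
  have Nsum n x : (forall j, ~ F j (phi x)) -> \sum_(0 <= k < n) (\1_(F k) (phi x) : R) = 0.
    by move=> nF; rewrite big1// => k _; rewrite indicE memNset.
  have hc : {ae mu_per2, forall x, forall e, 0 < e -> exists N, forall n, (N <= n)%N ->
      normc (f_ n x - h x * toC (\1_(\bigcup_k F k) (phi x))) <= e}.
    apply: aeW => x e' e'0; have [[j Fj]|nF] := Ucase x.
      exists j.+1 => n jn; rewrite f_E (sum_indic_trivIset _ tF Fj) jn indicE mem_set; last by exists j.
      by rewrite subrr normc0 ltW.
    exists 0%N => n _; rewrite f_E Nsum// indicE memNset; last by move=> [j _]; exact: nF.
    by rewrite subrr normc0 ltW.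
  have hb : {ae mu_per2, forall x, forall n, normc (f_ n x) <= normc (h x)}.
    apply: aeW => x n; rewrite f_E normcM ler_piMr ?normc_ge0//; have [[j Fj]|nF] := Ucase x.
      by rewrite (sum_indic_trivIset _ tF Fj) normc_toC ger0_norm// lern1 leq_b1.
    by rewrite Nsum// toC0 normc0 ler01.
  have [_ H] := cintg_dct mf_ (cintegrable_cmeasurable (ihA _ mU)) (integrable_normc measurableT ih) hc hb.
  apply/eq0_normc/le_anti; rewrite normc_ge0 andbT; apply/ler_addgt0Pl => e e0; rewrite addr0.
  have [N /(_ N (leqnn _))] := H _ e0.
  by rewrite z sub0r normcN.
Qed.

Lemma ae_mu_per (P : TR -> Prop) (a : R) : (forall x, 0 < x < 2 * pi -> x != a -> P x) -> {ae mu_per, forall x, P x}.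
Proof.
move=> HP.
pose N : set TR := ~` `]0, 2 * pi[%classic `|` [set a].
have mN : measurable N.
  by apply: measurableU => //; apply: measurableC; exact: measurable_itv.
exists N; split => //.
- have e z : @lebesgue_measure R ([set z] : set TR) = 0%E by exact: lebesgue_measure_set1.
  have : (lebesgue_measure (N `&` @per_itv R) <= 0 :> \bar R)%E.
    pose B0 : set TR := [set 0]; pose Ba : set TR := [set a].
    have h : N `&` @per_itv R `<=` B0 `|` Ba.
      move=> x [[/= h|->] Ix]; last by right.
      left; move: Ix h; rewrite /per_itv /= !in_itv /= => /andP[x0 x2] h /=.
      by apply/eqP; rewrite eq_le x0 andbT leNgt; apply/negP => xp; apply: h; rewrite xp x2.
    have mB0 : measurable B0 := measurable_set1 0.
    have mBa : measurable Ba := measurable_set1 a.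
    apply: le_trans (_ : lebesgue_measure (B0 `|` Ba) <= 0)%E.
      apply: le_measure => //; rewrite ?inE; last exact: measurableU.
      by apply: measurableI => //; exact: measurable_itv.
    have := measureU2 (@lebesgue_measure R) mB0 mBa; rewrite [X in (_ <= X)%E](_ : _ = 0%E)//.
    by rewrite -[RHS]adde0; congr (_ + _)%E; exact: e.
  by rewrite measure_le0 => /eqP.
- move=> x /= nP; rewrite /N; have [->|xa] := eqVneq x a; first by right.
  left => /=; rewrite in_itv /= => h; exact/nP/HP.
Qed.

Lemma ae_fst (P : TR -> Prop) : {ae mu_per, forall x, P x} -> {ae mu_per2, forall x, P x.1}.
Proof.
move=> [N [mN N0 NP]]; exists (N `*` setT); split.
- exact: measurableX.
- transitivity (mu_per N * mu_per setT)%E; [exact: product_measure1E|by rewrite N0 mul0e].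
- by move=> [x y] /= h; split => //; exact: NP.
Qed.
Lemma ae_snd (P : TR -> Prop) : {ae mu_per, forall x, P x} -> {ae mu_per2, forall x, P x.2}.
Proof.
move=> [N [mN N0 NP]]; exists (setT `*` N); split.
- exact: measurableX.
- transitivity (mu_per setT * mu_per N)%E; [exact: product_measure1E|by rewrite N0 mule0].
- by move=> [x y] /= h; split => //; exact: NP.
Qed.

(* mollified indicator of a half-line: a trigonometric polynomial *)
Definition mollifier (a : R) (m : nat) (x : R) : C :=
  toC (cQ R m)^-1 * cintg mu_per setT (fun s : TR => toC (\1_(`]-oo, a[%classic) s) * toC (Q m (x - s))).

Lemma mollifier_trig a m : exists S : seq (C * int), forall x, mollifier a m x = \sum_(p <- S) p.1 * cexpi (p.2%:~R * x).
Proof.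
have [S HS] := Q_trig R m.
pose g : TR -> C := fun s => toC (\1_(`]-oo, a[%classic) s).
have mg : cmeasurable setT g by apply: cmeasurable_indic; exact: measurable_itv.
pose dp (p : C * int) : C := toC (cQ R m)^-1 * cintg mu_per setT (fun s : TR => g s * cexpi (- p.2%:~R * s)).
exists [seq (p.1 * dp p, p.2) | p <- S] => x.
have ip (p : C * int) : cintegrable mu_per setT (fun s : TR => g s * cexpi (- p.2%:~R * s)).
  apply: (@cintegrable_bounded _ _ _ mu_per _ 1); first by apply: cmeasM => //; exact: cmeasurable_cexpi1.
  by move=> s; rewrite normcM normc_cexpi mulr1 normc_indic.
rewrite big_map /= /mollifier.
transitivity (toC (cQ R m)^-1 * cintg mu_per setT (fun s : TR => \sum_(p <- S) (p.1 * cexpi (p.2%:~R * x)) * (g s * cexpi (- p.2%:~R * s)))).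
  congr (_ * _); apply: eq_cintg => s _; rewrite HS mulr_sumr; apply: eq_bigr => p _.
  by rewrite mulrBr cexpiD /g mulNr; ring.
rewrite cintg_sum//; last by move=> p; exact: cintegrableZ.
rewrite mulr_sumr; apply: eq_bigr => p _; rewrite cIZ// /dp; ring.
Qed.

Lemma mollifier_le1 a m x : 0 < x < 2 * pi -> normc (mollifier a m x) <= 1.
Proof.
move=> /andP[x0 x2].
have msub : measurable_fun (setT : set TR) (fun s : TR => (x - s)%R : TR) by exact: measurable_funB.
have cp := cQ_gt0 R m.
rewrite /mollifier normcM normc_toC ger0_norm ?invr_ge0 ?(ltW cp)// mulrC ler_pdivrMr// mul1r.
rewrite -(@cQ_shift R m x) ?(ltW x0)//.
apply: normc_cintg_le => //.
- apply: cmeasM; first by apply: cmeasurable_indic; exact: measurable_itv.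
  by apply: cmeasurable_toC; exact: (measurable_Q m msub).
- exact: (integrable_Q m msub).
- move=> s _; rewrite normcM [X in _ * X]normc_toC ger0_norm ?Q_ge0// ler_piMl ?Q_ge0//.
  exact: normc_indic.
Qed.

Lemma mollifier_cvg a x : 0 < x < 2 * pi -> x != a -> forall e, 0 < e ->
  exists N : nat, forall m, (N <= m)%N -> normc (mollifier a m x - toC (\1_(`]-oo, a[%classic) x)) <= e.
Proof.
move=> x02 xa; apply: (@approx_identity R (fun s => toC (\1_(`]-oo, a[%classic) s)) 1) => //.
- by apply: cmeasurable_indic; exact: measurable_itv.
- by move=> s; exact: normc_indic.
- move=> e e0; exists `|x - a|; first by rewrite normr_gt0 subr_eq0.
  move=> s sx; rewrite (_ : \1_(`]-oo, a[%classic) s = \1_(`]-oo, a[%classic) x) ?subrr ?normc0 ?ltW//.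
  rewrite !indicE; congr (_%:R); congr nat_of_bool; apply/idP/idP; rewrite !inE /= !in_itv /= => h.
    move: sx; rewrite ltr_norml; have [h'|h'] := leP a x; last by [].
    by rewrite ger0_norm ?subr_ge0//; lra.
  move: sx; rewrite ltr_norml; rewrite ltr0_norm ?subr_lt0//; lra.
Qed.

(** Vanishing coefficients make [f] orthogonal to all trigonometric polynomials, in particular to
    products of two mollified indicators of half-lines. In the limit [f] integrates to 0 over every
    quadrant; Dynkin's argument, used in each coordinate and then on the product, extends this to
    all measurable sets. *)
Lemma fcoeff_eq0_ae (f : TR * TR -> C) : cintegrable mu_per2 setT f -> (forall k, fcoeff f k = 0) ->
  {ae mu_per2, forall x, f x = 0}.
Proof.
move=> iF f0.
have mexp (j l : int) : cmeasurable (setT : set (TR * TR)) (fun x : TR * TR => cexpi (j%:~R * x.1) * cexpi (l%:~R * x.2)).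
  have := cmeasurable_ebasis R (j, l); move=> /(cmeasM (cmeasurable_cst _ (toC (2 * pi)))).
  case=> a b; split; [apply: (eq_measurable_fun _ _ a)|apply: (eq_measurable_fun _ _ b)] => x _;
    by rewrite ebasisE mulrA -toCM divff ?gt_eqF ?pi2_gt0// mul1r.
have z1 (j l : int) : cintg mu_per2 setT (fun x => f x * (cexpi (j%:~R * x.1) * cexpi (l%:~R * x.2))) = 0.
  have := f0 (- j, - l); rewrite /fcoeff => h.
  have e : cintg mu_per2 setT (fun x => f x * (cexpi (j%:~R * x.1) * cexpi (l%:~R * x.2))) =
     toC (2 * pi) * cintg mu_per2 setT (fun x => f x * conjc (ebasis (- j, - l) x)).
    rewrite -cIZ//; last exact: fcE.
    apply: eq_cintg => x _; rewrite ebasisE conjcM conjc_toC conjcM -!cexpiN /= !intrN !mulNr !opprK.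
    by rewrite [RHS]mulrCA [toC _ * (toC _ * _)]mulrA -toCM divff ?gt_eqF ?pi2_gt0// mul1r.
  by rewrite e h mulr0.
have itr (S S' : seq (C * int)) : cmeasurable (setT : set (TR * TR)) (fun x : TR * TR =>
     (\sum_(p <- S) p.1 * cexpi (p.2%:~R * x.1)) * (\sum_(p <- S') p.1 * cexpi (p.2%:~R * x.2))).
  have c1 (j : int) : cmeasurable (setT : set (TR * TR)) (fun x : TR * TR => cexpi (j%:~R * x.1)).
    by have [a b] := cmeasurable_cexpi1 (j%:~R : R); split; [exact: (measurableT_comp a)|exact: (measurableT_comp b)].
  have c2 (j : int) : cmeasurable (setT : set (TR * TR)) (fun x : TR * TR => cexpi (j%:~R * x.2)).
    by have [a b] := cmeasurable_cexpi1 (j%:~R : R); split; [exact: (measurableT_comp a)|exact: (measurableT_comp b)].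
  by apply: cmeasM; apply: cmeasurable_sum => p; apply: cmeasM => //; exact: cmeasurable_cst.
have z2 (S S' : seq (C * int)) : cintg mu_per2 setT (fun x => f x *
   ((\sum_(p <- S) p.1 * cexpi (p.2%:~R * x.1)) * (\sum_(p <- S') p.1 * cexpi (p.2%:~R * x.2)))) = 0.
  have i1 (p p' : C * int) : cintegrable mu_per2 setT (fun x => (p.1 * p'.1) * (f x * (cexpi (p.2%:~R * x.1) * cexpi (p'.2%:~R * x.2)))).
    apply: cintegrableZ => //; apply: (@cintegrableM _ _ _ mu_per2 setT measurableT _ _ 1) => //.
    by move=> x _; rewrite normcM !normc_cexpi mulr1.
  transitivity (cintg mu_per2 setT (fun x => \sum_(p <- S) \sum_(p' <- S') (p.1 * p'.1) * (f x * (cexpi (p.2%:~R * x.1) * cexpi (p'.2%:~R * x.2))))).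
    apply: eq_cintg => x _; rewrite mulr_suml mulr_sumr; apply: eq_bigr => p _.
    by rewrite !mulr_sumr; apply: eq_bigr => p' _; ring.
  rewrite cintg_sum//; last by move=> p; apply: cintegrable_sum.
  rewrite big1// => p _; rewrite cintg_sum// big1// => p' _.
  rewrite cIZ ?z1 ?mulr0//; apply: (@cintegrableM _ _ _ mu_per2 setT measurableT _ _ 1) => //.
  by move=> x _; rewrite normcM !normc_cexpi mulr1.
have iN := integrable_normc measurableT iF.
have mr (a : R) : measurable (`]-oo, a[%classic : set TR) by exact: measurable_itv.
have mr1 (a : R) : cmeasurable (setT : set (TR * TR)) (fun x : TR * TR => toC (\1_(`]-oo, a[%classic : set TR) x.1 : R)).
  exact: (cmeasurable_fst (cmeasurable_indic (mr a))).
have mr2 (a : R) : cmeasurable (setT : set (TR * TR)) (fun x : TR * TR => toC (\1_(`]-oo, a[%classic : set TR) x.2 : R)).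
  exact: (cmeasurable_snd (cmeasurable_indic (mr a))).
have rays (a b : R) : cintg mu_per2 setT (fun x => f x * (toC (\1_(`]-oo, a[%classic : set TR) x.1) * toC (\1_(`]-oo, b[%classic : set TR) x.2))) = 0.
  pose f_ m x := f x * (mollifier a m x.1 * mollifier b m x.2).
  have zf m : cintg mu_per2 setT (f_ m) = 0.
    have [S HS] := mollifier_trig a m; have [S' HS'] := mollifier_trig b m.
    by rewrite -[RHS](z2 S S'); apply: eq_cintg => x _; rewrite /f_ HS HS'.
  have mf_ m : cmeasurable setT (f_ m).
    apply: cmeasM; first exact: cintegrable_cmeasurable iF.
    have [S HS] := mollifier_trig a m; have [S' HS'] := mollifier_trig b m.
    by have := itr S S'; congr cmeasurable; apply/funext => x; rewrite HS HS'.
  have A1 := ae_fst (@ae_mu_per (fun x => 0 < x < 2 * pi /\ x != a) a (fun x h1 h2 => conj h1 h2)).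
  have A2 := ae_snd (@ae_mu_per (fun x => 0 < x < 2 * pi /\ x != b) b (fun x h1 h2 => conj h1 h2)).
  have hb : {ae mu_per2, forall x, forall n, normc (f_ n x) <= normc (f x)}.
    apply: (@filterS2 _ _ (ae_filter_ringOfSetsType mu_per2) _ _ _ _ A1 A2).
    move=> x [x1 _] [x2 _] n; rewrite /f_ normcM ler_piMr ?normc_ge0// normcM.
    by rewrite mulr_ile1 ?normc_ge0// mollifier_le1.
  have hc : {ae mu_per2, forall x, forall e, 0 < e -> exists N, forall n, (N <= n)%N ->
     normc (f_ n x - f x * (toC (\1_(`]-oo, a[%classic : set TR) x.1) * toC (\1_(`]-oo, b[%classic : set TR) x.2))) <= e}.
    apply: (@filterS2 _ _ (ae_filter_ringOfSetsType mu_per2) _ _ _ _ A1 A2).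
    move=> x [x1 xa] [x2 xb] e e0.
    have K0 : 0 < normc (f x) + 1 by rewrite ltr_wpDl ?normc_ge0.
    have d0 : 0 < e / (2 * (normc (f x) + 1)) by rewrite divr_gt0// mulr_gt0.
    have [N1 H1] := mollifier_cvg x1 xa d0; have [N2 H2] := mollifier_cvg x2 xb d0.
    exists (maxn N1 N2) => n; rewrite geq_max => /andP[n1 n2].
    rewrite /f_ -mulrBr normcM.
    set u := mollifier a n x.1; set v := mollifier b n x.2; set u' := toC _; set v' := toC _.
    have -> : u * v - u' * v' = (u - u') * v + u' * (v - v') by ring.
    have hu : normc (u - u') <= e / (2 * (normc (f x) + 1)) by exact: H1.
    have hv : normc (v - v') <= e / (2 * (normc (f x) + 1)) by exact: H2.
    have lv : normc v <= 1 by exact: mollifier_le1.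
    have lu : normc u' <= 1 by exact: normc_indic.
    have hs : normc ((u - u') * v + u' * (v - v')) <= e / (normc (f x) + 1).
      rewrite (le_trans (ler_normcD _ _))// (normcM (u - u') v) (normcM u' (v - v')).
      have -> : e / (normc (f x) + 1) = e / (2 * (normc (f x) + 1)) * 1 + 1 * (e / (2 * (normc (f x) + 1))).
        by have kn : normc (f x) + 1 != 0; [rewrite gt_eqF|field].
      by apply: lerD; [apply: (ler_pM _ _ hu lv)|apply: (ler_pM _ _ lu hv)]; apply: normc_ge0.
    apply: (@le_trans _ _ ((normc (f x) + 1) * (e / (normc (f x) + 1)))).
      by apply: ler_pM; rewrite ?normc_ge0// lerDl.
    by rewrite mulrC divfK// gt_eqF.
  have mlim : cmeasurable setT (fun x => f x * (toC (\1_(`]-oo, a[%classic : set TR) x.1) * toC (\1_(`]-oo, b[%classic : set TR) x.2))).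
    by apply: cmeasM; [exact: cintegrable_cmeasurable iF|exact: cmeasM].
  have [_ H] := cintg_dct mf_ mlim iN hc hb.
  apply/eq0_normc/le_anti; rewrite normc_ge0 andbT; apply/ler_addgt0Pl => e e0; rewrite addr0.
  have [N /(_ N (leqnn _))] := H _ e0.
  by rewrite zf sub0r normcN.
have GI : setI_closed (@RGenInftyO.G R).
  move=> _ _ [x ->] [y ->]; exists (Num.min x y).
  apply/seteqP; split => z /=; rewrite !in_itv /= lt_min; first by move=> [-> ->].
  by move=> /andP[].
have GE : @measurable _ TR = <<s (@RGenInftyO.G R) >> by exact: (RGenInftyO.measurableE R).
(* The measure lives below [2 * pi], so the half-line below [2 * pi] stands for the whole line. This
   supplies the vanishing total integral that [dynkin_cintg] asks for. *)
have A2pi : {ae mu_per, forall x, x < 2 * pi}.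
  by apply: (@ae_mu_per _ 0) => x /andP[].
have step1 (b : R) A : measurable A -> cintg mu_per2 setT (fun x => (f x * toC (\1_(`]-oo, b[%classic : set TR) x.2)) * toC (\1_(A : set TR) x.1)) = 0.
  have ih : cintegrable mu_per2 setT (fun x => f x * toC (\1_(`]-oo, b[%classic : set TR) x.2)).
    apply: (@cintegrableM _ _ _ mu_per2 setT measurableT _ _ 1) => //.
    by move=> x _; exact: normc_indic.
  apply: (dynkin_cintg _ GE GI ih) => //.
    rewrite -[RHS](rays (2 * pi) b); apply: ae_eq_cintg => //; first exact: cintegrable_cmeasurable ih.
      by apply: cmeasM; [exact: cintegrable_cmeasurable iF|exact: cmeasM].
    apply: (@filterS _ _ (ae_filter_ringOfSetsType mu_per2) _ _ _ (ae_fst A2pi)).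
    move=> x hx _; have e : \1_(`]-oo, 2 * pi[%classic : set TR) x.1 = 1 :> R by rewrite indicE mem_set//= in_itv.
    by rewrite e mul1r.
  move=> _ [a ->]; rewrite -[RHS](rays a b); apply: eq_cintg => x _.
  by rewrite -mulrA [toC _ * _]mulrC.
have step2 A B : measurable A -> measurable B -> cintg mu_per2 setT (fun x => (f x * toC (\1_(A : set TR) x.1)) * toC (\1_(B : set TR) x.2)) = 0.
  move=> mA; move: B.
  have mA1 : cmeasurable (setT : set (TR * TR)) (fun x : TR * TR => toC (\1_A x.1 : R)).
    exact: (cmeasurable_fst (cmeasurable_indic mA)).
  have ih : cintegrable mu_per2 setT (fun x => f x * toC (\1_(A : set TR) x.1)).
    apply: (@cintegrableM _ _ _ mu_per2 setT measurableT _ _ 1) => //.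
    by move=> x _; exact: normc_indic.
  apply: (dynkin_cintg _ GE GI ih) => //.
    rewrite -[RHS](step1 (2 * pi) A mA); apply: ae_eq_cintg => //; first exact: cintegrable_cmeasurable ih.
      by apply: cmeasM => //; apply: cmeasM => //; exact: cintegrable_cmeasurable iF.
    apply: (@filterS _ _ (ae_filter_ringOfSetsType mu_per2) _ _ _ (ae_snd A2pi)).
    move=> x hx _; have e : \1_(`]-oo, 2 * pi[%classic : set TR) x.2 = 1 :> R by rewrite indicE mem_set//= in_itv.
    by rewrite e mulr1.
  move=> _ [b ->]; rewrite -[RHS](step1 b A mA); apply: eq_cintg => x _.
  by rewrite -!mulrA [toC _ * _]mulrC.
have step3 (X : set (TR * TR)) : measurable X -> cintg mu_per2 setT (fun x => f x * toC (\1_X x)) = 0.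
  move=> mX; apply: (@dynkin_cintg _ _ f id _ (@measurable_id _ _ _) (measurable_prod_measurableType TR TR) _ iF _ _ X mX).
  - move=> _ _ [A mA [B mB <-]] [A' mA' [B' mB' <-]]; exists (A `&` A'); first exact: measurableI.
    by exists (B `&` B'); [exact: measurableI|rewrite setXI].
  - rewrite -[RHS](step2 setT setT)//; apply: eq_cintg => x _.
    by rewrite !indicT !mulr1.
  - move=> _ [A mA [B mB <-]]; rewrite -[RHS](step2 A B)//; apply: eq_cintg => x _.
    rewrite -mulrA -toCM; congr (_ * toC _); rewrite !indicE -natrM mulnb; congr (_%:R); congr nat_of_bool.
    by case: x => x y; rewrite in_setX.
have [ir ii] := iF.
have fin (g : TR * TR -> R) : mu_per2.-integrable setT (EFin \o g) ->
   (forall X : set (TR * TR), measurable X -> Rintegral mu_per2 setT (fun x => g x * \1_X x) = 0) -> {ae mu_per2, forall x, g x = 0}.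
  move=> ig hg; have : ae_eq mu_per2 setT (EFin \o g) (cst 0%E).
    apply: integral_ae_eq => // E _ mE; rewrite integral0.
    have h := hg E mE.
    have ie : mu_per2.-integrable setT (EFin \o (fun x => g x * \1_E x)).
      have := (integrable_mkcond (EFin \o g) mE).1 (integrableS measurableT mE (@subsetT _ _) ig).
      by apply: eq_integrable => // x _; rewrite patchE /= indicE; case: ifP => _; rewrite ?mulr1 ?mulr0.
    have := integrable_fin_num measurableT ie => /fineK e1.
    transitivity (\int[mu_per2]_x (EFin \o (fun x => (g x * \1_E x)%R)) x)%E; last first.
      by rewrite -e1; move: h; rewrite /Rintegral => ->.
    rewrite integral_mkcond; apply: eq_integral => x _; rewrite patchE /= indicE.
    by case: ifP => _; rewrite ?mulr1 ?mulr0.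
  by move=> h; apply: (@filterS _ _ (ae_filter_ringOfSetsType mu_per2) _ _ _ h) => x /(_ I) [].
have R0 := fin (fun x => complex.Re (f x)) ir.
have I0 := fin (fun x => complex.Im (f x)) ii.
have h1 : {ae mu_per2, forall x, complex.Re (f x) = 0}.
  apply: R0 => X mX; have := step3 X mX => /(congr1 (@complex.Re R)) /= <-.
  by apply: eq_Rintegral => x _; rewrite ReM /toC /= mulr0 subr0.
have h2 : {ae mu_per2, forall x, complex.Im (f x) = 0}.
  apply: I0 => X mX; have := step3 X mX => /(congr1 (@complex.Im R)) /= <-.
  by apply: eq_Rintegral => x _; rewrite ImM /toC /= mulr0 add0r.
apply: (@filterS2 _ _ (ae_filter_ringOfSetsType mu_per2) _ _ _ _ h1 h2).
by move=> x a b; exact: complexP.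
Qed.

End dynkin.

(** * Riesz-Fischer, Parseval and Riemann-Lebesgue *)

Section riesz_fischer.
Variable R : realType.
Local Notation TR := (measurableTypeR R).
Local Notation C := (R[i]).
Local Notation mu_per2 := (@mu_per2 R).
Implicit Types (a : int * int -> C) (f : R * R -> C).

Lemma sum_sub_uniq (T : eqType) (s t : seq T) (F : T -> R) : uniq s -> {subset s <= t} ->
  (forall k, 0 <= F k) -> \sum_(k <- s) F k <= \sum_(k <- t) F k.
Proof.
elim: s t => [|x s IH] t /=; first by move=> _ _ F0; rewrite big_nil sumr_ge0.
move=> /andP[xs us] st F0; rewrite big_cons.
have xt : x \in t by apply: st; rewrite mem_head.
rewrite [leRHS](perm_big _ (perm_to_rem xt)) big_cons lerD2l; apply: IH => // y ys.
have : y \in t by apply: st; rewrite in_cons ys orbT.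
rewrite (perm_mem (perm_to_rem xt)) in_cons => /predU1P[e|//].
by move: xs; rewrite -e ys.
Qed.

Definition box_sq a n : R := \sum_(k <- box n) normc (a k) ^+ 2.

Lemma box_sq_nd a m n : (m <= n)%N -> box_sq a m <= box_sq a n.
Proof.
by move=> mn; apply: sum_sub_uniq; [exact: box_uniq|exact: box_sub|move=> k; exact: sqr_ge0].
Qed.

Lemma sqnorm_trig_poly_sub a m n : (m <= n)%N ->
  sqnorm (fun x => trig_poly (box n) a x - trig_poly (box m) a x) = box_sq a n - box_sq a m.
Proof.
move=> mn; rewrite sqnorm_sub_trig_poly ?box_uniq//; last exact: inL2m_trig_poly.
rewrite sqnorm_trig_poly ?box_uniq// -/(box_sq a n).
have e k : k \in box m -> fcoeff (trig_poly (box n) a) k = a k.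
  by move=> km; rewrite fcoeff_trig_poly ?box_uniq// (box_sub mn km).
rewrite (eq_big_seq (fun k => normc (a k) ^+ 2)); last by move=> k km; rewrite e.
have -> : \sum_(k <- box m) normc (fcoeff (trig_poly (box n) a) k - a k) ^+ 2 = 0.
  by rewrite big_seq big1// => k km; rewrite e// subrr normc0 expr0n.
by rewrite addr0.
Qed.

Lemma limn_einf_le_cst (v : (\bar R)^nat) (c : \bar R) : (forall n, v n <= c)%E -> (limn_einf v <= c)%E.
Proof.
move=> vc; rewrite limn_einf_lim; apply: lime_le; first exact: is_cvg_einfs.
apply: nearW => n; apply: le_trans (vc n).
by apply: ereal_inf_lbound; exists n => /=.
Qed.

Lemma cvg_of_summable (v d : R^nat) (b : R) : (forall n, `|v n.+1 - v n| <= d n) ->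
  (forall n, \sum_(0 <= k < n) d k <= b) -> cvgn v.
Proof.
move=> vd db.
have d0 n : 0 <= d n by exact: le_trans (normr_ge0 _) (vd n).
have c1 : cvgn (series (fun n => v n.+1 - v n)).
  apply: normed_cvg; apply: nondecreasing_is_cvgn.
    by apply/nondecreasing_seqP => n; rewrite /series [leRHS]big_nat_recr//= lerDl.
  exists b => _ [n _ <-]; apply: le_trans (db n).
  by apply: ler_sum => k _; exact: vd.
have -> : v = (fun n => v 0%N + series (fun n => v n.+1 - v n) n).
  apply/funext => n; rewrite /series /= telescope_sumr//; ring.
by apply: is_cvgD => //; exact: is_cvg_cst.
Qed.

Lemma sqnorm_fin f : inL2m f -> (\int[mu_per2]_x (normc (f x) ^+ 2)%:E)%E = (sqnorm f)%:E.
Proof. by move=> [_ hL]; rewrite /sqnorm /Rintegral fineK// integrable_fin_num. Qed.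

(** A rapidly Cauchy subsequence of box sums has summable L^1 increments, so it converges absolutely
    almost everywhere; Fatou's lemma turns the pointwise limit into a limit in L^2, which fixes the
    coefficients. *)
Lemma riesz_fischer a (M : R) : (forall n, box_sq a n <= M) ->
  exists w : R * R -> C, [/\ inL2m w, forall k, fcoeff w k = a k &
    forall e, 0 < e -> exists N, forall n, (N <= n)%N -> sqnorm (fun x => w x - trig_poly (box n) a x) <= e].
Proof.
move=> aM.
have scv : cvgn (box_sq a).
  apply: nondecreasing_is_cvgn; first by move=> m n; exact: box_sq_nd.
  by exists M => _ [n _ <-].
pose l := limn (box_sq a).
have sl n : box_sq a n <= l by apply: nondecreasing_cvgn_le => // i j; exact: box_sq_nd.
(* Squared L^2 distances of order 4^(-j) give L^2, hence L^1, distances of order 2^(-j), which are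
   summable. *)
pose ep (j : nat) : R := (4^-1) ^+ j.
have ep0 j : 0 < ep j by rewrite exprn_gt0.
have exN j : exists N, forall n, (N <= n)%N -> l - box_sq a n <= ep j.
  have /cvgrPdist_le /(_ _ (ep0 j)) [N _ HN] := scv.
  by exists N => n Nn; have := HN n Nn => h; exact: le_trans (ler_norm _) h.
have /choice [nu Hnu] := exN.
(* Summing the thresholds makes the subsequence nondecreasing, above [nu j], and, through the
   successors, at least [j], so that it exhausts all boxes. *)
pose nn j := (\sum_(0 <= i < j.+1) (nu i).+1)%N.
have nnS j : (nn j <= nn j.+1)%N by rewrite /nn [leqRHS]big_nat_recr//= leq_addr.
have nn_nu j : (nu j <= nn j)%N by rewrite /nn big_nat_recr//= (leq_trans (leqnSn _))// leq_addl.
have nn_j j : (j <= nn j)%N.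
  by rewrite /nn; elim: j => // j IH; rewrite big_nat_recr//= addnS ltnS (leq_trans IH)// leq_addr.
have nn_nd i j : (i <= j)%N -> (nn i <= nn j)%N.
  by move=> ij; apply: (homo_leq (f := nn) (r := leq)) => //; exact: leq_trans.
pose u j := trig_poly (box (nn j)) a.
have uL j : inL2m (u j) by exact: inL2m_trig_poly.
have um j : cmeasurable (setT : set (TR * TR)) (u j) by have [] := uL j.
have usq i j : (i <= j)%N -> sqnorm (fun x => u j x - u i x) <= ep i.
  move=> ij; rewrite sqnorm_trig_poly_sub ?nn_nd//.
  by apply: le_trans (Hnu i (nn i) (nn_nu i)); rewrite lerB.
pose d j (x : TR * TR) := normc (u j.+1 x - u j x).
have md j : measurable_fun setT (d j) by apply: measurable_normc; exact: (cmeasB (um j.+1) (um j)).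
have d0 j x : 0 <= d j x by exact: normc_ge0.
pose K : R := 7 * pi ^+ 2.
have K0 : 0 <= K by rewrite mulr_ge0// sqr_ge0.
have dL j : (\int[mu_per2]_x (d j x)%:E <= (K * 2^-1 ^+ j)%:E)%E.
  have hL := inL2mB (uL j.+1) (uL j).
  have iN := integrable_normc measurableT (inL2m_cintegrable hL).
  rewrite -(fineK (integrable_fin_num measurableT iN)) lee_fin.
  apply: le_trans (L1_le_L2 hL) _; rewrite ler_wpM2l//.
  rewrite -[leRHS]ger0_norm ?exprn_ge0// -sqrtr_sqr ler_sqrt ?sqr_ge0//.
  apply: le_trans (usq _ _ (leqnSn j)) _.
  by rewrite /ep -exprM mulnC exprM; apply: lerXn2r; rewrite ?nnegrE; lra.
pose D x : \bar R := (\sum_(j <oo) (d j x)%:E)%E.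
have mD : measurable_fun setT D.
  apply: ge0_emeasurable_sum; first by move=> k x _ _; rewrite lee_fin.
  by move=> k _; exact/measurable_EFinP.
have D0 x : (0 <= D x)%E by apply: nneseries_ge0 => n _ _; rewrite lee_fin.
have iD : mu_per2.-integrable setT D.
  apply/integrableP; split => //; under eq_integral do rewrite gee0_abs//.
  rewrite /D integral_nneseries//; [|by move=> n; exact/measurable_EFinP|by move=> n x _; rewrite lee_fin].
  apply: (@le_lt_trans _ _ (K * 2)%:E); last exact: ltry.
  apply: lime_le; first by apply: is_cvg_nneseries => n _ _; apply: integral_ge0 => x _; rewrite lee_fin.
  apply: nearW => n; apply: (@le_trans _ _ (\sum_(0 <= j < n) (K * 2^-1 ^+ j)%:E)%E).
    by apply: lee_sum => j _; exact: dL.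
  rewrite sumEFin lee_fin -mulr_sumr ler_wpM2l//.
  have geo : \sum_(0 <= j < n) (2^-1 : R) ^+ j = 2 - 2 * 2^-1 ^+ n.
    elim: n => [|n IH]; first by rewrite big_geq// expr0; lra.
    rewrite big_nat_recr//= IH exprS; lra.
  have qn : 0 <= (2^-1 : R) ^+ n by rewrite exprn_ge0// invr_ge0.
  by rewrite geo; lra.
have Dfin : {ae mu_per2, forall x, D x \is a fin_num}.
  by apply: (@filterS _ _ (ae_filter_ringOfSetsType mu_per2) _ _ _ (integrable_ae measurableT iD)) => x /(_ I).
have ucv x : D x \is a fin_num -> cvgn (fun j => complex.Re (u j x)) /\ cvgn (fun j => complex.Im (u j x)).
  move=> Dx.
  have db n : \sum_(0 <= k < n) d k x <= fine (D x).
    rewrite -lee_fin fineK// -sumEFin; apply: nneseries_lim_ge => k _ _; by rewrite lee_fin.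
  split; apply: (@cvg_of_summable _ (d ^~ x) _ _ db) => n.
  - by rewrite -ReN -ReD; exact: Re_le_normc.
  - by rewrite -ImN -ImD; exact: Im_le_normc.
(* The upper limit exists everywhere and is measurable; on the set of full measure where [D] is
   finite it is the limit. *)
pose w (x : R * R) : C := Complex (fine (limn_esup (fun j => (complex.Re (u j x))%:E)))
                        (fine (limn_esup (fun j => (complex.Im (u j x))%:E))).
have mw : cmeasurable (setT : set (TR * TR)) w.
  split; apply: (measurableT_comp (@fine_measurable R setT measurableT)); apply: measurable_fun_limn_esup => j;
   by apply/measurable_EFinP; have [] := um j.
have ucw x : D x \is a fin_num -> (fun j => normc (w x - u j x)) @ \oo --> (0 : R).
  move=> Dx; have [c1 c2] := ucv x Dx.
  have e1 : complex.Re (w x) = limn (fun j => complex.Re (u j x)).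
    rewrite /w /= is_cvg_limn_esupE; last first.
      by apply/cvg_ex; eexists; apply: cvg_EFin; [exact: nearW|exact: c1].
    by rewrite EFin_lim.
  have e2 : complex.Im (w x) = limn (fun j => complex.Im (u j x)).
    rewrite /w /= is_cvg_limn_esupE; last first.
      by apply/cvg_ex; eexists; apply: cvg_EFin; [exact: nearW|exact: c2].
    by rewrite EFin_lim.
  apply/cvgrPdist_le => e e0.
  have e20 : 0 < e / 2 by rewrite divr_gt0.
  have /cvgrPdist_le /(_ _ e20) [N1 _ H1] := c1; have /cvgrPdist_le /(_ _ e20) [N2 _ H2] := c2.
  exists (maxn N1 N2) => // n /=; rewrite geq_max => /andP[n1 n2].
  rewrite sub0r normrN ger0_norm ?normc_ge0//.
  apply: le_trans (normc_leD _) _; rewrite ReD ImD ReN ImN e1 e2.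
  have := H1 n n1; have := H2 n n2; rewrite /=; lra.
(* Fatou's lemma in [i], for the squared distances between the terms [i + j] and [j] of the
   subsequence. *)
have wsq j : (\int[mu_per2]_x (normc (w x - u j x) ^+ 2)%:E <= (ep j)%:E)%E.
  pose f i (x : TR * TR) := (normc (u (i + j)%N x - u j x) ^+ 2)%:E.
  have mf i : measurable_fun setT (f i).
    by apply/measurable_EFinP/measurable_funX/measurable_normc/cmeasB.
  have f0 i x : setT x -> (0 <= f i x)%E by rewrite lee_fin sqr_ge0.
  have F := fatou mu_per2 measurableT mf f0.
  apply: (@le_trans _ _ (\int[mu_per2]_x limn_einf (f^~ x))%E); last first.
    apply: le_trans F _; apply: limn_einf_le_cst => i.
    have [_ hL] := inL2mB (uL (i + j)%N) (uL j).
    rewrite -(fineK (integrable_fin_num measurableT hL)) lee_fin.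
    exact: usq (leq_addl _ _).
  apply: ae_ge0_le_integral => //.
  - by move=> x _; rewrite lee_fin sqr_ge0.
  - by apply/measurable_EFinP/measurable_funX/measurable_normc/cmeasB.
  - move=> x _; rewrite limn_einf_lim; apply: lime_ge; first exact: is_cvg_einfs.
    by apply: nearW => n; apply: le_ereal_inf_tmp => _ [m _ <-]; exact: f0.
  - have -> : (fun x => limn_einf (f^~ x)) = (fun x => - limn_esup (fun n => - f n x))%E.
      by apply/funext => x; rewrite (limn_esupN (f^~ x)) oppeK.
    apply: measurableT_comp => //; apply: measurable_fun_limn_esup => n; exact: measurableT_comp.
  - apply: (@filterS _ _ (ae_filter_ringOfSetsType mu_per2) _ _ _ Dfin) => x Dx _.
    suff : f ^~ x @ \oo --> (normc (w x - u j x) ^+ 2)%:E.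
      by move=> /cvg_limn_einf_sup[-> _].
    apply: cvg_EFin; first exact: nearW.
    have cn : (fun i => normc (u (i + j)%N x - u j x)) @ \oo --> normc (w x - u j x).
      apply/cvgrPdist_le => e e0.
      have /cvgrPdist_le /(_ _ e0) [N _ HN] := ucw x Dx.
      exists N => // n /= Nn; have := HN (n + j)%N (leq_trans Nn (leq_addr _ _)).
      rewrite sub0r normrN ger0_norm ?normc_ge0// => h.
      apply: le_trans h; rewrite ler_norml.
      have h1 := normcBsum (w x - u j x) (u (n + j)%N x - u j x).
      have h2 := normcBsum (u (n + j)%N x - u j x) (w x - u j x).
      have e1 : w x - u j x - (u (n + j)%N x - u j x) = w x - u (n + j)%N x by ring.
      have e2 : u (n + j)%N x - u j x - (w x - u j x) = - (w x - u (n + j)%N x) by ring.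
      by rewrite e1 in h1; rewrite e2 normcN in h2; apply/andP; split; lra.
    exact: (cvgM cn cn).
have wu j : inL2m (fun x => w x - u j x).
  split; first exact: cmeasB.
  apply/integrableP; split; first by apply/measurable_EFinP/measurable_funX/measurable_normc/cmeasB.
  under eq_integral do rewrite gee0_abs ?lee_fin ?sqr_ge0//.
  exact: le_lt_trans (wsq j) (ltry _).
have wL : inL2m w.
  have := inL2mD (wu 0%N) (uL 0%N).
  by congr inL2m; apply/funext => x; rewrite subrK.
have sqw j : sqnorm (fun x => w x - u j x) <= ep j.
  rewrite -lee_fin -sqnorm_fin//; exact: wsq.
have fcw k : fcoeff w k = a k.
  apply/eqP; rewrite -subr_eq0 -normc_eq0 -sqrf_eq0; apply/eqP/le_anti; rewrite sqr_ge0 andbT.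
  apply/ler_addgt0Pl => e e0; rewrite addr0.
  have [N HN] := @geo_small R 1 4^-1 e ltac:(lra) e0 ler01.
  have [n0 hk] := in_big_box [:: k].
  pose j := maxn N n0.
  have kj : k \in box (nn j).
    by apply: (box_sub (leq_trans (leq_maxr N n0) (nn_j j))); apply: hk; rewrite mem_head.
  have -> : fcoeff w k - a k = fcoeff (fun x => w x - u j x) k.
    rewrite fcB; [|exact: inL2m_cintegrable|exact: inL2m_cintegrable].
    by rewrite fcoeff_trig_poly ?box_uniq// kj.
  apply: le_trans (normc_fcoeff_le k (wu j)) _; apply: (le_trans (sqw j)).
  by have := HN j (leq_maxl _ _); rewrite mul1r.
exists w; split => // e e0.
have [N HN] := @geo_small R 1 4^-1 e ltac:(lra) e0 ler01.
have sE n : sqnorm (fun x => w x - trig_poly (box n) a x) = sqnorm w - box_sq a n.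
  rewrite sqnorm_sub_trig_poly ?box_uniq// [X in _ + X]big1; last by move=> k _; rewrite fcw subrr normc0 expr0n.
  by rewrite addr0; congr (_ - _); apply: eq_bigr => k _; rewrite fcw.
exists (nn N) => n Nn; rewrite sE.
apply: (@le_trans _ _ (sqnorm w - box_sq a (nn N))); first by rewrite lerB// box_sq_nd.
rewrite -sE; apply: (le_trans (sqw N)).
by have := HN N (leqnn _); rewrite mul1r.
Qed.

Lemma sqnorm_ae0 f : inL2m f -> {ae mu_per2, forall x, f x = 0} -> sqnorm f = 0.
Proof.
move=> [mf hL] f0; rewrite /sqnorm /Rintegral (ae_eq_integral (cst 0%E))// ?integral0//.
- exact: measurable_int hL.
- apply: (@filterS _ _ (ae_filter_ringOfSetsType mu_per2) _ _ _ f0) => x -> _.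
  by rewrite normc0 expr0n.
Qed.

(** By Bessel's inequality the coefficients of [f] are square summable, so Riesz-Fischer produces a
    function [w] with the same coefficients and convergent box sums. Uniqueness of the coefficients
    makes [w] equal to [f] almost everywhere. *)
Lemma parseval f : inL2m f -> forall e, 0 < e -> exists N, forall n, (N <= n)%N ->
  sqnorm (fun x => f x - trig_poly (box n) (fcoeff f) x) <= e.
Proof.
move=> hf e e0.
have bs n : box_sq (fcoeff f) n <= sqnorm f by apply: bessel => //; exact: box_uniq.
have [w [hw wf wc]] := riesz_fischer bs.
have z : {ae mu_per2, forall x, f x - w x = 0}.
  apply: fcoeff_eq0_ae; first exact/inL2m_cintegrable/inL2mB.
  move=> k; rewrite fcB; [|exact: inL2m_cintegrable|exact: inL2m_cintegrable].
  by rewrite wf subrr.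
have [N HN] := wc e e0; exists N => n Nn; apply: le_trans (HN n Nn).
rewrite !sqnorm_sub_trig_poly ?box_uniq//.
have -> : sqnorm f = sqnorm w.
  rewrite /sqnorm /Rintegral; congr fine.
  apply: ae_eq_integral; [by []|exact: measurable_int hf.2|exact: measurable_int hw.2|].
  apply: (@filterS _ _ (ae_filter_ringOfSetsType mu_per2) _ _ _ z) => x /eqP.
  by rewrite subr_eq0 => /eqP ->.
have e1 : \sum_(k <- box n) normc (fcoeff w k) ^+ 2 = \sum_(k <- box n) normc (fcoeff f k) ^+ 2 by apply: eq_bigr => k _; rewrite wf.
have e2 : \sum_(k <- box n) normc (fcoeff w k - fcoeff f k) ^+ 2 = \sum_(k <- box n) normc (fcoeff f k - fcoeff f k) ^+ 2 by apply: eq_bigr => k _; rewrite wf.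
by rewrite e1 e2.
Qed.

Lemma parseval_sum f : inL2m f -> forall e, 0 < e -> exists N, forall n, (N <= n)%N ->
  sqnorm f - box_sq (fcoeff f) n <= e.
Proof.
move=> hf e e0; have [N HN] := parseval hf e0; exists N => n Nn; have := HN n Nn.
rewrite sqnorm_sub_trig_poly ?box_uniq// [X in _ + X]big1 ?addr0//.
by move=> k _; rewrite subrr normc0 expr0n.
Qed.

(** Bessel's inequality for the box together with the one extra frequency [k] leaves for [k] only
    the Parseval remainder of the box. *)
Lemma fcoeff_tail_L2 f : inL2m f -> forall e, 0 < e -> exists L, forall k, k \notin box L -> normc (fcoeff f k) ^+ 2 <= e.
Proof.
move=> hf e e0; have [N HN] := parseval_sum hf e0; exists N => k kN.
have := HN N (leqnn _).
have /bessel : uniq (k :: box N) by rewrite /= kN box_uniq.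
by move=> /(_ R f hf); rewrite big_cons -/(box_sq (fcoeff f) N); lra.
Qed.

Lemma normc_fcoeff_le1 f k : cintegrable mu_per2 setT f ->
  normc (fcoeff f k) <= (2 * pi)^-1 * Rintegral mu_per2 setT (fun x => normc (f x)).
Proof.
move=> iF; have iN := integrable_normc measurableT iF.
rewrite -RintegralZl//; apply: normc_cintg_le => //.
- exact: cintegrable_cmeasurable (fcE k iF).
- exact: (integrableZl measurableT _ iN).
- by move=> x _; rewrite normcM normcJ normc_ebasis mulrC.
Qed.

(** Cut [f] off where its modulus exceeds [N]. The rest is small in L^1, so all its coefficients are
    small at once; the bounded part is square integrable and its coefficients tend to 0. *)
Lemma riemann_lebesgue f : cintegrable mu_per2 setT f -> forall e, 0 < e ->
  exists L, forall k, k \notin box L -> normc (fcoeff f k) <= e.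
Proof.
move=> iF e e0.
have mf := cintegrable_cmeasurable iF; have mn := measurable_normc mf.
have iN := integrable_normc measurableT iF.
pose A n : set (TR * TR) := [set x | normc (f x) <= n%:R].
have mA n : measurable (A n).
  by have := mn measurableT `]-oo, n%:R]%classic (measurable_itv _); rewrite setTI; congr measurable; apply/seteqP; split => x /=; rewrite in_itv.
pose g n x := f x * toC (\1_(A n) x : R).
have mg n : cmeasurable (setT : set (TR * TR)) (g n) by apply: cmeasM => //; exact: cmeasurable_indic.
pose h n x := toC (normc (f x - g n x)).
have mh n : cmeasurable (setT : set (TR * TR)) (h n) := cmeasurable_toC (measurable_normc (cmeasB mf (mg n))).
have hc : {ae mu_per2, forall x, forall e, 0 < e -> exists N, forall n, (N <= n)%N -> normc (h n x - 0) <= e}.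
  apply: aeW => x e' e'0; exists (Num.bound (normc (f x))) => n Nn.
  rewrite /h /g indicE mem_set ?mulr1 ?subrr ?normc0 ?subr0 ?normc0 ?ltW//.
  rewrite /A /=; apply: le_trans (ltW (archi_boundP (normc_ge0 _))) _.
  by rewrite ler_nat.
have hb : {ae mu_per2, forall x, forall n, normc (h n x) <= normc (f x)}.
  apply: aeW => x n; rewrite /h normc_toC ger0_norm ?normc_ge0// /g indicE.
  by case: (_ \in _); rewrite ?mulr1 ?subrr ?normc0 ?normc_ge0// mulr0 subr0.
have [_ H] := cintg_dct mh (cmeasurable_cst _ 0) iN hc hb.
have e20 : 0 < e / 2 by rewrite divr_gt0.
have p1 : (2 * pi)^-1 <= 1 :> R by rewrite invf_le1 ?pi2_gt0//; have := @pi_ge2 R; lra.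
have [N /(_ N (leqnn _))] := H _ e20.
rewrite cI0 subr0 /h cintg_toC normc_toC => hN.
have gL : inL2m (g N).
  apply: (@inL2m_bounded _ _ N%:R (mg N)) => x; rewrite /g indicE.
  case: (boolP (x \in A N)) => [|_]; last by rewrite mulr0 normc0.
  by rewrite inE mulr1.
have ig := inL2m_cintegrable gL.
have e220 : 0 < (e / 2) ^+ 2 by rewrite exprn_gt0.
have [L HL] := fcoeff_tail_L2 gL e220.
exists L => k kL.
have -> : fcoeff f k = fcoeff (fun x => f x - g N x) k + fcoeff (g N) k by rewrite fcB// subrK.
have -> : e = e / 2 + e / 2 by field.
apply: le_trans (ler_normcD _ _) _; apply: lerD.
  apply: le_trans (normc_fcoeff_le1 k (cintegrableB measurableT iF ig)) _.
  apply: le_trans (le_trans (ler_norm _) hN).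
  rewrite ler_piMl// Rintegral_ge0// => x _; exact: normc_ge0.
rewrite -(@ler_pXn2r _ 2) ?nnegrE ?normc_ge0 ?(ltW e20)//.
exact: HL.
Qed.
End riesz_fischer.

(** * Complex derivatives, Goursat's theorem and contour shifts *)

Section hasD.
Variable R : realType.
Local Notation C := (R[i]).
Implicit Types (F : C * C -> C) (z : C * C).

(* The complex derivative, written with the real norm normc: the topology of C^o is bridged only in differentiable_hasD2 and hasDP. *)
Definition hasD2 F z (A B : C) := forall e : R, 0 < e -> exists2 d : R, 0 < d &
  forall h k : C, normc h < d -> normc k < d ->
  normc (F (z.1 + h, z.2 + k) - F z - A * h - B * k) <= e * (normc h + normc k).

Lemma normrC (z : C) : `|z| = toC (normc z). Proof. by rewrite normc_def normcE. Qed.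
Lemma lecC (x y : R) : (toC x <= toC y :> C) = (x <= y). Proof. exact: lecR. Qed.
Lemma ltcC (x y : R) : (toC x < toC y :> C) = (x < y). Proof. exact: ltcR. Qed.
Lemma gt0C (z : C) : 0 < z -> z = toC (complex.Re z) /\ 0 < complex.Re z.
Proof. by case: z => a b; rewrite ltcE /= => /andP[/eqP -> ?]. Qed.

Lemma differentiable_hasD2 (F : C^o * C^o -> C^o) (z : C^o * C^o) : differentiable F z ->
  hasD2 F z (cd0 F z) (cd1 F z).
Proof.
move=> dF e e0.
have e0' : (0 : C) < toC e by rewrite ltcC.
have /eqaddoP H0 := diff_locally dF.
have := H0 (toC e) e0'; rewrite near_simpl => /nbhs_ballP [d /= d0 Hd].
have [dE d0'] := gt0C d0.
exists (complex.Re d) => // h k hd kd.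
have bh : ball (0 : C^o * C^o) d (h : C^o, k : C^o).
  by split; rewrite /= /ball /= sub0r normrN normrC dE ltcC.
have := Hd _ bh.
rewrite /= !fctE.
have -> : 'd F z (h, k) = cd0 F z * h + cd1 F z * k.
  have -> : (h, k) = h *: (1 : C^o, 0 : C^o) + k *: (0 : C^o, 1 : C^o).
    by congr pair; rewrite /= /GRing.scale /= ?mulr1 ?mulr0 ?addr0 ?add0r.
  by rewrite linearD !linearZ /cd0 /cd1 !deriveE// /GRing.scale /= mulrC [X in _ + X]mulrC.
move=> H.
have -> : F (z.1 + h, z.2 + k) - F z - cd0 F z * h - cd1 F z * k =
  F ((h, k) + z) - (F z + (cd0 F z * h + cd1 F z * k)).
  have -> : (h, k) + z = (z.1 + h, z.2 + k) by rewrite [LHS]surjective_pairing /= [h + _]addrC [k + _]addrC.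
  ring.
rewrite -lecC toCM -normrC; apply: le_trans H _.
rewrite ler_pM2l// toCD -!normrC.
rewrite [leLHS](_ : _ = Num.max `|h : C| `|k : C|)// /Num.max.
by case: ifP => _; rewrite !normrC -toCD lecC ?lerDl ?lerDr ?normc_ge0.
Qed.

Lemma hasD2_derive (F : C^o * C^o -> C^o) (z : C^o * C^o) (A B a b : C) : hasD2 F z A B ->
  'D_(a : C^o, b : C^o) F z = A * a + B * b.
Proof.
move=> H; apply/cvg_lim => //.
apply/cvgrPdist_le => e e0; have [eE e0'] := gt0C e0.
have M0 : 0 < normc a + normc b + 1 by rewrite ltr_wpDl ?addr_ge0 ?normc_ge0.
have [d d0 Hd] := H _ (divr_gt0 e0' M0).
apply/nbhs_ballP; exists (toC (d / (normc a + normc b + 1))) => /=.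
  by rewrite ltcC divr_gt0.
move=> t; rewrite /ball /= sub0r normrN normrC ltcC => td t0.
have nt : 0 < normc t by rewrite normc_gt0.
have td' : normc t * (normc a + normc b + 1) < d by rewrite -ltr_pdivlMr.
have ha : normc (t * a) < d.
  by rewrite normcM; apply: le_lt_trans td'; rewrite ler_pM2l// -addrA lerDl addr_ge0 ?normc_ge0.
have hb : normc (t * b) < d.
  by rewrite normcM; apply: le_lt_trans td'; rewrite ler_pM2l// addrAC lerDr addr_ge0 ?normc_ge0.
have := Hd _ _ ha hb.
have -> : F (t *: (a : C^o, b : C^o) + z) = F (z.1 + t * a, z.2 + t * b).
  by congr F; rewrite [LHS]surjective_pairing /= addrC [X in (_, X)]addrC.
rewrite normrC eE lecC => h.
have -> : A * a + B * b - t^-1 *: (F (z.1 + t * a, z.2 + t * b) - F z : C^o) =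
   - (t^-1 * (F (z.1 + t * a, z.2 + t * b) - F z - A * (t * a) - B * (t * b))).
  rewrite /GRing.scale /=.
  have tt : t^-1 * t = 1 by rewrite mulVf.
  have -> : A * a + B * b = (t^-1 * t) * (A * a + B * b) by rewrite tt mul1r.
  ring.
rewrite normcN normcM normcV ler_pdivrMl//; apply: le_trans h _.
rewrite !normcM -mulrDr mulrCA; apply: ler_wpM2l; first exact: ltW.
by rewrite mulrAC ler_pdivrMr// ler_pM2l//; lra.
Qed.

Lemma hasD2_cd0 (F : C^o * C^o -> C^o) z A B : hasD2 F z A B -> cd0 F z = A.
Proof. by move=> /hasD2_derive h; rewrite /cd0 h mulr1 mulr0 addr0. Qed.
Lemma hasD2_cd1 (F : C^o * C^o -> C^o) z A B : hasD2 F z A B -> cd1 F z = B.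
Proof. by move=> /hasD2_derive h; rewrite /cd1 h mulr1 mulr0 add0r. Qed.

Definition real_deriv (f : R -> C) (s : R) (d : C) := forall e : R, 0 < e -> exists2 r : R, 0 < r &
  forall h : R, `|h| < r -> normc (f (s + h) - f s - toC h * d) <= e * `|h|.

Lemma hasD2_real_deriv F (p v : C * C) (s : R) A B :
  hasD2 F (p.1 + toC s * v.1, p.2 + toC s * v.2) A B ->
  real_deriv (fun t => F (p.1 + toC t * v.1, p.2 + toC t * v.2)) s (A * v.1 + B * v.2).
Proof.
move=> H e e0; set M := normc v.1 + normc v.2 + 1.
have M0 : 0 < M by rewrite ltr_wpDl ?addr_ge0 ?normc_ge0.
have [d d0 Hd] := H _ (divr_gt0 e0 M0).
exists (d / M); first by rewrite divr_gt0.
move=> h hd; have td' : `|h| * M < d by rewrite -ltr_pdivlMr.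
have h1 : normc (toC h * v.1) < d.
  rewrite normcM normc_toC; apply: le_lt_trans td'; rewrite ler_wpM2l// /M -addrA lerDl addr_ge0 ?normc_ge0//.
have h2 : normc (toC h * v.2) < d.
  rewrite normcM normc_toC; apply: le_lt_trans td'; rewrite ler_wpM2l// /M addrAC lerDr addr_ge0 ?normc_ge0//.
have := Hd _ _ h1 h2; rewrite /= -!addrA -!mulrDl -!toCD => HH.
have -> : toC h * (A * v.1 + B * v.2) = A * (toC h * v.1) + B * (toC h * v.2) by ring.
rewrite opprD; apply: le_trans HH _.
rewrite !normcM !normc_toC -mulrDr mulrCA [leRHS]mulrC; apply: ler_wpM2l => //.
by rewrite mulrAC ler_pdivrMr// ler_pM2l// /M lerDl.
Qed.

Lemma real_derive (g : R -> R) (s d : R) :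
  (forall e, 0 < e -> exists2 r : R, 0 < r & forall h : R, `|h| < r -> `|g (s + h) - g s - h * d| <= e * `|h|) ->
  is_derive s (1 : R) g d.
Proof.
move=> H; have L : (fun h : R => h^-1 *: ((g \o shift s) (h *: (1 : R)) - g s)) @ 0^' --> d.
  apply/cvgrPdist_le => e e0; have [r r0 Hr] := H e e0.
  apply/nbhs_ballP; exists r => //= h; rewrite /ball /= sub0r normrN => hr h0.
  have := Hr h hr; rewrite /shift /= /GRing.scale /= mulr1 [h + s]addrC => k.
  have -> : d - h^-1 * (g (s + h) - g s) = - (h^-1 * (g (s + h) - g s - h * d)).
    by rewrite [in RHS]mulrBr mulKf//; ring.
  by rewrite normrN normrM normfV ler_pdivrMl ?normr_gt0// [leRHS]mulrC.
by apply: DeriveDef; [apply/cvg_ex; exists d|apply/cvg_lim].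
Qed.

Lemma real_deriv_Re f s d : real_deriv f s d -> is_derive s (1 : R) (fun t => complex.Re (f t)) (complex.Re d).
Proof.
move=> H; apply: real_derive => e e0; have [r r0 Hr] := H e e0; exists r => // h hr.
apply: le_trans (Hr h hr); rewrite (_ : _ - _ = complex.Re (f (s + h) - f s - toC h * d)); first exact: Re_le_normc.
by rewrite !ReD !ReN ReM /toC /= mul0r subr0.
Qed.

Lemma rDZ f s d (c : C) : real_deriv f s d -> real_deriv (fun t => c * f t) s (c * d).
Proof.
move=> H e e0; have c1 : 0 < normc c + 1 by rewrite ltr_wpDl ?normc_ge0.
have [r r0 Hr] := H _ (divr_gt0 e0 c1); exists r => // h hr.
have -> : c * f (s + h) - c * f s - toC h * (c * d) = c * (f (s + h) - f s - toC h * d) by ring.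
rewrite normcM; apply: (@le_trans _ _ (normc c * (e / (normc c + 1) * `|h|))).
  by rewrite ler_wpM2l ?normc_ge0// Hr.
rewrite mulrA ler_wpM2r// mulrCA ger_pMr// ler_pdivrMr// mul1r; lra.
Qed.
Lemma rDD f g s d d' : real_deriv f s d -> real_deriv g s d' -> real_deriv (fun t => f t + g t) s (d + d').
Proof.
move=> H H' e e0; have e2 : 0 < e / 2 by rewrite divr_gt0.
have [r r0 Hr] := H _ e2; have [r' r0' Hr'] := H' _ e2.
exists (Num.min r r'); first by rewrite lt_min r0.
move=> h; rewrite lt_min => /andP[h1 h2].
have -> : f (s + h) + g (s + h) - (f s + g s) - toC h * (d + d') = (f (s + h) - f s - toC h * d) + (g (s + h) - g s - toC h * d') by ring.
apply: le_trans (ler_normcD _ _) _; have := Hr h h1; have := Hr' h h2; lra.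
Qed.

(** A complex-valued function need not attain its mean slope. Rotating the increment onto the
    positive real axis by a unit [u] reduces the inequality to the real mean value theorem for the
    real part of [u * f]. *)
Lemma mvt_le (f : R -> C) (df : R -> C) (M : R) :
  (forall s, 0 <= s <= 1 -> real_deriv f s (df s)) -> (forall s, 0 <= s <= 1 -> normc (df s) <= M) ->
  normc (f 1 - f 0) <= M.
Proof.
move=> Hf HM; have [->|n0] := eqVneq (f 1 - f 0) 0.
  by rewrite normc0; apply: le_trans (HM 0 _); rewrite ?normc_ge0// lexx ler01.
have np : 0 < normc (f 1 - f 0) by rewrite normc_gt0.
pose u := toC (normc (f 1 - f 0))^-1 * conjc (f 1 - f 0).
have nu : normc u = 1.
  by rewrite normcM normc_toC normcJ gtr0_norm ?invr_gt0// mulVf// gt_eqF.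
pose g t := complex.Re (u * f t).
have dg (s : R) : s \in `[0, 1] -> is_derive s (1 : R) g (complex.Re (u * df s)).
  by rewrite in_itv /= => hs; apply: real_deriv_Re; apply: rDZ; exact: Hf.
have dg' (x : R) : x \in `]0, 1[ -> is_derive x (1 : R) g (complex.Re (u * df x)).
  by move=> hx; apply: dg; move: hx; rewrite !in_itv /= => /andP[/ltW -> /ltW ->].
have cg : {within `[0, 1], continuous g}.
  apply: derivable_within_continuous => x hx.
  by have [] := dg x hx.
have [c c01 ec] := @MVT R g (fun x => complex.Re (u * df x)) 0 1 ltr01 dg' cg.
have E : normc (f 1 - f 0) = g 1 - g 0.
  have -> : g 1 - g 0 = complex.Re (u * (f 1 - f 0)) by rewrite /g mulrBr ReD ReN.
  rewrite /u -mulrA (mulrC (conjc _)) mulcJ -toCM expr2 mulrA mulVf ?mul1r// gt_eqF//.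
rewrite E ec subr0 mulr1; apply: le_trans (ler_norm _) _; apply: le_trans (Re_le_normc _) _.
rewrite normcM nu mul1r; apply: HM; move: c01; rewrite in_itv /= => /andP[/ltW -> /ltW ->] //.
Qed.

Definition hasD (f : C -> C) (z d : C) := forall e : R, 0 < e -> exists2 r : R, 0 < r &
  forall h : C, normc h < r -> normc (f (z + h) - f z - d * h) <= e * normc h.

Lemma hasDP (f : C^o -> C^o) (z d : C^o) : is_derive z (1 : C^o) f d <-> hasD f z d.
Proof.
split=> [[df dE]|H].
  move=> e e0; have e0' : (0 : C) < toC e by rewrite ltcC.
  have : (fun h : C^o => h^-1 *: ((f \o shift z) (h *: (1 : C^o)) - f z)) @ 0^' --> d.
    by rewrite -dE; exact: df.
  move=> /cvgrPdist_le /(_ _ e0') /nbhs_ballP [r /= r0 Hr].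
  have [rE r0'] := gt0C r0; exists (complex.Re r) => // h hr.
  have [->|h0] := eqVneq h 0; first by rewrite addr0 mulr0 !subr0 subrr normc0 mulr0.
  have bh : ball (0 : C^o) r h by rewrite /ball /= sub0r normrN normrC rE ltcC.
  have nh : 0 < normc h by rewrite normc_gt0.
  have := Hr h bh h0; rewrite /shift /= normrC lecC /GRing.scale /= mulr1 [h + z]addrC => k.
  have -> : f (z + h) - f z - d * h = - (h * (d - h^-1 * (f (z + h) - f z))).
    by rewrite [in RHS]mulrBr mulVKf//; ring.
  by rewrite normcN normcM [leRHS]mulrC ler_pM2l.
have L : (fun h : C^o => h^-1 *: ((f \o shift z) (h *: (1 : C^o)) - f z)) @ 0^' --> d.
  apply/cvgrPdist_le => e e0; have [eE e0'] := gt0C e0; have [r r0 Hr] := H _ e0'.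
  apply/nbhs_ballP; exists (toC r); first by rewrite /= ltcC.
  move=> h; rewrite /ball /= sub0r normrN normrC ltcC => hr h0.
  have nh : 0 < normc h by rewrite normc_gt0.
  have := Hr h hr; rewrite /shift /= /GRing.scale /= mulr1 [h + z]addrC => k.
  rewrite eE normrC lecC.
  have -> : d - h^-1 * (f (z + h) - f z) = - (h^-1 * (f (z + h) - f z - d * h)).
    by rewrite [in RHS]mulrBr [d * h]mulrC mulKf//; ring.
  by rewrite normcN normcM normcV ler_pdivrMl// [leRHS]mulrC.
by apply: DeriveDef; [apply/cvg_ex; exists d|apply/cvg_lim].
Qed.
End hasD.

(** * Goursat's theorem for rectangles *)

Section goursat.
Variable R : realType.
Local Notation TR := (measurableTypeR R).
Local Notation C := (R[i]).
Local Notation leb := (@lebesgue_measure R).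
Implicit Types (g : R -> C) (f : C -> C).

Definition econt g (x : R) := forall e : R, 0 < e -> exists2 d : R, 0 < d & forall y, `|y - x| < d -> normc (g y - g x) <= e.

Lemma econt_Re g x : econt g x -> {for x, continuous (fun t => complex.Re (g t))}.
Proof.
move=> H; apply/cvgrPdist_le => e e0; have [d d0 Hd] := H e e0.
apply/nbhs_ballP; exists d => // y; rewrite /ball /= distrC => yx.
rewrite distrC; apply: le_trans (Hd y yx); rewrite -ReN -ReD; exact: Re_le_normc.
Qed.
Lemma econt_Im g x : econt g x -> {for x, continuous (fun t => complex.Im (g t))}.
Proof.
move=> H; apply/cvgrPdist_le => e e0; have [d d0 Hd] := H e e0.
apply/nbhs_ballP; exists d => // y; rewrite /ball /= distrC => yx.
rewrite distrC; apply: le_trans (Hd y yx); rewrite -ImN -ImD; exact: Im_le_normc.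
Qed.

Lemma ccontB g g' x : econt g x -> econt g' x -> econt (fun t => g t - g' t) x.
Proof.
move=> H H' e e0; have e2 : 0 < e / 2 by rewrite divr_gt0.
have [d d0 Hd] := H _ e2; have [d' d'0 Hd'] := H' _ e2.
exists (Num.min d d'); first by rewrite lt_min d0.
move=> y; rewrite lt_min => /andP[y1 y2].
have -> : g y - g' y - (g x - g' x) = (g y - g x) - (g' y - g' x) by ring.
apply: le_trans (ler_normcB _ _) _; have := Hd y y1; have := Hd' y y2; lra.
Qed.

Definition seg_int (a b : R) g : C := cintg leb `[a, b]%classic g.
Definition econt_on (a b : R) g := forall x, a <= x <= b -> econt g x.

Lemma econt_onS a b a' b' g : a <= a' -> b' <= b -> econt_on a b g -> econt_on a' b' g.
Proof.
by move=> aa bb H x /andP[h1 h2]; apply: H; rewrite (le_trans aa h1) (le_trans h2 bb).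
Qed.

Lemma seg_cintegrable a b g : econt_on a b g -> cintegrable leb `[a, b]%classic g.
Proof.
move=> H; split; apply: continuous_compact_integrable; try exact: segment_compact.
- apply: continuous_in_subspaceT => x; rewrite inE /= in_itv /= => hx.
  exact: econt_Re (H x hx).
- apply: continuous_in_subspaceT => x; rewrite inE /= in_itv /= => hx.
  exact: econt_Im (H x hx).
Qed.

Lemma measurable_seg (a b : R) : measurable (`[a, b]%classic : set TR).
Proof. exact: measurable_itv. Qed.

Lemma sIB a b g g' : econt_on a b g -> econt_on a b g' ->
  seg_int a b (fun x => g x - g' x) = seg_int a b g - seg_int a b g'.
Proof. by move=> H H'; apply: cIB; [exact: measurable_seg|exact: seg_cintegrable|exact: seg_cintegrable]. Qed.

Lemma seg_int_split a b c g : a <= b -> b <= c -> econt_on a c g -> seg_int a c g = seg_int a b g + seg_int b c g.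
Proof.
move=> ab bc H; have [ir ii] := seg_cintegrable H.
have key (h : R -> R) : leb.-integrable `[a, c]%classic (EFin \o h) ->
   Rintegral leb `[a, c]%classic h = Rintegral leb `[a, b]%classic h + Rintegral leb `[b, c]%classic h.
  move=> ih.
  have := @Rintegral_itvB R h (BLeft a) (BRight c) b ih; rewrite !bnd_simp => /(_ ab bc).
  rewrite Rintegral_itv_obnd_cbnd; first by move=> <-; ring.
  have mi : measurable (`]b, c]%classic : set TR) by exact: measurable_itv.
  have sub : (`]b, c]%classic : set TR) `<=` `[a, c]%classic by apply: subset_itvr; rewrite bnd_simp.
  exact: (integrableS (measurable_seg a c) mi sub ih).
by apply: complexP; rewrite ?ReD ?ImD; apply: key.
Qed.

Lemma seg_int_le a b g M : a <= b -> econt_on a b g -> (forall x, a <= x <= b -> normc (g x) <= M) ->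
  normc (seg_int a b g) <= M * (b - a).
Proof.
move=> ab H HM; have iG := seg_cintegrable H.
have mab : fine (leb `[a, b]%classic) = b - a.
  rewrite lebesgue_measure_itv /= lte_fin; case: ltgtP ab => //= ->; rewrite subrr//.
have -> : M * (b - a) = Rintegral leb `[a, b]%classic (fun=> M).
  by rewrite Rintegral_cst ?mab//; exact: measurable_seg.
apply: normc_cintg_le; first exact: measurable_seg.
- exact: cintegrable_cmeasurable iG.
- have := @seg_cintegrable a b (fun=> toC M) _ => -[] // x _ e e0.
  by exists 1 => // y _; rewrite subrr normc0 ltW.
- by move=> x; rewrite /= in_itv /=; exact: HM.
Qed.

Lemma seg_int_cst a b c : a <= b -> seg_int a b (fun=> c) = toC (b - a) * c.
Proof.
move=> ab; have mab : fine (leb `[a, b]%classic) = b - a.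
  rewrite lebesgue_measure_itv /= lte_fin; case: ltgtP ab => //= ->; rewrite subrr//.
by apply: complexP; rewrite ?ReM ?ImM /seg_int /cintg /toC /= Rintegral_cst ?mab ?mul0r ?subr0 ?addr0 1?mulrC//;
  exact: measurable_seg.
Qed.

(** The integral of [f] along the boundary of [a, b] x [c, d], counterclockwise, with opposite sides
    combined into one integrand. *)
Definition J f (a b c d : R) : C :=
  seg_int a b (fun x => f (Complex x c) - f (Complex x d)) +
  'i%C * seg_int c d (fun y => f (Complex b y) - f (Complex a y)).

Definition holo_on f (a b c d : R) := forall x y, a <= x <= b -> c <= y <= d -> exists A, hasD f (Complex x y) A.

Lemma hasD_cont f z A : hasD f z A -> forall e, 0 < e -> exists2 d, 0 < d & forall w, normc (w - z) < d -> normc (f w - f z) <= e.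
Proof.
move=> H e e0; have [r r0 Hr] := H 1 ltr01.
have K0 : 0 < normc A + 1 by rewrite ltr_wpDl ?normc_ge0.
exists (Num.min r (e / (normc A + 1))); first by rewrite lt_min r0 divr_gt0.
move=> w; rewrite lt_min => /andP[h1]; rewrite ltr_pdivlMr// => h2.
have := Hr _ h1; rewrite [z + _]addrC subrK mul1r => h3.
have -> : f w - f z = (f w - f z - A * (w - z)) + A * (w - z) by ring.
apply: le_trans (ler_normcD _ _) _; rewrite normcM.
apply: (@le_trans _ _ (normc (w - z) * (normc A + 1))); last exact: ltW.
by rewrite [leRHS]mulrDr mulr1 addrC [normc A * _]mulrC lerD2l.
Qed.

Lemma hasD_econt_h f (x y : R) A : hasD f (Complex x y) A -> econt (fun t => f (Complex t y)) x.
Proof.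
move=> H e e0; have [d d0 Hd] := hasD_cont H e0; exists d => // t tx; apply: Hd.
rewrite (_ : _ - _ = toC (t - x)) ?normc_toC//.
by apply: complexP; rewrite ?ReD ?ImD ?ReN ?ImN /toC /= ?subrr.
Qed.
Lemma hasD_econt_v f (x y : R) A : hasD f (Complex x y) A -> econt (fun t => f (Complex x t)) y.
Proof.
move=> H e e0; have [d d0 Hd] := hasD_cont H e0; exists d => // t tx; apply: Hd.
rewrite (_ : _ - _ = 'i%C * toC (t - y)).
  by rewrite normcM normc_toC normcE /= expr0n expr1n add0r sqrtr1 mul1r.
by apply: complexP; rewrite ?ReM ?ImM ?ReD ?ImD ?ReN ?ImN /toC /=; ring.
Qed.

Lemma holo_h f a b c d y : holo_on f a b c d -> c <= y <= d -> econt_on a b (fun t => f (Complex t y)).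
Proof. by move=> H hy x hx; have [A hA] := H x y hx hy; exact: hasD_econt_h hA. Qed.
Lemma holo_v f a b c d x : holo_on f a b c d -> a <= x <= b -> econt_on c d (fun t => f (Complex x t)).
Proof. by move=> H hx y hy; have [A hA] := H x y hx hy; exact: hasD_econt_v hA. Qed.

Lemma holo_onS f a b c d a' b' c' d' : a <= a' -> b' <= b -> c <= c' -> d' <= d ->
  holo_on f a b c d -> holo_on f a' b' c' d'.
Proof.
move=> h1 h2 h3 h4 H x y /andP[x1 x2] /andP[y1 y2]; apply: H.
  by rewrite (le_trans h1 x1) (le_trans x2 h2).
by rewrite (le_trans h3 y1) (le_trans y2 h4).
Qed.

Lemma J_split f a m b c n d : a <= m -> m <= b -> c <= n -> n <= d -> holo_on f a b c d ->
  J f a b c d = (J f a m c n + J f m b c n) + (J f a m n d + J f m b n d).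
Proof.
move=> am mb cn nd H.
have hc : c <= c <= d by rewrite lexx (le_trans cn nd).
have hd : c <= d <= d by rewrite lexx (le_trans cn nd).
have hn : c <= n <= d by rewrite cn nd.
have ha : a <= a <= b by rewrite lexx (le_trans am mb).
have hb : a <= b <= b by rewrite lexx (le_trans am mb).
have hm : a <= m <= b by rewrite am mb.
have Hh y : c <= y <= d -> econt_on a m (fun t => f (Complex t y)) /\ econt_on m b (fun t => f (Complex t y)).
  by move=> hy; have := holo_h H hy => h; split; apply: econt_onS h.
have Hv x : a <= x <= b -> econt_on c n (fun t => f (Complex x t)) /\ econt_on n d (fun t => f (Complex x t)).
  by move=> hx; have := holo_v H hx => h; split; apply: econt_onS h.
have Sh y : c <= y <= d -> seg_int a b (fun t => f (Complex t y)) = seg_int a m (fun t => f (Complex t y)) + seg_int m b (fun t => f (Complex t y)).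
  by move=> hy; apply: seg_int_split => //; exact: holo_h H hy.
have Sv x : a <= x <= b -> seg_int c d (fun t => f (Complex x t)) = seg_int c n (fun t => f (Complex x t)) + seg_int n d (fun t => f (Complex x t)).
  by move=> hx; apply: seg_int_split => //; exact: holo_v H hx.
have [c1 c2] := Hh c hc; have [d1 d2] := Hh d hd; have [n1 n2] := Hh n hn.
have [a1 a2] := Hv a ha; have [b1 b2] := Hv b hb; have [mu_per m2] := Hv m hm.
have hC := holo_h H hc; have hD' := holo_h H hd; have hA := holo_v H ha; have hB := holo_v H hb.
by rewrite /J !sIB// !Sh// !Sv//; ring.
Qed.

Lemma J_small f (z0 A : C) (e a b c d : R) : 0 <= e -> a <= b -> c <= d -> holo_on f a b c d ->
  a <= complex.Re z0 <= b -> c <= complex.Im z0 <= d ->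
  (forall w, normc (w - z0) <= (b - a) + (d - c) -> normc (f w - f z0 - A * (w - z0)) <= e * normc (w - z0)) ->
  normc (J f a b c d) <= 2 * e * ((b - a) + (d - c)) ^+ 2.
Proof.
move=> e0 ab cd H hx hy Hz; set L := (b - a) + (d - c).
have L0 : 0 <= L by rewrite addr_ge0 ?subr_ge0.
pose r w := f w - f z0 - A * (w - z0).
have rb x y : a <= x <= b -> c <= y <= d -> normc (r (Complex x y)) <= e * L.
  move=> hx' hy'; have h : normc (Complex x y - z0) <= L.
    apply: le_trans (normc_leD _) _; rewrite ReD ImD ReN ImN /=; apply: lerD.
      by rewrite ler_norml; apply/andP; split; lra.
    by rewrite ler_norml; apply/andP; split; lra.
  by apply: le_trans (Hz _ h) _; rewrite ler_wpM2l.
have hc : c <= c <= d by rewrite lexx.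
have hd : c <= d <= d by rewrite lexx cd.
have ha : a <= a <= b by rewrite lexx.
have hb : a <= b <= b by rewrite lexx ab.
have cst_on u v (k : C) : econt_on u v (fun=> k) by move=> x _ e' e'0; exists 1 => // y _; rewrite subrr normc0 ltW.
(* Between opposite sides the affine part of [f] at [z0] differs by a constant: [kh] between bottom
   and top, [kv] between right and left. As (b - a) kh + i (d - c) kv = 0, both may be subtracted
   from the integrands, and only the remainder [r] of order [e * L] is left. *)
pose kh := A * 'i%C * toC (c - d); pose kv := A * toC (b - a).
have c1 : econt_on a b (fun x => f (Complex x c) - f (Complex x d)).
  by move=> x hx'; apply: ccontB; [exact: (holo_h H hc)|exact: (holo_h H hd)].
have c2 : econt_on c d (fun y => f (Complex b y) - f (Complex a y)).
  by move=> x hx'; apply: ccontB; [exact: (holo_v H hb)|exact: (holo_v H ha)].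
have c1k : econt_on a b (fun x => f (Complex x c) - f (Complex x d) - kh).
  by move=> x hx'; apply: ccontB; [exact: c1|exact: (cst_on a b)].
have c2k : econt_on c d (fun y => f (Complex b y) - f (Complex a y) - kv).
  by move=> x hx'; apply: ccontB; [exact: c2|exact: (cst_on c d)].
have Ci (x y : R) : Complex x y = toC x + 'i%C * toC y.
  by apply: complexP; rewrite ?ReD ?ImD ?ReM ?ImM /toC /=; ring.
have -> : J f a b c d = seg_int a b (fun x => (f (Complex x c) - f (Complex x d)) - kh) +
   'i%C * seg_int c d (fun y => (f (Complex b y) - f (Complex a y)) - kv).
  rewrite (sIB c1 (cst_on a b kh)) (sIB c2 (cst_on c d kv)) !seg_int_cst// /J /kh /kv !toCB; ring.
apply: le_trans (ler_normcD _ _) _; rewrite normcM (_ : normc 'i%C = 1) ?mul1r; last first.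
  by rewrite normcE /= expr0n expr1n add0r sqrtr1.
have b1 : normc (seg_int a b (fun x => (f (Complex x c) - f (Complex x d)) - kh)) <= (2 * (e * L)) * (b - a).
  apply: seg_int_le => // x hx'.
  have -> : f (Complex x c) - f (Complex x d) - kh = r (Complex x c) - r (Complex x d).
    by rewrite /r /kh !(Ci x) !toCB; ring.
  apply: le_trans (ler_normcB _ _) _; rewrite mulr_natl mulr2n; apply: lerD; exact: rb.
have b2 : normc (seg_int c d (fun y => (f (Complex b y) - f (Complex a y)) - kv)) <= (2 * (e * L)) * (d - c).
  apply: seg_int_le => // y hy'.
  have -> : f (Complex b y) - f (Complex a y) - kv = r (Complex b y) - r (Complex a y).
    by rewrite /r /kv !(Ci _ y) !toCB; ring.
  apply: le_trans (ler_normcB _ _) _; rewrite mulr_natl mulr2n; apply: lerD; exact: rb.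
apply: le_trans (lerD b1 b2) _; rewrite -mulrDr -/L expr2 !mulrA lexx//.
Qed.

Lemma J_quarter f a b c d : a <= b -> c <= d -> holo_on f a b c d -> forall w h, w = (b - a) / 2 -> h = (d - c) / 2 ->
  exists a' c', [/\ a <= a', a' + w <= b, c <= c', c' + h <= d & normc (J f a b c d) <= 4 * normc (J f a' (a' + w) c' (c' + h))].
Proof.
move=> ab cd H w h wE hE.
have E := @J_split f a (a + w) b c (c + h) d.
have am : a <= a + w by rewrite wE; lra.
have mb : a + w <= b by rewrite wE; lra.
have cn : c <= c + h by rewrite hE; lra.
have nd : c + h <= d by rewrite hE; lra.
have bE : a + w + w = b by rewrite wE; field.
have dE : c + h + h = d by rewrite hE; field.
have {}E := E am mb cn nd H.
have [k1|k1] := lerP (normc (J f a b c d)) (4 * normc (J f a (a + w) c (c + h))).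
  by exists a, c.
have [k2|k2] := lerP (normc (J f a b c d)) (4 * normc (J f (a + w) b c (c + h))).
  by exists (a + w), c; rewrite bE.
have [k3|k3] := lerP (normc (J f a b c d)) (4 * normc (J f a (a + w) (c + h) d)).
  by exists a, (c + h); rewrite dE.
have [k4|k4] := lerP (normc (J f a b c d)) (4 * normc (J f (a + w) b (c + h) d)).
  by exists (a + w), (c + h); rewrite dE bE.
exfalso; move: k1 k2 k3 k4; rewrite E.
have := ler_normcD (J f a (a + w) c (c + h) + J f (a + w) b c (c + h)) (J f a (a + w) (c + h) d + J f (a + w) b (c + h) d).
have := ler_normcD (J f a (a + w) c (c + h)) (J f (a + w) b c (c + h)).
have := ler_normcD (J f a (a + w) (c + h) d) (J f (a + w) b (c + h) d).
lra.
Qed.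

Lemma goursat f a b c d : a <= b -> c <= d -> holo_on f a b c d -> J f a b c d = 0.
Proof.
move=> ab cd H; set w := b - a; set h := d - c.
have w0 : 0 <= w by rewrite subr_ge0.
have h0 : 0 <= h by rewrite subr_ge0.
pose W n := w / 2 ^+ n; pose V n := h / 2 ^+ n.
have p2 n : 0 < 2 ^+ n :> R by rewrite exprn_gt0.
have W0 n : 0 <= W n by rewrite divr_ge0// ltW.
have V0 n : 0 <= V n by rewrite divr_ge0// ltW.
have WS n : W n.+1 = W n / 2 by rewrite /W exprSr invfM mulrA.
have VS n : V n.+1 = V n / 2 by rewrite /V exprSr invfM mulrA.
pose good n (s : R * R) := [/\ a <= s.1, s.1 + W n <= b, c <= s.2 & s.2 + V n <= d].
pose nxt n (s t : R * R) := [/\ s.1 <= t.1, t.1 + W n.+1 <= s.1 + W n, s.2 <= t.2, t.2 + V n.+1 <= s.2 + V n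
  & normc (J f s.1 (s.1 + W n) s.2 (s.2 + V n)) <= 4 * normc (J f t.1 (t.1 + W n.+1) t.2 (t.2 + V n.+1))].
(* The next rectangle is chosen for every pair, with [good] as a premise, so that [choice] yields a
   total function to iterate; [good] is then carried along by induction. *)
have step (ns : nat * (R * R)) : exists t, good ns.1 ns.2 -> nxt ns.1 ns.2 t.
  case: ns => n s /=; have [g|ng] := pselect (good n s); last by exists s.
  case: (g) => g1 g2 g3 g4.
  have Hs : holo_on f s.1 (s.1 + W n) s.2 (s.2 + V n) by apply: holo_onS H.
  have s1 : s.1 <= s.1 + W n by rewrite lerDl.
  have s2 : s.2 <= s.2 + V n by rewrite lerDl.
  have e1 : W n.+1 = (s.1 + W n - s.1) / 2 by rewrite WS addrC addKr.
  have e2 : V n.+1 = (s.2 + V n - s.2) / 2 by rewrite VS addrC addKr.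
  have [a' [c' [q1 q2 q3 q4 q5]]] := J_quarter s1 s2 Hs e1 e2.
  by exists (a', c').
have [st Hst] := choice step.
pose fix S n := if n is m.+1 then st (m, S m) else (a, c).
have goodS n : good n (S n).
  elim: n => [|n IH]; first by rewrite /good /= /W /V expr0 !divr1 /w /h !subrKC !lexx.
  have [k1 k2 k3 k4 _] := Hst (n, S n) IH; case: IH => g1 g2 g3 g4.
  by split; rewrite /= in k1 k2 k3 k4 *; [exact: le_trans g1 k1|exact: le_trans k2 g2|exact: le_trans g3 k3|exact: le_trans k4 g4].
have nxtS n : nxt n (S n) (S n.+1) by exact: Hst (n, S n) (goodS n).
have SJ n : normc (J f a b c d) <= 4 ^+ n * normc (J f (S n).1 ((S n).1 + W n) (S n).2 ((S n).2 + V n)).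
  elim: n => [|n IH]; first by rewrite /= /W /V expr0 !divr1 /w /h !subrKC mul1r.
  have [_ _ _ _ k] := nxtS n; apply: le_trans IH _; rewrite exprSr -mulrA ler_wpM2l// exprn_ge0//.
have mono n m : (n <= m)%N -> [/\ (S n).1 <= (S m).1, (S m).1 + W m <= (S n).1 + W n, (S n).2 <= (S m).2 & (S m).2 + V m <= (S n).2 + V n].
  elim: m => [|m IH]; first by rewrite leqn0 => /eqP ->.
  rewrite leq_eqVlt => /predU1P[->//|]; rewrite ltnS => /IH[j1 j2 j3 j4].
  have [k1 k2 k3 k4 _] := nxtS m.
  by split; [exact: le_trans j1 k1|exact: le_trans k2 j2|exact: le_trans j3 k3|exact: le_trans k4 j4].
have lim (u : nat -> R) (U : nat -> R) : (forall n, 0 <= U n) -> (forall n m, (n <= m)%N -> u n <= u m /\ u m + U m <= u n + U n) ->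
   exists x, forall n, u n <= x <= u n + U n.
  move=> U0 Hu; exists (sup (range u)) => n.
  have ub m : ubound (range u) (u m + U m).
    move=> _ [k _ <-]; case: (leqP k m) => [km|kernel_adj].
      by apply: le_trans (Hu _ _ km).1 _; rewrite lerDl.
    by apply: le_trans (Hu _ _ (ltnW kernel_adj)).2; rewrite lerDl.
  apply/andP; split; last by apply: ge_sup; [exists (u 0%N), 0%N|exact: ub].
  by apply: ub_le_sup; [exists (u 0%N + U 0%N); exact: ub|exists n].
have [x0 Hx0] := lim (fun n => (S n).1) W W0 (fun n m nm => let: And4 k1 k2 _ _ := mono n m nm in conj k1 k2).
have [y0 Hy0] := lim (fun n => (S n).2) V V0 (fun n m nm => let: And4 _ _ k1 k2 := mono n m nm in conj k1 k2).
have [A hA] : exists A, hasD f (Complex x0 y0) A.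
  apply: H; [have := Hx0 0%N|have := Hy0 0%N]; by rewrite /= /W /V expr0 !divr1 /w /h !subrKC.
have wh0 : 0 <= w + h by rewrite addr_ge0.
have key e : 0 < e -> normc (J f a b c d) <= e * (2 * (w + h) ^+ 2).
  move=> e0; have [r r0 Hr] := hA e e0.
  have [n nr] : exists n : nat, (w + h) / 2 ^+ n < r.
    have cv : (fun n => (2^-1 : R) ^+ n) @ \oo --> (0 : R) by apply: cvg_expr; rewrite ger0_norm; lra.
    have K0 : 0 < w + h + 1 by rewrite ltr_wpDl.
    move/cvgrPdist_lt/(_ _ (divr_gt0 r0 K0)): cv => [n _ /(_ n (leqnn n))].
    rewrite sub0r normrN exprVn ger0_norm ?invr_ge0 ?(ltW (p2 n))// ltr_pdivlMr// => k; exists n.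
    apply: le_lt_trans k; rewrite mulrC; apply: ler_wpM2l; last by rewrite lerDl.
    by rewrite invr_ge0 ltW.
  have [g1 g2 g3 g4] := goodS n.
  have sz : (S n).1 + W n - (S n).1 + ((S n).2 + V n - (S n).2) = (w + h) / 2 ^+ n.
    by rewrite /W /V [in RHS]mulrDl [_.1 + _]addrC addrK [_.2 + _]addrC addrK.
  have Js : normc (J f (S n).1 ((S n).1 + W n) (S n).2 ((S n).2 + V n)) <= 2 * e * ((w + h) / 2 ^+ n) ^+ 2.
    rewrite -sz; apply: (@J_small f (Complex x0 y0) A); rewrite ?lerDl ?(ltW e0)//.
    - exact: holo_onS H.
    - by move=> z; rewrite sz => zr; have := Hr (z - Complex x0 y0) (le_lt_trans zr nr); rewrite [_ + (z - _)]addrC subrK.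
  apply: le_trans (SJ n) _; apply: le_trans (ler_wpM2l _ Js) _; first by rewrite exprn_ge0.
  rewrite expr_div_n -exprM mulnC exprM (_ : 2 ^+ 2 = 4 :> R); last by rewrite expr2; ring.
  have f4 : (4 : R) ^+ n != 0 by rewrite expf_neq0// pnatr_eq0.
  by rewrite mulrCA [X in _ * X]mulrCA divff// mulr1 le_eqVlt; apply/orP; left; apply/eqP; rewrite !expr2; ring.
have [->//|nz] := eqVneq (J f a b c d) 0; exfalso.
have np : 0 < normc (J f a b c d) by rewrite normc_gt0.
have K0 : 0 < 2 * (w + h) ^+ 2 + 1 by rewrite ltr_wpDl// mulr_ge0// sqr_ge0.
have := key _ (divr_gt0 np K0); rewrite mulrAC ler_pdivlMr// ler_pM2l//; lra.
Qed.
End goursat.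

(** * Horizontal contour shifts and the complex exponential *)

Section cexp.
Variable R : realType.
Local Notation TR := (measurableTypeR R).
Local Notation C := (R[i]).
Local Notation leb := (@lebesgue_measure R).
Local Notation mu_per := (@mu_per R).
Implicit Types (f g : C -> C).

Lemma Rintegral_mu_per (f : TR -> R) : measurable_fun setT f -> Rintegral mu_per setT f = Rintegral leb (@per_itv R) f.
Proof.
move=> mf; have mF : measurable_fun setT (EFin \o f) by exact/measurable_EFinP.
rewrite /Rintegral integralE [X in _ = fine X]integralE; congr (fine (_ - _)).
- by rewrite ge0_integral_mu_per//; exact: measurable_funepos.
- by rewrite ge0_integral_mu_per//; exact: measurable_funeneg.
Qed.

Lemma econt_cmeasurable (g : R -> C) : (forall x, econt g x) -> cmeasurable (setT : set TR) g.
Proof.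
move=> H; split; apply: measurable_fun_mu_per => x; [exact: (econt_Re (H x))|exact: (econt_Im (H x))].
Qed.

Lemma seg_int_mu_per (g : R -> C) : (forall x, econt g x) -> seg_int 0 (2 * pi) g = cintg mu_per setT g.
Proof.
move=> H; have [mr mi] := econt_cmeasurable H.
have [ir ii] : cintegrable leb `[0, 2 * pi]%classic g by apply: seg_cintegrable => x _; exact: H.
have sub : (`[0, 2 * pi[%classic : set TR) `<=` `[0, 2 * pi]%classic by apply: subset_itvl; rewrite bnd_simp.
have m2 : measurable (`[0, 2 * pi[%classic : set TR) by exact: measurable_itv.
have key (h : R -> R) : measurable_fun (setT : set TR) h -> leb.-integrable `[0, 2 * pi]%classic (EFin \o h) ->
   Rintegral leb `[0, 2 * pi]%classic h = Rintegral mu_per setT h.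
  move=> mh ih; rewrite Rintegral_mu_per// /per_itv -Rintegral_itv_bndo_bndc//.
  exact: (integrableS (measurable_seg 0 (2 * pi)) m2 sub ih).
by apply: complexP; exact: key.
Qed.

Lemma periodic_contour f (c d : R) : c <= d -> holo_on f 0 (2 * pi) c d ->
  (forall y, c <= y <= d -> f (Complex (2 * pi) y) = f (Complex 0 y)) ->
  seg_int 0 (2 * pi) (fun x => f (Complex x c)) = seg_int 0 (2 * pi) (fun x => f (Complex x d)).
Proof.
move=> cd H per; have p0 := ltW (pi2_gt0 R).
have := goursat p0 cd H; rewrite /J.
have -> : seg_int c d (fun y => f (Complex (2 * pi) y) - f (Complex 0 y)) = seg_int c d (fun=> 0).
  apply: eq_cintg => y; rewrite /= inE /= in_itv /= => hy; by rewrite per// subrr.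
rewrite seg_int_cst// !mulr0 addr0 sIB; last 2 first.
- by apply: (holo_h H); rewrite lexx.
- by apply: (holo_h H); rewrite lexx cd.
by move/eqP; rewrite subr_eq0 => /eqP.
Qed.

Lemma hasD_comp f g (z a b : C) : hasD g z b -> hasD f (g z) a -> hasD (fun t => f (g t)) z (a * b).
Proof.
move=> Hg Hf e e0.
have B0 : 0 < normc b + 1 by rewrite ltr_wpDl ?normc_ge0.
have A0 : 0 < normc a + 1 by rewrite ltr_wpDl ?normc_ge0.
have [r r0 Hr] := Hf _ (divr_gt0 (divr_gt0 e0 (@ltr0n R 2)) B0).
have e1 : 0 < Num.min 1 (e / 2 / (normc a + 1)) by rewrite lt_min ltr01 !divr_gt0.
have [s s0 Hs] := Hg _ e1.
exists (Num.min s (r / (normc b + 1))); first by rewrite lt_min s0 divr_gt0.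
move=> h; rewrite lt_min => /andP[h1]; rewrite ltr_pdivlMr// => h2.
have k1 := Hs h h1; set k := g (z + h) - g z.
have n0 := normc_ge0 h.
have kle : normc k <= normc h * (normc b + 1).
  have -> : k = (k - b * h) + b * h by ring.
  apply: le_trans (ler_normcD _ _) _; rewrite normcM.
  have : normc (k - b * h) <= normc h by apply: le_trans k1 _; by rewrite ler_piMl// ge_min lexx.
  lra.
have := Hr k (le_lt_trans kle h2); rewrite {1}/k [g z + _]addrC subrK => k2.
have -> : f (g (z + h)) - f (g z) - a * b * h = (f (g (z + h)) - f (g z) - a * k) + a * (k - b * h) by ring.
apply: le_trans (ler_normcD _ _) _; rewrite normcM.
have l1 : e / 2 / (normc b + 1) * normc k <= e / 2 * normc h.
  by rewrite mulrAC ler_pdivrMr// -[leRHS]mulrA ler_wpM2l// ltW ?divr_gt0.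
have l2 : normc a * normc (k - b * h) <= e / 2 * normc h.
  apply: (@le_trans _ _ ((normc a + 1) * (e / 2 / (normc a + 1) * normc h))).
    apply: ler_pM; rewrite ?normc_ge0//; first lra.
    by apply: le_trans k1 _; rewrite ler_wpM2r// ge_min lexx orbT.
  by rewrite mulrA mulrCA divff ?mulr1// gt_eqF.
have := le_trans k2 l1; lra.
Qed.

Lemma hasD_cst (c z : C) : hasD (fun=> c) z 0.
Proof. by move=> e e0; exists 1 => // h _; rewrite subrr mul0r subrr normc0 mulr_ge0 ?normc_ge0 ?ltW. Qed.
Lemma hasD_id (z : C) : hasD (fun t => t) z 1.
Proof. move=> e e0; exists 1 => // h _; rewrite mul1r (_ : z + h - z - h = 0); last by ring.
by rewrite normc0 mulr_ge0 ?normc_ge0 ?ltW. Qed.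
Lemma hasDD f g z a b : hasD f z a -> hasD g z b -> hasD (fun t => f t + g t) z (a + b).
Proof. by move=> /hasDP H /hasDP H'; apply/hasDP; exact: (@is_deriveD C C^o C^o f g z 1 a b). Qed.
Lemma hasDB f g z a b : hasD f z a -> hasD g z b -> hasD (fun t => f t - g t) z (a - b).
Proof. by move=> /hasDP H /hasDP H'; apply/hasDP; exact: (@is_deriveB C C^o C^o f g z 1 a b). Qed.
Lemma hasDM f g z a b : hasD f z a -> hasD g z b -> hasD (fun t => f t * g t) z (f z * b + g z * a).
Proof. by move=> /hasDP H /hasDP H'; apply/hasDP; exact: (@is_deriveM C C^o f g z 1 a b). Qed.
Lemma hasDZ c g z b : hasD g z b -> hasD (fun t => c * g t) z (c * b).
Proof. by move=> H; have := hasDM (hasD_cst c z) H; rewrite mulr0 addr0. Qed.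

(** The entire function exp (i z). Its modulus exp (- Im z) decays upwards, which is the source of
    the exponential decay of the matrix entries. *)
Definition cexp_up (z : C) : C := toC (expR (- complex.Im z)) * cexpi (complex.Re z).

Lemma cED z w : cexp_up (z + w) = cexp_up z * cexp_up w.
Proof. by rewrite /cexp_up ReD ImD opprD expRD toCM cexpiD; ring. Qed.
Lemma cE0 : cexp_up 0 = 1. Proof. by rewrite /cexp_up /= oppr0 expR0 cexpi0 toC1 mulr1. Qed.
Lemma normc_cexp_up z : normc (cexp_up z) = expR (- complex.Im z).
Proof. by rewrite normcM normc_toC normc_cexpi mulr1 ger0_norm// expR_ge0. Qed.

Lemma derive_eps (g : R -> R) (s d : R) : is_derive s (1 : R) g d ->
  forall e, 0 < e -> exists2 r : R, 0 < r & forall h : R, `|h| < r -> `|g (s + h) - g s - h * d| <= e * `|h|.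
Proof.
move=> [df dE] e e0.
have : (fun h : R => h^-1 *: ((g \o shift s) (h *: (1 : R)) - g s)) @ 0^' --> d by rewrite -dE; exact: df.
move=> /cvgrPdist_le /(_ _ e0) /nbhs_ballP [r /= r0 Hr].
exists r => // h hr; have [->|h0] := eqVneq h 0; first by rewrite addr0 mul0r !subr0 subrr normr0 mulr0.
have bh : ball (0 : R) r h by rewrite /ball /= sub0r normrN.
have := Hr h bh h0; rewrite /shift /= /GRing.scale /= mulr1 [h + s]addrC => k.
have -> : g (s + h) - g s - h * d = - (h * (d - h^-1 * (g (s + h) - g s))).
  by rewrite [in RHS]mulrBr mulVKf//; ring.
by rewrite normrN normrM [leRHS]mulrC ler_pM2l ?normr_gt0.
Qed.

Lemma hasD_cE0 : hasD cexp_up 0 'i%C.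
Proof.
move=> e e0; have e8 : 0 < e / 8 by rewrite divr_gt0.
have e4 : 0 < e / 4 by rewrite divr_gt0.
have [r1 r10 H1] := derive_eps (is_derive_expR 0) e8.
have [r2 r20 H2] := derive_eps (is_derive_sin 0) e8.
have [r3 r30 H3] := derive_eps (is_derive_cos 0) e8.
exists (Num.min (Num.min 1 (e / 4)) (Num.min r1 (Num.min r2 r3))).
  by rewrite !lt_min ltr01 e4 r10 r20 r30.
move=> h; rewrite !lt_min => /andP[/andP[h1 h2] /and3P[h3 h4 h5]].
rewrite add0r cE0; case: h h1 h2 h3 h4 h5 => x y h1 h2 h3 h4 h5.
have xle := Re_le_normc (Complex x y); have yle := Im_le_normc (Complex x y).
rewrite /= in xle yle.
have := H1 (- y); rewrite normrN => /(_ (le_lt_trans yle h3)); rewrite add0r expR0 mulr1 => k1.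
have := H2 x (le_lt_trans xle h4); rewrite add0r sin0 cos0 subr0 mulr1 => k2.
have := H3 x (le_lt_trans xle h5); rewrite add0r cos0 sin0 oppr0 mulr0 subr0 => k3.
(* As i z = - y + i x, the remainder splits into those of the real exponential at - y, of the cosine
   and of the sine at x, and the second-order product x y. *)
have -> : cexp_up (Complex x y) - 1 - 'i%C * Complex x y = toC (expR (- y) - 1 - - y) * cexpi x +
   (toC (1 - y) * (toC (cos x - 1) + 'i%C * toC (sin x - x)) - 'i%C * toC (x * y)).
  rewrite /cexp_up /cexpi /toC.
  by apply: complexP; rewrite ?(ReD, ImD, ReN, ImN, ReM, ImM) /=; ring.
apply: le_trans (ler_normcD _ _) _; rewrite normcM normc_toC normc_cexpi mulr1.
have ni : normc ('i%C : C) = 1 by rewrite normcE /= expr0n expr1n add0r sqrtr1.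
have b1 : normc (toC (1 - y) * (toC (cos x - 1) + 'i%C * toC (sin x - x)) - 'i%C * toC (x * y)) <=
   2 * (e / 8 * `|x| + e / 8 * `|x|) + `|x| * `|y|.
  apply: le_trans (ler_normcB _ _) _; rewrite !normcM ni mul1r !normc_toC normrM; apply: lerD => //.
  apply: ler_pM; rewrite ?normc_ge0//.
    by apply: le_trans (ler_normB _ _) _; rewrite normr1; lra.
  apply: le_trans (ler_normcD _ _) _; rewrite normcM ni mul1r !normc_toC; exact: lerD.
set N := normc (Complex x y) in h1 h2 h3 h4 h5 xle yle *.
apply: le_trans (lerD k1 b1) _.
have xy : `|x| * `|y| <= N * (e / 4) by apply: ler_pM => //; lra.
have ex : e / 8 * `|x| <= e / 8 * N by rewrite ler_pM2l.
have ey : e / 8 * `|y| <= e / 8 * N by rewrite ler_pM2l.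
have eN : 0 <= e * N by rewrite mulr_ge0 ?normc_ge0 ?ltW.
lra.
Qed.
Lemma hasD_cexp_up z : hasD cexp_up z (cexp_up z * 'i%C).
Proof.
move=> e e0; have [r r0 Hr] := hasDZ (cexp_up z) hasD_cE0 e0.
by exists r => // h hr; have := Hr h hr; rewrite add0r cE0 mulr1 cED.
Qed.
End cexp.

(** * Cauchy's formula for the derivative *)

Section cauchy.
Variable R : realType.
Local Notation TR := (measurableTypeR R).
Local Notation C := (R[i]).
Local Notation mu_per := (@mu_per R).
Implicit Types (h : C -> C) (z : C).

Lemma hasD_toC (x : R) z : hasD (fun t : C => toC x * t) z (toC x).
Proof. by have := hasDZ (toC x) (@hasD_id R z); rewrite mulr1. Qed.

Lemma cexp_up_scale (a x y : R) : cexp_up (toC a * Complex x y) = toC (expR (- (a * y))) * cexpi (a * x).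
Proof. by rewrite /cexp_up; congr (toC (expR (- _)) * cexpi _) => /=; ring. Qed.

Lemma econt_circle h z r : 0 <= r -> (forall w, normc (w - z) <= r -> exists A, hasD h w A) ->
  forall x, econt (fun x => h (z + toC r * cexpi x)) x.
Proof.
move=> r0 H x.
have Ex t : cexpi t = cexp_up (Complex t 0) :> C by rewrite /cexp_up /= oppr0 expR0 toC1 mul1r.
have [|A hA] := H (z + toC r * cexp_up (Complex x 0)).
  by rewrite addrC addKr normcM normc_toC -Ex normc_cexpi mulr1 ger0_norm.
rewrite (_ : (fun x => _) = (fun t => (fun w => h (z + toC r * cexp_up w)) (Complex t 0))); last first.
  by apply/funext => t; rewrite Ex.
have d1 : hasD (fun w => z + toC r * cexp_up w) (Complex x 0) (0 + toC r * (cexp_up (Complex x 0) * 'i%C)).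
  by apply: hasDD; [exact: hasD_cst|apply: hasDZ; exact: hasD_cexp_up].
exact: (hasD_econt_h (hasD_comp d1 hA)).
Qed.

(** For [h] holomorphic near the disc this is 2 pi r^m times the m-th power series coefficient of
    [h] at [z]. *)
Definition circle_coef h z r (m : int) : C := cintg mu_per setT (fun x : TR => h (z + toC r * cexpi x) * cexpi (- m%:~R * x)).

Lemma ccontM (g g' : R -> C) x : econt g x -> econt g' x -> econt (fun t => g t * g' t) x.
Proof.
move=> H H' e e0.
set M := normc (g x) + normc (g' x) + 1.
have M0 : 0 < M by rewrite ltr_wpDl ?addr_ge0 ?normc_ge0.
have e1 : 0 < Num.min 1 (e / 2 / M) by rewrite lt_min ltr01 !divr_gt0.
have [d d0 Hd] := H _ e1; have [d' d'0 Hd'] := H' _ e1.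
exists (Num.min d d'); first by rewrite lt_min d0.
move=> y; rewrite lt_min => /andP[y1 y2].
have -> : g y * g' y - g x * g' x = (g y - g x) * (g' y - g' x) + ((g y - g x) * g' x + g x * (g' y - g' x)) by ring.
have k := Hd y y1; have k' := Hd' y y2.
have [ka kb] : normc (g y - g x) <= 1 /\ normc (g y - g x) <= e / 2 / M.
  by move: k; rewrite le_min => /andP.
have {k'} kc : normc (g' y - g' x) <= e / 2 / M by move: k'; rewrite le_min => /andP[].
apply: le_trans (ler_normcD _ _) _; rewrite normcM.
have := normc_ge0 (g x); have := normc_ge0 (g' x) => nx' nx.
apply: (@le_trans _ _ (normc (g y - g x) * normc (g' y - g' x) + (normc (g y - g x) * normc (g' x) + normc (g x) * normc (g' y - g' x)))).
  by rewrite -!normcM lerD2l ler_normcD.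
have EM : e / 2 / M * M = e / 2 by rewrite divfK ?gt_eqF.
have q0 : 0 <= e / 2 / M by rewrite !divr_ge0 // ltW.
have p1 : normc (g y - g x) * normc (g' y - g' x) <= e / 2 / M * 1 by rewrite mulrC; apply: ler_pM; rewrite ?normc_ge0.
have p2 : normc (g y - g x) * normc (g' x) <= e / 2 / M * normc (g' x) by apply: ler_wpM2r.
have p3 : normc (g x) * normc (g' y - g' x) <= e / 2 / M * normc (g x) by rewrite mulrC; apply: ler_wpM2r.
have p4 : e / 2 / M * 1 + e / 2 / M * normc (g' x) + e / 2 / M * normc (g x) = e / 2 by rewrite -[RHS]EM -!mulrDr; congr (_ * _); rewrite /M; ring.
lra.
Qed.

Lemma econt_cexpi (a : R) x : econt (fun x => cexpi (a * x) : C) x.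
Proof.
rewrite (_ : (fun x => _) = (fun t => (fun w => cexp_up (toC a * w)) (Complex t 0))); last first.
  by apply/funext => t; rewrite cexp_up_scale mulr0 oppr0 expR0 toC1 mul1r.
exact: (hasD_econt_h (hasD_comp (hasD_toC a _) (hasD_cexp_up _))).
Qed.

Lemma econt_circle_coef h z r m : 0 <= r -> (forall w, normc (w - z) <= r -> exists A, hasD h w A) ->
  forall x, econt (fun x => h (z + toC r * cexpi x) * cexpi (- m%:~R * x)) x.
Proof. by move=> r0 H x; apply: ccontM; [exact: econt_circle|exact: econt_cexpi]. Qed.

Lemma ccontZ (c : C) g x : econt g x -> econt (fun t => c * g t) x.
Proof. by apply: ccontM => e e0; exists 1 => // y _; rewrite subrr normc0 ltW. Qed.

Lemma econt_cintegrable (g : R -> C) : (forall x, econt g x) -> cintegrable mu_per setT g.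
Proof.
move=> H; have [mr mi] := econt_cmeasurable H.
have [ir ii] : cintegrable (@lebesgue_measure R) `[0, 2 * pi]%classic g by apply: seg_cintegrable => x _; exact: H.
have sub : (`[0, 2 * pi[%classic : set TR) `<=` `[0, 2 * pi]%classic by apply: subset_itvl; rewrite bnd_simp.
have m2 : measurable (`[0, 2 * pi[%classic : set TR) by exact: measurable_itv.
have key (h : TR -> R) : measurable_fun (setT : set TR) h -> (@lebesgue_measure R).-integrable `[0, 2 * pi]%classic (EFin \o h) ->
   mu_per.-integrable setT (EFin \o h).
  move=> mh /(integrableS (measurable_seg 0 (2 * pi)) m2 sub) ih.
  apply/integrableP; split; first exact/measurable_EFinP.
  rewrite ge0_integral_mu_per//; first by move/integrableP: ih => [].
  by apply: measurableT_comp => //; exact/measurable_EFinP.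
by split; exact: key.
Qed.

(** The map w -> z + exp (i w) turns the circle of radius t into the horizontal line Im w = - ln t,
    and the annulus between the two circles into a rectangle of width one period. The shift of a
    periodic contour then compares the two integrals; the real exponentials are s^(-m) and
    r^(-m). *)
Lemma circle_coef_indep h z m s r : 0 < s -> s <= r -> (forall w, normc (w - z) <= r -> exists A, hasD h w A) ->
  toC (expR (- (m%:~R * ln s))) * circle_coef h z s m = toC (expR (- (m%:~R * ln r))) * circle_coef h z r m.
Proof.
move=> s0 sr H; have r0 := lt_le_trans s0 sr.
pose f w := h (z + cexp_up w) * cexp_up (toC (- m%:~R) * w).
have cd : - ln r <= - ln s by rewrite lerN2 ler_ln.
have fE x y : f (Complex x y) = toC (expR (m%:~R * y)) * (h (z + toC (expR (- y)) * cexpi x) * cexpi (- m%:~R * x)).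
  by rewrite /f cexp_up_scale mulNr opprK [cexp_up _]/cexp_up /=; ring.
have holo2 : holo_on f 0 (2 * pi) (- ln r) (- ln s).
  move=> x y _ /andP[y1 _].
  have [|A hA] := H (z + cexp_up (Complex x y)).
    rewrite addrC addKr normc_cexp_up /= -[leRHS]lnK ?ler_expR//; lra.
  have d1 : hasD (fun w => z + cexp_up w) (Complex x y) (0 + cexp_up (Complex x y) * 'i%C).
    by apply: hasDD; [exact: hasD_cst|exact: hasD_cexp_up].
  have d2 := hasD_comp d1 hA.
  have d3 : hasD (fun w => cexp_up (toC (- m%:~R) * w)) (Complex x y) (cexp_up (toC (- m%:~R) * Complex x y) * 'i%C * toC (- m%:~R)).
    exact: (hasD_comp (hasD_toC _ _) (hasD_cexp_up _)).
  exact: (ex_intro _ _ (hasDM d2 d3)).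
have per y : - ln r <= y <= - ln s -> f (Complex (2 * pi) y) = f (Complex 0 y).
  have := cexpi_2piZ R 1; rewrite mul1r => e1.
  by move=> _; rewrite !fE mulNr cexpiN cexpi_2piZ e1 mulr0 !cexpi0 conjc1.
have := periodic_contour cd holo2 per.
have E t : 0 < t -> t <= r -> seg_int 0 (2 * pi) (fun x => f (Complex x (- ln t))) = toC (expR (- (m%:~R * ln t))) * circle_coef h z t m.
  move=> t0 tr; have Ht : forall w, normc (w - z) <= t -> exists A, hasD h w A by move=> w wt; apply: H; exact: le_trans wt tr.
  have cc := econt_circle_coef m (ltW t0) Ht.
  rewrite (_ : (fun x => _) = (fun x => toC (expR (- (m%:~R * ln t))) * (h (z + toC t * cexpi x) * cexpi (- m%:~R * x)))).
    rewrite seg_int_mu_per; last by move=> x; apply: ccontZ; exact: cc.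
    by rewrite cIZ//; exact: econt_cintegrable.
  by apply/funext => x; rewrite fE opprK lnK// mulrN.
by rewrite !E// => ->.
Qed.

(** The coefficient divided by the radius does not depend on the radius, so it may be computed for
    radii tending to 0. There h (z) integrates to 0 against exp (- i x) and the linear term
    contributes 2 pi A. *)
Lemma cauchy1 h z r A : 0 < r -> (forall w, normc (w - z) <= r -> exists A, hasD h w A) -> hasD h z A ->
  circle_coef h z r 1 = toC (2 * pi * r) * A.
Proof.
move=> r0 H hA.
have key e : 0 < e -> normc (toC r^-1 * circle_coef h z r 1 - toC (2 * pi) * A) <= e * (2 * pi).
  move=> e0; have [d d0 Hd] := hA e e0.
  pose s := Num.min r (d / 2); have s0 : 0 < s by rewrite lt_min r0 divr_gt0.
  have sr : s <= r by rewrite ge_min lexx.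
  have sd : s < d by rewrite /s gt_min; apply/orP; right; lra.
  have Hs : forall w, normc (w - z) <= s -> exists A, hasD h w A by move=> w ws; apply: H; exact: le_trans ws sr.
  have := circle_coef_indep 1 s0 sr H; rewrite mulr1z !mul1r !expRN !lnK// => <-.
  have ic := econt_cintegrable (econt_circle_coef 1 (ltW s0) Hs).
  have iz : cintegrable mu_per setT (fun x : TR => h z * cexpi ((-1)%:~R * x)).
    by apply: econt_cintegrable => x; apply: ccontZ; exact: econt_cexpi.
  have iA : cintegrable mu_per setT (fun _ : TR => A * toC s).
    by apply: econt_cintegrable => x e1 e10; exists 1 => // y _; rewrite subrr normc0 ltW.
  have im : cintegrable mu_per setT (fun x : TR => h (z + toC s * cexpi x) * cexpi (- 1%:~R * x) - h z * cexpi ((-1)%:~R * x)).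
    exact: cintegrableB.
  have E : circle_coef h z s 1 - toC (2 * pi * s) * A =
     cintg mu_per setT (fun x : TR => (h (z + toC s * cexpi x) * cexpi (- 1%:~R * x) - h z * cexpi ((-1)%:~R * x)) - A * toC s).
    rewrite (cIB measurableT im iA) (cIB measurableT ic iz) cintg_cst -[fine _]/(fine (mu_per setT)) m1T cIZ ?cintg_cexpi; last 2 first.
    - exact: measurableT.
    - by apply: econt_cintegrable; exact: econt_cexpi.
    by rewrite /circle_coef /= mulr0 subr0 toCM; ring.
  have sn : s != 0 by rewrite gt_eqF.
  have -> : toC s^-1 * circle_coef h z s 1 - toC (2 * pi) * A = toC s^-1 * (circle_coef h z s 1 - toC (2 * pi * s) * A).
    rewrite mulrBr mulrA -toCM (_ : s^-1 * (2 * pi * s) = 2 * pi)//; field; exact: sn.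
  rewrite normcM normc_toC gtr0_norm ?invr_gt0// ler_pdivrMl// E.
  have -> : s * (e * (2 * pi)) = Rintegral mu_per setT (fun _ : TR => e * s).
    by rewrite Rintegral_cst// -[fine _]/(fine (mu_per setT)) m1T /=; ring.
  apply: normc_cintg_le => //.
  - exact: cintegrable_cmeasurable (cintegrableB measurableT im iA).
  - by apply: finite_measure_integrable_cst.
  move=> x _.
  have -> : h (z + toC s * cexpi x) * cexpi (- 1%:~R * x) - h z * cexpi ((-1)%:~R * x) - A * toC s =
     (h (z + toC s * cexpi x) - h z - A * (toC s * cexpi x)) * cexpi (- x).
    have ee : cexpi x * cexpi (- x) = 1 :> C by rewrite -cexpiD subrr cexpi0.
    rewrite intrN mulr1z mulN1r [in RHS]mulrBl -!mulrA ee mulr1 mulrBl//.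
  rewrite normcM normc_cexpi mulr1.
  have ns : normc (toC s * cexpi x) = s by rewrite normcM normc_cexpi mulr1 normc_toC ger0_norm// ltW.
  by have := Hd (toC s * cexpi x); rewrite ns => /(_ sd).
have p0 := pi2_gt0 R.
have Z : toC r^-1 * circle_coef h z r 1 - toC (2 * pi) * A = 0.
  have [//|nz] := eqVneq (toC r^-1 * circle_coef h z r 1 - toC (2 * pi) * A) 0; exfalso.
  set X := _ - _ in nz key; have np : 0 < normc X by rewrite normc_gt0.
  have := key _ (divr_gt0 np (mulr_gt0 (@ltr0n R 2) p0)).
  by rewrite [2 * (2 * pi)]mulrC invfM -mulrA -mulrA [2^-1 * _]mulrC mulrA mulrA divfK ?gt_eqF//; lra.
move/eqP: Z; rewrite subr_eq0 => /eqP Z.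
have -> : toC (2 * pi * r) * A = toC r * (toC (2 * pi) * A) by rewrite !toCM; ring.
by rewrite -Z mulrA -toCM divff ?gt_eqF// toC1 mul1r.
Qed.

End cauchy.

(** * The identity theorem on a strip *)

Section identity.
Variable R : realType.
Local Notation TR := (measurableTypeR R).
Local Notation C := (R[i]).
Local Notation mu_per := (@mu_per R).
Implicit Types (h : C -> C) (z : C).

Lemma red2pi (x : R) : exists k : int, 0 <= x - 2 * pi * k%:~R < 2 * pi.
Proof.
have p0 := pi2_gt0 R; exists (Num.floor (x / (2 * pi))).
have /andP[] := mem_rg1_floor (x / (2 * pi)); rewrite ler_pdivlMr// ltr_pdivrMr// => h1 h2.
rewrite subr_ge0 mulrC h1 /=; move: h2; rewrite ?intrD mulrDl ?mulr1z mul1r; lra.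
Qed.

Lemma periodic_int (T : Type) (g : R -> T) : (forall x, g (x + 2 * pi) = g x) ->
  forall x (k : int), g (x - 2 * pi * k%:~R) = g x.
Proof.
move=> H x k.
have nat_case (n : nat) y : g (y + 2 * pi * n%:R) = g y.
  elim: n y => [|n IH] y; first by rewrite mulr0 addr0.
  by rewrite -[X in y + _ * X]natr1 mulrDr mulr1 addrA H IH.
case: k => n; last by rewrite NegzE intrN mulrN opprK nat_case.
by rewrite -[RHS](nat_case n) -[in RHS](nat_case n) -(nat_case n (x - _)) subrK nat_case.
Qed.

Lemma econt_normc (g : R -> C) x : econt g x -> {for x, continuous (fun t => normc (g t))}.
Proof.
move=> H; apply/cvgrPdist_le => e e0; have [d d0 Hd] := H e e0.
apply/nbhs_ballP; exists d => // y; rewrite /ball /= distrC => yx.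
rewrite distrC; apply: le_trans (Hd y yx); rewrite ler_norml; apply/andP; split; last exact: normcBsum.
by rewrite lerNl opprB distcC normcBsum.
Qed.

Lemma econt_bounded (g : R -> C) : (forall x, econt g x) -> (forall x, g (x + 2 * pi) = g x) ->
  exists M, forall x, normc (g x) <= M.
Proof.
move=> H per; have p0 := pi2_gt0 R.
have cw : {within `[0, 2 * pi], continuous (fun t => normc (g t))}.
  by apply: continuous_in_subspaceT => x _; exact: econt_normc.
have [c _ Hc] := EVT_max (ltW p0) cw.
exists (normc (g c)) => x; have [k /andP[k1 k2]] := red2pi x.
by rewrite -(periodic_int per x k); apply: Hc; rewrite in_itv /= k1 ltW.
Qed.

(** Convolution with the trigonometric approximate identity sees only the Fourier coefficients,
    hence is 0, and converges to [g t] at an interior point of the period. *)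
Lemma trig_uniq (g : R -> C) : (forall x, econt g x) -> (forall x, g (x + 2 * pi) = g x) ->
  (forall j : int, cintg mu_per setT (fun x : TR => g x * cexpi (- j%:~R * x)) = 0) ->
  forall t, 0 < t < 2 * pi -> g t = 0.
Proof.
move=> cg per H t t0; have [M gM] := econt_bounded cg per.
have mg := econt_cmeasurable cg.
have E m : cintg mu_per setT (fun s : TR => g s * toC (Q m (t - s))) = 0.
  have [S HS] := @Q_trig R m.
  rewrite (_ : (fun s => _) = fun s => \sum_(p <- S) (p.1 * cexpi (p.2%:~R * t)) * (g s * cexpi (- p.2%:~R * s))); last first.
    apply/funext => s; rewrite HS mulr_sumr; apply: eq_bigr => p _.
    by rewrite mulrBr cexpiD mulNr; ring.
  have ic (p : C * int) : cintegrable mu_per setT (fun s : TR => g s * cexpi (- p.2%:~R * s)).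
    by apply: econt_cintegrable => x; apply: ccontM => //; exact: econt_cexpi.
  rewrite cintg_sum//; last by move=> p; apply: (cintegrableZ measurableT _ (ic p)).
  by rewrite big1 // => p _; rewrite cIZ// H mulr0.
have key e : 0 < e -> normc (g t) <= e.
  move=> e0; have [N HN] := approx_identity mg gM t0 (cg t) e0.
  by have := HN N (leqnn N); rewrite E mulr0 sub0r normcN.
have [//|nz] := eqVneq (g t) 0; exfalso.
have np : 0 < normc (g t) by rewrite normc_gt0.
have := key _ (divr_gt0 np (@ltr0n R 2)); lra.
Qed.

(** Extend [h] by 0 to the lower half-plane; since [h] vanishes on the real line the extension [ht]
    is again complex differentiable. A small circle below the axis sees only zeros, so all circle
    coefficients vanish, also on a larger circle with the same centre that reaches up to [w]; there
    [ht] is 0 by uniqueness of Fourier coefficients. *)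
Lemma identity_upper h (r0 : R) : (forall w, 0 <= complex.Im w < r0 -> exists A, hasD h w A) ->
  (forall x, h (toC x) = 0) -> forall w, 0 <= complex.Im w < r0 -> h w = 0.
Proof.
move=> H h0 w /andP[]; rewrite le_eqVlt => /predU1P[w0 _|y0 yr].
  by rewrite (_ : w = toC (complex.Re w)) //; apply: complexP.
pose ht (u : C) := if 0 < complex.Im u then h u else 0.
have hD u : complex.Im u < r0 -> exists A, hasD ht u A.
  move=> ur; case: (ltrgtP (complex.Im u) 0) => [u0|u0|u0].
  - exists 0 => e e0; exists (- complex.Im u); first by rewrite oppr_gt0.
    move=> k kr; have := le_lt_trans (Im_le_normc k) kr => ki.
    have i1 : complex.Im (u + k) < 0 by rewrite ImD; have := ler_norm (complex.Im k); lra.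
    have htn v : complex.Im v < 0 -> ht v = 0 by move=> vn; rewrite /ht ltNge (ltW vn).
    by rewrite !htn// mul0r !subr0 normc0 mulr_ge0 ?normc_ge0 ?(ltW e0).
  - have [|A hA] := H u; first by rewrite (ltW u0).
    exists A => e e0; have [d d0 Hd] := hA e e0; exists (Num.min d (complex.Im u)); first by rewrite lt_min d0.
    move=> k; rewrite lt_min => /andP[k1 k2].
    have i1 : 0 < complex.Im (u + k).
      rewrite ImD; have := ler_norm (- complex.Im k); rewrite normrN; have := Im_le_normc k; lra.
    by rewrite /ht i1 u0; exact: Hd.
  (* At a real point the derivative [A] can be computed along the real axis, where [h] is constantly
     0. So [A = 0], and the two halves of [ht] fit together with derivative 0. *)
  - have [|A hA] := H u; first by rewrite u0 lexx -u0.
    have uE : u = toC (complex.Re u) by apply: complexP.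
    have hu : h u = 0 by rewrite uE h0.
    have A0 : A = 0.
      have [//|nz] := eqVneq A 0; exfalso.
      have np : 0 < normc A by rewrite normc_gt0.
      have [d d0 Hd] := hA _ (divr_gt0 np (@ltr0n R 2)).
      have nd : normc (toC (d / 2)) = d / 2 by rewrite normc_toC ger0_norm// divr_ge0// ltW.
      have := Hd (toC (d / 2)); rewrite nd hu {1}uE -toCD h0 subrr sub0r normcN normcM nd => /(_ _).
      have : d / 2 < d by lra.
      move=> dd /(_ dd); rewrite ler_pM2r ?divr_gt0//; lra.
    exists 0 => e e0; have [d d0 Hd] := hA e e0; exists d => // k kd.
    rewrite /ht u0 ltxx mul0r !subr0; case: ifP => _; last by rewrite normc0 mulr_ge0 ?normc_ge0 ?ltW.
    by have := Hd k kd; rewrite hu A0 mul0r !subr0.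
(* The centre [z] is the mirror image of [w]. The circle of radius y / 2 stays below the real axis,
   and the one of radius 2 y passes through [w] at angle pi / 2 without rising above the height of
   [w]. *)
pose y := complex.Im w; pose z := Complex (complex.Re w) (- y).
have disc s u : normc (u - z) <= s -> complex.Im u <= s - y.
  move=> hs; have := le_trans (Im_le_normc (u - z)) hs.
  by rewrite ImD ImN /= => h'; have := ler_norm (complex.Im u - - y); lra.
have Hd u : normc (u - z) <= 2 * y -> exists A, hasD ht u A.
  by move=> /disc hu; apply: hD; rewrite /y in hu *; lra.
have y20 : 0 < y / 2 by rewrite divr_gt0.
have y2y : y / 2 <= 2 * y by rewrite /y; lra.
have Z m : circle_coef ht z (2 * y) m = 0.
  have := circle_coef_indep m y20 y2y Hd.
  have -> : circle_coef ht z (y / 2) m = 0.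
    rewrite /circle_coef (_ : (fun x => _) = fun=> 0) ?cI0//; apply/funext => x.
    rewrite /ht; case: ifP => //; last by rewrite mul0r.
    have := @disc (y / 2) (z + toC (y / 2) * cexpi x); rewrite addrC addKr normcM normc_cexpi mulr1 normc_toC.
    rewrite gtr0_norm// => /(_ (lexx _)) k1 k2; exfalso; lra.
  rewrite mulr0 => /esym/eqP; rewrite mulf_eq0 => /orP[|/eqP//].
  by rewrite -normc_eq0 normc_toC normr_eq0 gt_eqF ?expR_gt0.
have y00 : 0 <= 2 * y by rewrite mulr_ge0// ltW.
have p0 := @pi_gt0 R.
have := trig_uniq (econt_circle y00 Hd) _ Z.
have per x : ht (z + toC (2 * y) * cexpi (x + 2 * pi)) = ht (z + toC (2 * y) * cexpi x).
  by have := cexpi_2piZ R 1; rewrite cexpiD mul1r => ->; rewrite mulr1.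
move=> /(_ per (pi / 2)); rewrite /cexpi cos_pihalf sin_pihalf => E.
have -> : h w = ht (z + toC (2 * y) * Complex 0 1).
  have -> : z + toC (2 * y) * Complex 0 1 = w.
    by apply: complexP; rewrite ?ReD ?ImD ?ReM ?ImM /toC /= /y; ring.
  by rewrite /ht y0.
apply: E; lra.
Qed.

Lemma identity_strip h (r0 : R) : (forall w, `|complex.Im w| < r0 -> exists A, hasD h w A) ->
  (forall x, h (toC x) = 0) -> forall w, `|complex.Im w| < r0 -> h w = 0.
Proof.
move=> H h0 w wr; have [w0|w0] := leP 0 (complex.Im w).
  apply: (@identity_upper h r0) => //; last by rewrite w0 -(ger0_norm w0).
  by move=> u /andP[u0 u1]; apply: H; rewrite ger0_norm.
rewrite -[w]opprK; apply: (@identity_upper (fun u => h (- u)) r0).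
- move=> u /andP[u0 u1]; have [|A hA] := H (- u); first by rewrite ImN normrN ger0_norm.
  exists (A * -1); apply: (@hasD_comp R h (fun t => - t)) => //.
  have := hasDZ (-1) (@hasD_id R u); rewrite mulr1.
  by rewrite (_ : (fun t => _) = (fun t => - t))//; apply/funext => t; rewrite mulN1r.
- by move=> x; rewrite -toCN h0.
- by rewrite ImN oppr_ge0 ltW//= -(ltr0_norm w0).
Qed.
End identity.

(** * Holomorphic functions of two variables *)

Section regularity.
Variable R : realType.
Local Notation TR := (measurableTypeR R).
Local Notation C := (R[i]).
Local Notation mu_per := (@mu_per R).
Implicit Types (h : C -> C) (F : C^o * C^o -> C^o).

Lemma cauchy_est h z r A M : 0 < r -> (forall w, normc (w - z) <= r -> exists A, hasD h w A) -> hasD h z A ->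
  (forall w, normc (w - z) <= r -> normc (h w) <= M) -> normc A <= M / r.
Proof.
move=> r0 H hA HM; have E := cauchy1 r0 H hA.
have p0 := pi2_gt0 R.
have B : normc (circle_coef h z r 1) <= M * (2 * pi).
  have -> : M * (2 * pi) = Rintegral mu_per setT (fun _ : TR => M).
    by rewrite Rintegral_cst// -[fine _]/(fine (mu_per setT)) m1T.
  apply: normc_cintg_le => //.
  - by apply: cintegrable_cmeasurable; apply: econt_cintegrable; apply: econt_circle_coef => //; exact: ltW.
  - by apply: finite_measure_integrable_cst.
  move=> x _; rewrite normcM normc_cexpi mulr1; apply: HM.
  by rewrite addrC addKr normcM normc_cexpi mulr1 normc_toC gtr0_norm.
move: B; rewrite E normcM normc_toC gtr0_norm ?mulr_gt0 ?pi_gt0//.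
move=> B; rewrite ler_pdivlMr// -(ler_pM2r p0) (_ : normc A * r * (2 * pi) = 2 * pi * r * normc A) //; ring.
Qed.

Definition polydisc (z : C * C) (r : R) : set (C * C) := [set w | normc (w.1 - z.1) <= r /\ normc (w.2 - z.2) <= r].
Definition holo2 F (U : set (C * C)) := forall w, U w -> hasD2 F w (cd0 F w) (cd1 F w).

Lemma hasD2_self F z A B : hasD2 F z A B -> hasD2 F z (cd0 F z) (cd1 F z).
Proof. by move=> H; rewrite (hasD2_cd0 H) (hasD2_cd1 H). Qed.

Lemma holS F (U V : set (C * C)) : V `<=` U -> holo2 F U -> holo2 F V.
Proof. by move=> VU H w /VU; exact: H. Qed.
Lemma polydisc_S z r s : r <= s -> polydisc z r `<=` polydisc z s.
Proof. by move=> rs w [h1 h2]; split; [exact: le_trans h1 rs|exact: le_trans h2 rs]. Qed.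
Lemma polydisc_add z r s (w h : C * C) : polydisc z r w -> normc h.1 <= s -> normc h.2 <= s -> polydisc z (r + s) (w.1 + h.1, w.2 + h.2).
Proof.
by move=> [a b] c d; split => /=; rewrite addrAC; apply: le_trans (ler_normcD _ _) _; exact: lerD.
Qed.
Lemma polydisc_convex z r (w w' : C * C) (s : R) : 0 <= s <= 1 -> polydisc z r w -> polydisc z r w' ->
  polydisc z r (w.1 + toC s * (w'.1 - w.1), w.2 + toC s * (w'.2 - w.2)).
Proof.
have key (u v c : C) : 0 <= s <= 1 -> normc (u - c) <= r -> normc (v - c) <= r -> normc (u + toC s * (v - u) - c) <= r.
  move=> /andP[s0 s1] h1 h2.
  have -> : u + toC s * (v - u) - c = toC (1 - s) * (u - c) + toC s * (v - c) by rewrite toCB toC1; ring.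
  apply: le_trans (ler_normcD _ _) _; rewrite !normcM !normc_toC !ger0_norm ?subr_ge0//.
  have -> : r = (1 - s) * r + s * r by ring.
  by apply: lerD; apply: ler_wpM2l; rewrite ?subr_ge0.
by move=> s01 [a b] [a' b']; split; exact: key.
Qed.

Definition cconvex (V : set (C * C)) := forall (w w' : C * C) (s : R), 0 <= s <= 1 -> V w -> V w' ->
  V (w.1 + toC s * (w'.1 - w.1), w.2 + toC s * (w'.2 - w.2)).
Lemma cconvex_polydisc z r : cconvex (polydisc z r).
Proof. by move=> w w' s; exact: polydisc_convex. Qed.

Lemma hasD2_slice0 F (z : C * C) A B (u : C) : hasD2 F (z.1 + u, z.2) A B -> hasD (fun t => F (z.1 + t, z.2)) u A.
Proof.
move=> H e e0; have [d d0 Hd] := H e e0; exists d => // k kd.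
have := Hd k 0 kd; rewrite normc0 => /(_ d0); rewrite /= mulr0 subr0 !addr0 addrA; exact.
Qed.

Lemma mvt2 F V (w w' : C * C) M : cconvex V -> holo2 F V -> V w -> V w' ->
  (forall u, V u -> normc (cd0 F u * (w'.1 - w.1) + cd1 F u * (w'.2 - w.2)) <= M) ->
  normc (F w' - F w) <= M.
Proof.
move=> cV H hw hw' HM.
pose p t : C^o * C^o := (w.1 + toC t * (w'.1 - w.1), w.2 + toC t * (w'.2 - w.2)).
have -> : F w' - F w = F (p 1) - F (p 0).
  by rewrite /p toC1 toC0 !mul1r !mul0r !addr0 ![_ + (_ - _)]addrC !subrK -!surjective_pairing.
apply: (@mvt_le _ (fun t => F (p t)) (fun t => cd0 F (p t) * (w'.1 - w.1) + cd1 F (p t) * (w'.2 - w.2))).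
- move=> s s01; apply: (@hasD2_real_deriv _ F w (w'.1 - w.1, w'.2 - w.2)); apply: H; exact: cV.
- by move=> s s01; apply: HM; exact: cV.
Qed.

Lemma cd0_bound F z r s M : 0 < s -> holo2 F (polydisc z (r + s)) -> (forall w, polydisc z (r + s) w -> normc (F w) <= M) ->
  forall w, polydisc z r w -> normc (cd0 F w) <= M / s.
Proof.
move=> s0 H HM w hw.
have in_ u : normc (u - 0) <= s -> polydisc z (r + s) (w.1 + u, w.2).
  move=> us; have := @polydisc_add z r s w (u, 0) hw; rewrite subr0 in us; rewrite /= normc0 addr0; apply => //; exact: ltW.
apply: (@cauchy_est (fun t => F (w.1 + t, w.2)) 0) => //.
- by move=> u us; exists (cd0 F (w.1 + u, w.2)); apply: (hasD2_slice0 (B := cd1 F (w.1 + u, w.2))); apply: H; exact: in_.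
- apply: (hasD2_slice0 (B := cd1 F w)); rewrite addr0 -surjective_pairing; apply: H.
  apply: polydisc_S hw; rewrite lerDl; exact: ltW.
- by move=> u us; apply: HM; exact: in_.
Qed.

(** Cauchy's estimate is applied to the difference of two translates of [F] in the first variable:
    the Lipschitz bound of [F] bounds that difference, and its derivative is the difference of the
    partial derivatives. *)
Lemma cd0_lip F z r s L : 0 < s -> holo2 F (polydisc z (r + s)) ->
  (forall w w', polydisc z (r + s) w -> polydisc z (r + s) w' -> normc (F w' - F w) <= L * (normc (w'.1 - w.1) + normc (w'.2 - w.2))) ->
  forall w w', polydisc z r w -> polydisc z r w' -> normc (cd0 F w' - cd0 F w) <= L / s * (normc (w'.1 - w.1) + normc (w'.2 - w.2)).
Proof.
move=> s0 H HL w w' hw hw'.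
have in_ v u : polydisc z r v -> normc (u - 0) <= s -> polydisc z (r + s) (v.1 + u, v.2).
  move=> hv us; have := @polydisc_add z r s v (u, 0) hv; rewrite subr0 in us; rewrite /= normc0 addr0; apply => //; exact: ltW.
have in0 v : polydisc z r v -> polydisc z (r + s) v by apply: polydisc_S; rewrite lerDl ltW.
rewrite mulrAC.
apply: (@cauchy_est (fun t => F (w'.1 + t, w'.2) - F (w.1 + t, w.2)) 0) => //.
- move=> u us; exists (cd0 F (w'.1 + u, w'.2) - cd0 F (w.1 + u, w.2)); apply: hasDB.
    by apply: (hasD2_slice0 (B := cd1 F (w'.1 + u, w'.2))); apply: H; exact: in_.
  by apply: (hasD2_slice0 (B := cd1 F (w.1 + u, w.2))); apply: H; exact: in_.
- apply: hasDB.
    by apply: (hasD2_slice0 (B := cd1 F w')); rewrite addr0 -surjective_pairing; apply: H; exact: in0.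
  by apply: (hasD2_slice0 (B := cd1 F w)); rewrite addr0 -surjective_pairing; apply: H; exact: in0.
- move=> u us; apply: le_trans (HL (w.1 + u, w.2) (w'.1 + u, w'.2) _ _) _; [exact: in_|exact: in_|].
  by rewrite /= opprD addrACA subrr addr0.
Qed.

Definition swap2 F : C^o * C^o -> C^o := fun w => F (w.2, w.1).
Lemma hasD2_swap F w A B : hasD2 F (w.2, w.1) A B -> hasD2 (swap2 F) w B A.
Proof.
move=> H e e0; have [d d0 Hd] := H e e0; exists d => // h k hd kd.
have := Hd k h kd hd; rewrite /swap2 /= [normc k + _]addrC => HH.
by rewrite addrAC.
Qed.
Lemma cd_swap F w : hasD2 F (w.2, w.1) (cd0 F (w.2, w.1)) (cd1 F (w.2, w.1)) ->
  cd0 (swap2 F) w = cd1 F (w.2, w.1) /\ cd1 (swap2 F) w = cd0 F (w.2, w.1).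
Proof. by move=> /hasD2_swap H; split; [exact: hasD2_cd0 H|exact: hasD2_cd1 H]. Qed.
Lemma holo2_swap F U V : (forall w, V w -> U (w.2, w.1)) -> holo2 F U -> holo2 (swap2 F) V.
Proof.
move=> UV H w /UV /H h; have [-> ->] := cd_swap h; exact: hasD2_swap.
Qed.

Lemma polydisc_swap z r w : polydisc z r w -> polydisc (z.2, z.1) r (w.2, w.1).
Proof. by case. Qed.

Lemma cd1_bound F z r s M : 0 < s -> holo2 F (polydisc z (r + s)) -> (forall w, polydisc z (r + s) w -> normc (F w) <= M) ->
  forall w, polydisc z r w -> normc (cd1 F w) <= M / s.
Proof.
move=> s0 H HM w hw.
have Hs : holo2 (swap2 F) (polydisc (z.2, z.1) (r + s)) by apply: (holo2_swap _ H) => u /polydisc_swap; rewrite -surjective_pairing.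
have := cd0_bound s0 Hs _ (polydisc_swap hw) (M := M).
have [|-> _] := @cd_swap F (w.2, w.1); first by apply: H; apply: polydisc_S (hw); rewrite lerDl ltW.
by rewrite -surjective_pairing; apply=> u /polydisc_swap; rewrite -surjective_pairing; exact: HM.
Qed.

Lemma cd1_lip F z r s L : 0 < s -> holo2 F (polydisc z (r + s)) ->
  (forall w w', polydisc z (r + s) w -> polydisc z (r + s) w' -> normc (F w' - F w) <= L * (normc (w'.1 - w.1) + normc (w'.2 - w.2))) ->
  forall w w', polydisc z r w -> polydisc z r w' -> normc (cd1 F w' - cd1 F w) <= L / s * (normc (w'.1 - w.1) + normc (w'.2 - w.2)).
Proof.
move=> s0 H HL w w' hw hw'.
have Hs : holo2 (swap2 F) (polydisc (z.2, z.1) (r + s)) by apply: (holo2_swap _ H) => u /polydisc_swap; rewrite -surjective_pairing.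
have := cd0_lip s0 Hs _ (polydisc_swap hw) (polydisc_swap hw') (L := L).
have [|-> _] := @cd_swap F (w.2, w.1); first by apply: H; apply: polydisc_S (hw); rewrite lerDl ltW.
have [|-> _] := @cd_swap F (w'.2, w'.1); first by apply: H; apply: polydisc_S (hw'); rewrite lerDl ltW.
rewrite -!surjective_pairing /= [normc (w'.2 - _) + _]addrC; apply=> u u' /polydisc_swap hu /polydisc_swap hu'.
rewrite -surjective_pairing in hu; rewrite -surjective_pairing in hu'.
by rewrite [_ + normc (u'.2 - u.2)]addrC; exact: HL.
Qed.

(** Along the segment, subtract the linear part from [F]. The derivative of what remains is a
    difference of gradients, of size [K] times the distance, and the mean value inequality
    applies. *)
Lemma quad F V K (w : C * C) (h k : C) : cconvex V -> holo2 F V -> V w -> V (w.1 + h, w.2 + k) -> 0 <= K ->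
  (forall w w', V w -> V w' -> normc (cd0 F w' - cd0 F w) <= K * (normc (w'.1 - w.1) + normc (w'.2 - w.2))) ->
  (forall w w', V w -> V w' -> normc (cd1 F w' - cd1 F w) <= K * (normc (w'.1 - w.1) + normc (w'.2 - w.2))) ->
  normc (F (w.1 + h, w.2 + k) - F w - cd0 F w * h - cd1 F w * k) <= K * (normc h + normc k) ^+ 2.
Proof.
move=> cV H hw hw' K0 K1 K2; set D := cd0 F w * h + cd1 F w * k.
pose p t : C^o * C^o := (w.1 + toC t * h, w.2 + toC t * k).
have pin s : 0 <= s <= 1 -> V (p s).
  by move=> s01; have := cV _ _ _ s01 hw hw'; rewrite /= [w.1 + h]addrC addrK [w.2 + k]addrC addrK.
pose f t := F (p t) + D * - toC t.
have -> : F (w.1 + h, w.2 + k) - F w - cd0 F w * h - cd1 F w * k = f 1 - f 0.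
  rewrite /f /p toC1 toC0 !mul1r !mul0r !addr0 -surjective_pairing /D oppr0 mulr0 addr0; ring.
pose S := normc h + normc k.
have S0 : 0 <= S by rewrite addr_ge0 ?normc_ge0.
apply: (@mvt_le _ f (fun t => (cd0 F (p t) * h + cd1 F (p t) * k) + D * -1)).
- move=> s s01; apply: rDD.
    by apply: (@hasD2_real_deriv _ F w (h, k)); apply: H; exact: pin.
  apply: rDZ => e e0; exists 1 => // t _.
  by rewrite toCD (_ : _ - _ = 0) ?normc0 ?mulr_ge0 ?(ltW e0)//; ring.
- move=> s s01; have hp := pin s s01.
  have d1 : normc ((p s).1 - w.1) + normc ((p s).2 - w.2) <= S.
    rewrite /p /= [w.1 + _]addrC addrK [w.2 + _]addrC addrK !normcM normc_toC; move: s01 => /andP[s0 s1].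
    by rewrite ger0_norm// -mulrDr ler_piMl.
  have -> : cd0 F (p s) * h + cd1 F (p s) * k + D * -1 = (cd0 F (p s) - cd0 F w) * h + (cd1 F (p s) - cd1 F w) * k.
    have aux (a b a' b' : C) : a * h + b * k + (a' * h + b' * k) * -1 = (a - a') * h + (b - b') * k by ring.
    exact: aux.
  apply: le_trans (ler_normcD _ _) _; rewrite !normcM -/S expr2 mulrA {2}/S mulrDr; apply: lerD; apply: ler_wpM2r; rewrite ?normc_ge0//.
    by apply: le_trans (K1 _ _ hw hp) _; rewrite ler_wpM2l.
  by apply: le_trans (K2 _ _ hw hp) _; rewrite ler_wpM2l.
Qed.

(** Differentiability at [z] alone bounds [F] on a polydisc of radius 4 r. One Cauchy estimate
    bounds the partial derivatives on radius 3 r, so [F] is Lipschitz there; a second one makes the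
    partial derivatives Lipschitz on radius 2 r. *)
Lemma holo2_local F (U : set (C * C)) z : (forall w, U w -> exists2 r, 0 < r & polydisc w r `<=` U) -> holo2 F U -> U z ->
  exists r K, [/\ 0 < r, 0 <= K, polydisc z (2 * r) `<=` U,
   (forall w w', polydisc z (2 * r) w -> polydisc z (2 * r) w' -> normc (cd0 F w' - cd0 F w) <= K * (normc (w'.1 - w.1) + normc (w'.2 - w.2))) &
   (forall w w', polydisc z (2 * r) w -> polydisc z (2 * r) w' -> normc (cd1 F w' - cd1 F w) <= K * (normc (w'.1 - w.1) + normc (w'.2 - w.2)))].
Proof.
move=> oU H Uz; have [r1 r10 Hr1] := oU z Uz.
have [d d0 Hd] := H z Uz 1 ltr01.
pose r := Num.min r1 (d / 2) / 4.
have r0 : 0 < r by rewrite divr_gt0// lt_min r10 divr_gt0.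
have r4 : 2 * r + r + r <= Num.min r1 (d / 2) by rewrite /r; lra.
have [r41 r42] : 2 * r + r + r <= r1 /\ 2 * r + r + r <= d / 2 by move: r4; rewrite le_min => /andP.
have sub4 : polydisc z (2 * r + r + r) `<=` U by apply: subset_trans Hr1; apply: polydisc_S.
pose M := normc (F z) + normc (cd0 F z) * d + normc (cd1 F z) * d + (d + d).
have M0 : 0 <= M by rewrite !addr_ge0// ?mulr_ge0 ?normc_ge0 ?ltW.
have HM w : polydisc z (2 * r + r + r) w -> normc (F w) <= M.
  move=> [a b]; have a' : normc (w.1 - z.1) < d by lra.
  have b' : normc (w.2 - z.2) < d by lra.
  have := Hd _ _ a' b'; rewrite [z.1 + _]addrC [z.2 + _]addrC !subrK -surjective_pairing mul1r.
  set h := w.1 - z.1 in a a' *; set k := w.2 - z.2 in b b' * => HH.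
  have -> : F w = (F w - F z - cd0 F z * h - cd1 F z * k) + (F z + cd0 F z * h + cd1 F z * k).
    have aux (x y u v : C) : x = (x - y - u - v) + (y + u + v) by ring.
    exact: aux.
  have n1 := ler_normcD (F w - F z - cd0 F z * h - cd1 F z * k) (F z + cd0 F z * h + cd1 F z * k).
  have n2 := ler_normcD (F z + cd0 F z * h) (cd1 F z * k).
  have n3 := ler_normcD (F z) (cd0 F z * h).
  have n4 : normc (cd0 F z * h) <= normc (cd0 F z) * d by rewrite normcM ler_wpM2l ?normc_ge0 ?ltW.
  have n5 : normc (cd1 F z * k) <= normc (cd1 F z) * d by rewrite normcM ler_wpM2l ?normc_ge0 ?ltW.
  apply: le_trans n1 _; apply: le_trans (lerD HH (le_trans n2 (lerD (le_trans n3 (lerD (lexx _) n4)) n5))) _.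
  by rewrite /M addrC lerD2l lerD ?ltW.
have H3 := holS sub4 H.
have B0 := cd0_bound r0 H3 HM; have B1 := cd1_bound r0 H3 HM.
have sub3 : polydisc z (2 * r + r) `<=` U by apply: subset_trans sub4; apply: polydisc_S; lra.
have HL w w' : polydisc z (2 * r + r) w -> polydisc z (2 * r + r) w' ->
   normc (F w' - F w) <= M / r * (normc (w'.1 - w.1) + normc (w'.2 - w.2)).
  move=> hw hw'; apply: (mvt2 (@cconvex_polydisc _ _) (holS sub3 H) hw hw') => u hu.
  apply: le_trans (ler_normcD _ _) _; rewrite !normcM mulrDr.
  by apply: lerD; (apply: ler_wpM2r; first exact: normc_ge0); [exact: B0|exact: B1].
exists r, (M / r / r); split => //.
- by apply: divr_ge0; [apply: divr_ge0 => //; exact: ltW|exact: ltW].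
- by apply: subset_trans sub3; apply: polydisc_S; lra.
- exact: (cd0_lip r0 (holS sub3 H) HL).
- exact: (cd1_lip r0 (holS sub3 H) HL).
Qed.

Lemma cintg_comb4 (f1 f2 f3 f4 : TR -> C) (h k : C) : cintegrable mu_per setT f1 -> cintegrable mu_per setT f2 ->
  cintegrable mu_per setT f3 -> cintegrable mu_per setT f4 ->
  cintegrable mu_per setT (fun x => f1 x - f2 x - h * f3 x - k * f4 x) /\
  cintg mu_per setT (fun x => f1 x - f2 x - h * f3 x - k * f4 x) =
  cintg mu_per setT f1 - cintg mu_per setT f2 - h * cintg mu_per setT f3 - k * cintg mu_per setT f4.
Proof.
move=> i1 i2 i3 i4.
have j0 := cintegrableZ measurableT h i3; have j1 := cintegrableZ measurableT k i4.
have j2 := cintegrableB measurableT i1 i2; have j3 := cintegrableB measurableT j2 j0.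
have q := cintegrableB measurableT j3 j1; split; first by exact q.
by rewrite (cIB measurableT j3 j1) (cIB measurableT j2 j0) (cIB measurableT i1 i2) (cIZ measurableT _ i3) (cIZ measurableT _ i4).
Qed.

(** Cauchy's formula in the first variable writes [cd0 F] near [z] as an integral of [F] over a
    circle of fixed radius. Differentiating under the integral gives the candidates [A] and [B]; the
    bound of [quad] is uniform on the circle and controls the remainder. *)
Lemma holo2_cd0 F (U : set (C * C)) : (forall w, U w -> exists2 r, 0 < r & polydisc w r `<=` U) -> holo2 F U -> holo2 (cd0 F) U.
Proof.
move=> oU H z Uz; have [r [K [r0 K0 sub K1 K2]]] := holo2_local oU H Uz.
have p0 := pi2_gt0 R.
pose A := toC (2 * pi * r)^-1 * circle_coef (fun t => cd0 F (t, z.2)) z.1 r 1.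
pose B := toC (2 * pi * r)^-1 * circle_coef (fun t => cd1 F (t, z.2)) z.1 r 1.
suff HD : hasD2 (cd0 F) z A B by exact: hasD2_self HD.
have H2 := holS sub H.
have circ x : normc (toC r * cexpi x) = r by rewrite normcM normc_cexpi mulr1 normc_toC gtr0_norm.
have pin (h k : C) x : normc h <= r -> normc k <= r -> polydisc z (2 * r) (z.1 + h + toC r * cexpi x, z.2 + k).
  move=> hr kr; split => /=.
    have -> : z.1 + h + toC r * cexpi x - z.1 = h + toC r * cexpi x by ring.
    by apply: le_trans (ler_normcD _ _) _; rewrite circ; lra.
  by rewrite addrC addKr; lra.
have cd_cont (G : C^o * C^o -> C) x : (forall w w', polydisc z (2 * r) w -> polydisc z (2 * r) w' -> normc (G w' - G w) <= K * (normc (w'.1 - w.1) + normc (w'.2 - w.2))) ->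
    econt (fun x => G (z.1 + toC r * cexpi x, z.2)) x.
  move=> HG e e0.
  have [d d0 Hd] := ccontZ (toC r) (econt_cexpi 1 x) (divr_gt0 e0 (ltr_wpDl K0 ltr01)).
  exists d => // y yx; have := Hd y yx; rewrite !mul1r ler_pdivlMr ?ltr_wpDl// => k.
  have nn := normc0 R.
  have P1 t : polydisc z (2 * r) (z.1 + toC r * cexpi t, z.2).
    by have := @pin 0 0 t; rewrite !addr0 nn; apply; exact: ltW.
  apply: le_trans (HG _ _ (P1 x) (P1 y)) _; rewrite /= subrr nn addr0.
  have -> : z.1 + toC r * cexpi y - (z.1 + toC r * cexpi x) = toC r * cexpi y - toC r * cexpi x by ring.
  apply: le_trans k; rewrite mulrC; apply: ler_wpM2l; rewrite ?normc_ge0//; lra.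
have c0 x := cd_cont _ x K1; have c1 x := cd_cont _ x K2.
have mul_e (g : R -> C) : (forall x, econt g x) -> cintegrable mu_per setT (fun x : TR => g x * cexpi (- 1%:~R * x)).
  by move=> cg; apply: econt_cintegrable => x; apply: ccontM => //; exact: econt_cexpi.
have i0 := mul_e _ c0; have i1 := mul_e _ c1.
have cF (h k : C) x : normc h <= r -> normc k <= r -> econt (fun x => F (z.1 + h + toC r * cexpi x, z.2 + k)) x.
  move=> hr kr; apply: (@econt_circle _ (fun t => F (t, z.2 + k)) (z.1 + h) r); first exact: ltW.
  move=> w wr; exists (cd0 F (w, z.2 + k)).
  have Hw : hasD2 F (w, z.2 + k) (cd0 F (w, z.2 + k)) (cd1 F (w, z.2 + k)).
    apply: H2; split => /=; last by rewrite addrC addKr; lra.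
    have -> : w - z.1 = w - (z.1 + h) + h by ring.
    by apply: le_trans (ler_normcD _ _) _; lra.
  have := @hasD2_slice0 F (0, z.2 + k) (cd0 F (w, z.2 + k)) (cd1 F (w, z.2 + k)) w; rewrite /= add0r => /(_ Hw).
  by rewrite (_ : (fun t => _) = (fun t => F (t, z.2 + k)))//; apply/funext => t; rewrite add0r.
have formula (h k : C) : normc h < r -> normc k < r ->
   cd0 F (z.1 + h, z.2 + k) = toC (2 * pi * r)^-1 * cintg mu_per setT (fun x : TR => F (z.1 + h + toC r * cexpi x, z.2 + k) * cexpi (- 1%:~R * x)).
  move=> hr kr.
  have Hw w : normc (w - (z.1 + h)) <= r -> hasD (fun t => F (t, z.2 + k)) w (cd0 F (w, z.2 + k)).
    move=> wr; have Hw : hasD2 F (w, z.2 + k) (cd0 F (w, z.2 + k)) (cd1 F (w, z.2 + k)).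
      apply: H2; split => /=; last by rewrite addrC addKr; lra.
      have -> : w - z.1 = w - (z.1 + h) + h by ring.
      by apply: le_trans (ler_normcD _ _) _; lra.
    have := @hasD2_slice0 F (0, z.2 + k) (cd0 F (w, z.2 + k)) (cd1 F (w, z.2 + k)) w; rewrite /= add0r => /(_ Hw).
    by rewrite (_ : (fun t => _) = (fun t => F (t, z.2 + k)))//; apply/funext => t; rewrite add0r.
  have := @cauchy1 R (fun t => F (t, z.2 + k)) (z.1 + h) r (cd0 F (z.1 + h, z.2 + k)) r0.
  rewrite /circle_coef => ->.
  - by rewrite mulrA -toCM mulVf ?toC1 ?mul1r// gt_eqF// mulr_gt0.
  - by move=> w wr; exists (cd0 F (w, z.2 + k)); exact: Hw.
  - by apply: Hw; rewrite subrr (normc0 R) ltW.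
have nn := normc0 R.
move=> e e0.
have K10 : 0 < K + 1 by lra.
(* The integrand's remainder is at most K S^2 with S = |h| + |k|, and this choice makes it at most e
   r S; the factor r compensates the normalization (2 pi r)^(-1). *)
pose dl := Num.min r (e * r / (K + 1) / 2).
have dl0 : 0 < dl by rewrite lt_min r0 !divr_gt0// mulr_gt0.
exists dl => // h k hd kd.
have [hr hd2] : normc h < r /\ normc h < e * r / (K + 1) / 2 by move: hd; rewrite lt_min => /andP.
have [kr kd2] : normc k < r /\ normc k < e * r / (K + 1) / 2 by move: kd; rewrite lt_min => /andP.
have f0 := @formula 0 0; rewrite !addr0 nn -surjective_pairing in f0.
rewrite formula// f0// /A /B.
have cF0 x : econt (fun x => F (z.1 + toC r * cexpi x, z.2)) x.
  by have := @cF 0 0 x; rewrite !addr0 nn; apply; exact: ltW.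
have iF := mul_e _ (fun x => cF h k x (ltW hr) (ltW kr)); have iF0 := mul_e _ cF0.
have E : toC (2 * pi * r)^-1 * cintg mu_per setT (fun x : TR => F (z.1 + h + toC r * cexpi x, z.2 + k) * cexpi (- 1%:~R * x)) -
  toC (2 * pi * r)^-1 * cintg mu_per setT (fun x : TR => F (z.1 + toC r * cexpi x, z.2) * cexpi (- 1%:~R * x)) -
  toC (2 * pi * r)^-1 * circle_coef (fun t => cd0 F (t, z.2)) z.1 r 1 * h - toC (2 * pi * r)^-1 * circle_coef (fun t => cd1 F (t, z.2)) z.1 r 1 * k =
  toC (2 * pi * r)^-1 * cintg mu_per setT (fun x : TR => F (z.1 + h + toC r * cexpi x, z.2 + k) * cexpi (- 1%:~R * x) -
    F (z.1 + toC r * cexpi x, z.2) * cexpi (- 1%:~R * x) - h * (cd0 F (z.1 + toC r * cexpi x, z.2) * cexpi (- 1%:~R * x)) -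
    k * (cd1 F (z.1 + toC r * cexpi x, z.2) * cexpi (- 1%:~R * x))).
  rewrite (cintg_comb4 h k iF iF0 i0 i1).2 /circle_coef.
  have aux (c a1 a2 a3 a4 : C) : c * a1 - c * a2 - c * a3 * h - c * a4 * k = c * (a1 - a2 - h * a3 - k * a4) by ring.
  exact: aux.
rewrite E normcM normc_toC gtr0_norm ?invr_gt0 ?mulr_gt0 ?pi_gt0//.
rewrite ler_pdivrMl ?mulr_gt0 ?pi_gt0//.
set S := normc h + normc k.
have S0 : 0 <= S by rewrite addr_ge0 ?normc_ge0.
have S1 : (K + 1) * S <= e * r by rewrite mulrC -ler_pdivlMr//; rewrite /S; lra.
have -> : 2 * pi * r * (e * S) = Rintegral mu_per setT (fun _ : TR => e * r * S).
  by rewrite Rintegral_cst// -[fine _]/(fine (mu_per setT)) m1T /=; ring.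
apply: normc_cintg_le => //.
- exact: cintegrable_cmeasurable (cintg_comb4 h k iF iF0 i0 i1).1.
- by apply: finite_measure_integrable_cst.
move=> x _.
set a := F _; set b := F _; set c := cd0 F _; set d := cd1 F _; set u := cexpi _.
have -> : a * u - b * u - h * (c * u) - k * (d * u) = (a - b - c * h - d * k) * u.
  have aux : forall a b c d h k u : C, a * u - b * u - h * (c * u) - k * (d * u) = (a - b - c * h - d * k) * u by move=> *; ring.
  exact: aux.
rewrite normcM normc_cexpi mulr1 /a /b /c /d.
rewrite -[z.1 + h + _]addrA [h + _]addrC addrA.
have w0 : polydisc z (2 * r) (z.1 + toC r * cexpi x, z.2).
  by have := @pin 0 0 x; rewrite !addr0 nn; apply; exact: ltW.
have w1 : polydisc z (2 * r) (z.1 + toC r * cexpi x + h, z.2 + k).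
  by have := @pin h k x (ltW hr) (ltW kr); rewrite -[z.1 + h + _]addrA [h + _]addrC addrA.
apply: le_trans (@quad F (polydisc z (2 * r)) K (z.1 + toC r * cexpi x, z.2) h k (@cconvex_polydisc _ _) H2 w0 w1 K0 K1 K2) _.
rewrite -/S expr2 mulrA; apply: ler_wpM2r => //; apply: le_trans S1.
by apply: ler_wpM2r => //; lra.
Qed.

(** Exchanging the variables reduces this to [holo2_cd0]. The partial derivatives correspond only
    where [F] is differentiable, so the result is transferred within a polydisc inside [U]. *)
Lemma holo2_cd1 F (U : set (C * C)) : (forall w, U w -> exists2 r, 0 < r & polydisc w r `<=` U) -> holo2 F U -> holo2 (cd1 F) U.
Proof.
move=> oU H z Uz.
pose V : set (C * C) := [set w | U (w.2, w.1)].
have oV w : V w -> exists2 r, 0 < r & polydisc w r `<=` V.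
  by move=> Vw; have [r r0 Hr] := oU _ Vw; exists r => // u /polydisc_swap hu; exact: Hr.
have HV : holo2 (swap2 F) V by apply: (holo2_swap _ H).
have HV0 := holo2_cd0 oV HV.
have Vz : V (z.2, z.1) by rewrite /V /= -surjective_pairing.
have [r r0 Hr] := oU _ Uz.
have h1 : hasD2 (swap2 (cd0 (swap2 F))) z (cd1 (cd0 (swap2 F)) (z.2, z.1)) (cd0 (cd0 (swap2 F)) (z.2, z.1)).
  by apply: hasD2_swap; exact: HV0.
have h2 : hasD2 (cd1 F) z (cd1 (cd0 (swap2 F)) (z.2, z.1)) (cd0 (cd0 (swap2 F)) (z.2, z.1)).
  move=> e e0; have [d d0 Hd] := h1 e e0; exists (Num.min d r); first by rewrite lt_min d0.
  move=> h k; rewrite !lt_min => /andP[a a'] /andP[b b'].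
  have eqs w : U w -> swap2 (cd0 (swap2 F)) w = cd1 F w.
    by case: w => w1 w2 Uw; exact: (cd_swap (w := (w2, w1)) (H _ Uw)).1.
  have := Hd h k a b; rewrite !eqs//; apply: Hr; split; rewrite /= addrC addKr ltW//.
exact: hasD2_self h2.
Qed.
End regularity.

(** * Periodicity and boundedness on the strip *)

Section strip.
Variable R : realType.
Local Notation C := (R[i]).
Implicit Types (F H : C^o * C^o -> C^o).

Lemma hasD2_sl0 F (w : C * C) A B : hasD2 F w A B -> hasD (fun t => F (t, w.2)) w.1 A.
Proof.
move=> H e e0; have [d d0 Hd] := H e e0; exists d => // k kd.
have := Hd k 0 kd; rewrite normc0 => /(_ d0); rewrite /= mulr0 subr0 !addr0 -surjective_pairing; exact.
Qed.
Lemma hasD2_sl1 F (w : C * C) A B : hasD2 F w A B -> hasD (fun t => F (w.1, t)) w.2 B.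
Proof.
move=> H e e0; have [d d0 Hd] := H e e0; exists d => // k kd.
have := Hd 0 k; rewrite normc0 => /(_ d0 kd); rewrite /= mulr0 subr0 !addr0 add0r -surjective_pairing; exact.
Qed.

Lemma hasD_line F (p v : C * C) (s : C) A B :
  hasD2 F (p.1 + s * v.1, p.2 + s * v.2) A B ->
  hasD (fun t => F (p.1 + t * v.1, p.2 + t * v.2)) s (A * v.1 + B * v.2).
Proof.
move=> H e e0; set M := normc v.1 + normc v.2 + 1.
have M0 : 0 < M by rewrite ltr_wpDl ?addr_ge0 ?normc_ge0.
have [d d0 Hd] := H _ (divr_gt0 e0 M0).
exists (d / M); first by rewrite divr_gt0.
move=> h hd; have td' : normc h * M < d by rewrite -ltr_pdivlMr.
have h1 : normc (h * v.1) < d.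
  by rewrite normcM; apply: le_lt_trans td'; rewrite ler_wpM2l ?normc_ge0// /M -addrA lerDl addr_ge0 ?normc_ge0.
have h2 : normc (h * v.2) < d.
  by rewrite normcM; apply: le_lt_trans td'; rewrite ler_wpM2l ?normc_ge0// /M addrAC lerDr addr_ge0 ?normc_ge0.
have := Hd _ _ h1 h2; rewrite /= -!addrA -!mulrDl => HH.
have -> : (A * v.1 + B * v.2) * h = A * (h * v.1) + B * (h * v.2) by ring.
rewrite opprD; apply: le_trans HH _.
rewrite !normcM -mulrDr mulrCA [leRHS]mulrC; apply: ler_wpM2l; first exact: normc_ge0.
by rewrite mulrAC ler_pdivrMr// ler_pM2l// /M lerDl.
Qed.

Variable r0 : R.

Lemma in_strip2 (z : C * C) : strip2 r0 z <-> (`|complex.Im z.1| < r0 /\ `|complex.Im z.2| < r0).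
Proof. by split. Qed.

Lemma cconvex_strip : cconvex (strip2 r0 : set (C * C)).
Proof.
have key (u v s : R) : 0 <= s <= 1 -> `|u| < r0 -> `|v| < r0 -> `|u + s * (v - u)| < r0.
  move=> /andP[s0 s1] a b; have -> : u + s * (v - u) = (1 - s) * u + s * v by ring.
  apply: le_lt_trans (ler_normD _ _) _; rewrite !normrM (ger0_norm s0) ger0_norm ?subr_ge0//.
  have mu_per : `|u| <= Num.max `|u| `|v| by rewrite le_max lexx.
  have m2 : `|v| <= Num.max `|u| `|v| by rewrite le_max lexx orbT.
  have m3 : Num.max `|u| `|v| < r0 by rewrite gt_max a b.
  apply: le_lt_trans m3; have s1' : 0 <= 1 - s by rewrite subr_ge0.
  have := ler_wpM2l s0 m2; have := ler_wpM2l s1' mu_per; lra.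
move=> w w' s s01 /in_strip2[a b] /in_strip2[a' b']; apply/in_strip2.
by split; rewrite /= ImD ImM /toC /= mul0r addr0 ImD ImN; apply: key.
Qed.

Lemma open_strip (w : C * C) : strip2 r0 w -> exists2 r, 0 < r & polydisc w r `<=` (strip2 r0 : set (C * C)).
Proof.
move=> /in_strip2[a b]; exists (Num.min (r0 - `|complex.Im w.1|) (r0 - `|complex.Im w.2|) / 2).
  by rewrite divr_gt0// lt_min !subr_gt0 a b.
have mu_per : Num.min (r0 - `|complex.Im w.1|) (r0 - `|complex.Im w.2|) <= r0 - `|complex.Im w.1| by rewrite ge_min lexx.
have m2 : Num.min (r0 - `|complex.Im w.1|) (r0 - `|complex.Im w.2|) <= r0 - `|complex.Im w.2| by rewrite ge_min lexx orbT.
have m3 : 0 < Num.min (r0 - `|complex.Im w.1|) (r0 - `|complex.Im w.2|) by rewrite lt_min !subr_gt0 a b.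
move=> z [h1 h2]; apply/in_strip2; split.
- have := le_trans (Im_le_normc _) h1; rewrite ImD ImN => k.
  have -> : complex.Im z.1 = complex.Im w.1 + (complex.Im z.1 - complex.Im w.1) by ring.
  apply: le_lt_trans (ler_normD _ _) _; lra.
- have := le_trans (Im_le_normc _) h2; rewrite ImD ImN => k.
  have -> : complex.Im z.2 = complex.Im w.2 + (complex.Im z.2 - complex.Im w.2) by ring.
  apply: le_lt_trans (ler_normD _ _) _; lra.
Qed.

Definition strip_per H := forall z : C * C, strip2 r0 z -> H (z.1 + toC (2 * pi), z.2) = H z /\ H (z.1, z.2 + toC (2 * pi)) = H z.

(** The identity theorem is used twice: in the first variable with the second one real, then in the
    second variable with the first one fixed in the strip. *)
Lemma per_first F (gam : R * R -> R) : 0 < r0 -> holo2 F (strip2 r0) -> (forall x, F (toC x.1, toC x.2) = toC (gam x)) ->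
  (forall t, gam (t.1 + 2 * pi, t.2) = gam t) ->
  forall z : C * C, strip2 r0 z -> F (z.1 + toC (2 * pi), z.2) = F z.
Proof.
move=> r00 HF Fg gp.
have shD u v : `|complex.Im u| < r0 -> `|complex.Im v| < r0 ->
   hasD (fun t => F (t + toC (2 * pi), v) - F (t, v)) u (cd0 F (u + toC (2 * pi), v) - cd0 F (u, v)).
  move=> hu hv; apply: hasDB.
    have := @hasD_comp R (fun t => F (t, v)) (fun t => t + toC (2 * pi)) u (cd0 F (u + toC (2 * pi), v)) 1.
    rewrite mulr1; apply.
      by have := hasDD (@hasD_id R u) (hasD_cst (toC (2 * pi)) u); rewrite addr0.
    apply: (@hasD2_sl0 F (u + toC (2 * pi), v) _ (cd1 F (u + toC (2 * pi), v))); apply: HF.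
    by apply/in_strip2; rewrite /= ImD /toC /= addr0.
  by apply: (@hasD2_sl0 F (u, v) _ (cd1 F (u, v))); apply: HF; apply/in_strip2.
have st1 (y : R) u : `|complex.Im u| < r0 -> F (u + toC (2 * pi), toC y) - F (u, toC y) = 0.
  apply: (@identity_strip R (fun u => F (u + toC (2 * pi), toC y) - F (u, toC y)) r0).
    by move=> w hw; eexists; apply: shD => //=; rewrite normr0.
  by move=> x; rewrite -toCD (Fg (x + 2 * pi, y)) (Fg (x, y)) (gp (x, y)) subrr.
move=> z /in_strip2[h1 h2].
have := @identity_strip R (fun v => F (z.1 + toC (2 * pi), v) - F (z.1, v)) r0 _ _ z.2 h2.
rewrite -surjective_pairing => HH; apply/eqP; rewrite -subr_eq0; apply/eqP; apply: HH.
- move=> w hw; exists (cd1 F (z.1 + toC (2 * pi), w) - cd1 F (z.1, w)); apply: hasDB.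
    apply: (@hasD2_sl1 F (z.1 + toC (2 * pi), w) (cd0 F (z.1 + toC (2 * pi), w))); apply: HF.
    by apply/in_strip2; rewrite /= ImD /toC /= addr0.
  by apply: (@hasD2_sl1 F (z.1, w) (cd0 F (z.1, w))); apply: HF; apply/in_strip2.
- by move=> x; exact: st1.
Qed.

Lemma strip_swap (z : C * C) : strip2 r0 z -> (strip2 r0 : set (C * C)) (z.2, z.1).
Proof. by move=> /in_strip2[a b]; apply/in_strip2. Qed.

Lemma strip_per_ext F (gam : R * R -> R) : 0 < r0 -> holo2 F (strip2 r0) -> (forall x, F (toC x.1, toC x.2) = toC (gam x)) ->
  biper gam -> strip_per F.
Proof.
move=> r00 HF Fg gp z hz; split.
  by apply: (per_first r00 HF Fg) => // t; have [] := gp t.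
have HS : holo2 (swap2 F) (strip2 r0) by apply: (holo2_swap _ HF) => w; exact: strip_swap.
have := @per_first (swap2 F) (fun t => gam (t.2, t.1)) r00 HS _ _ (z.2, z.1) (strip_swap hz).
rewrite /swap2 /= -surjective_pairing; apply.
  by move=> x; rewrite (Fg (x.2, x.1)).
by move=> t; have [] := gp (t.2, t.1).
Qed.

Lemma hasD2_shift H (a z : C * C) A B : hasD2 H (z.1 + a.1, z.2 + a.2) A B -> hasD2 (fun w => H (w.1 + a.1, w.2 + a.2)) z A B.
Proof.
move=> HH e e0; have [d d0 Hd] := HH e e0; exists d => // h k hd kd.
by have := Hd h k hd kd; rewrite /= [z.1 + h + _]addrAC [z.2 + k + _]addrAC.
Qed.

Lemma hasD2_local F H (z : C * C) A B r : 0 < r -> (forall w, polydisc z r w -> F w = H w) -> hasD2 F z A B -> hasD2 H z A B.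
Proof.
move=> r00 FH HF e e0; have [d d0 Hd] := HF e e0; exists (Num.min d r); first by rewrite lt_min d0.
move=> h k; rewrite !lt_min => /andP[a a'] /andP[b b'].
have := Hd h k a b; rewrite !FH //; split; rewrite /= ?subrr ?(normc0 R) ?(ltW r00)// addrC addKr ltW//.
Qed.

Lemma cd_shift H (a z : C * C) : holo2 H (strip2 r0) -> strip2 r0 z -> complex.Im a.1 = 0 -> complex.Im a.2 = 0 ->
  (forall w : C * C, strip2 r0 w -> H (w.1 + a.1, w.2 + a.2) = H w) ->
  cd0 H (z.1 + a.1, z.2 + a.2) = cd0 H z /\ cd1 H (z.1 + a.1, z.2 + a.2) = cd1 H z.
Proof.
move=> HH hz a1 a2 per; have [r r1 Hr] := open_strip hz.
have hz' : (strip2 r0 : set (C * C)) (z.1 + a.1, z.2 + a.2).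
  by move/in_strip2: hz => [h1 h2]; apply/in_strip2; rewrite /= !ImD a1 a2 !addr0.
have h := hasD2_shift (HH _ hz').
have h' := @hasD2_local _ H z _ _ r r1 (fun w hw => per w (Hr w hw)) h.
by rewrite (hasD2_cd0 h') (hasD2_cd1 h').
Qed.

Lemma strip_per_cd H : holo2 H (strip2 r0) -> strip_per H -> strip_per (cd0 H) /\ strip_per (cd1 H).
Proof.
move=> HH per; have s1 := @cd_shift H (toC (2 * pi), 0); have s2 := @cd_shift H (0, toC (2 * pi)).
split=> z hz.
- have := s1 z HH hz erefl erefl; have := s2 z HH hz erefl erefl; rewrite /= !addr0 => k2 k1.
  split; [apply: (k1 _).1|apply: (k2 _).1] => w hw; rewrite addr0; by have [] := per w hw.
- have := s1 z HH hz erefl erefl; have := s2 z HH hz erefl erefl; rewrite /= !addr0 => k2 k1.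
  split; [apply: (k1 _).2|apply: (k2 _).2] => w hw; rewrite addr0; by have [] := per w hw.
Qed.

Lemma box_bounded (f : (R * R) * (R * R) -> R) (a b c d : R) :
  (forall p : (R * R) * (R * R), a <= p.1.1 <= b -> a <= p.1.2 <= b -> c <= p.2.1 <= d -> c <= p.2.2 <= d ->
    exists e M, 0 < e /\ forall p', `|p'.1.1 - p.1.1| < e -> `|p'.1.2 - p.1.2| < e -> `|p'.2.1 - p.2.1| < e -> `|p'.2.2 - p.2.2| < e ->
      f p' <= M) ->
  exists M, forall p, a <= p.1.1 <= b -> a <= p.1.2 <= b -> c <= p.2.1 <= d -> c <= p.2.2 <= d -> f p <= M.
Proof.
move=> Hloc.
pose K : set ((R * R) * (R * R)) := (`[a, b]%classic `*` `[a, b]%classic) `*` (`[c, d]%classic `*` `[c, d]%classic).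
have cK : compact K by do 2 apply: compact_setX; (try apply: compact_setX); exact: segment_compact.
move/compact_near_coveringP: cK => cK.
have [M [_ HM]] : \forall M \near +oo%R, K `<=` [set p | f p <= M].
  apply: (cK R (+oo)%R (fun M p => f p <= M)) => p [[p11 p12] [p21 p22]].
  have [e [M [e0 HM]]] := Hloc p ltac:(by move: p11; rewrite /= in_itv) ltac:(by move: p12; rewrite /= in_itv) ltac:(by move: p21; rewrite /= in_itv) ltac:(by move: p22; rewrite /= in_itv).
  exists (ball p e, [set M' | M < M']) => /=.
    by split; [exact: nbhsx_ballx|exists M; split => //; exact: num_real].
  move=> [p' M'] /= [[[b1 b2] [b3 b4]] MM']; apply: le_trans (ltW MM'); apply: HM; rewrite distrC //.
exists (M + 1) => p h1 h2 h3 h4; apply: (HM (M + 1)); first by rewrite ltrDl.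
by split; split; rewrite /= in_itv.
Qed.

Lemma closure_box (x y : R * R) : 0 < r0 -> `|y.1| <= r0 -> `|y.2| <= r0 ->
  closure (strip2 r0) ((Complex x.1 y.1 : C^o), (Complex x.2 y.2 : C^o)).
Proof.
move=> r00 y1 y2 B /nbhs_ballP [e /= e0 He].
have [eE e0'] := gt0C e0; set e' := complex.Re e in eE e0'.
(* Scaling the imaginary parts by 1 - t moves a boundary point into the open strip; [t] is small
   enough for the move to stay below [e']. *)
pose t := Num.min (1 / 2) (e' / (2 * (r0 + 1))).
have r1 : 0 < r0 + 1 by lra.
have t0 : 0 < t by rewrite lt_min !divr_gt0// mulr_gt0.
have t1 : t <= 1 / 2 by rewrite ge_min lexx.
have t2 : t * (r0 + 1) < e'.
  have : t <= e' / (2 * (r0 + 1)) by rewrite ge_min lexx orbT.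
  rewrite ler_pdivlMr ?mulr_gt0// => h; have : 0 < t * (r0 + 1) by rewrite mulr_gt0.
  lra.
exists ((Complex x.1 ((1 - t) * y.1) : C^o), (Complex x.2 ((1 - t) * y.2) : C^o)); split.
  have key (u : R) : `|u| <= r0 -> `|(1 - t) * u| < r0.
    by move=> hu; rewrite normrM ger0_norm; [nra|lra].
  by apply/in_strip2; split; apply: key.
apply: He; split; rewrite /ball /= normrC eE ltcC.
- rewrite (_ : _ - _ = 'i%C * toC (t * y.1)); last by apply: complexP; rewrite ?(ReD,ImD,ReN,ImN,ReM,ImM) /toC /=; ring.
  rewrite normcM normc_toC normrM (gtr0_norm t0) normcE /= expr0n expr1n add0r sqrtr1 mul1r; nra.
- rewrite (_ : _ - _ = 'i%C * toC (t * y.2)); last by apply: complexP; rewrite ?(ReD,ImD,ReN,ImN,ReM,ImM) /toC /=; ring.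
  rewrite normcM normc_toC normrM (gtr0_norm t0) normcE /= expr0n expr1n add0r sqrtr1 mul1r; nra.
Qed.

Lemma strip_per_int H (z : C * C) (k l : int) : strip_per H -> strip2 r0 z ->
  H (z.1 - toC (2 * pi * k%:~R), z.2 - toC (2 * pi * l%:~R)) = H z.
Proof.
move=> per hz.
have hx (x y : R) : strip2 r0 ((Complex x (complex.Im z.1) : C), (Complex y (complex.Im z.2) : C)).
  by move/in_strip2: hz => ?; apply/in_strip2.
have E (c : C) (x : R) : c - toC x = Complex (complex.Re c - x) (complex.Im c).
  by apply: complexP; rewrite ?(ReD,ImD,ReN,ImN) /toC /= ?subr0.
have E' (c : R) (d : R) : Complex c d + toC (2 * pi) = Complex (c + 2 * pi) d.
  by apply: complexP; rewrite ?(ReD,ImD,ReN,ImN) /toC /= ?addr0.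
rewrite !E.
rewrite (@periodic_int _ _ (fun x => H (Complex x _, _))); last first.
  by move=> x; have [] := per _ (hx x (complex.Re z.2 - 2 * pi * l%:~R)); rewrite /= E'.
rewrite (@periodic_int _ _ (fun y => H (_, Complex y _))); last first.
  by move=> y; have [] := per _ (hx (complex.Re z.1) y); rewrite /= !E'.
by congr H; rewrite [RHS]surjective_pairing; congr pair; apply: complexP.
Qed.

Lemma holo2_locbound H (U : set (C * C)) z : holo2 H U -> U z -> exists e M, 0 < e /\ forall w, normc (w.1 - z.1) < e -> normc (w.2 - z.2) < e -> normc (H w) <= M.
Proof.
move=> HH Uz; have [d d0 Hd] := HH z Uz 1 ltr01.
exists d, (normc (H z) + normc (cd0 H z) * d + normc (cd1 H z) * d + (d + d)); split=> // w a' b'.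
have := Hd _ _ a' b'; rewrite [z.1 + _]addrC [z.2 + _]addrC !subrK -surjective_pairing mul1r.
set h := w.1 - z.1 in a' *; set k := w.2 - z.2 in b' * => HH'.
have aux (x y u v : C) : x = (x - y - u - v) + (y + u + v) by ring.
rewrite (aux (H w) (H z) (cd0 H z * h) (cd1 H z * k)).
have n1 := ler_normcD (H w - H z - cd0 H z * h - cd1 H z * k) (H z + cd0 H z * h + cd1 H z * k).
have n2 := ler_normcD (H z + cd0 H z * h) (cd1 H z * k).
have n3 := ler_normcD (H z) (cd0 H z * h).
have n4 : normc (cd0 H z * h) <= normc (cd0 H z) * d by rewrite normcM ler_wpM2l ?normc_ge0 ?ltW.
have n5 : normc (cd1 H z * k) <= normc (cd1 H z) * d by rewrite normcM ler_wpM2l ?normc_ge0 ?ltW.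
apply: le_trans n1 _; apply: le_trans (lerD HH' (le_trans n2 (lerD (le_trans n3 (lerD (lexx _) n4)) n5))) _.
by rewrite addrC lerD2l lerD ?ltW.
Qed.

(** Periodicity confines the real parts to one period, and the closed box that remains is compact
    and lies in [U]; this is where extension to the closure of the strip is used. *)
Lemma strip_bounded H (U : set (C * C)) : 0 < r0 -> closure (strip2 r0) `<=` U -> holo2 H U -> strip_per H ->
  exists M, forall z : C * C, strip2 r0 z -> normc (H z) <= M.
Proof.
move=> r00 cU HH per.
pose f (p : (R * R) * (R * R)) : R := normc (H (Complex p.1.1 p.2.1, Complex p.1.2 p.2.2)).
have [|M HM] := @box_bounded f 0 (2 * pi) (- r0) r0.
  move=> p _ _ p3 p4.
  have Up : U (Complex p.1.1 p.2.1, Complex p.1.2 p.2.2).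
    by apply: cU; apply: (@closure_box p.1 p.2) => //; rewrite ler_norml.
  have [e [M [e0 He]]] := holo2_locbound HH Up.
  exists (e / 2), M; split; first by rewrite divr_gt0.
  have key (a b c d : R) : `|a - c| < e / 2 -> `|b - d| < e / 2 -> normc (Complex a b - Complex c d) < e.
    move=> h1 h2; apply: le_lt_trans (normc_leD _) _; rewrite ReD ImD ReN ImN /=; lra.
  by move=> p' h1 h2 h3 h4; apply: He; apply: key.
exists M => z hz; have [k /andP[k1 k2]] := red2pi (complex.Re z.1); have [l /andP[l1 l2]] := red2pi (complex.Re z.2).
rewrite -(strip_per_int k l per hz).
have E (c : C) (x : R) : c - toC x = Complex (complex.Re c - x) (complex.Im c).
  by apply: complexP; rewrite ?(ReD,ImD,ReN,ImN) /toC /= ?subr0.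
rewrite !E; move/in_strip2: hz => [h1 h2].
apply: (HM ((complex.Re z.1 - 2 * pi * k%:~R, complex.Re z.2 - 2 * pi * l%:~R), (complex.Im z.1, complex.Im z.2))) => /=.
- by rewrite k1 ltW.
- by rewrite l1 ltW.
- by rewrite -ler_norml ltW.
- by rewrite -ler_norml ltW.
Qed.
End strip.

(** * The suprema [M0j], [M1j] and mean value estimates *)

Section sups.
Variable R : realType.
Local Notation C := (R[i]).
Implicit Types (F H : C^o * C^o -> C^o).

Definition cnorm2 (x y : C) : R := Num.sqrt (normc x ^+ 2 + normc y ^+ 2).

Lemma cnorm2_ge0 x y : 0 <= cnorm2 x y. Proof. exact: sqrtr_ge0. Qed.
Lemma cnorm2_sqr x y : cnorm2 x y ^+ 2 = normc x ^+ 2 + normc y ^+ 2.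
Proof. by rewrite sqr_sqrtr// addr_ge0 ?sqr_ge0. Qed.
Lemma cnorm2_le x y : cnorm2 x y <= normc x + normc y.
Proof.
have a0 := normc_ge0 x; have b0 := normc_ge0 y.
rewrite -(ler_pXn2r (n := 2)) ?nnegrE ?cnorm2_ge0 ?addr_ge0// cnorm2_sqr.
have : 0 <= normc x * normc y by rewrite mulr_ge0.
nra.
Qed.
Lemma cnorm2_ge_l x y : normc x <= cnorm2 x y.
Proof. by rewrite -(ler_pXn2r (n := 2)) ?nnegrE ?cnorm2_ge0 ?normc_ge0// cnorm2_sqr lerDl sqr_ge0. Qed.
Lemma cnorm2_ge_r x y : normc y <= cnorm2 x y.
Proof. by rewrite -(ler_pXn2r (n := 2)) ?nnegrE ?cnorm2_ge0 ?normc_ge0// cnorm2_sqr lerDr sqr_ge0. Qed.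
Lemma nrm2Z c x y : cnorm2 (c * x) (c * y) = normc c * cnorm2 x y.
Proof.
apply/eqP; rewrite -(eqrXn2 (n := 2)) ?cnorm2_ge0 ?mulr_ge0 ?normc_ge0 ?cnorm2_ge0//.
by rewrite exprMn !cnorm2_sqr !normcM; apply/eqP; ring.
Qed.
Lemma cnorm2_CS (a b x y : C) : normc (a * x + b * y) <= cnorm2 a b * cnorm2 x y.
Proof.
apply: le_trans (ler_normcD _ _) _; rewrite !normcM.
rewrite -(ler_pXn2r (n := 2)) ?nnegrE ?mulr_ge0 ?cnorm2_ge0 ?addr_ge0 ?mulr_ge0 ?normc_ge0//.
rewrite exprMn !cnorm2_sqr.
have := sqr_ge0 (normc a * normc y - normc b * normc x).
rewrite !expr2; lra.
Qed.

Lemma cvnormE (v : 'cV[C]_2) : cvnorm v = cnorm2 (v 0 0) (v 1 0).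
Proof.
rewrite /cvnorm /cnorm2 !big_ord_recl big_ord0 addr0 !cabs2E.
by rewrite (_ : lift _ _ = 1 :> 'I_2)//; apply: val_inj.
Qed.

Lemma mx2E (H : 'M[C]_2) (v : 'cV[C]_2) a : (H *m v) a 0 = H a 0 * v 0 0 + H a 1 * v 1 0.
Proof.
rewrite mxE !big_ord_recl big_ord0 addr0.
by rewrite (_ : lift _ _ = 1 :> 'I_2)//; apply: val_inj.
Qed.

Lemma opnorm2_le (H : 'M[C]_2) K : (forall a b, normc (H a b) <= K) -> 0 <= K ->
  has_ubound [set cvnorm (H *m v) | v in [set v : 'cV[C]_2 | cvnorm v = 1]] /\ opnorm2 H <= 4 * K.
Proof.
move=> HK K0.
have ub : ubound [set cvnorm (H *m v) | v in [set v : 'cV[C]_2 | cvnorm v = 1]] (4 * K).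
  move=> _ [v /= sing_majorant <-]; rewrite cvnormE.
  have [l0 l1] : normc (v 0 0) <= 1 /\ normc (v 1 0) <= 1.
    by rewrite -sing_majorant cvnormE; split; [exact: cnorm2_ge_l|exact: cnorm2_ge_r].
  have k a : normc ((H *m v) a 0) <= 2 * K.
    rewrite mx2E; apply: le_trans (ler_normcD _ _) _; rewrite !normcM.
    have := ler_pM (normc_ge0 _) (normc_ge0 _) (HK a 0) l0.
    have := ler_pM (normc_ge0 _) (normc_ge0 _) (HK a 1) l1; lra.
  apply: le_trans (cnorm2_le _ _) _; have := k 0; have := k 1; lra.
split; first by exists (4 * K).
apply: ge_sup => //.
pose v : 'cV[C]_2 := \col_i (if i == 0 then 1 else 0).
exists (cvnorm (H *m v)), v => //=.
rewrite cvnormE /v !mxE /= /cnorm2 normc0 expr0n /= addr0 sqrtr_sqr ger0_norm ?normc_ge0//.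
by rewrite -toC1 normc_toC normr1.
Qed.

(** A supremum dominates its members only if the set is bounded, so the entries are bounded first; a
    nonzero vector is then scaled to norm 1. *)
Lemma opnorm2P (H : 'M[C]_2) (v : 'cV[C]_2) : cvnorm (H *m v) <= opnorm2 H * cvnorm v.
Proof.
pose K := \sum_(a < 2) \sum_(b < 2) normc (H a b).
have HK a b : normc (H a b) <= K.
  rewrite /K (bigD1 a)//= (bigD1 b)//= -addrA lerDl addr_ge0//; last by apply: sumr_ge0 => i _; apply: sumr_ge0 => j _; exact: normc_ge0.
  by apply: sumr_ge0 => j _; exact: normc_ge0.
have K0 : 0 <= K by apply: le_trans (normc_ge0 _) (HK 0 0).
have [ub _] := opnorm2_le HK K0.
have [v0|vn] := eqVneq (cvnorm v) 0.
  have [n0 n1] : normc (v 0 0) <= 0 /\ normc (v 1 0) <= 0.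
    by rewrite -v0 cvnormE; split; [exact: cnorm2_ge_l|exact: cnorm2_ge_r].
  have z (w : C) : normc w <= 0 -> w = 0.
    by move=> h; apply/eqP; rewrite -normc_eq0 eq_le h normc_ge0.
  rewrite v0 mulr0 cvnormE !mx2E (z _ n0) (z _ n1) !mulr0 addr0 /cnorm2 normc0 expr0n /= addr0 sqrtr0//.
have np : 0 < cvnorm v by rewrite lt_def vn cvnormE cnorm2_ge0.
set t := (cvnorm v)^-1; have t0 : 0 < t by rewrite invr_gt0.
pose u : 'cV[C]_2 := \col_i (toC t * v i 0).
have nt : normc (toC t) = t by rewrite normc_toC gtr0_norm.
have u1 : cvnorm u = 1.
  by rewrite cvnormE /u !mxE nrm2Z nt -cvnormE /t mulVf// gt_eqF.
have Eu : cvnorm (H *m u) = t * cvnorm (H *m v).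
  transitivity (normc (toC t) * cnorm2 ((H *m v) 0 0) ((H *m v) 1 0)); last by rewrite nt cvnormE.
  rewrite -nrm2Z cvnormE !mx2E /u !mxE.
  have aux (a b c d e : C) : a * (c * d) + b * (c * e) = c * (a * d + b * e) by ring.
  by rewrite !aux.
rewrite -ler_pdivrMr// mulrC -/t -Eu; apply: ub_le_sup => //; by exists u.
Qed.

Variable r0 : R.
Hypothesis r00 : 0 < r0.

Lemma reP_strip (z : C^o * C^o) : strip2 r0 z -> strip2 r0 (reP z).
Proof. by move=> _; apply/in_strip2; rewrite /= normr0. Qed.

(** [B] guarantees that the set under the supremum is bounded; its value does not enter the
    result. *)
Lemma M0jP F B (z : C^o * C^o) : (forall z : C^o * C^o, strip2 r0 z -> normc (cd0 F z) <= B /\ normc (cd1 F z) <= B) ->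
  strip2 r0 z -> cnorm2 (cd0 F z + cd0 F (reP z)) (cd1 F z + cd1 F (reP z)) <= M0j r0 F.
Proof.
move=> HB hz.
have E (w : C^o * C^o) : cvnorm (cgrad F w + cgrad F (reP w)) = cnorm2 (cd0 F w + cd0 F (reP w)) (cd1 F w + cd1 F (reP w)).
  by rewrite cvnormE !mxE.
rewrite -E; apply: ub_le_sup; last by exists z.
exists (4 * B) => _ [w hw <-]; rewrite E; apply: le_trans (cnorm2_le _ _) _.
have [a b] := HB w hw; have [c d] := HB _ (reP_strip hw).
have := ler_normcD (cd0 F w) (cd0 F (reP w)); have := ler_normcD (cd1 F w) (cd1 F (reP w)) => n1 n2.
apply: le_trans (lerD n2 n1) _; apply: le_trans (lerD (lerD a c) (lerD b d)) _.
by rewrite (_ : 4 * B = B + B + (B + B))//; clear; ring.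
Qed.

(** The left side is the Hessian as a bilinear form in the directions (s0, s1) and (b0, b1): the
    operator norm handles the second direction, Cauchy-Schwarz the first. *)
Lemma M1jP F B (z : C^o * C^o) (s0 s1 b0 b1 : C) :
  (forall z : C^o * C^o, strip2 r0 z -> [/\ normc (cd0 (cd0 F) z) <= B, normc (cd1 (cd0 F) z) <= B,
     normc (cd0 (cd1 F) z) <= B & normc (cd1 (cd1 F) z) <= B]) -> strip2 r0 z ->
  normc ((cd0 (cd0 F) z * s0 + cd1 (cd0 F) z * s1) * b0 + (cd0 (cd1 F) z * s0 + cd1 (cd1 F) z * s1) * b1)
   <= M1j r0 F * cnorm2 b0 b1 * cnorm2 s0 s1.
Proof.
move=> HB hz.
pose v : 'cV[C]_2 := \col_i (if i == 0 then b0 else b1).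
have Hv := opnorm2P (chess F z) v.
have le : opnorm2 (chess F z) <= M1j r0 F.
  apply: ub_le_sup; last by exists z.
  exists (4 * B) => _ [w hw <-]; have [q1 q2 q3 q4] := HB w hw.
  apply: (opnorm2_le _ _).2; last by apply: le_trans (normc_ge0 _) q1.
  by move=> a b; rewrite mxE /cpartial; case: (a == 0); case: (b == 0).
have -> : (cd0 (cd0 F) z * s0 + cd1 (cd0 F) z * s1) * b0 + (cd0 (cd1 F) z * s0 + cd1 (cd1 F) z * s1) * b1 =
   (chess F z *m v) 0 0 * s0 + (chess F z *m v) 1 0 * s1.
  rewrite !mx2E !mxE /= /cpartial /=.
  have aux (a b c d : C) : (a * s0 + b * s1) * b0 + (c * s0 + d * s1) * b1 = (a * b0 + c * b1) * s0 + (b * b0 + d * b1) * s1 by ring.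
  exact: aux.
apply: le_trans (cnorm2_CS _ _ _ _) _; apply: ler_wpM2r; first exact: cnorm2_ge0.
rewrite -cvnormE; apply: le_trans Hv _.
have -> : cvnorm v = cnorm2 b0 b1 by rewrite cvnormE !mxE.
by apply: ler_wpM2r => //; exact: cnorm2_ge0.
Qed.

Section diffs.
Variables (F : C^o * C^o -> C^o) (B : R).
Hypotheses (HF : holo2 F (strip2 r0)) (H0 : holo2 (cd0 F) (strip2 r0)) (H1 : holo2 (cd1 F) (strip2 r0)).
Hypothesis B1 : forall z : C^o * C^o, strip2 r0 z -> normc (cd0 F z) <= B /\ normc (cd1 F z) <= B.
Hypothesis B2 : forall z : C^o * C^o, strip2 r0 z -> [/\ normc (cd0 (cd0 F) z) <= B, normc (cd1 (cd0 F) z) <= B,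
     normc (cd0 (cd1 F) z) <= B & normc (cd1 (cd1 F) z) <= B].
Variables (x : R * R) (be : R * R) (sg : R * R).
Hypotheses (be1 : `|be.1| < r0) (be2 : `|be.2| < r0).

(** Two parameters: [s] moves the real part from [x] to [x + sg], and [u] moves the imaginary part
    from 0 to [be]. The four corners of the unit square are the points at which [F] is compared. *)
Definition segpt (u s : R) : C^o * C^o := (Complex (x.1 + s * sg.1) (u * be.1), Complex (x.2 + s * sg.2) (u * be.2)).
Let sgC : C * C := (toC sg.1, toC sg.2).
Let beC : C * C := ('i%C * toC be.1, 'i%C * toC be.2).

Let pt_strip u s : 0 <= u <= 1 -> strip2 r0 (segpt u s).
Proof.
move=> /andP[u0 u1].
have key (y : R) : `|y| < r0 -> `|u * y| < r0.
  by move=> hy; rewrite normrM ger0_norm//; apply: le_lt_trans hy; rewrite ler_piMl.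
by apply/in_strip2; split; apply: key.
Qed.

Let ptE u s : segpt u s = ((segpt u 0).1 + toC s * sgC.1, (segpt u 0).2 + toC s * sgC.2).
Proof. by rewrite /segpt; congr pair; apply: complexP; rewrite ?(ReD,ImD,ReM,ImM) /toC /=; ring. Qed.
Let ptE' u s : segpt u s = ((segpt 0 s).1 + toC u * beC.1, (segpt 0 s).2 + toC u * beC.2).
Proof. by rewrite /segpt; congr pair; apply: complexP; rewrite ?(ReD,ImD,ReM,ImM) /toC /=; ring. Qed.

Let rDs H u s : holo2 H (strip2 r0) -> 0 <= u <= 1 ->
  real_deriv (fun s => H (segpt u s)) s (cd0 H (segpt u s) * sgC.1 + cd1 H (segpt u s) * sgC.2).
Proof.
move=> HH u01; have := @hasD2_real_deriv _ H (segpt u 0) sgC s (cd0 H (segpt u s)) (cd1 H (segpt u s)).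
rewrite -ptE (_ : (fun t => _) = (fun s => H (segpt u s))); last by apply/funext => t; rewrite [in RHS]ptE.
by apply; apply: HH; exact: pt_strip.
Qed.
Let rDu H u s : holo2 H (strip2 r0) -> 0 <= u <= 1 ->
  real_deriv (fun u => H (segpt u s)) u (cd0 H (segpt u s) * beC.1 + cd1 H (segpt u s) * beC.2).
Proof.
move=> HH u01; have := @hasD2_real_deriv _ H (segpt 0 s) beC u (cd0 H (segpt u s)) (cd1 H (segpt u s)).
rewrite -ptE' (_ : (fun t => _) = (fun u => H (segpt u s))); last by apply/funext => t; rewrite [in RHS]ptE'.
by apply; apply: HH; exact: pt_strip.
Qed.

(** The mean value inequality in [s] for the sum of [F] at [segpt 1 s] and at its real part
    [segpt 0 s]; its derivative pairs [sg] with the sum of the two gradients that [M0j] bounds. *)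
Lemma diff_plus : normc ((F (segpt 1 1) - F (segpt 1 0)) + (F (segpt 0 1) - F (segpt 0 0))) <= M0j r0 F * cnorm2 (toC sg.1) (toC sg.2).
Proof.
have -> : (F (segpt 1 1) - F (segpt 1 0)) + (F (segpt 0 1) - F (segpt 0 0)) = (F (segpt 1 1) + F (segpt 0 1)) - (F (segpt 1 0) + F (segpt 0 0)).
  have aux (a b c d : C) : (a - b) + (c - d) = (a + c) - (b + d) by ring.
  exact: aux.
have h1 : 0 <= (1 : R) <= 1 by rewrite ler01 lexx.
have h0 : 0 <= (0 : R) <= 1 by rewrite ler01 lexx.
apply: (@mvt_le _ (fun s => F (segpt 1 s) + F (segpt 0 s)) _ _ (fun s _ => rDD (rDs s HF h1) (rDs s HF h0))) => s s01.
have aux (a b c d u v : C) : a * u + b * v + (c * u + d * v) = (a + c) * u + (b + d) * v by ring.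
rewrite aux; apply: le_trans (cnorm2_CS _ _ _ _) _; apply: ler_wpM2r; first exact: cnorm2_ge0.
have -> : segpt 0 s = reP (segpt 1 s) by rewrite /reP /segpt /toC /= !mul0r.
by apply: M0jP B1 _; exact: pt_strip.
Qed.

(** A second difference: the mean value inequality in [u] and then in [s] leaves the mixed second
    derivative in the directions i [be] and [sg], which the Hessian bounds. *)
Lemma diff_minus : normc ((F (segpt 1 1) - F (segpt 1 0)) - (F (segpt 0 1) - F (segpt 0 0))) <=
  M1j r0 F * cnorm2 beC.1 beC.2 * cnorm2 (toC sg.1) (toC sg.2).
Proof.
have rDN f s d : real_deriv f s d -> real_deriv (fun t => - f t) s (- d :> C).
  move=> h; have := rDZ (-1) h; rewrite mulN1r.
  by rewrite (_ : (fun t => _) = (fun t => - f t))//; apply/funext => t; rewrite mulN1r.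
apply: (@mvt_le _ (fun u => F (segpt u 1) - F (segpt u 0)) _ _ (fun u hu => rDD (rDu 1 HF hu) (rDN _ _ _ (rDu 0 HF hu)))) => u u01.
pose D w : C := beC.1 * cd0 F w + beC.2 * cd1 F w.
have -> : cd0 F (segpt u 1) * beC.1 + cd1 F (segpt u 1) * beC.2 - (cd0 F (segpt u 0) * beC.1 + cd1 F (segpt u 0) * beC.2) = D (segpt u 1) - D (segpt u 0).
  rewrite /D.
  have aux (a b c d e v : C) : a * e + b * v - (c * e + d * v) = e * a + v * b - (e * c + v * d) by ring.
  exact: aux.
apply: (@mvt_le _ (fun s => D (segpt u s)) _ _ (fun s _ => rDD (rDZ beC.1 (rDs s H0 u01)) (rDZ beC.2 (rDs s H1 u01)))) => s s01.
rewrite [beC.1 * _]mulrC [beC.2 * _]mulrC.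
by apply: M1jP B2 _; exact: pt_strip.
Qed.
End diffs.
End sups.

(** * Holomorphic continuation of the kernel along diagonals *)

Section csqrt.
Variable R : realType.
Local Notation C := (R[i]).

(** The principal branch by the half-angle formulas, meant for Re w > 0. On nonnegative reals it is
    the real root, also at 0, where division by 0 gives 0. *)
Definition csqrt (w : C) : C :=
  let p := Num.sqrt ((normc w + complex.Re w) / 2) in Complex p (complex.Im w / (2 * p)).

Lemma Re_csqrt_gt0 w : 0 < complex.Re w -> 0 < complex.Re (csqrt w).
Proof. by move=> h; rewrite /= sqrtr_gt0 divr_gt0// ltr_wpDl ?normc_ge0. Qed.

Lemma csqrt_sqr w : 0 < complex.Re w -> csqrt w ^+ 2 = w.
Proof.
move=> h; have p0 := Re_csqrt_gt0 h; set p := complex.Re (csqrt w) in p0.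
have p2 : p ^+ 2 = (normc w + complex.Re w) / 2.
  by rewrite sqr_sqrtr// divr_ge0// addr_ge0 ?normc_ge0// ltW.
have nw : normc w ^+ 2 = complex.Re w ^+ 2 + complex.Im w ^+ 2 by rewrite -cabs2E.
have -> : csqrt w = Complex p (complex.Im w / (2 * p)) by [].
have pn : p != 0 by rewrite gt_eqF.
have E : (complex.Im w / (2 * p)) ^+ 2 = (normc w - complex.Re w) / 2.
  rewrite expr_div_n exprMn p2; apply: (mulIf (x := 2 ^+ 2 * ((normc w + complex.Re w) / 2))).
    by rewrite mulf_neq0// ?expf_neq0// ?pnatr_eq0// -p2 expf_neq0.
  rewrite divfK; last by rewrite mulf_neq0// ?expf_neq0// ?pnatr_eq0// -p2 expf_neq0.
  have -> : complex.Im w ^+ 2 = normc w ^+ 2 - complex.Re w ^+ 2 by rewrite nw; ring.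
  by field.
rewrite expr2; apply: complexP; rewrite ?ReM ?ImM /=.
  by rewrite -!expr2 p2 E; field.
by field.
Qed.

Lemma csqrt_toC (s : R) : 0 <= s -> csqrt (toC s) = toC (Num.sqrt s).
Proof.
move=> s0; rewrite /csqrt /= mul0r normc_toC ger0_norm// (_ : (s + s) / 2 = s)//; by field.
Qed.

Lemma normc_csqrt w : 0 < complex.Re w -> normc (csqrt w) ^+ 2 = normc w.
Proof. by move=> h; rewrite -normcX csqrt_sqr. Qed.

(** With q and q' the roots at w and w + k, one has k = (q' - q)(q' + q), hence q' - q - k / (2 q) =
    - k^2 / (2 q (q' + q)^2). The denominator stays away from 0 because both roots have positive
    real part, so |q' + q| >= Re q. *)
Lemma hasD_csqrt w : 0 < complex.Re w -> hasD csqrt w (2 * csqrt w)^-1.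
Proof.
move=> h e e0; have q0 := Re_csqrt_gt0 h.
have nq : csqrt w != 0 by apply: contraTneq q0 => ->; rewrite ltxx.
have nq0 : 0 < normc (csqrt w) by rewrite normc_gt0.
set q := csqrt w in q0 nq nq0 *; set rq := complex.Re q in q0.
have K0 : 0 < 2 * normc q * rq ^+ 2 by rewrite !mulr_gt0// exprn_gt0.
exists (Num.min (complex.Re w) (e * (2 * normc q * rq ^+ 2))); first by rewrite lt_min h mulr_gt0.
move=> k; rewrite lt_min => /andP[k1 k2].
have hk : 0 < complex.Re (w + k).
  rewrite ReD; have := ler_norm (- complex.Re k); rewrite normrN; have := Re_le_normc k; lra.
have q0' := Re_csqrt_gt0 hk.
have sq' := csqrt_sqr hk; have sq0 := csqrt_sqr h; rewrite -/q in sq0.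
set q' := csqrt (w + k) in q0' sq' *.
have s0 : rq <= normc (q' + q).
  apply: le_trans (Re_le_normc _); rewrite ReD ger0_norm ?addr_ge0 ?ltW//; rewrite -/rq; lra.
have sn : q' + q != 0 by rewrite -normc_gt0 (lt_le_trans q0).
have kE : k = (q' - q) * (q' + q).
  have aux (a b : C) : (a - b) * (a + b) = a ^+ 2 - b ^+ 2 by ring.
  by rewrite aux sq' sq0 addrC addKr.
have D : q' - q - (2 * q)^-1 * k = - (k ^+ 2 / (2 * q * (q' + q) ^+ 2)).
  have aux (a b h' : C) : b != 0 -> a + b != 0 -> h' = (a - b) * (a + b) -> a - b - (2 * b)^-1 * h' = - (h' ^+ 2 / (2 * b * (a + b) ^+ 2)).
    by move=> b0 ab ->; field; rewrite b0 ab.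
  exact: aux.
rewrite D normcN [normc (_ / _)]normcM normcX normcV [normc (_ * (q' + q) ^+ 2)]normcM normcX [normc (2 * q)]normcM.
have n2 : normc (2 : C) = 2 by rewrite -[2 : C]/(toC 1 + toC 1) -toCD normc_toC ger0_norm; [ring|lra].
rewrite n2 ler_pdivrMr; last by rewrite mulr_gt0 ?exprn_gt0 ?normc_gt0// mulr_gt0.
have -> : e * normc k * (2 * normc q * normc (q' + q) ^+ 2) = normc k * (e * (2 * normc q * normc (q' + q) ^+ 2)) by ring.
rewrite [leLHS]expr2; apply: ler_wpM2l; first exact: normc_ge0.
apply: (le_trans (ltW k2)); rewrite ler_pM2l// ler_pM2l ?mulr_gt0//.
by rewrite ler_pXn2r// nnegrE ?normc_ge0 ?ltW.
Qed.

Lemma hasD_inv (z : C) : z != 0 -> hasD (fun t => t^-1) z (- (z ^+ 2)^-1).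
Proof.
move=> zn e e0; have nz : 0 < normc z by rewrite normc_gt0.
exists (Num.min (normc z / 2) (e * (normc z ^+ 3 / 2))).
  by rewrite lt_min divr_gt0//= mulr_gt0// divr_gt0// exprn_gt0.
move=> h; rewrite lt_min => /andP[h1 h2].
have n1 : normc z / 2 <= normc (z + h).
  have := normcBsum z (- h); rewrite opprK normcN; lra.
have zhn : z + h != 0 by rewrite -normc_gt0; apply: lt_le_trans n1; rewrite divr_gt0.
have D : (z + h)^-1 - z^-1 - - (z ^+ 2)^-1 * h = h ^+ 2 / (z ^+ 2 * (z + h)) by field; rewrite zn zhn.
rewrite D [normc (_ / _)]normcM normcX normcV [normc (z ^+ 2 * _)]normcM normcX ler_pdivrMr; last by rewrite mulr_gt0 ?exprn_gt0// normc_gt0.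
rewrite expr2 [e * _]mulrC -mulrA; apply: ler_wpM2l; first exact: normc_ge0.
apply: (le_trans (ltW h2)); rewrite ler_pM2l// exprSr -mulrA; apply: ler_wpM2l => //.
exact: sqr_ge0.
Qed.

Definition cdiffable (f : C -> C) (z : C) := exists A, hasD f z A.
Lemma dfbM f g z : cdiffable f z -> cdiffable g z -> cdiffable (fun t => f t * g t) z.
Proof. by move=> [A a] [B b]; eexists; exact: hasDM a b. Qed.
Lemma dfbD f g z : cdiffable f z -> cdiffable g z -> cdiffable (fun t => f t + g t) z.
Proof. by move=> [A a] [B b]; eexists; exact: hasDD a b. Qed.
Lemma dfbB f g z : cdiffable f z -> cdiffable g z -> cdiffable (fun t => f t - g t) z.
Proof. by move=> [A a] [B b]; eexists; exact: hasDB a b. Qed.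
Lemma cdiffable_cst c z : cdiffable (fun=> c) z.
Proof. by eexists; exact: hasD_cst. Qed.
Lemma cdiffable_id z : cdiffable (fun t => t) z.
Proof. by eexists; exact: hasD_id. Qed.
Lemma cdiffable_comp f g z : cdiffable g z -> cdiffable f (g z) -> cdiffable (fun t => f (g t)) z.
Proof. by move=> [B b] [A a]; eexists; exact: hasD_comp b a. Qed.
Lemma dfbX f z n : cdiffable f z -> cdiffable (fun t => f t ^+ n) z.
Proof.
move=> h; elim: n => [|n IH]; first exact: (cdiffable_cst 1).
rewrite (_ : (fun t => _) = (fun t => f t * f t ^+ n)); first exact: dfbM.
by apply/funext => t; rewrite exprS.
Qed.
Lemma dfbV f z : f z != 0 -> cdiffable f z -> cdiffable (fun t => (f t)^-1) z.
Proof. by move=> n h; apply: (cdiffable_comp h); eexists; exact: hasD_inv. Qed.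
Lemma cdiffable_sum (I : Type) (s : seq I) (f : I -> C -> C) z : (forall i, cdiffable (f i) z) -> cdiffable (fun t => \sum_(i <- s) f i t) z.
Proof.
move=> h; elim: s => [|a s IH].
  by rewrite (_ : (fun t => _) = (fun=> 0)); [exact: cdiffable_cst|apply/funext => t; rewrite big_nil].
rewrite (_ : (fun t => _) = (fun t => f a t + \sum_(i <- s) f i t)); first exact: dfbD.
by apply/funext => t; rewrite big_cons.
Qed.
End csqrt.

(** * The continued kernel and its singularity *)

Section kappa.
Variable R : realType.
Local Notation C := (R[i]).
Variables (r0 : R) (F : 'I_3 -> C^o * C^o -> C^o) (B : R).
Hypothesis r00 : 0 < r0.
Hypotheses (HF : forall j, holo2 (F j) (strip2 r0)) (H0 : forall j, holo2 (cd0 (F j)) (strip2 r0)) (H1 : forall j, holo2 (cd1 (F j)) (strip2 r0)).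
Hypothesis B0 : 0 <= B.
Hypothesis B1 : forall j (z : C^o * C^o), strip2 r0 z -> normc (cd0 (F j) z) <= B /\ normc (cd1 (F j) z) <= B.
Hypothesis B2 : forall j (z : C^o * C^o), strip2 r0 z -> [/\ normc (cd0 (cd0 (F j)) z) <= B, normc (cd1 (cd0 (F j)) z) <= B,
     normc (cd0 (cd1 (F j)) z) <= B & normc (cd1 (cd1 (F j)) z) <= B].

Lemma sum3 (V : nmodType) (f : 'I_3 -> V) : \sum_(i < 3) f i = f 0 + f 1 + f 2.
Proof.
rewrite !big_ord_recl big_ord0 addr0 -addrA; congr (f _ + (f _ + f _)); exact: val_inj.
Qed.

Definition cshift (z : C * C) (s : R * R) : C^o * C^o := (z.1 + toC s.1, z.2 + toC s.2).
Definition ccross (P Q : 'I_3 -> C) (i : 'I_3) : C :=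
  if i == 0 then P 1 * Q 2 - P 2 * Q 1 else if i == 1 then P 2 * Q 0 - P 0 * Q 2 else P 0 * Q 1 - P 1 * Q 0.
(** The cross product is orthogonal to both factors, so tangential parts can be removed from [A].
    This makes the numerator of the kernel of second order in [s] although the increment itself is
    only of first order. *)
Lemma ccross_orth (A P Q : 'I_3 -> C) (x y : C) :
  \sum_(j < 3) A j * ccross P Q j = \sum_(j < 3) (A j - P j * x - Q j * y) * ccross P Q j.
Proof.
have E0 : ccross P Q 0 = P 1 * Q 2 - P 2 * Q 1 by [].
have E1 : ccross P Q 1 = P 2 * Q 0 - P 0 * Q 2 by [].
have E2 : ccross P Q 2 = P 0 * Q 1 - P 1 * Q 0 by [].
rewrite !sum3 E0 E1 E2.
move: (A 0) (A 1) (A 2) (P 0) (P 1) (P 2) (Q 0) (Q 1) (Q 2) => *; ring.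
Qed.
Lemma ccross_bound (P Q : 'I_3 -> C) i : (forall j, normc (P j) <= B) -> (forall j, normc (Q j) <= B) ->
  normc (ccross P Q i) <= 2 * B ^+ 2.
Proof.
move=> PB QB.
have two (a b c d : C) : normc a <= B -> normc b <= B -> normc c <= B -> normc d <= B -> normc (a * b - c * d) <= 2 * B ^+ 2.
  move=> ha hb hc hd; apply: le_trans (ler_normcB _ _) _; rewrite !normcM mulr_natl mulr2n expr2.
  by apply: lerD; apply: ler_pM; rewrite ?normc_ge0.
by rewrite /ccross; case: (i == 0); [|case: (i == 1)]; apply: two.
Qed.
Lemma cdiffable_ccross (P Q : 'I_3 -> C -> C) z i : (forall j, cdiffable (P j) z) -> (forall j, cdiffable (Q j) z) ->
  cdiffable (fun x => ccross (fun j => P j x) (fun j => Q j x) i) z.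
Proof.
by move=> dP dQ; rewrite /ccross; case: (i == 0); [|case: (i == 1)];
  apply: (dfbB (dfbM (dP _) (dQ _)) (dfbM (dP _) (dQ _))).
Qed.
Definition shift_diff j (z : C^o * C^o) s : C := F j z - F j (cshift z s).
Definition dist2_ext (z : C^o * C^o) s : C := \sum_(j < 3) shift_diff j z s ^+ 2.
Definition num_ext (z : C^o * C^o) s : C :=
  \sum_(j < 3) shift_diff j z s * ccross (fun j => cd0 (F j) (cshift z s)) (fun j => cd1 (F j) (cshift z s)) j.
(** The continuation of t -> K (t, t + s) to complex t, for a fixed real shift s. The squared
    distance is continued without conjugation, hence holomorphically, and [csqrt] replaces the
    Euclidean norm. *)
Definition kappa (z : C^o * C^o) s : C := toC (- (2 * pi)^-1) * (num_ext z s / csqrt (dist2_ext z s) ^+ 3).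

Definition rnorm (s : R * R) : R := cnorm2 (toC s.1) (toC s.2).

Lemma cshift_strip z s : strip2 r0 z -> strip2 r0 (cshift z s).
Proof. by move=> [a b]; apply/in_strip2; rewrite /= !ImD /toC /= !addr0. Qed.

(** After removal of the tangential part each increment is at most B (|s1| + |s2|)^2 <= 4 B |s|^2,
    each component of the cross product at most 2 B^2, and there are three terms: 24 B^3 |s|^2. *)
Lemma num_ext_bound z s : strip2 r0 z -> normc (num_ext z s) <= 24 * B ^+ 3 * rnorm s ^+ 2.
Proof.
move=> hz; have hw := cshift_strip s hz; set w := cshift z s in hw.
have lip0 j (u v : C * C) : strip2 r0 u -> strip2 r0 v -> normc (cd0 (F j) v - cd0 (F j) u) <= B * (normc (v.1 - u.1) + normc (v.2 - u.2)).
  move=> hu hv; apply: (mvt2 (@cconvex_strip R r0) (H0 j) hu hv) => t ht.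
  have [q1 q2 q3 q4] := B2 j ht.
  apply: le_trans (ler_normcD _ _) _; rewrite !normcM mulrDr.
  by apply: lerD; (apply: ler_wpM2r; first exact: normc_ge0); [exact: q1|exact: q2].
have lip1 j (u v : C * C) : strip2 r0 u -> strip2 r0 v -> normc (cd1 (F j) v - cd1 (F j) u) <= B * (normc (v.1 - u.1) + normc (v.2 - u.2)).
  move=> hu hv; apply: (mvt2 (@cconvex_strip R r0) (H1 j) hu hv) => t ht.
  have [q1 q2 q3 q4] := B2 j ht.
  apply: le_trans (ler_normcD _ _) _; rewrite !normcM mulrDr.
  by apply: lerD; (apply: ler_wpM2r; first exact: normc_ge0); [exact: q3|exact: q4].
pose P j := cd0 (F j) w; pose Q j := cd1 (F j) w.
pose E j := shift_diff j z s - P j * (- toC s.1) - Q j * (- toC s.2).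
have wz : z = (w.1 + - toC s.1, w.2 + - toC s.2).
  by rewrite /w /cshift /= !addrK -surjective_pairing.
have Eb j : normc (E j) <= B * (4 * rnorm s ^+ 2).
  have := @quad R (F j) _ B w (- toC s.1) (- toC s.2) (@cconvex_strip R r0) (HF j) hw _ B0 (lip0 j) (lip1 j).
  rewrite -wz [normc (- toC s.1)]normcN [normc (- toC s.2)]normcN => /(_ hz) q.
  apply: (le_trans q); apply: ler_wpM2l => //.
  have a := cnorm2_ge_l (toC s.1) (toC s.2); have b := cnorm2_ge_r (toC s.1) (toC s.2).
  have a0 := normc_ge0 (toC s.1); have b0 := normc_ge0 (toC s.2); rewrite -/(rnorm s) in a b.
  have -> : 4 * rnorm s ^+ 2 = (rnorm s + rnorm s) ^+ 2 by ring.
  by rewrite ler_pXn2r// ?nnegrE ?addr_ge0// ?cnorm2_ge0//; exact: lerD.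
have NE : num_ext z s = \sum_(j < 3) E j * ccross P Q j.
  exact: (ccross_orth (fun j => shift_diff j z s) P Q (- toC s.1) (- toC s.2)).
have PB i : normc (P i) <= B by exact: (B1 i hw).1.
have QB i : normc (Q i) <= B by exact: (B1 i hw).2.
have cb j := ccross_bound j PB QB.
rewrite NE; apply: le_trans (ler_normc_sum _ _ _) _.
have each j : normc (E j * ccross P Q j) <= B * (4 * rnorm s ^+ 2) * (2 * B ^+ 2).
  by rewrite normcM; apply: ler_pM; rewrite ?normc_ge0.
rewrite sum3; apply: (le_trans (lerD (lerD (each 0) (each 1)) (each 2))).
by rewrite le_eqVlt; apply/orP; left; apply/eqP; clear; ring.
Qed.

Variables (c b' : R).
Hypotheses (c0 : 0 < c) (bp : 0 <= b' < r0).
Definition in_cstrip (z : C * C) := `|complex.Im z.1| <= b' /\ `|complex.Im z.2| <= b'.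
Definition sqnorm_pi (s : R * R) := `|s.1| <= pi /\ `|s.2| <= pi.
Hypothesis ReS : forall z s, in_cstrip z -> sqnorm_pi s -> c * rnorm s ^+ 2 <= complex.Re (dist2_ext z s).

Lemma in_cstrip_strip z : in_cstrip z -> strip2 r0 z.
Proof. by move: bp => /andP[_ br] [h1 h2]; apply/in_strip2; split; apply: le_lt_trans br. Qed.

Definition kappa_cst : R := (2 * pi)^-1 * (24 * B ^+ 3) / Num.sqrt c ^+ 3.
Lemma kappa_cst_ge0 : 0 <= kappa_cst.
Proof. by rewrite /kappa_cst divr_ge0 ?exprn_ge0 ?sqrtr_ge0// mulr_ge0 ?invr_ge0 ?(ltW (pi2_gt0 R))// mulr_ge0 ?exprn_ge0. Qed.

(** Second order in the numerator against the cube of a distance of order |s| leaves the weak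
    singularity 1 / |s|. *)
Lemma kappa_bound z s : in_cstrip z -> sqnorm_pi s -> 0 < rnorm s -> normc (kappa z s) <= kappa_cst / rnorm s.
Proof.
move=> hz hs s0; have S := ReS hz hs.
have cs0 : 0 < c * rnorm s ^+ 2 by rewrite mulr_gt0// exprn_gt0.
have S0 : 0 < complex.Re (dist2_ext z s) by apply: lt_le_trans S.
have q : Num.sqrt c * rnorm s <= normc (csqrt (dist2_ext z s)).
  rewrite -(ler_pXn2r (n := 2)) ?nnegrE ?normc_ge0 ?mulr_ge0 ?sqrtr_ge0 ?(ltW s0)//.
  rewrite exprMn sqr_sqrtr ?(ltW c0)// normc_csqrt//; apply: (le_trans S).
  by apply: le_trans (ler_norm _) (Re_le_normc _).
have sc : 0 < Num.sqrt c by rewrite sqrtr_gt0.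
have q0 : 0 < Num.sqrt c * rnorm s by rewrite mulr_gt0.
rewrite /kappa !normcM normc_toC normrN gtr0_norm ?invr_gt0 ?pi2_gt0// normcV normcX.
have -> : kappa_cst / rnorm s = (2 * pi)^-1 * ((24 * B ^+ 3 * rnorm s ^+ 2) / (Num.sqrt c * rnorm s) ^+ 3).
  have aux (x k a r : R) : a != 0 -> r != 0 -> x * k / a ^+ 3 / r = x * (k * r ^+ 2 / (a * r) ^+ 3).
    by move=> a0 r0'; field; rewrite a0 r0'.
  by rewrite /kappa_cst aux// gt_eqF.
apply: ler_wpM2l; first by rewrite invr_ge0 ltW ?pi2_gt0.
apply: ler_pM; rewrite ?normc_ge0 ?invr_ge0 ?exprn_ge0 ?normc_ge0//; first exact: num_ext_bound (in_cstrip_strip hz).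
rewrite lef_pV2 ?posrE ?exprn_gt0// ?(lt_le_trans q0)//.
by rewrite ler_pXn2r// nnegrE ?normc_ge0 ?ltW.
Qed.

Lemma kappa_cdiffable (t sg : C * C) s (ze : C) : in_cstrip (t.1 + ze * sg.1, t.2 + ze * sg.2) -> sqnorm_pi s -> 0 < rnorm s ->
  cdiffable (fun ze => kappa (t.1 + ze * sg.1, t.2 + ze * sg.2) s) ze.
Proof.
move=> hz hs s0; have S := ReS hz hs.
have cs0 : 0 < c * rnorm s ^+ 2 by rewrite mulr_gt0// exprn_gt0.
have S0 : 0 < complex.Re (dist2_ext (t.1 + ze * sg.1, t.2 + ze * sg.2) s) by apply: lt_le_trans S.
have hst := in_cstrip_strip hz.
have line H : holo2 H (strip2 r0) -> cdiffable (fun ze => H (t.1 + ze * sg.1, t.2 + ze * sg.2)) ze.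
  by move=> HH; eexists; apply: hasD_line; exact: HH.
have linesh H : holo2 H (strip2 r0) -> cdiffable (fun ze => H (cshift (t.1 + ze * sg.1, t.2 + ze * sg.2) s)) ze.
  move=> HH; have E : forall x, cshift (t.1 + x * sg.1, t.2 + x * sg.2) s = (t.1 + toC s.1 + x * sg.1, t.2 + toC s.2 + x * sg.2).
    by move=> x; rewrite /cshift /= addrAC [t.2 + _ + _]addrAC.
  rewrite (_ : (fun x => _) = (fun x => H (t.1 + toC s.1 + x * sg.1, t.2 + toC s.2 + x * sg.2))); last by apply/funext => x; rewrite E.
  have hE := HH _ (cshift_strip s hst); rewrite E in hE.
  by eexists; exact: (@hasD_line _ H (t.1 + toC s.1, t.2 + toC s.2) sg ze _ _ hE).
have dA j : cdiffable (fun ze => shift_diff j (t.1 + ze * sg.1, t.2 + ze * sg.2) s) ze.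
  by apply: dfbB; [exact: (line (F j) (HF j))|exact: (linesh (F j) (HF j))].
have dP j : cdiffable (fun ze => cd0 (F j) (cshift (t.1 + ze * sg.1, t.2 + ze * sg.2) s)) ze by exact: (linesh (cd0 (F j)) (H0 j)).
have dQ j : cdiffable (fun ze => cd1 (F j) (cshift (t.1 + ze * sg.1, t.2 + ze * sg.2) s)) ze by exact: (linesh (cd1 (F j)) (H1 j)).
apply: dfbM; first exact: cdiffable_cst.
apply: dfbM.
  by apply: cdiffable_sum => j; apply: (dfbM (dA j)); exact: (cdiffable_ccross j dP dQ).
apply: dfbV.
  rewrite expf_neq0//; have := Re_csqrt_gt0 S0; apply: contraTneq => ->; by rewrite ltxx.
apply: dfbX; apply: cdiffable_comp; first by apply: cdiffable_sum => j; apply: dfbX.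
by eexists; exact: hasD_csqrt.
Qed.
End kappa.

(** * An integrable majorant in one variable *)

Section sing_majorant.
Variable R : realType.
Local Notation TR := (measurableTypeR R).
Local Notation leb := (@lebesgue_measure R).
Local Notation mu_per := (@mu_per R).

(** The identity 1 / x = x exp (- ln (x^2)) reduces inversion to measurable functions; at 0 both
    sides are 0. *)
Lemma measurable_invr : measurable_fun (setT : set TR) (fun x : TR => (x : R)^-1 : TR).
Proof.
have E (x : R) : x * expR (- ln (x ^+ 2)) = x^-1.
  have [->|x0] := eqVneq x 0; first by rewrite mul0r invr0.
  have p : 0 < x ^+ 2 by rewrite exprn_even_gt0.
  by rewrite expRN lnK// expr2 invfM mulrA divff// mul1r.
apply: (eq_measurable_fun (fun x : TR => x * expR (- ln (x ^+ 2)))).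
  by move=> x _; rewrite E.
apply: measurable_funM => //; apply: (measurableT_comp (@measurable_expR R)).
apply: (measurableT_comp (@oppr_measurable R setT)) => /=.
by apply: (measurableT_comp (@measurable_ln R)); exact: measurable_funX.
Qed.

(* Integrable at both ends of the period; a product of two copies dominates 1 / |s| by AM-GM. *)
Definition sing_majorant (s : R) : R := (Num.sqrt s)^-1 + (Num.sqrt (2 * pi - s))^-1.
Lemma sing_majorant_ge0 s : 0 <= sing_majorant s. Proof. by rewrite addr_ge0// invr_ge0 sqrtr_ge0. Qed.

Lemma measurable_sing_majorant : measurable_fun (setT : set TR) sing_majorant.
Proof.
have ms : measurable_fun [set: R] (@Num.sqrt R).
  by apply: continuous_measurable_fun => x; exact: sqrt_continuous.
apply: measurable_funD; apply: (measurableT_comp measurable_invr); first by [].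
by apply: (measurableT_comp ms); exact: measurable_funB.
Qed.

(** An antiderivative is 2 sqrt s - 2 sqrt (2 pi - s). Each of the four root terms is at most 4 pi,
    since sqrt s <= 2 pi for s <= 2 pi, and only two of them enter positively; this gives 8 pi. *)
Lemma sing_majorant_seg (a b : R) : 0 < a -> a < b -> b < 2 * pi ->
  (\int[leb]_(x in `[a, b]) (sing_majorant x)%:E <= (8 * pi)%:E)%E.
Proof.
move=> a0 ab b2; pose Fv s : R := 2 * Num.sqrt s - 2 * Num.sqrt (2 * pi - s).
have dF (x : R) : 0 < x -> x < 2 * pi -> is_derive x (1 : R) Fv (sing_majorant x).
  move=> x0 x2; have x2' : 0 < 2 * pi - x by rewrite subr_gt0.
  have d1 := is_derive1_sqrt x0.
  have d2 := is_derive1_sqrt x2'.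
  have d3 : is_derive x (1 : R) (fun s : R => 2 * pi - s) (-1).
    have := @is_deriveB R R R (cst (2 * pi)) id x 1 0 1 _ _; rewrite sub0r; apply.
  have d4 := @is_derive1_comp R (@Num.sqrt R) (fun s => 2 * pi - s) x _ _ d2 d3.
  have s1 : Num.sqrt x != 0 by rewrite gt_eqF// sqrtr_gt0.
  have s2 : Num.sqrt (2 * pi - x) != 0 by rewrite gt_eqF// sqrtr_gt0.
  have := @is_deriveB R R R (fun s => 2 *: Num.sqrt s) (fun s => 2 *: Num.sqrt (2 * pi - s)) x 1 _ _ (is_deriveZ 2 d1) (is_deriveZ 2 d4).
  move=> H; apply: (is_derive_eq H); rewrite /GRing.scale /= /sing_majorant.
  move: (Num.sqrt x) (Num.sqrt (2 * pi - x)) s1 s2 => u w u0 w0.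
  by field; rewrite u0 w0.
have dfin (x : R) : a <= x <= b -> is_derive x (1 : R) Fv (sing_majorant x).
  by move=> /andP[h1 h2]; apply: dF; [exact: lt_le_trans h1|exact: le_lt_trans b2].
have cF x : a <= x <= b -> {for x, continuous Fv}.
  by move=> /dfin [h _]; apply: differentiable_continuous; apply/derivable1_diffP.
rewrite (@continuous_FTC2 R sing_majorant Fv a b ab).
- rewrite -EFinB lee_fin /Fv.
  have q (s : R) : 0 <= s <= 2 * pi -> 0 <= Num.sqrt s <= 2 * pi.
    move=> /andP[h1 h2]; rewrite sqrtr_ge0 /=.
    rewrite -(ler_pXn2r (n := 2)) ?nnegrE ?sqrtr_ge0 ?(ltW (pi2_gt0 R))// sqr_sqrtr//.
    apply: (le_trans h2); rewrite expr2 ler_peMr ?(ltW (pi2_gt0 R))//.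
    by have := @pi_ge2 R; lra.
  have qa := q a ltac:(lra); have qb := q b ltac:(lra).
  have qa' := q (2 * pi - a) ltac:(lra); have qb' := q (2 * pi - b) ltac:(lra).
  move: qa qb qa' qb' => /andP[? ?] /andP[? ?] /andP[? ?] /andP[? ?]; lra.
- apply: continuous_in_subspaceT => x; rewrite inE /= in_itv /= => /andP[h1 h2].
  have x0 : 0 < x := lt_le_trans a0 h1.
  have x2 : 0 < 2 * pi - x by rewrite subr_gt0; exact: le_lt_trans b2.
  apply: cvgD; apply: cvgV; rewrite ?gt_eqF ?sqrtr_gt0//; first exact: sqrt_continuous.
  have d3 : is_derive x (1 : R) (fun s : R => 2 * pi - s) (-1).
    have := @is_deriveB R R R (cst (2 * pi)) id x 1 0 1 _ _; rewrite sub0r; apply.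
  have [dd _] := @is_derive1_comp R (@Num.sqrt R) (fun s => 2 * pi - s) x _ _ (is_derive1_sqrt x2) d3.
  have /derivable1_diffP/differentiable_continuous cc := dd; exact: cc.
- split.
  + by move=> x; rewrite in_itv /= => /andP[h1 h2]; have [] := dfin x ltac:(by rewrite !ltW).
  + by apply: cvg_at_right_filter; apply: cF; rewrite lexx ltW.
  + by apply: cvg_at_left_filter; apply: cF; rewrite lexx ltW.
- move=> x; rewrite in_itv /= => /andP[h1 h2]; rewrite derive1E; have [_ ->//] := dfin x ltac:(by rewrite !ltW).
Qed.

(** Exhaust the period by compact intervals that avoid both singular ends. The bound on them does
    not depend on the interval, monotone convergence passes to the union, and only the point 0 is
    missing. *)
Lemma sing_majorant_int : (\int[mu_per]_x (sing_majorant x)%:E <= (8 * pi)%:E)%E.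
Proof.
have mv : measurable_fun (setT : set TR) (EFin \o sing_majorant) by apply/measurable_EFinP; exact: measurable_sing_majorant.
have p0 := @pi_gt0 R; have p2 := @pi_ge2 R.
rewrite ge0_integral_mu_per//; last by move=> x; rewrite lee_fin sing_majorant_ge0.
pose An (n : nat) : set TR := `[(n.+1%:R)^-1, 2 * pi - (n.+1%:R)^-1]%classic.
have mA n : measurable (An n) by exact: measurable_itv.
have nd : nondecreasing_seq An.
  move=> n m nm; apply/subsetPset => x; rewrite /An /= !in_itv /= => /andP[h1 h2].
  have k : (m.+1%:R)^-1 <= (n.+1%:R)^-1 :> R by rewrite lef_pV2 ?posrE ?ltr0n// ler_nat.
  by apply/andP; split; [exact: le_trans h1|apply: (le_trans h2); rewrite lerD2l lerN2].
have mvA n : measurable_fun (An n) (EFin \o sing_majorant) by apply: measurable_funTS.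
have cv := @ge0_nondecreasing_set_cvg_integral _ TR R An (EFin \o sing_majorant) leb nd mA mvA (fun i x _ => sing_majorant_ge0 x).
have E : (\int[leb]_(x in @per_itv R) (sing_majorant x)%:E = \int[leb]_(x in \bigcup_i An i) (sing_majorant x)%:E)%E.
  have mU : measurable (\bigcup_i An i) by apply: bigcupT_measurable.
  have s1 : (\bigcup_i An i) `<=` @per_itv R.
    move=> x [n _]; rewrite /An /per_itv /= !in_itv /= => /andP[h1 h2].
    have i0 : 0 < (n.+1%:R)^-1 :> R by rewrite invr_gt0 ltr0n.
    by rewrite (le_trans (ltW i0) h1) /=; apply: (le_lt_trans h2); rewrite gtrBl.
  have s2 : @per_itv R `\` (\bigcup_i An i) `<=` [set 0].
    move=> x [xI xn] /=; apply: contrapT => x0; apply: xn.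
    move: xI; rewrite /per_itv /= in_itv /= => /andP[h1 h2].
    have x0' : 0 < x by rewrite lt_def h1 andbT; apply/eqP.
    have d0 : 0 < Num.min x (2 * pi - x) by rewrite lt_min x0' subr_gt0.
    have [n nP] : exists n : nat, (n.+1%:R)^-1 < Num.min x (2 * pi - x).
      have [n _ Hn] := @near_infty_natSinv_lt R (PosNum d0); exists n; exact: (Hn n (leqnn n)).
    exists n => //; rewrite /An /= in_itv /=; move: nP; rewrite lt_min => /andP[q1 q2]; by rewrite (ltW q1) /= lerBrDr -lerBrDl ltW.
  rewrite -(setDUK s1) ge0_integral_setU//=.
  - rewrite [X in (_ + X)%E](_ : _ = 0%E) ?adde0//.
    apply: null_set_integral => //; first by apply: measurableD => //; exact: measurable_per_itv.
      by apply: measurable_funTS.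
    have l0 : leb [set (0 : R)] = 0%E by exact: lebesgue_measure_set1.
    apply/eqP; rewrite -measure_le0 -l0; apply: le_measure => //; rewrite inE; last exact: measurable_set1.
    by apply: measurableD => //; exact: measurable_per_itv.
  - by apply: measurableD => //; exact: measurable_per_itv.
  - by rewrite setDUK//; apply: measurable_funTS.
  - by move=> x _; rewrite lee_fin sing_majorant_ge0.
  - by apply/disj_setPS => x [h [_ h']].
rewrite E; apply: (cvge_le _ cv) => //; near=> n.
have n1 : (n.+1%:R)^-1 < (1 : R) by near: n; exact: (near_infty_natSinv_lt (PosNum (@ltr01 R))).
have i0 : 0 < (n.+1%:R)^-1 :> R by rewrite invr_gt0 ltr0n.
have i2 : (n.+1%:R)^-1 < 2 * pi - (n.+1%:R)^-1 :> R.
  by rewrite ltrBrDr; apply: (lt_le_trans (ltrD n1 n1)); lra.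
by apply: sing_majorant_seg => //; rewrite gtrBl.
Unshelve. all: by end_near.
Qed.

Lemma sing_majorant_lb (s r : R) : 0 < r -> (r = s \/ r = 2 * pi - s) -> (Num.sqrt r)^-1 <= sing_majorant s.
Proof.
move=> r0 [->|->]; rewrite /sing_majorant; first by rewrite lerDl invr_ge0 sqrtr_ge0.
by rewrite lerDr invr_ge0 sqrtr_ge0.
Qed.
End sing_majorant.

(** * Fourier matrix of a weakly singular periodic kernel *)

Section absker.
Variable R : realType.
Local Notation TR := (measurableTypeR R).
Local Notation C := (R[i]).
Local Notation mu_per2 := (@mu_per2 R).
Local Notation mu_per := (@mu_per R).

Lemma biper_int (T : Type) (f : R * R -> T) : biper f -> forall x (k l : int),
  f (x.1 - 2 * pi * k%:~R, x.2 - 2 * pi * l%:~R) = f x.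
Proof.
move=> bf x k l.
rewrite (@periodic_int _ _ (fun u => f (u, _))); last by move=> u; have [] := bf (u, x.2 - 2 * pi * l%:~R).
rewrite (@periodic_int _ _ (fun u => f (_, u))); last by move=> u; have [] := bf (x.1, u).
by rewrite -surjective_pairing.
Qed.

Lemma red2 (a : R * R) : exists k l : int, @I2 R (a.1 - 2 * pi * k%:~R, a.2 - 2 * pi * l%:~R).
Proof.
have [k hk] := red2pi a.1; have [l hl] := red2pi a.2; exists k, l.
by split; rewrite /= in_itv /=.
Qed.

Lemma shift2_red (T : Type) (f : R * R -> T) (a : R * R) (k l : int) : biper f ->
  (fun x => f (shift2 (a.1 - 2 * pi * k%:~R, a.2 - 2 * pi * l%:~R) x)) = (fun x => f (shift2 a x)).
Proof.
move=> bf; apply/funext => x; rewrite -(biper_int bf (shift2 a x) k l).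
by rewrite /shift2 /= !addrA.
Qed.

Lemma cintg_shift (f : TR * TR -> C) (a : R * R) : cmeasurable setT f -> biper f ->
  cintg mu_per2 setT (fun x => f (shift2 a x)) = cintg mu_per2 setT f.
Proof.
move=> mf bf; have [k [l hI]] := red2 a.
by rewrite -(shift2_red a k l bf) (cperiodic_mu_per2 hI mf bf).
Qed.

Lemma ge0_shift (f : TR * TR -> \bar R) (a : R * R) : (forall x, 0 <= f x)%E -> measurable_fun setT f -> biper f ->
  (\int[mu_per2]_x f (shift2 a x) = \int[mu_per2]_x f x)%E.
Proof.
move=> f0 mf bf; have [k [l hI]] := red2 a.
have := shift2_red a k l bf => E.
transitivity (\int[mu_per2]_x f (shift2 (a.1 - 2 * pi * k%:~R, a.2 - 2 * pi * l%:~R)%R x))%E.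
  by apply: eq_integral => x _; rewrite -[RHS]/((fun y => f (shift2 _ y)) x) E.
exact: ge0_periodic_mu_per2.
Qed.

(** A cell of full measure. The lines where a coordinate of [s] is 0 must be left out: as the
    inverse of 0 is 0, the majorant fails to be large there. *)
Definition open_cell (s : R * R) := 0 < s.1 < 2 * pi /\ 0 < s.2 < 2 * pi.
Lemma ae_open_cell : {ae mu_per2, forall s, open_cell s}.
Proof.
have h : {ae mu_per, forall x : TR, 0 < x < 2 * pi} by apply: (@ae_mu_per R _ 0).
have h1 := ae_fst h; have h2 := ae_snd h.
by apply: (@filterS2 _ _ (ae_filter_ringOfSetsType mu_per2) (fun s : TR * TR => 0 < s.1 < 2 * pi) (fun s : TR * TR => 0 < s.2 < 2 * pi) _ _ h1 h2).
Qed.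

Variable K : R * R -> R * R -> R.
Hypothesis mK : measurable_fun (setT : set ((TR * TR) * (TR * TR))) (fun p => K p.1 p.2).
Hypothesis K1per : forall e, biper (fun t => K t e).
Hypothesis K2per : forall t, biper (fun e => K t e).
Variable v : R * R -> R.
Hypothesis v0 : forall s, 0 <= v s.
Hypothesis mv : measurable_fun (setT : set (TR * TR)) v.
Variable V : R.
Hypothesis Vint : (\int[mu_per2]_x (v x)%:E <= V%:E)%E.
Hypothesis Kv1 : forall t s, open_cell s -> `|K t (t.1 + s.1, t.2 + s.2)| <= v s.
Hypothesis Kv2 : forall e s, open_cell s -> `|K (e.1 + s.1, e.2 + s.2) e| <= v s.

Lemma V_ge0 : 0 <= V.
Proof. by rewrite -lee_fin; apply: le_trans Vint; apply: integral_ge0 => x _; rewrite lee_fin. Qed.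

Lemma v_integrable : mu_per2.-integrable setT (EFin \o v).
Proof.
apply/integrableP; split; first exact/measurable_EFinP.
under eq_integral do rewrite /= ger0_norm//.
by apply: le_lt_trans Vint _; rewrite ltry.
Qed.

Lemma v_integral_le : Rintegral mu_per2 setT v <= V.
Proof.
rewrite /Rintegral -lee_fin fineK//.
by rewrite ge0_fin_numE; [apply: le_lt_trans Vint _; rewrite ltry|apply: integral_ge0 => x _; rewrite lee_fin].
Qed.

Lemma measurable_kernel1 e : measurable_fun (setT : set (TR * TR)) (fun t => K t e).
Proof. by apply: (measurableT_comp mK (g := fun t : TR * TR => (t, e))); apply: measurable_fun_pair. Qed.
Lemma measurable_kernel2 t : measurable_fun (setT : set (TR * TR)) (fun e => K t e).
Proof. by apply: (measurableT_comp mK (g := fun e : TR * TR => (t, e))); apply: measurable_fun_pair. Qed.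

Let absE (f : TR * TR -> R) : measurable_fun setT f -> measurable_fun setT (fun x => (`|f x|)%:E).
Proof. by move=> mf; apply/measurable_EFinP; exact: measurableT_comp. Qed.

Lemma kernel_integral_le1 e : (\int[mu_per2]_t (`|K t e|)%:E <= V%:E)%E.
Proof.
have bp : biper (fun t => (`|K t e|)%:E) by move=> t; have [-> ->] := K1per e t.
rewrite -(@ge0_shift (fun t => (`|K t e|)%:E) e)//; last exact: absE (measurable_kernel1 e).
apply: le_trans Vint; apply: ae_ge0_le_integral => //; try (by move=> x _; rewrite lee_fin ?normr_ge0 ?v0); try exact/measurable_EFinP.
- by apply: (measurableT_comp (absE (measurable_kernel1 e))); exact: measurable_shift2.
- apply: (@filterS _ _ (ae_filter_ringOfSetsType mu_per2) _ _ _ ae_open_cell) => s hs _.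
  by rewrite lee_fin /shift2 [s.1 + _]addrC [s.2 + _]addrC; exact: Kv2.
Qed.

Definition kernel_op (phi : R * R -> C) (t : R * R) : C := cintg mu_per2 setT (fun e => toC (K t e) * phi e).

Let mp1 (f : TR * TR -> C) : cmeasurable setT f -> cmeasurable (setT : set ((TR * TR) * (TR * TR))) (fun p => f p.1).
Proof. by move=> [a b]; split; [apply: (measurableT_comp a)|apply: (measurableT_comp b)]. Qed.
Let mp2 (f : TR * TR -> C) : cmeasurable setT f -> cmeasurable (setT : set ((TR * TR) * (TR * TR))) (fun p => f p.2).
Proof. by move=> [a b]; split; [apply: (measurableT_comp a)|apply: (measurableT_comp b)]. Qed.

(** Tonelli's theorem with the integration over [t] first: the kernel's integral in [t] is at most
    [V] uniformly in [e], and what remains is the L^1 norm of [phi]. *)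
Lemma kernel_prod_integrable phi u M : cintegrable mu_per2 setT phi -> cmeasurable (setT : set (TR * TR)) u -> (forall t, normc (u t) <= M) ->
  cintegrable (mu_per2 \x mu_per2)%E setT (fun p : (TR * TR) * (TR * TR) => toC (K p.1 p.2) * phi p.2 * u p.1).
Proof.
move=> iF mu uM; have mf := cintegrable_cmeasurable iF.
have M0 : 0 <= M by apply: le_trans (normc_ge0 _) (uM 0).
apply: cintegrable_prod21.
  apply: cmeasM; last exact: mp1.
  apply: cmeasM; last exact: mp2.
  exact: cmeasurable_toC.
have iN := integrable_normc measurableT iF.
apply: (@le_lt_trans _ _ (\int[mu_per2]_e ((V * M)%:E * (normc (phi e))%:E))%E).
  apply: ge0_le_integral => //.
  - by move=> e _; apply: integral_ge0 => t _; rewrite lee_fin normc_ge0.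
  - have := @measurable_fun_fubini_tonelli_G _ _ _ _ R mu_per2 (fun p => (normc (toC (K p.1 p.2) * phi p.2 * u p.1))%:E); apply.
      apply/measurable_EFinP; apply: measurable_normc; apply: cmeasM; last exact: mp1.
      apply: cmeasM; last exact: mp2.
      exact: cmeasurable_toC.
    by move=> p; rewrite lee_fin normc_ge0.
  - by apply: measurable_funeM; apply/measurable_EFinP; exact: measurable_normc.
  - move=> e _.
    apply: (@le_trans _ _ (\int[mu_per2]_t ((M * normc (phi e))%:E * (`|K t e|)%:E))%E).
      apply: ge0_le_integral => //.
      + by move=> t _; rewrite lee_fin normc_ge0.
      + apply/measurable_EFinP; apply: measurable_normc.
        exact: (cmeasM (cmeasM (cmeasurable_toC (measurable_kernel1 e)) (cmeasurable_cst setT (phi e))) mu).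
      + by apply: measurable_funeM; exact: absE (measurable_kernel1 e).
      + move=> t _; rewrite -EFinM lee_fin !normcM normc_toC.
        have -> : `|K t e| * normc (phi e) * normc (u t) = normc (u t) * normc (phi e) * `|K t e| by ring.
        by apply: ler_wpM2r => //; apply: ler_wpM2r; [exact: normc_ge0|exact: uM].
    rewrite ge0_integralZl//.
    + rewrite -EFinM [V * M]mulrC -mulrA [V * _]mulrC mulrA EFinM; apply: lee_wpmul2l; first by rewrite lee_fin mulr_ge0 ?normc_ge0.
      exact: kernel_integral_le1.
    + exact: absE (measurable_kernel1 e).
    + by rewrite lee_fin mulr_ge0 ?normc_ge0.
rewrite ge0_integralZl//.
- apply: lte_mul_pinfty => //; first by rewrite lee_fin mulr_ge0// V_ge0.
  move/integrableP: iN => [_]; by under eq_integral do rewrite /= ger0_norm ?normc_ge0//.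
- by apply/measurable_EFinP; exact: measurable_normc.
- by move=> e _; rewrite lee_fin normc_ge0.
- by rewrite lee_fin mulr_ge0// V_ge0.
Qed.

Lemma kernel_op_int phi : cintegrable mu_per2 setT phi -> cintegrable mu_per2 setT (kernel_op phi).
Proof.
move=> iF; have one (t : TR * TR) : normc (1 : C) <= 1 by rewrite -toC1 normc_toC normr1.
have iP := kernel_prod_integrable iF (cmeasurable_cst _ _) one.
have [h _] := cfubini iP.
by have := h; rewrite (_ : (fun x => cintg _ _ _) = kernel_op phi)//; apply/funext => t; apply: eq_cintg => e _; rewrite mulr1.
Qed.

Definition kernel_adj (u : R * R -> C) (e : R * R) : C := cintg mu_per2 setT (fun t => toC (K t e) * u t).

Lemma kernel_adjP (u : R * R -> C) M : cmeasurable (setT : set (TR * TR)) u -> (forall t, normc (u t) <= M) ->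
  cmeasurable (setT : set (TR * TR)) (kernel_adj u) /\ forall e, normc (kernel_adj u e) <= M * V.
Proof.
move=> mu uM; have M0 : 0 <= M by apply: le_trans (normc_ge0 _) (uM 0).
have i1 : cintegrable mu_per2 setT (fun=> 1 : C).
  by apply: (@cintegrable_bounded _ _ _ _ _ 1); [exact: cmeasurable_cst|move=> x; rewrite -toC1 normc_toC normr1].
split.
  have [h _] := cfubini_swap (kernel_prod_integrable i1 mu uM).
  have := cintegrable_cmeasurable h; rewrite (_ : (fun x => cintg _ _ _) = kernel_adj u)//.
  by apply/funext => t; apply: eq_cintg => e _; rewrite mulr1.
move=> e.
have ik : mu_per2.-integrable setT (fun t : TR * TR => (`|K t e|)%:E).
  apply/integrableP; split; first exact: absE (measurable_kernel1 e).
  under eq_integral do rewrite /= normr_id.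
  by apply: le_lt_trans (kernel_integral_le1 e) _; rewrite ltry.
have ik2 := integrableZl measurableT M ik.
apply: (@le_trans _ _ (Rintegral mu_per2 setT (fun t : TR * TR => M * `|K t e|))).
  apply: normc_cintg_le => //.
    by apply: cmeasM => //; apply: cmeasurable_toC; exact: measurable_kernel1.
  by move=> t _; rewrite normcM normc_toC mulrC; apply: ler_wpM2r.
rewrite RintegralZl//; apply: ler_wpM2l => //.
rewrite /Rintegral -lee_fin fineK; first exact: kernel_integral_le1.
rewrite ge0_fin_numE; first by apply: le_lt_trans (kernel_integral_le1 e) _; rewrite ltry.
by apply: integral_ge0 => x _; rewrite lee_fin.
Qed.

(** Fubini moves the operator onto the basis function, where its transpose is a bounded function by
    [kernel_adjP]. Each coefficient of the image is thus an L^1-continuous functional of [phi]. *)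
Lemma fcoeff_kernel_op phi k : cintegrable mu_per2 setT phi ->
  fcoeff (kernel_op phi) k = cintg mu_per2 setT (fun e => phi e * kernel_adj (fun t => conjc (ebasis k t)) e).
Proof.
move=> iF; pose u t := conjc (ebasis k t) : C.
have mu : cmeasurable (setT : set (TR * TR)) u by apply: cmeasJ; exact: cmeasurable_ebasis.
have uM t : normc (u t) <= (2 * pi)^-1 by rewrite normcJ normc_ebasis.
have one (t : TR * TR) : normc (1 : C) <= 1 by rewrite -toC1 normc_toC normr1.
have iP1 := kernel_prod_integrable iF (cmeasurable_cst _ _) one.
have iP := kernel_prod_integrable iF mu uM.
have [hA EA] := cfubini iP; have [hB EB] := cfubini_swap iP.
have mm := (kernel_adjP mu uM).1.
transitivity (cintg (mu_per2 \x mu_per2)%E setT (fun p : (TR * TR) * (TR * TR) => toC (K p.1 p.2) * phi p.2 * u p.1)).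
- rewrite EA /fcoeff; apply: ae_eq_cintg => //.
  + exact: cintegrable_cmeasurable (fcE k (kernel_op_int iF)).
  + exact: cintegrable_cmeasurable hA.
  + have [a b] := iP1.
    have a1 := ae_integrable1 a; have b1 := ae_integrable1 b.
    rewrite /ae_eq; apply: (@filterS2 _ _ (ae_filter_ringOfSetsType mu_per2) _ _ _ _ a1 b1) => t ha hb _.
    rewrite /kernel_op mulrC -cIZ//; last first.
      split; [apply: (eq_integrable _ _ _ _ ha) => // e _|apply: (eq_integrable _ _ _ _ hb) => // e _]; by rewrite /= mulr1.
    by apply: eq_cintg => e _; rewrite mulrC.
- rewrite EB; apply: ae_eq_cintg => //.
  + exact: cintegrable_cmeasurable hB.
  + by apply: cmeasM => //; exact: cintegrable_cmeasurable iF.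
  + apply: aeW => e _; rewrite /kernel_adj -cIZ//.
      by apply: eq_cintg => t _; rewrite /= mulrA [phi e * _]mulrC.
    have ik : mu_per2.-integrable setT (fun t : TR * TR => (`|K t e|)%:E).
      apply/integrableP; split; first exact: absE (measurable_kernel1 e).
      under eq_integral do rewrite /= normr_id.
      by apply: le_lt_trans (kernel_integral_le1 e) _; rewrite ltry.
    have ik2 := integrableZl measurableT (2 * pi)^-1 ik.
    apply: (le_cintegrable measurableT (f := fun t : TR * TR => toC (K t e) * u t) (h := fun t : TR * TR => ((2 * pi)^-1 * `|K t e| : R))) => //.
      by apply: cmeasM => //; apply: cmeasurable_toC; exact: measurable_kernel1.
    by move=> t _; rewrite normcM normc_toC mulrC; apply: ler_wpM2r.
Qed.

Definition kernel_mx (k l : int * int) : C := fcoeff (kernel_op (ebasis l)) k.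

(** The box sums of [phi] converge in L^2, hence in L^1, and the coefficient of the image is
    L^1-continuous. This is how the operator equation becomes an infinite linear system. *)
Lemma fcoeff_kernel_op_lim phi k : inL2m phi -> forall e, 0 < e -> exists N, forall n, (N <= n)%N ->
  normc (fcoeff (kernel_op phi) k - \sum_(l <- box n) kernel_mx k l * fcoeff phi l) <= e.
Proof.
move=> hf e e0; pose u t := conjc (ebasis k t) : C.
have mu : cmeasurable (setT : set (TR * TR)) u by apply: cmeasJ; exact: cmeasurable_ebasis.
have uM t : normc (u t) <= (2 * pi)^-1 by rewrite normcJ normc_ebasis.
have [mm mb] := kernel_adjP mu uM; set B := (2 * pi)^-1 * V in mb.
have B0 : 0 <= B by rewrite mulr_ge0 ?V_ge0// invr_ge0 ltW ?pi2_gt0.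
have p0 : 0 < B * (7 * pi ^+ 2) + 1 by rewrite ltr_wpDl// mulr_ge0// mulr_ge0// sqr_ge0.
have [N HN] := parseval hf (exprn_gt0 2 (divr_gt0 e0 p0)).
exists N => n Nn; have hq := HN n Nn.
pose d x := phi x - trig_poly (box n) (fcoeff phi) x.
have hd : inL2m d by apply: inL2mB => //; exact: inL2m_trig_poly.
have imul f : cintegrable mu_per2 setT f -> cintegrable mu_per2 setT (fun e => f e * kernel_adj u e).
  by move=> iF; apply: (cintegrableM measurableT (M := B)) => // x _; exact: mb.
have E : fcoeff (kernel_op phi) k - \sum_(l <- box n) kernel_mx k l * fcoeff phi l = cintg mu_per2 setT (fun x => d x * kernel_adj u x).
  rewrite fcoeff_kernel_op; last exact: inL2m_cintegrable.
  have -> : \sum_(l <- box n) kernel_mx k l * fcoeff phi l = cintg mu_per2 setT (fun x => trig_poly (box n) (fcoeff phi) x * kernel_adj u x).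
    rewrite (_ : (fun x => _) = (fun x => \sum_(l <- box n) fcoeff phi l * (ebasis l x * kernel_adj u x))); last first.
      by apply/funext => x; rewrite /trig_poly mulr_suml; apply: eq_bigr => l _; rewrite mulrA.
    have ie l : cintegrable mu_per2 setT (fun x => ebasis l x * kernel_adj u x) by apply: imul; exact: cint_ebasis.
    rewrite cintg_sum//; last by move=> l; exact: (cintegrableZ measurableT _ (ie l)).
    apply: eq_bigr => l _; rewrite cIZ// mulrC; congr (_ * _); rewrite /kernel_mx fcoeff_kernel_op//; exact: cint_ebasis.
  rewrite -cIB//.
  - by apply: eq_cintg => x _; rewrite /d mulrBl.
  - by apply: imul; exact: inL2m_cintegrable.
  - by apply: imul; apply: inL2m_cintegrable; exact: inL2m_trig_poly.
rewrite E.
have iN := integrable_normc measurableT (inL2m_cintegrable hd).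
apply: (@le_trans _ _ (Rintegral mu_per2 setT (fun x => B * normc (d x)))).
  apply: normc_cintg_le => //.
  - exact: cintegrable_cmeasurable (imul _ (inL2m_cintegrable hd)).
  - exact: (integrableZl measurableT B iN).
  - by move=> x _; rewrite normcM mulrC; apply: ler_wpM2r; [exact: normc_ge0|exact: mb].
rewrite RintegralZl//; apply: (le_trans (ler_wpM2l B0 (L1_le_L2 hd))).
have sqd : Num.sqrt (sqnorm d) <= e / (B * (7 * pi ^+ 2) + 1).
  have ep : 0 <= e / (B * (7 * pi ^+ 2) + 1) by rewrite ltW// divr_gt0.
  by rewrite -(ger0_norm ep) -sqrtr_sqr; apply: ler_wsqrtr.
have q0 : 0 <= B * (7 * pi ^+ 2) by rewrite mulr_ge0// mulr_ge0// sqr_ge0.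
rewrite mulrA; apply: (le_trans (ler_wpM2l q0 sqd)).
by rewrite mulrA ler_pdivrMr// mulrC ler_pM2l// lerDl.
Qed.
End absker.

Definition norm1 (m : int * int) : int := `|m.1| + `|m.2|.

(** * Exponential decay and Riemann-Lebesgue for the matrix entries *)

Section absker2.
Variable R : realType.
Local Notation TR := (measurableTypeR R).
Local Notation C := (R[i]).
Local Notation mu_per2 := (@mu_per2 R).
Local Notation mu_per := (@mu_per R).

Variable K : R * R -> R * R -> R.
Hypothesis mK : measurable_fun (setT : set ((TR * TR) * (TR * TR))) (fun p => K p.1 p.2).
Hypothesis K1per : forall e, biper (fun t => K t e).
Hypothesis K2per : forall t, biper (fun e => K t e).
Variable v : R * R -> R.
Hypothesis v0 : forall s, 0 <= v s.
Hypothesis mv : measurable_fun (setT : set (TR * TR)) v.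
Variable V : R.
Hypothesis Vint : (\int[mu_per2]_x (v x)%:E <= V%:E)%E.
Hypothesis Kv1 : forall t s, open_cell s -> `|K t (t.1 + s.1, t.2 + s.2)| <= v s.
Hypothesis Kv2 : forall e s, open_cell s -> `|K (e.1 + s.1, e.2 + s.2) e| <= v s.
Variable b : R.
Hypothesis b0 : 0 <= b.
(** The kernel along a diagonal line, with both arguments moving by the same signs (e1, e2),
    continues holomorphically to the upper strip with the same majorant. All sign patterns are
    needed, since the line must be adapted to the signs of the frequency. *)
Hypothesis line : forall (s t : R * R) (e1 e2 : R), open_cell s -> (e1 = 1 \/ e1 = -1) -> (e2 = 1 \/ e2 = -1) ->
  exists h : C -> C, [/\ forall z, 0 <= complex.Im z <= b -> cdiffable h z, forall z, 0 <= complex.Im z <= b -> normc (h z) <= v s,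
   forall x, h (toC x) = toC (K (t.1 + e1 * x, t.2 + e2 * x) (t.1 + e1 * x + s.1, t.2 + e2 * x + s.2)) &
   forall y, 0 <= y <= b -> h (Complex (2 * pi) y) = h (Complex 0 y)].

Definition sheared (s t : R * R) : R := K t (t.1 + s.1, t.2 + s.2).
Definition sheared_coef (m : int * int) (s t : R * R) : C := toC (sheared s t) * conjc (ebasis m t).

Lemma measurable_sheared s : measurable_fun (setT : set (TR * TR)) (sheared s).
Proof.
apply: (measurableT_comp mK (g := fun t : TR * TR => (t, (t.1 + s.1, t.2 + s.2)) : (TR * TR) * (TR * TR))).
apply: measurable_fun_pair => //; apply: measurable_fun_pair; exact: measurable_funD.
Qed.
Lemma cmeasurable_sheared_coef m s : cmeasurable (setT : set (TR * TR)) (sheared_coef m s).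
Proof.
apply: cmeasM; first exact: cmeasurable_toC (measurable_sheared s).
by apply: cmeasJ; exact: cmeasurable_ebasis.
Qed.

Lemma ebasis_biper m : biper (fun t : R * R => ebasis m t : C).
Proof.
have E x y : ebasis m (x, y) = toC (2 * pi)^-1 * (cexpi (m.1%:~R * x) * cexpi (m.2%:~R * y)) :> C by exact: ebasisE m (x, y).
have P (j : int) (x : R) : cexpi (j%:~R * (x + 2 * pi)) = cexpi (j%:~R * x) :> C by rewrite mulrDr cexpiD cexpi_2piZ mulr1.
by case=> t1 t2; rewrite !E !P.
Qed.

Lemma sheared_coef_biper m s : biper (sheared_coef m s).
Proof.
move=> t; rewrite /sheared_coef; have [-> ->] := ebasis_biper m t; split; congr (toC _ * _); rewrite /sheared /=.
  have [-> _] := K1per (t.1 + 2 * pi + s.1, t.2 + s.2) t; rewrite addrAC.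
  by have [-> _] := K2per t (t.1 + s.1, t.2 + s.2).
have [_ ->] := K1per (t.1 + s.1, t.2 + 2 * pi + s.2) t; rewrite addrAC.
by have [_ ->] := K2per t (t.1 + s.1, t.2 + s.2).
Qed.

Lemma sheared_coef_bound m s t : open_cell s -> normc (sheared_coef m s t) <= v s * (2 * pi)^-1.
Proof.
move=> hs; rewrite normcM normc_toC normcJ normc_ebasis; apply: ler_wpM2r; last exact: Kv1.
by rewrite invr_ge0 ltW// pi2_gt0.
Qed.

(** The direction opposite to the sign of [m]: along it the conjugate of [ebasis m] varies like exp
    (i |m|_1 x), which decays in the upper half-plane. *)
Definition dir_sign (m : int) : R := if 0 < m then -1 else 1.
Lemma e_P m : (dir_sign m = 1 \/ dir_sign m = -1) /\ m%:~R * dir_sign m = - (`|m|%:~R).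
Proof.
rewrite /dir_sign; case: ltrP => h; split; [by right| |by left|].
  by rewrite mulrN1 gtr0_norm.
by rewrite mulr1 ler0_norm// intrN opprK.
Qed.

(** Moving the contour from height 0 to height [b] gains exp (- b |m|_1) from the exponential, while
    the continued kernel keeps the bound [v s]. *)
Lemma line_int m s t : open_cell s ->
  normc (cintg mu_per setT (fun x : TR => sheared_coef m s (t.1 + dir_sign m.1 * x, t.2 + dir_sign m.2 * x))) <= v s * expR (- (b * (norm1 m)%:~R)).
Proof.
move=> hs; have [p1 q1] := e_P m.1; have [p2 q2] := e_P m.2.
have [h [hd hb hx hp]] := line t hs p1 p2.
pose M : R := (norm1 m)%:~R.
pose g z := h z * conjc (ebasis m t) * cexp_up (toC M * z).
have gd' z : 0 <= complex.Im z <= b -> cdiffable g z.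
  move=> hz; apply: dfbM; first by apply: dfbM; [exact: hd|exact: cdiffable_cst].
  apply: (cdiffable_comp (f := @cexp_up R) (g := fun z => toC M * z)); first by apply: dfbM; [exact: cdiffable_cst|exact: cdiffable_id].
  by eexists; exact: hasD_cexp_up.
have holo2 : holo_on g 0 (2 * pi) 0 b by move=> x y _ hy; exact: gd'.
have per y : 0 <= y <= b -> g (Complex (2 * pi) y) = g (Complex 0 y).
  by move=> hy; rewrite /g hp// !cexp_up_scale mulr0 cexpi_2piZ cexpi0.
have E := periodic_contour b0 holo2 per.
have gx x : g (Complex x 0) = sheared_coef m s (t.1 + dir_sign m.1 * x, t.2 + dir_sign m.2 * x).
  rewrite /g cexp_up_scale mulr0 oppr0 expR0 toC1 mul1r -[Complex x 0]/(toC x) hx /sheared_coef -mulrA; congr (_ * _).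
  rewrite /ebasis !conjcM !conjc_toC -!cexpiN -mulrA -cexpiD; congr (_ * cexpi _) => /=.
  have -> : m.1%:~R * (t.1 + dir_sign m.1 * x) + m.2%:~R * (t.2 + dir_sign m.2 * x) =
    m.1%:~R * t.1 + m.2%:~R * t.2 + (m.1%:~R * dir_sign m.1 + m.2%:~R * dir_sign m.2) * x by ring.
  by rewrite q1 q2 /M /norm1 intrD; ring.
have cc x : econt (fun x => g (Complex x 0)) x.
  have [|A hA] := gd' (Complex x 0); first by rewrite /= lexx b0.
  exact: hasD_econt_h hA.
have -> : (fun x : TR => sheared_coef m s (t.1 + dir_sign m.1 * x, t.2 + dir_sign m.2 * x)) = (fun x => g (Complex x 0)).
  by apply/funext => x; rewrite gx.
rewrite -(seg_int_mu_per cc) E.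
have p0 := pi2_gt0 R.
have -> : v s * expR (- (b * (norm1 m)%:~R)) = (v s * (2 * pi)^-1 * expR (- (b * (norm1 m)%:~R))) * (2 * pi - 0).
  by rewrite subr0 mulrAC -[X in _ = X * _]mulrA mulVf ?mulr1// gt_eqF.
apply: seg_int_le; first exact: ltW.
  by apply: (holo_h holo2); rewrite lexx b0.
move=> x hx'; rewrite /g normcM [normc (h _ * _)]normcM cexp_up_scale [normc (toC _ * cexpi _)]normcM normc_cexpi mulr1.
rewrite normcJ normc_ebasis normc_toC ger0_norm ?expR_ge0//.
rewrite [M * b]mulrC; apply: ler_wpM2r; first exact: expR_ge0.
apply: ler_wpM2r; first by rewrite invr_ge0 ltW.
by apply: hb; rewrite /= lexx b0.
Qed.

(* Substituting s = e - t in the kernel, its entry at (k, l) is, up to normalization, the Fourier coefficient of diag_coef (k - l) at -l; this is what lets a shift of the contour in t give decay in k - l. *)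
Definition diag_coef m s : C := cintg mu_per2 setT (sheared_coef m s).

(** Average over all translates of the line. Integrating first in [t], translation invariance makes
    each translate contribute [diag_coef m s]; integrating first along the line gives [line_int]. A
    contour shift in one variable thus yields decay in both components of [m]. *)
Lemma diag_coef_bound m s : open_cell s -> normc (diag_coef m s) <= 2 * pi * v s * expR (- (b * (norm1 m)%:~R)).
Proof.
move=> hs; have p0 := pi2_gt0 R; pose E := v s * expR (- (b * (norm1 m)%:~R)).
pose g (p : (TR * TR) * TR) : C := sheared_coef m s (p.1.1 + dir_sign m.1 * p.2, p.1.2 + dir_sign m.2 * p.2).
have mg : cmeasurable setT g.
  have mm : measurable_fun (setT : set ((TR * TR) * TR)) (fun p => (p.1.1 + dir_sign m.1 * p.2, p.1.2 + dir_sign m.2 * p.2) : TR * TR).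
    apply: measurable_fun_pair; apply: measurable_funD; try exact: measurable_funM.
      by apply: (measurableT_comp (f := fst) (g := fst)).
    by apply: (measurableT_comp (f := snd) (g := fst)).
  have [a a'] := cmeasurable_sheared_coef m s.
  by split; [exact: (measurableT_comp a mm)|exact: (measurableT_comp a' mm)].
set M0 := v s * (2 * pi)^-1.
have M00 : 0 <= M0 by rewrite mulr_ge0// invr_ge0 ltW.
have ig : cintegrable (mu_per2 \x mu_per)%E setT g.
  apply: cintegrable_prod12 => //.
  apply: (@le_lt_trans _ _ (\int[mu_per2]_x \int[mu_per]_y M0%:E)%E).
    apply: ge0_le_integral => //.
    - by move=> x _; apply: integral_ge0 => y _; rewrite lee_fin normc_ge0.
    - apply: (@measurable_fun_fubini_tonelli_F _ _ _ _ R mu_per (fun p => (normc (g p))%:E)).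
        by apply/measurable_EFinP; exact: measurable_normc.
      by move=> p; rewrite lee_fin normc_ge0.
    - move=> x _; apply: ge0_le_integral => //; try by move=> y _; rewrite lee_fin ?normc_ge0.
        apply/measurable_EFinP; apply: measurable_normc.
        have [a a'] := mg.
        have ms : measurable_fun (setT : set TR) (fun y : TR => (x, y)) by apply: measurable_fun_pair.
        by split; [exact: (measurableT_comp a ms)|exact: (measurableT_comp a' ms)].
      by move=> y _; rewrite lee_fin; exact: sheared_coef_bound.
  have T1 : (\int[mu_per]_y M0%:E = (M0 * (2 * pi))%:E)%E.
    transitivity (M0%:E * mu_per setT)%E; first exact: integral_cst.
    by have -> : mu_per setT = (2 * pi)%:E by exact: m1T.
  rewrite T1; apply: (@le_lt_trans _ _ ((M0 * (2 * pi))%:E * mu_per2 setT)%E); first by rewrite integral_cst.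
  by have -> : mu_per2 setT = ((2 * pi) * (2 * pi))%:E; [exact: mIT|rewrite -EFinM ltry].
have [_ E1] := cfubini ig; have [_ E2] := cfubini_swap ig.
have c1 : cintg (mu_per2 \x mu_per)%E setT g = toC (2 * pi) * diag_coef m s.
  rewrite E2 (_ : (fun y => _) = (fun=> diag_coef m s)).
    by rewrite cintg_cst -[fine _]/(fine (mu_per setT)) m1T.
  apply/funext => x; rewrite /diag_coef -[RHS](@cintg_shift _ _ (dir_sign m.1 * x, dir_sign m.2 * x))//; [exact: cmeasurable_sheared_coef|exact: sheared_coef_biper].
have c2 : normc (cintg (mu_per2 \x mu_per)%E setT g) <= E * ((2 * pi) * (2 * pi)).
  rewrite E1; have -> : E * ((2 * pi) * (2 * pi)) = Rintegral mu_per2 setT (fun _ : TR * TR => E).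
    by rewrite Rintegral_cst// -[fine _]/(fine (mu_per2 setT)) mIT.
  apply: normc_cintg_le => //.
  - exact: cintegrable_cmeasurable (cfubini ig).1.
  - by apply: finite_measure_integrable_cst.
  - by move=> t _; exact: line_int.
move: c2; rewrite c1 normcM normc_toC gtr0_norm// => c2.
rewrite -(ler_pM2l p0); apply: (le_trans c2).
rewrite le_eqVlt; apply/orP; left; apply/eqP; rewrite /E; ring.
Qed.

Lemma measurable_Ks2 t : measurable_fun (setT : set (TR * TR)) (fun s => sheared s t).
Proof.
apply: (measurableT_comp mK (g := fun s : TR * TR => (t, (t.1 + s.1, t.2 + s.2)) : (TR * TR) * (TR * TR))).
apply: measurable_fun_pair => //; apply: measurable_fun_pair; exact: measurable_funD.
Qed.

Lemma sheared_integral_le t : (\int[mu_per2]_s (`|sheared s t|)%:E <= V%:E)%E.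
Proof.
apply: le_trans Vint; apply: ae_ge0_le_integral => //; try (by move=> x _; rewrite lee_fin ?normr_ge0 ?v0); try exact/measurable_EFinP.
- by apply/measurable_EFinP; apply: measurableT_comp => //; exact: measurable_Ks2.
- apply: (@filterS _ _ (ae_filter_ringOfSetsType mu_per2) _ _ _ (@ae_open_cell R)) => s hs _.
  by rewrite lee_fin; exact: Kv1.
Qed.

Lemma ifs_prod m : cintegrable (mu_per2 \x mu_per2)%E setT (fun p : (TR * TR) * (TR * TR) => sheared_coef m p.2 p.1).
Proof.
have mf : cmeasurable setT (fun p : (TR * TR) * (TR * TR) => sheared_coef m p.2 p.1).
  apply: cmeasM.
    apply: cmeasurable_toC.
    apply: (measurableT_comp mK (g := fun p : (TR * TR) * (TR * TR) => (p.1, (p.1.1 + p.2.1, p.1.2 + p.2.2)) : (TR * TR) * (TR * TR))).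
    apply: measurable_fun_pair => //; apply: measurable_fun_pair; apply: measurable_funD.
    - by apply: (measurableT_comp (f := fst) (g := fst)).
    - by apply: (measurableT_comp (f := fst) (g := snd)).
    - by apply: (measurableT_comp (f := snd) (g := fst)).
    - by apply: (measurableT_comp (f := snd) (g := snd)).
  have [a a'] := cmeasJ (@cmeasurable_ebasis R m).
  by split; [apply: (measurableT_comp a)|apply: (measurableT_comp a')].
have VV := V_ge0 v0 Vint.
apply: cintegrable_prod12 => //.
apply: (@le_lt_trans _ _ (\int[mu_per2]_x ((2 * pi)^-1 * V)%:E)%E); last first.
  apply: (@le_lt_trans _ _ (((2 * pi)^-1 * V)%:E * mu_per2 setT)%E); first by rewrite integral_cst.
  by have -> : mu_per2 setT = ((2 * pi) * (2 * pi))%:E; [exact: mIT|rewrite -EFinM ltry].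
have pn : 0 <= (2 * pi : R)^-1 by rewrite invr_ge0 ltW// pi2_gt0.
apply: ge0_le_integral => //; try by move=> x _; rewrite lee_fin mulr_ge0.
- by move=> x _; apply: integral_ge0 => y _; rewrite lee_fin normc_ge0.
- apply: (@measurable_fun_fubini_tonelli_F _ _ _ _ R mu_per2 (fun p => (normc (sheared_coef m p.2 p.1))%:E)).
    by apply/measurable_EFinP; exact: measurable_normc.
  by move=> p; rewrite lee_fin normc_ge0.
- move=> t _; have mt : measurable_fun (setT : set (TR * TR)) (fun s => (`|sheared s t|)%:E).
    by apply/measurable_EFinP; apply: measurableT_comp => //; exact: measurable_Ks2.
  rewrite (_ : (fun x => _) = (fun s => ((2 * pi)^-1)%:E * (`|sheared s t|)%:E)%E); last first.
    by apply/funext => s; rewrite /sheared_coef normcM normc_toC normcJ normc_ebasis mulrC EFinM.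
  rewrite ge0_integralZl// EFinM; apply: lee_wpmul2l; first by rewrite lee_fin.
  exact: sheared_integral_le.
Qed.

Lemma kernel_mx_diagE k l : kernel_mx K k l = cintg mu_per2 setT (fun s => diag_coef (k - l) s * ebasis l s).
Proof.
have ip := ifs_prod (k - l).
have ip2 : cintegrable (mu_per2 \x mu_per2)%E setT (fun p : (TR * TR) * (TR * TR) => sheared_coef (k - l) p.2 p.1 * ebasis l p.2).
  apply: (cintegrableM measurableT (M := (2 * pi)^-1)) => //.
    have [a a'] := @cmeasurable_ebasis R l.
    by split; [apply: (measurableT_comp a)|apply: (measurableT_comp a')].
  by move=> p _; rewrite normc_ebasis.
have mix (t s : R * R) : ebasis l (t.1 + s.1, t.2 + s.2) * conjc (ebasis k t) = conjc (ebasis (k - l) t) * ebasis l s :> C.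
  rewrite /ebasis !conjcM !conjc_toC -!cexpiN /=.
  have -> : l.1%:~R * (t.1 + s.1) + l.2%:~R * (t.2 + s.2) = (l.1%:~R * t.1 + l.2%:~R * t.2) + (l.1%:~R * s.1 + l.2%:~R * s.2) by ring.
  have -> : - ((k.1 - l.1)%:~R * t.1 + (k.2 - l.2)%:~R * t.2) = - (k.1%:~R * t.1 + k.2%:~R * t.2) + (l.1%:~R * t.1 + l.2%:~R * t.2).
    by rewrite !intrB; ring.
  rewrite !cexpiD.
  have aux (a x y z : C) : a * (x * y) * (a * z) = a * (z * x) * (a * y) by ring.
  exact: aux.
have bp t : biper (fun e => toC (K t e) * ebasis l e).
  move=> e; have [-> ->] := ebasis_biper l e; by have [-> ->] := K2per t e.
transitivity (cintg (mu_per2 \x mu_per2)%E setT (fun p : (TR * TR) * (TR * TR) => sheared_coef (k - l) p.2 p.1 * ebasis l p.2)).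
  have [_ ->] := cfubini ip2.
  rewrite /kernel_mx /fcoeff; apply: eq_cintg => t _.
  have mKl : cmeasurable (setT : set (TR * TR)) (fun e => toC (K t e) * ebasis l e).
    by apply: cmeasM; [apply: cmeasurable_toC; exact: measurable_kernel2|exact: cmeasurable_ebasis].
  rewrite /kernel_op -(@cintg_shift _ _ t mKl (bp t)) mulrC -cIZ//.
    apply: eq_cintg => s _; rewrite /shift2 /= [s.1 + _]addrC [s.2 + _]addrC mulrC -mulrA mix /sheared_coef /sheared.
    by rewrite -mulrA.
  have mt : measurable_fun (setT : set (TR * TR)) (fun s => sheared s t).
    apply: (measurableT_comp mK (g := fun s : TR * TR => (t, (t.1 + s.1, t.2 + s.2)) : (TR * TR) * (TR * TR))).
    apply: measurable_fun_pair => //; apply: measurable_fun_pair; exact: measurable_funD.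
  have ik : mu_per2.-integrable setT (fun s : TR * TR => (sheared s t)%:E).
    apply/integrableP; split; first exact/measurable_EFinP.
    by apply: le_lt_trans (sheared_integral_le t) _; rewrite ltry.
  have ikc : cintegrable mu_per2 setT (fun s : TR * TR => toC (sheared s t)).
    by split => //=; rewrite (_ : (fun x => _) = cst 0%E)//; exact: integrable0.
  have := @cintegrableM _ _ _ mu_per2 setT measurableT _ (fun s => ebasis l (shift2 t s)) (2 * pi)^-1 ikc _ _.
  rewrite (_ : (fun x => toC (sheared x t) * _) = (fun x => toC (K t (shift2 t x)) * ebasis l (shift2 t x))); last first.
    by apply/funext => s; rewrite /sheared /shift2 [s.1 + _]addrC [s.2 + _]addrC.
  apply.
    have [a a'] := @cmeasurable_ebasis R l.
    by split; [apply: (measurableT_comp a)|apply: (measurableT_comp a')]; exact: measurable_shift2.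
  by move=> s _; rewrite normc_ebasis.
have [h ->] := cfubini_swap ip2; have [h' _] := cfubini_swap ip.
apply: ae_eq_cintg => //.
- exact: cintegrable_cmeasurable h.
- by apply: cmeasM; [exact: cintegrable_cmeasurable h'|exact: cmeasurable_ebasis].
rewrite /ae_eq; apply: (@filterS _ _ (ae_filter_ringOfSetsType mu_per2) _ _ _ (@ae_open_cell R)) => s hs _.
rewrite /diag_coef mulrC -cIZ//; first by apply: eq_cintg => t _; rewrite mulrC.
apply: (@cintegrable_bounded _ _ _ mu_per2 _ (v s * (2 * pi)^-1)); first exact: cmeasurable_sheared_coef.
by move=> t; exact: sheared_coef_bound.
Qed.

Lemma diag_coef_integrable m : cintegrable mu_per2 setT (diag_coef m).
Proof. exact: (cfubini_swap (ifs_prod m)).1. Qed.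

Lemma kernel_mx_bound k l : normc (kernel_mx K k l) <= V * expR (- (b * (norm1 (k - l))%:~R)).
Proof.
rewrite kernel_mx_diagE; have p0 := pi2_gt0 R; set E := expR _.
have E0 : 0 <= E by exact: expR_ge0.
have iv' := v_integrable v0 mv Vint.
apply: (@le_trans _ _ (Rintegral mu_per2 setT (fun s : TR * TR => E * v s))).
  apply: normc_cintg_le_ae.
  - apply: (cintegrableM measurableT (M := (2 * pi)^-1)); [exact: diag_coef_integrable|exact: cmeasurable_ebasis|].
    by move=> s _; rewrite normc_ebasis.
  - exact: (integrableZl measurableT E iv').
  - apply: (@filterS _ _ (ae_filter_ringOfSetsType mu_per2) _ _ _ (@ae_open_cell R)) => s hs.
    rewrite normcM normc_ebasis ler_pdivrMr//; apply: (le_trans (diag_coef_bound (k - l) hs)); rewrite -/E.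
    by rewrite le_eqVlt; apply/orP; left; apply/eqP; ring.
rewrite RintegralZl// mulrC; apply: ler_wpM2r => //; exact: (v_integral_le v0 Vint).
Qed.

Lemma kernel_mx_RL m e : 0 < e -> exists L, forall l, l \notin box L -> normc (kernel_mx K (l + m) l) <= e.
Proof.
move=> e0; have [L HL] := riemann_lebesgue (diag_coef_integrable m) e0; exists L => l hl.
have := HL (- l); rewrite mem_box /= !normrN -mem_box => /(_ hl).
rewrite kernel_mx_diagE addrC addKr /fcoeff.
have -> // : (fun x : TR * TR => diag_coef m x * conjc (ebasis (- l) x)) = (fun x => diag_coef m x * ebasis l x).
apply/funext => x; congr (_ * _); rewrite /ebasis conjcM conjc_toC -cexpiN /= !intrN; congr (_ * cexpi _); ring.
Qed.
End absker2.

(** * Matrices with exponential off-diagonal decay *)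

Section esums.
Variable R : realType.
Local Notation C := (R[i]).
Definition exp_wt (be : R) (m : int * int) : R := expR (- (be * (norm1 m)%:~R)).

Lemma exp_wt_ge0 be m : 0 <= exp_wt be m. Proof. exact: expR_ge0. Qed.


Lemma geo_nat (r : R) (s : seq nat) : 0 <= r < 1 -> uniq s -> \sum_(i <- s) r ^+ i <= (1 - r)^-1.
Proof.
move=> /andP[r0 r1] us; have r1' : 0 < 1 - r by rewrite subr_gt0.
pose N := (\max_(i <- s) i).+1.
apply: (@le_trans _ _ (\sum_(i <- iota 0 N) r ^+ i)).
  apply: sum_sub_uniq => // [i hi|i]; last by rewrite exprn_ge0.
  by rewrite mem_iota /= add0n /N ltnS; apply: (@leq_bigmax_seq _ _ xpredT id).
have -> : \sum_(i <- iota 0 N) r ^+ i = (1 - r ^+ N) / (1 - r).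
  elim: N => [|n IH]; first by rewrite big_nil expr0 subrr mul0r.
  rewrite -addn1 iotaD big_cat /= IH add0n big_seq1 addn1 exprS.
  by field; rewrite gt_eqF.
by rewrite ler_pdivrMr// mulVf ?gt_eqF// gerBl exprn_ge0.
Qed.

Lemma geo_int (r : R) (s : seq int) : 0 <= r < 1 -> uniq s -> \sum_(i <- s) r ^+ (absz i) <= 2 * (1 - r)^-1.
Proof.
move=> hr us; rewrite (bigID (fun i => 0 <= i)) /= mulr_natl mulr2n.
rewrite -[X in X + _]big_filter -[X in _ + X]big_filter.
have key (P : pred int) : {in [seq i <- s | P i] &, injective absz} -> \sum_(i <- [seq i <- s | P i]) r ^+ (absz i) <= (1 - r)^-1.
  move=> inj; rewrite -(big_map absz xpredT (fun i => r ^+ i)); apply: geo_nat => //.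
  by rewrite map_inj_in_uniq// filter_uniq.
apply: lerD; apply: key => i j; rewrite !mem_filter /= => /andP[hi _] /andP[hj _] h.
  by rewrite -(gez0_abs hi) -(gez0_abs hj) h.
rewrite -ltNge in hi; rewrite -ltNge in hj; apply: oppr_inj.
by rewrite -(ltz0_abs hi) -(ltz0_abs hj) h.
Qed.

Lemma exp_wt_sum be : 0 < be -> exists2 S, 0 <= S & forall s, uniq s -> \sum_(m <- s) exp_wt be m <= S.
Proof.
move=> b0; pose r := expR (- be).
have hr : 0 <= r < 1 by rewrite expR_ge0 /= -expR0 ltr_expR oppr_lt0.
pose S1 := 2 * (1 - r)^-1.
have S10 : 0 <= S1 by rewrite mulr_ge0// invr_ge0 subr_ge0 ltW//; case/andP: hr.
exists (S1 * S1); first by rewrite mulr_ge0.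
move=> s us; have [n sn] := in_big_box s.
apply: (le_trans (sum_sub_uniq us sn (exp_wt_ge0 be))).
have EE m : exp_wt be m = r ^+ (absz m.1) * r ^+ (absz m.2).
  rewrite -exprD /r -expRM_natl /exp_wt; congr expR.
  have -> : norm1 m = (absz m.1 + absz m.2)%N :> int by rewrite /norm1; lia.
  by rewrite mulrN mulrC.
have -> : \sum_(k <- box n) exp_wt be k = (\sum_(i < Nn n) r ^+ (absz (idx i))) * (\sum_(j < Nn n) r ^+ (absz (idx j))).
  rewrite -sum_box mulr_suml; apply: eq_bigr => i _; rewrite mulr_sumr; apply: eq_bigr => j _.
  by rewrite EE.
have one : \sum_(i < Nn n) r ^+ (absz (idx i)) <= S1.
  rewrite -(big_map (@idx n) xpredT (fun z : int => r ^+ (absz z))) /=; apply: geo_int => //.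
  by rewrite map_inj_uniq ?index_enum_uniq//; exact: idx_inj.
by apply: ler_pM => //; apply: sumr_ge0 => i _; rewrite exprn_ge0//; case/andP: hr.
Qed.

(** Where |m|_1 > T, split off exp (- b |m|_1) <= exp (- b T); the remaining exponent be - b > 0
    still sums over the lattice. So the tail loses no power of T. *)
Lemma exp_wt_tail be b : b < be -> 0 <= b -> exists2 S, 0 <= S & forall T s, uniq s ->
  \sum_(m <- s | T < (norm1 m)%:~R) exp_wt be m <= S * expR (- (b * T)).
Proof.
move=> bb b0; have [|S S0 HS] := @exp_wt_sum (be - b); first by rewrite subr_gt0.
exists S => // T s us.
apply: (@le_trans _ _ (\sum_(m <- s | T < (norm1 m)%:~R) (exp_wt (be - b) m * expR (- (b * T))))).
  apply: ler_sum => m hm; rewrite /exp_wt -expRD ler_expR.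
  have := ler_wpM2l b0 (ltW hm); lra.
rewrite -mulr_suml; apply: ler_wpM2r; first exact: expR_ge0.
by rewrite -big_filter; apply: HS; exact: filter_uniq.
Qed.

Lemma weighted_cauchy_schwarz (I : Type) (s : seq I) (a y : I -> R) : (forall i, 0 <= a i) -> (forall i, 0 <= y i) ->
  (\sum_(i <- s) a i * y i) ^+ 2 <= (\sum_(i <- s) a i) * (\sum_(i <- s) a i * y i ^+ 2).
Proof.
move=> a0 y0; elim: s => [|i s IH]; first by rewrite !big_nil expr0n mul0r.
rewrite !big_cons.
have Y0 : 0 <= \sum_(i <- s) a i * y i by apply: sumr_ge0 => j _; rewrite mulr_ge0.
have A0 : 0 <= \sum_(i <- s) a i by apply: sumr_ge0.
have Z0 : 0 <= \sum_(i <- s) a i * y i ^+ 2 by apply: sumr_ge0 => j _; rewrite mulr_ge0// sqr_ge0.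
move: (\sum_(i <- s) a i * y i) (\sum_(i <- s) a i) (\sum_(i <- s) a i * y i ^+ 2) Y0 A0 Z0 IH => Y A Z Y0 A0 Z0 IH.
have := a0 i; have := y0 i; move: (a i) (y i) => c u u0 c0.
(* The induction hypothesis Y^2 <= A Z gives (2 Y u)^2 <= 4 (A u^2) Z, and the arithmetic-geometric
   inequality bounds this by (A u^2 + Z)^2. *)
have key : 2 * Y * u <= A * u ^+ 2 + Z.
  rewrite leNgt; apply/negP => h.
  have p0 : 0 <= A * u ^+ 2 + Z by rewrite addr_ge0// mulr_ge0// sqr_ge0.
  have : (A * u ^+ 2 + Z) ^+ 2 < (2 * Y * u) ^+ 2 by rewrite ltr_pXn2r// nnegrE ?mulr_ge0.
  have : (2 * Y * u) ^+ 2 <= 4 * (A * Z) * u ^+ 2.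
    have -> : (2 * Y * u) ^+ 2 = 4 * Y ^+ 2 * u ^+ 2 by ring.
    by apply: ler_wpM2r; [exact: sqr_ge0|rewrite ler_pM2l].
  have := sqr_ge0 (A * u ^+ 2 - Z).
  have -> : (A * u ^+ 2 - Z) ^+ 2 = (A * u ^+ 2 + Z) ^+ 2 - 4 * (A * Z) * u ^+ 2 by ring.
  lra.
have := ler_wpM2l c0 key.
have -> : (c * u + Y) ^+ 2 = Y ^+ 2 + c * (2 * Y * u) + c ^+ 2 * u ^+ 2 by ring.
have -> : (c + A) * (c * u ^+ 2 + Z) = A * Z + c * (A * u ^+ 2 + Z) + c ^+ 2 * u ^+ 2 by ring.
lra.
Qed.

(** Weighted Cauchy-Schwarz in each row, then exchange of the sums. Row and column bounds are kept
    apart, since small column sums with merely bounded row sums already make the product small. *)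
Lemma schur (I J : eqType) (s : seq I) (t : seq J) (A : I -> J -> C) (x : J -> C) (al ga : R) :
  (forall k, k \in s -> \sum_(l <- t) normc (A k l) <= al) -> (forall l, l \in t -> \sum_(k <- s) normc (A k l) <= ga) -> 0 <= al ->
  \sum_(k <- s) normc (\sum_(l <- t) A k l * x l) ^+ 2 <= al * ga * \sum_(l <- t) normc (x l) ^+ 2.
Proof.
move=> ha hg al0.
apply: (@le_trans _ _ (\sum_(k <- s) al * \sum_(l <- t) (normc (A k l) * normc (x l) ^+ 2))).
  rewrite big_seq [leRHS]big_seq; apply: ler_sum => k ks.
  apply: (@le_trans _ _ ((\sum_(l <- t) normc (A k l) * normc (x l)) ^+ 2)).
    rewrite ler_pXn2r ?nnegrE ?normc_ge0//; last by apply: sumr_ge0 => l _; rewrite mulr_ge0 ?normc_ge0.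
    apply: le_trans (ler_normc_sum _ _ _) _; apply: ler_sum => l _; by rewrite normcM.
  apply: (le_trans (weighted_cauchy_schwarz t (fun l => normc_ge0 (A k l)) (fun l => normc_ge0 (x l)))).
  apply: ler_wpM2r; last exact: ha.
  by apply: sumr_ge0 => l _; rewrite mulr_ge0 ?normc_ge0 ?sqr_ge0.
rewrite -mulr_sumr -mulrA; apply: ler_wpM2l => //.
rewrite exchange_big /= mulr_sumr big_seq [leRHS]big_seq; apply: ler_sum => l lt.
rewrite -mulr_suml; apply: ler_wpM2r; [exact: sqr_ge0|exact: hg].
Qed.

Lemma sqnorm_add (z w : C) : normc (z + w) ^+ 2 <= 2 * normc z ^+ 2 + 2 * normc w ^+ 2.
Proof.
apply: (@le_trans _ _ ((normc z + normc w) ^+ 2)).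
  by rewrite ler_pXn2r ?nnegrE ?normc_ge0 ?addr_ge0 ?normc_ge0// ler_normcD.
have := sqr_ge0 (normc z - normc w).
have -> : (normc z - normc w) ^+ 2 = normc z ^+ 2 + normc w ^+ 2 - 2 * (normc z * normc w) by ring.
have -> : (normc z + normc w) ^+ 2 = normc z ^+ 2 + normc w ^+ 2 + 2 * (normc z * normc w) by ring.
lra.
Qed.

(** Tychonoff's theorem, with real and imaginary parts as separate coordinates in [-1, 1]. A cluster
    point is all that is needed: it is approached on any finite set of coordinates, for arbitrarily
    late indices. *)
Lemma cluster_segpt (x : nat -> int * int -> C) : (forall j k, normc (x j k) <= 1) ->
  exists a : int * int -> C, forall (s : seq (int * int)) e (J : nat), 0 < e -> exists2 j, (J <= j)%N & forall k, k \in s -> normc (x j k - a k) <= e.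
Proof.
move=> x1.
pose I := ((int * int) * bool)%type.
pose y (j : nat) : prod_topology (fun _ : I => R) := fun p => if p.2 then complex.Re (x j p.1) else complex.Im (x j p.1).
have yb j p : `|y j p| <= 1.
  by apply: le_trans (x1 j p.1); rewrite /y; case: p.2; [exact: Re_le_normc|exact: Im_le_normc].
have cK : compact [set f : prod_topology (fun _ : I => R) | forall i, `[-1, 1]%classic (f i)].
  by apply: (@tychonoff I (fun=> R) (fun=> `[-1, 1]%classic)) => i; exact: segment_compact.
have [|f [_ fcoeff]] := cK (y @ \oo) _.
  by exists 0%N => // j _ i; rewrite /= in_itv /= -ler_norml; exact: yb.
exists (fun k => Complex (f (k, true)) (f (k, false))) => s e J e0.
(* Here [trig_poly] is a local name for the product space of all coordinates, in which [f] is the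
   cluster point. *)
pose trig_poly := prod_topology (fun _ : I => R).
pose D p : set trig_poly := [set h | `|h p - f p| < e / 2].
pose U (s : seq (int * int)) : set trig_poly := [set h | forall k, k \in s -> D (k, true) h /\ D (k, false) h].
have FF : Filter (nbhs (f : trig_poly)) := @nbhs_filter trig_poly f.
have nD p : nbhs (f : trig_poly) (D p).
  have H : nbhs (f : trig_poly) ((@proj I (fun=> R) p) @^-1` (ball (f p) (e / 2))).
    by apply: (@proj_continuous I (fun=> R) p f); apply: nbhsx_ballx; rewrite divr_gt0.
  have sub : (@proj I (fun=> R) p) @^-1` (ball (f p) (e / 2)) `<=` D p.
    by move=> h; rewrite /D /ball /= distrC.
  exact: (@filterS _ _ FF _ _ sub H).
have nU : nbhs (f : trig_poly) (U s).
  elim: s => [|k s IH].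
    have -> : U [::] = setT by apply/seteqP; split.
    exact: (@filterT _ _ FF).
  have H3 : nbhs (f : trig_poly) (U s `&` (D (k, true) `&` D (k, false))) by exact: (@filterI _ _ FF _ _ IH (@filterI _ _ FF _ _ (nD _) (nD _))).
  have sub : U s `&` (D (k, true) `&` D (k, false)) `<=` U (k :: s).
    by move=> h [h1 [h2 h3]] k'; rewrite in_cons => /predU1P[->|]; [split|exact: h1].
  exact: (@filterS _ _ FF _ _ sub H3).
have [|_ [[j Jj <-] hj]] := fcoeff [set y j | j in [set j | (J <= j)%N]] (U s) _ nU.
  by exists J => // j Jj; exists j.
exists j => // k ks; have [h1 h2] := hj k ks.
apply: le_trans (normc_leD _) _; rewrite ReD ImD ReN ImN /=.
have {}h1 : `|complex.Re (x j k) - f (k, true)| < e / 2 := h1.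
have {}h2 : `|complex.Im (x j k) - f (k, false)| < e / 2 := h2.
lra.
Qed.
End esums.

(** * Uniform lower bound for the truncated sections *)

Section matrix.
Variable R : realType.
Local Notation C := (R[i]).
Variable A : int * int -> int * int -> C.
Variables (C0 be : R).
Hypotheses (C00 : 0 <= C0) (be0 : 0 < be).
Hypothesis hA : forall k l, normc (A k l) <= C0 * exp_wt be (k - l).

Definition trunc_mx (T : R) k l : C := if (norm1 (k - l))%:~R <= T then A k l else 0.

Lemma trunc_mx_le T k l : normc (trunc_mx T k l) <= normc (A k l).
Proof. by rewrite /trunc_mx; case: ifP => //; rewrite normc0 normc_ge0. Qed.

Lemma norm1N m : norm1 (- m) = norm1 m.
Proof. by rewrite /norm1 /= !normrN. Qed.
Lemma EnN m : exp_wt be (- m) = exp_wt be m. Proof. by rewrite /exp_wt norm1N. Qed.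

Lemma shift_sum (s : seq (int * int)) (k : int * int) (P : pred (int * int)) (f : int * int -> R) :
  \sum_(l <- s | P (l - k)) f (l - k) = \sum_(m <- [seq l - k | l <- s] | P m) f m.
Proof. by rewrite big_map. Qed.
Lemma shift_uniq (s : seq (int * int)) k : uniq s -> uniq [seq l - k | l <- s].
Proof. by move=> us; rewrite map_inj_uniq// => x y; exact: addIr. Qed.

Lemma row_col_bounds : exists2 La, 0 <= La & forall s, uniq s ->
  (forall k, \sum_(l <- s) normc (A k l) <= La) /\ (forall l, \sum_(k <- s) normc (A k l) <= La).
Proof.
have [S S0 HS] := exp_wt_sum be0; exists (C0 * S); first exact: mulr_ge0.
move=> s us; split=> k.
- apply: (@le_trans _ _ (\sum_(l <- s) C0 * exp_wt be (l - k))).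
    by apply: ler_sum => l _; rewrite -EnN opprB.
  by rewrite -mulr_sumr (shift_sum s k xpredT); apply: ler_wpM2l => //; apply: HS; exact: shift_uniq.
- apply: (@le_trans _ _ (\sum_(l <- s) C0 * exp_wt be (l - k))); first by apply: ler_sum.
  by rewrite -mulr_sumr (shift_sum s k xpredT); apply: ler_wpM2l => //; apply: HS; exact: shift_uniq.
Qed.

Lemma trunc_mx_tails b : 0 <= b -> b < be -> exists2 S, 0 <= S & forall T s, uniq s ->
  (forall k, \sum_(l <- s) normc (A k l - trunc_mx T k l) <= S * expR (- (b * T))) /\
  (forall l, \sum_(k <- s) normc (A k l - trunc_mx T k l) <= S * expR (- (b * T))).
Proof.
move=> b0 bb; have [S S0 HS] := exp_wt_tail bb b0; exists (C0 * S); first exact: mulr_ge0.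
have dle T k l : normc (A k l - trunc_mx T k l) <= if T < (norm1 (k - l))%:~R then C0 * exp_wt be (k - l) else 0.
  by rewrite /trunc_mx ltNge; case: (_ <= T) => /=; rewrite ?subr0 ?subrr ?normc0.
move=> T s us; split=> k.
- apply: (@le_trans _ _ (\sum_(l <- s | T < (norm1 (l - k))%:~R) C0 * exp_wt be (l - k))).
    by rewrite [leRHS]big_mkcond /=; apply: ler_sum => l _; rewrite -EnN -[norm1 (l - k)]norm1N opprB.
  rewrite -mulr_sumr -mulrA (shift_sum s k (fun m => T < (norm1 m)%:~R)); apply: ler_wpM2l => //.
  by apply: HS; exact: shift_uniq.
- apply: (@le_trans _ _ (\sum_(l <- s | T < (norm1 (l - k))%:~R) C0 * exp_wt be (l - k))).
    by rewrite [leRHS]big_mkcond /=; apply: ler_sum.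
  rewrite -mulr_sumr -mulrA (shift_sum s k (fun m => T < (norm1 m)%:~R)); apply: ler_wpM2l => //.
  by apply: HS; exact: shift_uniq.
Qed.

Lemma exp_small (S b eta : R) : 0 <= S -> 0 < b -> 0 < eta -> exists T0 : nat, forall T : R, T0%:R <= T -> S * expR (- (b * T)) <= eta.
Proof.
move=> S0 b0 e0; pose X := S / (eta * b).
have X0 : 0 <= X by rewrite divr_ge0// ltW// mulr_gt0.
exists (Num.bound X) => T hT.
have hX : X <= T by apply: le_trans hT; apply: ltW; exact: archi_boundP.
rewrite expRN ler_pdivrMr ?expR_gt0//.
have h1 : b * T <= expR (b * T) by have := expR_ge1Dx (b * T); lra.
apply: (@le_trans _ _ (eta * (b * T))); last by rewrite ler_pM2l.
by rewrite mulrA -ler_pdivrMl ?mulr_gt0// mulrC.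
Qed.

Lemma notin_box M m : m \notin box M -> M%:R < (norm1 m)%:~R :> R.
Proof.
rewrite mem_box negb_and -!ltNge -[M%:R]/(M%:Z%:~R) ltr_int /norm1 => h.
by case/orP: h => h; apply: (lt_le_trans h); rewrite ?lerDl ?lerDr.
Qed.

(** An index [l] outside the box of size [T0] plus |k|_1 satisfies |l - k|_1 > T0, so a fixed row
    has only the exponential tail left. *)
Lemma row_tail k eta : 0 < eta -> exists m0, forall m s, (m0 <= m)%N -> uniq s -> \sum_(l <- s | l \notin box m) normc (A k l) <= eta.
Proof.
move=> e0; have b2 : be / 2 < be by rewrite ltr_pdivrMr// ltr_pMr// ltr1n.
have b20 : 0 < be / 2 by rewrite divr_gt0.
have [S S0 HS] := exp_wt_tail b2 (ltW b20).
have [T0 HT] := exp_small (mulr_ge0 C00 S0) b20 e0.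
exists (T0 + absz (norm1 k))%N => m s hm us.
apply: (@le_trans _ _ (\sum_(l <- s | (T0%:R : R) < (norm1 (l - k))%:~R) C0 * exp_wt be (l - k))); last first.
  rewrite -mulr_sumr (shift_sum s k (fun m => (T0%:R : R) < (norm1 m)%:~R)).
  apply: le_trans (HT _ (lexx _)); rewrite -[leRHS]mulrA; apply: ler_wpM2l => //; apply: HS; exact: shift_uniq.
rewrite [leLHS]big_mkcond [leRHS]big_mkcond /=; apply: ler_sum => l _.
case: ifPn => hl; last by case: ifP => _ //; rewrite mulr_ge0 ?exp_wt_ge0.
have h : T0%:R < (norm1 (l - k))%:~R :> R.
  have h1 := notin_box hl; rewrite -[m%:R]/(m%:Z%:~R) ltr_int in h1.
  rewrite -[T0%:R]/(T0%:Z%:~R) ltr_int; move: h1 hm; rewrite /norm1 /=; lia.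
by rewrite h -EnN opprB.
Qed.

Hypothesis hRL : forall m e, 0 < e -> exists L, forall l, l \notin box L -> normc (A (l + m) l) <= e.

Lemma RL_seq (t : seq (int * int)) e : 0 < e -> exists L, forall m l, m \in t -> l \notin box L -> normc (A (l + m) l) <= e.
Proof.
move=> e0; elim: t => [|m t [L HL]]; first by exists 0%N.
have [L' HL'] := hRL m e0; exists (maxn L L') => m' l.
rewrite in_cons => /predU1P[->|mt] hl.
  by apply: HL'; apply: contra hl; apply: box_sub; rewrite leq_maxr.
by apply: HL => //; apply: contra hl; apply: box_sub; rewrite leq_maxl.
Qed.

(** Far from the diagonal the exponential decay is small uniformly in [l]; near it only finitely
    many diagonals remain, and [hRL] makes each of them small. This is the compactness of [A] in
    quantitative form. *)
Lemma col_small eta : 0 < eta -> exists L, forall l s, l \notin box L -> uniq s -> \sum_(k <- s) normc (A k l) <= eta.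
Proof.
move=> e0; have b2 : be / 2 < be by rewrite ltr_pdivrMr// ltr_pMr// ltr1n.
have b20 : 0 < be / 2 by rewrite divr_gt0.
have e2 : 0 < eta / 2 by rewrite divr_gt0.
have [S S0 HS] := exp_wt_tail b2 (ltW b20).
have [M HM] := exp_small (mulr_ge0 C00 S0) b20 e2.
pose sz : R := (size (box M))%:R.
have sz0 : 0 < sz + 1 by rewrite ltr_wpDl// ler0n.
have [L HL] := RL_seq (box M) (divr_gt0 e2 sz0).
exists L => l s hl us.
rewrite (bigID (fun k => k - l \in box M)) /=.
have p1 : \sum_(k <- s | k - l \in box M) normc (A k l) <= eta / 2.
  apply: (@le_trans _ _ (\sum_(k <- s | k - l \in box M) (eta / 2 / (sz + 1)))).
    by apply: ler_sum => k hk; have := HL _ _ hk hl; rewrite addrC subrK.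
  rewrite (shift_sum s l (fun m => m \in box M) (fun=> eta / 2 / (sz + 1))) -big_filter.
  apply: (@le_trans _ _ (\sum_(m <- box M) (eta / 2 / (sz + 1)))).
    apply: sum_sub_uniq; first by apply: filter_uniq; exact: shift_uniq.
      by move=> m; rewrite mem_filter => /andP[].
    by move=> _; rewrite !divr_ge0 ?ltW.
  rewrite big_const_seq count_predT iter_addr_0 -[leLHS]mulr_natr -/sz -[leRHS]mulr1 -[leLHS]mulrA ler_pM2l//.
  by rewrite mulrC ler_pdivrMr// mul1r lerDl.
have p2 : \sum_(k <- s | k - l \notin box M) normc (A k l) <= eta / 2.
  apply: (@le_trans _ _ (\sum_(k <- s | (M%:R : R) < (norm1 (k - l))%:~R) C0 * exp_wt be (k - l))); last first.
    rewrite -mulr_sumr (shift_sum s l (fun m => (M%:R : R) < (norm1 m)%:~R)).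
    apply: le_trans (HM _ (lexx _)); rewrite -[leRHS]mulrA; apply: ler_wpM2l => //; apply: HS; exact: shift_uniq.
  rewrite [leLHS]big_mkcond [leRHS]big_mkcond /=; apply: ler_sum => k _.
  case: ifPn => hk; last by case: ifP => _ //; rewrite mulr_ge0 ?exp_wt_ge0.
  by rewrite (notin_box hk).
lra.
Qed.

Hypothesis hinj : forall (a : int * int -> C) (M : R), (forall n, \sum_(k <- box n) normc (a k) ^+ 2 <= M) ->
  (forall k e, 0 < e -> exists N, forall n, (N <= n)%N -> normc (a k - \sum_(l <- box n) A k l * a l) <= e) ->
  forall k, a k = 0.
Variable T : nat -> R.
Hypothesis hT : forall x, exists N, forall n, (N <= n)%N -> x <= T n.

(* Compactness: unit vectors on which the truncated matrices tend to 0 would have a coordinatewise cluster point. It solves the homogeneous equation, and it is nonzero because the matrix entries tend to 0 along diagonals, so that the identity dominates away from the origin. *)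
Lemma bad_cluster (nj : nat -> nat) (x : nat -> int * int -> C) :
  (forall j, (j <= nj j)%N) -> (forall j k, k \notin box (nj j) -> x j k = 0) ->
  (forall j, \sum_(k <- box (nj j)) normc (x j k) ^+ 2 = 1) ->
  (forall j, \sum_(k <- box (nj j)) normc (x j k - \sum_(l <- box (nj j)) trunc_mx (T (nj j)) k l * x j l) ^+ 2 <= (j.+1%:R)^-1) -> False.
Proof.
move=> hn hsupp h1 hres.
have [La La0 HLa] := row_col_bounds.
have x1 j k : normc (x j k) <= 1.
  have [kb|kb] := boolP (k \in box (nj j)); last by rewrite hsupp// normc0.
  rewrite -(ler_pXn2r (n := 2)) ?nnegrE ?normc_ge0// expr1n -(h1 j) (bigD1_seq k) ?box_uniq//= lerDl.
  by apply: sumr_ge0 => i _; exact: sqr_ge0.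
have xbox j (s : seq (int * int)) : uniq s -> \sum_(k <- s) normc (x j k) ^+ 2 <= 1.
  move=> us; rewrite (bigID (fun k => k \in box (nj j))) /= [X in _ + X]big1 ?addr0; last first.
    by move=> k kb; rewrite hsupp// normc0 expr0n.
  rewrite -big_filter -(h1 j); apply: sum_sub_uniq; [exact: filter_uniq| |by move=> k; exact: sqr_ge0].
  by move=> k; rewrite mem_filter => /andP[].
have [a Ha] := cluster_segpt x1.
have inv_small (e : R) : 0 < e -> exists J : nat, forall j, (J <= j)%N -> (j.+1%:R)^-1 <= e.
  move=> e0; exists (Num.bound e^-1) => j hj.
  rewrite invf_ple ?posrE ?ltr0n//; apply: ltW; apply: (@lt_le_trans _ _ (Num.bound e^-1)%:R).
    by apply: archi_boundP; rewrite invr_ge0 ltW.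
  by rewrite ler_nat (leq_trans hj).
have a0 : forall k, a k = 0.
  (* The bound 4: on a fixed box |a_k|^2 <= 2 |x_k|^2 + 2 |a_k - x_k|^2; the first terms sum to at
     most 2, and closeness 1 / (sz + 1) on [sz] indices keeps the others below 2. *)
  apply: (hinj (M := 4)).
  - move=> m; pose sz : R := (size (box m))%:R.
    have sz0 : 0 < sz + 1 by rewrite ltr_wpDl// ler0n.
    have e0 : 0 < Num.min 1 (sz + 1)^-1 by rewrite lt_min ltr01 invr_gt0.
    have [j _ hj] := Ha (box m) _ 0%N e0.
    apply: (@le_trans _ _ (\sum_(k <- box m) (2 * normc (x j k) ^+ 2 + 2 * (sz + 1)^-1))).
      rewrite big_seq [leRHS]big_seq; apply: ler_sum => k km.
      have -> : a k = x j k + (a k - x j k) by rewrite addrC subrK.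
      apply: (le_trans (sqnorm_add _ _)); rewrite lerD2l ler_pM2l// distcC.
      have h := hj k km; have [ha hb] : normc (x j k - a k) <= 1 /\ normc (x j k - a k) <= (sz + 1)^-1.
        by move: h; rewrite le_min => /andP.
      rewrite expr2; apply: le_trans hb; by rewrite ler_piMl ?normc_ge0.
    rewrite big_split /= -mulr_sumr big_const_seq count_predT iter_addr_0 -mulr_natr -/sz.
    have := xbox j (box m) (box_uniq m).
    have : 2 * (sz + 1)^-1 * sz <= 2.
      by rewrite mulrAC ler_pdivrMr//; lra.
    lra.
  - move=> k e e0; have e5 : 0 < e / 5 by rewrite divr_gt0.
    have [m0 Hm0] := row_tail k e5.
    have [N0 HN0] := in_big_box [:: k].
    exists (maxn m0 N0) => n hmn.
    have [hm hN] : (m0 <= n)%N /\ (N0 <= n)%N by move: hmn; rewrite geq_max => /andP.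
    have b2 : be / 2 < be by rewrite ltr_pdivrMr// ltr_pMr// ltr1n.
    have b20 : 0 < be / 2 by rewrite divr_gt0.
    have [S S0 HS] := trunc_mx_tails (ltW b20) b2.
    have [T0 HT0] := exp_small S0 b20 e5.
    have [N1 HN1] := hT T0%:R.
    have [J HJ] := inv_small _ (exprn_gt0 2 e5).
    have La1 : 0 < La + 1 by lra.
    have ee : 0 < Num.min (e / 5) (e / 5 / (La + 1)) by rewrite lt_min e5 divr_gt0.
    have [j hj Hj] := Ha (k :: box n) _ (maxn (maxn N1 J) n) ee.
    have [[hj1 hj2] hj3] : ((N1 <= j)%N /\ (J <= j)%N) /\ (n <= j)%N by move: hj; rewrite !geq_max => /andP[/andP[]].
    have close l : l \in k :: box n -> normc (x j l - a l) <= e / 5 /\ normc (x j l - a l) <= e / 5 / (La + 1).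
      by move=> /Hj; rewrite le_min => /andP.
    set B := box (nj j).
    have nB : (n <= nj j)%N by exact: leq_trans (hn j).
    have kB : k \in B by apply: (box_sub nB); apply: (box_sub hN); apply: HN0; rewrite mem_head.
    have Tj : S * expR (- (be / 2 * T (nj j))) <= e / 5 by apply: HT0; apply: HN1; exact: leq_trans (hn j).
    (* Five errors of e / 5: coordinate k of the cluster point, the residual of the j-th vector, the
       truncation of the matrix, the row tail outside box n, and the coordinates inside box n. *)
    have -> : a k - \sum_(l <- box n) A k l * a l =
       (a k - x j k) + ((x j k - \sum_(l <- B) trunc_mx (T (nj j)) k l * x j l) +
       ((\sum_(l <- B) trunc_mx (T (nj j)) k l * x j l - \sum_(l <- B) A k l * x j l) +
       ((\sum_(l <- B) A k l * x j l - \sum_(l <- box n) A k l * x j l) +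
       (\sum_(l <- box n) A k l * x j l - \sum_(l <- box n) A k l * a l)))) by ring.
    have q1 : normc (a k - x j k) <= e / 5 by rewrite distcC; apply: (close k _).1; rewrite mem_head.
    have q2 : normc (x j k - \sum_(l <- B) trunc_mx (T (nj j)) k l * x j l) <= e / 5.
      rewrite -(ler_pXn2r (n := 2)) ?nnegrE ?normc_ge0 ?(ltW e5)//.
      apply: le_trans (HJ j hj2); apply: le_trans (hres j).
      by rewrite [leRHS](bigD1_seq k) ?box_uniq//= lerDl; apply: sumr_ge0 => i _; exact: sqr_ge0.
    have q3 : normc (\sum_(l <- B) trunc_mx (T (nj j)) k l * x j l - \sum_(l <- B) A k l * x j l) <= e / 5.
      rewrite distcC -sumrB; apply: le_trans (ler_normc_sum _ _ _) _.
      apply: le_trans Tj; apply: le_trans ((HS (T (nj j)) B (box_uniq _)).1 k); apply: ler_sum => l _.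
      by rewrite -mulrBl normcM ler_piMr ?normc_ge0.
    have q4 : normc (\sum_(l <- B) A k l * x j l - \sum_(l <- box n) A k l * x j l) <= e / 5.
      have -> : \sum_(l <- B) A k l * x j l - \sum_(l <- box n) A k l * x j l = \sum_(l <- B | l \notin box n) A k l * x j l.
        rewrite [X in X - _](bigID (fun l => l \in box n)) /=.
        have -> : \sum_(l <- B | l \in box n) A k l * x j l = \sum_(l <- box n) A k l * x j l.
          rewrite -big_filter; apply: perm_big; apply: uniq_perm; rewrite ?filter_uniq ?box_uniq// => l.
          rewrite mem_filter andb_idr//; exact: box_sub.
        have aux (u w : C) : u + w - u = w by rewrite addrC addKr.
        exact: aux.
      apply: le_trans (ler_normc_sum _ _ _) _; apply: le_trans (Hm0 n B hm (box_uniq _)); apply: ler_sum => l _.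
      by rewrite normcM ler_piMr ?normc_ge0.
    have q5 : normc (\sum_(l <- box n) A k l * x j l - \sum_(l <- box n) A k l * a l) <= e / 5.
      rewrite -sumrB; apply: le_trans (ler_normc_sum _ _ _) _.
      apply: (@le_trans _ _ (\sum_(l <- box n) normc (A k l) * (e / 5 / (La + 1)))).
        rewrite big_seq [leRHS]big_seq; apply: ler_sum => l lb.
        rewrite -mulrBr normcM; apply: ler_wpM2l; first exact: normc_ge0.
        by apply: (close l _).2; rewrite in_cons lb orbT.
      rewrite -mulr_suml; apply: (@le_trans _ _ (La * (e / 5 / (La + 1)))).
        by apply: ler_wpM2r; [rewrite divr_ge0 ?ltW|exact: (HLa _ (box_uniq n)).1].
      by rewrite mulrA ler_pdivrMr// mulrC ler_pM2l// lerDl.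
    have n1' := ler_normcD.
    apply: le_trans (ler_normcD _ _) _; apply: (le_trans (lerD q1 (lexx _))).
    apply: (@le_trans _ _ (e / 5 + (e / 5 + (e / 5 + (e / 5 + e / 5))))); last by lra.
    rewrite lerD2l; apply: le_trans (ler_normcD _ _) _; apply: lerD => //.
    by apply: le_trans (ler_normcD _ _) _; apply: lerD => //; apply: le_trans (ler_normcD _ _) _; apply: lerD.
have La1 : 0 < La + 1 by lra.
(* The constants make both parts of the matrix term at most 1/16: far columns by [eta], coordinates
   near the origin by [e]. With residual at most 1/8, the unit vector would have squared norm at
   most 2/8 + 2 (2/16 + 2/16) = 3/4. *)
pose eta := (16 * (La + 1))^-1; have eta0 : 0 < eta by rewrite invr_gt0 mulr_gt0.
have [L HL] := col_small eta0.
pose sz : R := (size (box L))%:R.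
have sz0 : 0 < sz + 1 by rewrite ltr_wpDl// ler0n.
pose e := (16 * (La + 1) ^+ 2 * (sz + 1))^-1.
have e0 : 0 < e by rewrite invr_gt0 !mulr_gt0// exprn_gt0.
have [J HJ] := inv_small (1 / 8) ltac:(by rewrite divr_gt0).
have [j hj Hj] := Ha (box L) _ J (ltac:(by rewrite lt_min ltr01 e0) : 0 < Num.min 1 e).
set B := box (nj j); set TT := T (nj j).
have res := hres j; rewrite -/B -/TT in res.
have inv8 := HJ j hj.
have AtS s : uniq s -> (forall k, \sum_(l <- s) normc (trunc_mx TT k l) <= La) /\ (forall l, \sum_(k <- s) normc (trunc_mx TT k l) <= La).
  move=> us; have [r1 r2] := HLa s us; split=> k; [apply: le_trans (r1 k)|apply: le_trans (r2 k)]; apply: ler_sum => l _; exact: trunc_mx_le.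
pose B1 := [seq l <- B | l \in box L]; pose B2 := [seq l <- B | l \notin box L].
have u1 : uniq B1 by rewrite filter_uniq ?box_uniq.
have u2 : uniq B2 by rewrite filter_uniq ?box_uniq.
have sp k : \sum_(l <- B) trunc_mx TT k l * x j l = \sum_(l <- B1) trunc_mx TT k l * x j l + \sum_(l <- B2) trunc_mx TT k l * x j l.
  by rewrite (bigID (fun l => l \in box L)) /= /B1 /B2 !big_filter.
have s1 : \sum_(k <- B) normc (\sum_(l <- B1) trunc_mx TT k l * x j l) ^+ 2 <= La * La * (sz * e).
  apply: (@le_trans _ _ (La * La * \sum_(l <- B1) normc (x j l) ^+ 2)).
    apply: schur => //; [by move=> k _; exact: (AtS B1 u1).1|by move=> l _; exact: (AtS B (box_uniq _)).2].
  apply: ler_wpM2l; first exact: mulr_ge0.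
  apply: (@le_trans _ _ (\sum_(l <- box L) e)); last by rewrite big_const_seq count_predT iter_addr_0 -mulr_natr mulrC.
  apply: (@le_trans _ _ (\sum_(l <- B1) e)).
    rewrite big_seq [leRHS]big_seq; apply: ler_sum => l; rewrite mem_filter => /andP[lL _].
    have := Hj l lL; rewrite a0 subr0 le_min => /andP[h1' h2'].
    rewrite expr2; apply: le_trans h2'; by rewrite ler_piMl ?normc_ge0.
  apply: sum_sub_uniq => //; last by move=> _; exact: ltW.
  by move=> l; rewrite mem_filter => /andP[].
have s2 : \sum_(k <- B) normc (\sum_(l <- B2) trunc_mx TT k l * x j l) ^+ 2 <= La * eta * 1.
  apply: (@le_trans _ _ (La * eta * \sum_(l <- B2) normc (x j l) ^+ 2)).
    apply: schur => //; first by move=> k _; exact: (AtS B2 u2).1.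
    move=> l; rewrite mem_filter => /andP[lL _]; apply: le_trans (HL l B lL (box_uniq _)).
    by apply: ler_sum => k _; exact: trunc_mx_le.
  apply: ler_wpM2l; [by rewrite mulr_ge0// ltW|exact: xbox].
have f : 1 <= 2 * (j.+1%:R)^-1 + 2 * (2 * (La * La * (sz * e)) + 2 * (La * eta * 1)).
  rewrite -{1}(h1 j) -/B.
  apply: (@le_trans _ _ (\sum_(k <- B) (2 * normc (x j k - \sum_(l <- B) trunc_mx TT k l * x j l) ^+ 2 +
     2 * (2 * normc (\sum_(l <- B1) trunc_mx TT k l * x j l) ^+ 2 + 2 * normc (\sum_(l <- B2) trunc_mx TT k l * x j l) ^+ 2)))).
    apply: ler_sum => k _.
    rewrite -{1}(subrK (\sum_(l <- B) trunc_mx TT k l * x j l) (x j k)).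
    apply: (le_trans (sqnorm_add _ _)); rewrite lerD2l ler_pM2l// sp; exact: sqnorm_add.
  rewrite big_split /= -!mulr_sumr big_split /= -!mulr_sumr.
  by apply: lerD; rewrite ler_pM2l//; apply: lerD; rewrite ler_pM2l.
have g1 : La * eta <= 1 / 16.
  rewrite /eta invfM mulrCA -[leRHS]mulr1 div1r ler_pM2l ?invr_gt0// ler_pdivrMr// mul1r lerDl//.
have g2 : La * La * (sz * e) <= 1 / 16.
  have -> : La * La * (sz * e) = (La / (La + 1)) ^+ 2 * (sz / (sz + 1)) / 16.
    by rewrite /e; field; rewrite !gt_eqF.
  have i1 : 0 <= La / (La + 1) <= 1 by rewrite divr_ge0 ?(ltW La1)//= ler_pdivrMr// mul1r lerDl.
  have i2 : 0 <= sz / (sz + 1) <= 1 by rewrite divr_ge0 ?ler0n ?(ltW sz0)//= ler_pdivrMr// mul1r lerDl.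
  move: i1 i2; move: (La / (La + 1)) (sz / (sz + 1)) => u w /andP[u0 u1'] /andP[w0 w1].
  have : u ^+ 2 * w <= 1.
    by rewrite -[leRHS]mulr1; apply: ler_pM; rewrite ?sqr_ge0// expr_le1.
  lra.
move: f g1 g2 inv8; rewrite mulr1; move: (La * eta) (La * La * (sz * e)) ((j.+1%:R : R)^-1) => u w r.
lra.
Qed.

(** If every constant 1 / (j + 1) failed for arbitrarily large sections, normalizing the offending
    vectors would give the sequence that [bad_cluster] excludes. *)
Lemma matrix_lower : exists2 c, 0 < c & exists n0, forall n, (n0 <= n)%N -> forall a : int * int -> C,
  c * \sum_(k <- box n) normc (a k) ^+ 2 <= \sum_(k <- box n) normc (a k - \sum_(l <- box n) trunc_mx (T n) k l * a l) ^+ 2.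
Proof.
apply: contrapT => H.
have step (j : nat) : exists p : nat * (int * int -> C), [/\ (j <= p.1)%N, forall k, k \notin box p.1 -> p.2 k = 0,
   \sum_(k <- box p.1) normc (p.2 k) ^+ 2 = 1 &
   \sum_(k <- box p.1) normc (p.2 k - \sum_(l <- box p.1) trunc_mx (T p.1) k l * p.2 l) ^+ 2 <= (j.+1%:R)^-1].
  apply: contrapT => Hj; apply: H; exists (j.+1%:R)^-1; first by rewrite invr_gt0 ltr0n.
  exists j => n jn a; rewrite leNgt; apply/negP => hlt; apply: Hj.
  set Q := \sum_(k <- box n) normc (a k) ^+ 2 in hlt.
  have Q0 : 0 < Q.
    rewrite lt_def; apply/andP; split; last by apply: sumr_ge0 => k _; exact: sqr_ge0.
    apply/eqP => Q0; move: hlt; rewrite Q0 mulr0 ltNge; apply/negP/negPn.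
    by apply: sumr_ge0 => k _; exact: sqr_ge0.
  pose t := (Num.sqrt Q)^-1.
  have t2 : t ^+ 2 = Q^-1 by rewrite /t exprVn sqr_sqrtr// ltW.
  pose x k := if k \in box n then toC t * a k else 0.
  have nx k : k \in box n -> normc (x k) ^+ 2 = Q^-1 * normc (a k) ^+ 2.
    by move=> kb; rewrite /x kb normcM normc_toC exprMn real_normK ?num_real// t2.
  exists (n, x); split => //=.
  - by move=> k kb; rewrite /x (negbTE kb).
  - rewrite big_seq (eq_bigr (fun k => Q^-1 * normc (a k) ^+ 2)); last exact: nx.
    by rewrite -big_seq -mulr_sumr mulVf// gt_eqF.
  - apply: (@le_trans _ _ (\sum_(k <- box n) Q^-1 * normc (a k - \sum_(l <- box n) trunc_mx (T n) k l * a l) ^+ 2)).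
      rewrite big_seq [leRHS]big_seq; apply: ler_sum => k kb.
      have -> : x k - \sum_(l <- box n) trunc_mx (T n) k l * x l = toC t * (a k - \sum_(l <- box n) trunc_mx (T n) k l * a l).
        rewrite mulrBr mulr_sumr {1}/x kb; congr (_ - _); rewrite big_seq [RHS]big_seq; apply: eq_bigr => l lb.
        by rewrite /x lb mulrCA.
      by rewrite normcM normc_toC exprMn real_normK ?num_real// t2.
    by rewrite -mulr_sumr ler_pdivrMl// mulrC ltW.
have [p Hp] := choice step.
apply: (@bad_cluster (fun j => (p j).1) (fun j => (p j).2)) => j; by have [] := Hp j.
Qed.
End matrix.

(** * Estimates for the double layer kernel *)

Section ext.
Variable R : realType.
Local Notation TR := (measurableTypeR R).
Local Notation C := (R[i]).

Lemma open_polydisc (U : set (C^o * C^o)) (w : C^o * C^o) : open U -> U w -> exists2 r, 0 < r & polydisc w r `<=` U.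
Proof.
move=> oU Uw; have /nbhs_ballP [e /= e0 He] : nbhs w U by exact: open_nbhs_nbhs.
have [eE e0'] := gt0C e0; exists (complex.Re e / 2); first by rewrite divr_gt0.
move=> z [h1 h2]; apply: He; split; rewrite /ball /= distrC normrC eE ltcC; [apply: (le_lt_trans h1)|apply: (le_lt_trans h2)]; lra.
Qed.

(** All derivatives up to second order are holomorphic on an open set around the closed strip and
    periodic on the strip, hence bounded on it; one constant [B] serves for all six. *)
Lemma ext_data (r0 : R) (gam : R * R -> R) (F : C^o * C^o -> C^o) : 0 < r0 -> biper gam -> analytic_ext r0 gam F ->
  [/\ holo2 F (strip2 r0), holo2 (cd0 F) (strip2 r0), holo2 (cd1 F) (strip2 r0),
      [/\ strip_per r0 F, strip_per r0 (cd0 F) & strip_per r0 (cd1 F)] &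
   exists2 B, 0 <= B & (forall z : C^o * C^o, strip2 r0 z -> normc (cd0 F z) <= B /\ normc (cd1 F z) <= B) /\
     (forall z : C^o * C^o, strip2 r0 z -> [/\ normc (cd0 (cd0 F) z) <= B, normc (cd1 (cd0 F) z) <= B,
     normc (cd0 (cd1 F) z) <= B & normc (cd1 (cd1 F) z) <= B])].
Proof.
move=> r00 bg [U [oU cU dU Fg]].
have oU' w : U w -> exists2 r, 0 < r & polydisc w r `<=` U by move=> Uw; exact: open_polydisc.
have HU : holo2 F U by move=> w /dU; exact: differentiable_hasD2.
have H0U := holo2_cd0 oU' HU; have H1U := holo2_cd1 oU' HU.
have H00 := holo2_cd0 oU' H0U; have H10 := holo2_cd1 oU' H0U.
have H01 := holo2_cd0 oU' H1U; have H11 := holo2_cd1 oU' H1U.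
have sU : (strip2 r0 : set (C * C)) `<=` U by move=> z hz; apply: cU; exact: subset_closure.
have HF := holS sU HU; have H0 := holS sU H0U; have H1 := holS sU H1U.
have pF := strip_per_ext r00 HF Fg bg.
have [p0 p1] := strip_per_cd HF pF; have [p00 p10] := strip_per_cd H0 p0; have [p01 p11] := strip_per_cd H1 p1.
split => //.
have [B0 h0] := strip_bounded r00 cU H0U p0; have [B1 h1] := strip_bounded r00 cU H1U p1.
have [B2 h2] := strip_bounded r00 cU H00 p00; have [B3 h3] := strip_bounded r00 cU H10 p10.
have [B4 h4] := strip_bounded r00 cU H01 p01; have [B5 h5] := strip_bounded r00 cU H11 p11.
pose B := `|B0| + `|B1| + `|B2| + `|B3| + `|B4| + `|B5|.
have le0 : B0 <= B by apply: (le_trans (ler_norm _)); rewrite /B -!addrA lerDl !addr_ge0.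
have le1 : B1 <= B by apply: (le_trans (ler_norm _)); rewrite /B -!addrA addrCA lerDl !addr_ge0.
have le2 : B2 <= B.
  by apply: (le_trans (ler_norm _)); rewrite /B -!addrA [`|B1| + _]addrCA [`|B0| + _]addrCA lerDl !addr_ge0.
have le5 : B5 <= B by apply: (le_trans (ler_norm _)); rewrite /B lerDr !addr_ge0.
have le4 : B4 <= B by apply: (le_trans (ler_norm _)); rewrite /B addrAC lerDr !addr_ge0.
have le3 : B3 <= B by apply: (le_trans (ler_norm _)); rewrite /B -addrA addrAC lerDr !addr_ge0.
exists B; first by rewrite /B !addr_ge0.
split=> z hz.
  by split; [apply: le_trans le0; exact: h0|apply: le_trans le1; exact: h1].
by split; [apply: le_trans le2; exact: h2|apply: le_trans le3; exact: h3|apply: le_trans le4; exact: h4|apply: le_trans le5; exact: h5].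
Qed.

Lemma lipschitz_aux (p q a b e : R) : 0 <= p -> 0 <= q -> 0 <= a -> 0 <= b ->
  p * (a + b + 2) * 2 < e -> q * (a + b + 2) * 2 < e -> p + q + (a * p + b * q) <= e.
Proof.
move=> p0 q0 a0 b0 h1 h2; have := mulr_ge0 p0 b0; have := mulr_ge0 q0 a0 => h3 h4; lra.
Qed.

Lemma holo2_real_meas (r0 : R) (H : C^o * C^o -> C^o) : 0 < r0 -> holo2 H (strip2 r0) ->
  measurable_fun (setT : set (TR * TR)) (fun x : TR * TR => complex.Re (H (toC x.1, toC x.2))).
Proof.
move=> r00 HH.
suff cf : continuous (fun x : R * R => complex.Re (H (toC x.1, toC x.2))) by exact: continuous_measurable2 cf.
move=> x; apply/cvgrPdist_le => e e0.
have hx : strip2 r0 ((toC x.1 : C^o), (toC x.2 : C^o)) by apply/in_strip2; rewrite /= normr0.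
have h := HH _ hx.
set A := cd0 _ _ in h; set B := cd1 _ _ in h.
have [d d0 Hd] := h 1 ltr01.
have K0 : 0 < normc A + normc B + 2 by rewrite ltr_wpDl ?addr_ge0 ?normc_ge0.
have db : 0 < Num.min d (e / 2 / (normc A + normc B + 2)) by rewrite lt_min d0 !divr_gt0.
apply: filterS (nbhsx_ballx x _ db) => y [/=]; rewrite /ball /= !lt_min => /andP[a1 a2] /andP[b1 b2].
rewrite distrC in a1; rewrite distrC in a2; rewrite distrC in b1; rewrite distrC in b2.
have := Hd (toC (y.1 - x.1)) (toC (y.2 - x.2)); rewrite !normc_toC => /(_ a1 b1).
rewrite /= -!toCD ![_ + (_ - _)]addrC !subrK mul1r => k.
rewrite distrC -ReN -ReD; apply: le_trans (Re_le_normc _) _.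
set X := H (toC y.1, toC y.2) in k *; set Y := H (toC x.1, toC x.2) in k *.
set u := toC (y.1 - x.1) in k; set w := toC (y.2 - x.2) in k.
have aux (X1 Y1 u1 w1 : C) : X1 - Y1 = (X1 - Y1 - u1 - w1) + (u1 + w1) by ring.
rewrite (aux X Y (A * u) (B * w)).
apply: le_trans (ler_normcD _ _) _; apply: le_trans (lerD k (ler_normcD _ _)) _; rewrite !normcM /u /w !normc_toC.
move: a2 b2; rewrite !ltr_pdivlMr//.
move=> h1 h2.
exact: (lipschitz_aux (normr_ge0 _) (normr_ge0 _) (normc_ge0 A) (normc_ge0 B) h1 h2).
Qed.

(** The extension is real on the real plane, so its derivative along a real direction has zero
    imaginary part; its real part is the limit of the same real difference quotients. *)
Lemma derive_real (H : C^o * C^o -> C^o) (f : R * R -> R) (e : R * R) (w : R * R) A B :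
  (forall x, H (toC x.1, toC x.2) = toC (f x)) -> hasD2 H (toC e.1, toC e.2) A B ->
  A * toC w.1 + B * toC w.2 = toC ('D_w f e).
Proof.
move=> Hf hD.
have rd : real_deriv (fun s => toC (f (e.1 + s * w.1, e.2 + s * w.2))) 0 (A * toC w.1 + B * toC w.2).
  have := @hasD2_real_deriv _ H (toC e.1, toC e.2) (toC w.1, toC w.2) 0 A B; rewrite toC0 !mul0r !addr0 => /(_ hD).
  rewrite (_ : (fun t => _) = (fun s => toC (f (e.1 + s * w.1, e.2 + s * w.2))))//.
  by apply/funext => t; rewrite /= -!toCM -!toCD (Hf (e.1 + t * w.1, e.2 + t * w.2)).
have dRe := real_deriv_Re rd.
have dIm := real_deriv_Re (rDZ (- 'i%C) rd).
have Im0 : complex.Im (A * toC w.1 + B * toC w.2) = 0.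
  have [_ E] := dIm; move: E.
  rewrite (_ : (fun t => _) = cst 0); last first.
    by apply/funext => t; rewrite ReM /toC /= ?oppr0 ?mul0r ?mulr0 ?subr0.
  rewrite derive_cst ReM /= oppr0 mul0r sub0r mulN1r opprK => E; by rewrite E.
have [_ E] := dRe.
apply: complexP; last by rewrite Im0.
rewrite -E /=.
pose g (s : R) := complex.Re (toC (f (e.1 + s * w.1, e.2 + s * w.2))).
have EQ : (fun h : R => h^-1 *: ((f \o shift e) (h *: w) - f e)) = (fun h : R => h^-1 *: ((g \o shift (0 : R)) (h *: (1 : R)) - g 0)).
  apply/funext => h; rewrite /g /= /shift /= addr0 !mul0r !addr0 -surjective_pairing.
  congr (_ *: (f _ - f _)); rewrite /GRing.scale /= mulr1 [LHS]surjective_pairing /= /GRing.scale /=.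
  by congr pair; rewrite addrC.
by rewrite /derive EQ.
Qed.
End ext.

(** * The double layer kernel satisfies the abstract hypotheses *)

Section concrete.
Variable R : realType.
Local Notation TR := (measurableTypeR R).
Local Notation C := (R[i]).
Local Notation mu_per2 := (@mu_per2 R).
Local Notation mu_per := (@mu_per R).
Variables (G : R * R -> 'rV[R]_3) (C0 r0 : R) (F : 'I_3 -> C^o * C^o -> C^o) (B : R).
Hypothesis r00 : 0 < r0.
Hypotheses (HF : forall j, holo2 (F j) (strip2 r0)) (H0 : forall j, holo2 (cd0 (F j)) (strip2 r0)) (H1 : forall j, holo2 (cd1 (F j)) (strip2 r0)).
Hypotheses (pF : forall j, strip_per r0 (F j)) (p0 : forall j, strip_per r0 (cd0 (F j))) (p1 : forall j, strip_per r0 (cd1 (F j))).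
Hypothesis B0 : 0 <= B.
Hypothesis B1 : forall j (z : C^o * C^o), strip2 r0 z -> normc (cd0 (F j) z) <= B /\ normc (cd1 (F j) z) <= B.
Hypothesis B2 : forall j (z : C^o * C^o), strip2 r0 z -> [/\ normc (cd0 (cd0 (F j)) z) <= B, normc (cd1 (cd0 (F j)) z) <= B,
     normc (cd0 (cd1 (F j)) z) <= B & normc (cd1 (cd1 (F j)) z) <= B].
Hypothesis Fg : forall j (x : R * R), F j (toC x.1, toC x.2) = toC (G x 0 j).
Hypothesis bG : biperiodic G.
Hypothesis dG : forall t, differentiable G t.
Hypothesis A1 : assumption_A1 G C0.

(** A nonzero multiple of 2 pi has modulus at least 2 pi >= 2 |s|, so moving [s] by it cannot bring
    [s] closer to 0. *)
Lemma dist2piZ_lb (s : R) (m : int) : `|s| <= pi -> `|s| <= dist2piZ (s + 2 * pi * m%:~R).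
Proof.
move=> hs; apply: lb_le_inf; first by exists `|s + 2 * pi * m%:~R - 2 * pi * 0%:~R|, 0.
move=> _ [k _ <-].
have -> : s + 2 * pi * m%:~R - 2 * pi * k%:~R = s + 2 * pi * (m - k)%:~R by rewrite intrB; ring.
have [->|n0] := eqVneq (m - k) 0; first by rewrite mulr0 addr0.
have pp := @pi_gt0 R.
have h1 : 1 <= `|(m - k)%:~R : R| by rewrite -intr_norm -[1]/(1%:~R) ler_int -gtz0_ge1 normr_gt0.
have h2 : 2 * pi <= `|2 * pi * (m - k)%:~R : R| by rewrite normrM gtr0_norm ?pi2_gt0// ler_peMr// ltW// pi2_gt0.
have := ler_normD (s + 2 * pi * (m - k)%:~R) (- s); rewrite normrN addrC addKr; lra.
Qed.

(** (A1) speaks of points of one period cell. Both points are reduced to it by periodicity, and for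
    a centred shift the periodic distance is at least |s|. *)
Lemma vnorm3_lb (x s : R * R) : sqnorm_pi s -> C0 * rnorm s <= vnorm3 (G (x.1 + s.1, x.2 + s.2) - G x).
Proof.
move=> [s1 s2]; have [c00 hA] := A1.
have [k [l hI]] := red2 x; have [k' [l' hI']] := red2 (x.1 + s.1, x.2 + s.2).
have := hA _ _ hI' hI; rewrite /= !(biper_int bG).
have := biper_int bG (x.1 + s.1, x.2 + s.2) k' l'; rewrite /= => ->.
apply: le_trans; rewrite ler_pM2l// /rnorm /cnorm2 /zeta /= ler_wsqrtr// !normc_toC.
have -> : x.1 + s.1 - 2 * pi * k'%:~R - (x.1 - 2 * pi * k%:~R) = s.1 + 2 * pi * (k - k')%:~R by rewrite intrB; ring.
have -> : x.2 + s.2 - 2 * pi * l'%:~R - (x.2 - 2 * pi * l%:~R) = s.2 + 2 * pi * (l - l')%:~R by rewrite intrB; ring.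
have d1 := dist2piZ_lb (k - k') s1; have d2 := dist2piZ_lb (l - l') s2.
by apply: lerD; rewrite ler_pXn2r// nnegrE//; apply: (le_trans _ d1) || apply: (le_trans _ d2).
Qed.

Lemma cauchy_schwarz3 (a b : 'I_3 -> R) : (forall j, 0 <= a j) -> (forall j, 0 <= b j) ->
  \sum_(j < 3) a j * b j <= Num.sqrt (\sum_(j < 3) a j ^+ 2) * Num.sqrt (\sum_(j < 3) b j ^+ 2).
Proof.
move=> a0 b0.
have sa : 0 <= \sum_(j < 3) a j ^+ 2 by apply: sumr_ge0 => j _; exact: sqr_ge0.
rewrite -sqrtrM// -[leLHS]ger0_norm; last by apply: sumr_ge0 => j _; rewrite mulr_ge0.
rewrite -sqrtr_sqr; apply: ler_wsqrtr; rewrite !sum3.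
move: (a 0) (a 1) (a 2) (b 0) (b 1) (b 2) => x y z u v w.
have := sqr_ge0 (x * v - y * u); have := sqr_ge0 (x * w - z * u); have := sqr_ge0 (y * w - z * v).
rewrite !expr2; lra.
Qed.

Lemma M0j_ge0 j : 0 <= M0j r0 (F j).
Proof.
have hz : strip2 r0 ((0 : C^o), (0 : C^o)) by apply/in_strip2; rewrite /= normr0.
by apply: le_trans (M0jP r00 (B1 j) hz); exact: cnorm2_ge0.
Qed.
Lemma M1j_ge0 j : 0 <= M1j r0 (F j).
Proof.
have hz : strip2 r0 ((0 : C^o), (0 : C^o)) by apply/in_strip2; rewrite /= normr0.
have n1 : cnorm2 (toC 1) 0 = 1 :> R by rewrite /cnorm2 normc0 normc_toC normr1 expr0n expr1n addr0 sqrtr1.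
have h := M1jP (toC 1) 0 (toC 1) 0 (B2 j) hz.
have E : M1j r0 (F j) * cnorm2 (toC 1) 0 * cnorm2 (toC 1) 0 = M1j r0 (F j) by rewrite n1 !mulr1.
by rewrite -E; apply: le_trans h; exact: normc_ge0.
Qed.

Variable b' : R.
Hypothesis bp : 0 <= b' < r0.

(** For each component write A^2 = d^2 + (A - d)(A + d), with A the complex and d the real
    increment. [diff_plus] bounds the sum by M0j |s|, [diff_minus] the difference by M1j sqrt 2 b'
    |s|. Adding up, (A1) bounds the squares d^2 from below, and Cauchy-Schwarz over the three
    components turns the products into M0 M1. *)
Lemma ReS_lb (z : C * C) s : in_cstrip b' z -> sqnorm_pi s ->
  (C0 ^+ 2 - Num.sqrt 2 * b' * (M0 r0 F * M1 r0 F)) * rnorm s ^+ 2 <= complex.Re (dist2_ext F z s).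
Proof.
move=> [z1 z2] hs; move: bp => /andP[b0 br].
pose x := (complex.Re z.1, complex.Re z.2); pose be := (complex.Im z.1, complex.Im z.2).
have be1 : `|be.1| < r0 by exact: le_lt_trans br.
have be2 : `|be.2| < r0 by exact: le_lt_trans br.
have ptz : segpt x be s 1 0 = z by rewrite /segpt /= !mul0r !mul1r !addr0 [RHS]surjective_pairing; congr pair; apply: complexP.
have pts : segpt x be s 1 1 = cshift z s.
  by rewrite /segpt /cshift /= !mul1r; congr pair; apply: complexP; rewrite ?ReD ?ImD /toC /= ?addr0.
have pt0 : segpt x be s 0 0 = (toC x.1, toC x.2) by rewrite /segpt /= !mul0r !addr0.
have pt1 : segpt x be s 0 1 = (toC (x.1 + s.1), toC (x.2 + s.2)) by rewrite /segpt /= !mul0r !mul1r.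
pose d j := G (x.1 + s.1, x.2 + s.2) 0 j - G x 0 j.
have nbe : cnorm2 ('i%C * toC be.1) ('i%C * toC be.2) <= Num.sqrt 2 * b'.
  have ni : normc ('i%C : C) = 1 by rewrite normcE /= expr0n expr1n add0r sqrtr1.
  have -> : cnorm2 ('i%C * toC be.1) ('i%C * toC be.2) = cnorm2 (toC be.1) (toC be.2) by rewrite nrm2Z ni mul1r.
  have q : cnorm2 (toC be.1) (toC be.2) ^+ 2 <= (Num.sqrt 2 * b') ^+ 2.
    rewrite cnorm2_sqr !normc_toC exprMn sqr_sqrtr// mulr_natl mulr2n.
    by apply: lerD; rewrite ler_pXn2r// nnegrE.
  by move: q; rewrite ler_pXn2r// ?nnegrE ?cnorm2_ge0 ?mulr_ge0 ?sqrtr_ge0.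
have each j : d j ^+ 2 - Num.sqrt 2 * b' * (M0j r0 (F j) * M1j r0 (F j)) * rnorm s ^+ 2 <= complex.Re (shift_diff F j z s ^+ 2).
  have dp := @diff_plus R r0 r00 (F j) B (HF j) (B1 j) x be s be1 be2.
  have dm := @diff_minus R r0 (F j) B (HF j) (H0 j) (H1 j) (B2 j) x be s be1 be2.
  rewrite ptz pts pt0 pt1 in dp dm.
  have Fd : F j (toC (x.1 + s.1), toC (x.2 + s.2)) - F j (toC x.1, toC x.2) = toC (d j).
    by rewrite (Fg j (x.1 + s.1, x.2 + s.2)) (Fg j x) -toCB.
  rewrite Fd in dp dm.
  set A := F j (cshift z s) - F j z in dp dm.
  have AE : shift_diff F j z s ^+ 2 = A ^+ 2 by rewrite /A /shift_diff -sqrrN opprB.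
  rewrite AE.
  have sp : A ^+ 2 = toC (d j ^+ 2) + (A - toC (d j)) * (A + toC (d j)).
    rewrite toCX; have aux (u w : C) : u ^+ 2 = w ^+ 2 + (u - w) * (u + w) by ring.
    exact: aux.
  rewrite sp ReD /= lerD2l.
  have h : normc ((A - toC (d j)) * (A + toC (d j))) <= Num.sqrt 2 * b' * (M0j r0 (F j) * M1j r0 (F j)) * rnorm s ^+ 2.
    rewrite normcM; have r_ge := cnorm2_ge0 (toC s.1) (toC s.2); rewrite -/(rnorm s) in r_ge dp dm.
    have dm' : normc (A - toC (d j)) <= M1j r0 (F j) * (Num.sqrt 2 * b') * rnorm s.
      by apply: (le_trans dm); apply: ler_wpM2r => //; apply: ler_wpM2l => //; exact: M1j_ge0.
    apply: (le_trans (ler_pM (normc_ge0 _) (normc_ge0 _) dm' dp)).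
    by rewrite le_eqVlt; apply/orP; left; apply/eqP; ring.
  have := Re_le_normc ((A - toC (d j)) * (A + toC (d j))); rewrite ler_norml => /andP[h1 _].
  by apply: le_trans h1; rewrite lerN2.
have vn : vnorm3 (G (x.1 + s.1, x.2 + s.2) - G x) ^+ 2 = \sum_(j < 3) d j ^+ 2.
  have E : dot3 (G (x.1 + s.1, x.2 + s.2) - G x) (G (x.1 + s.1, x.2 + s.2) - G x) = \sum_(j < 3) d j ^+ 2.
    by apply: eq_bigr => j _; rewrite !mxE expr2.
  by rewrite /vnorm3 E sqr_sqrtr//; apply: sumr_ge0 => j _; exact: sqr_ge0.
have c00 : 0 <= C0 by case: A1 => /ltW.
have lb : C0 ^+ 2 * rnorm s ^+ 2 <= \sum_(j < 3) d j ^+ 2.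
  by rewrite -vn -exprMn ler_pXn2r ?nnegrE ?mulr_ge0 ?cnorm2_ge0 ?sqrtr_ge0//; exact: vnorm3_lb.
have up : \sum_(j < 3) M0j r0 (F j) * M1j r0 (F j) <= M0 r0 F * M1 r0 F by apply: cauchy_schwarz3 => j; [exact: M0j_ge0|exact: M1j_ge0].
have up' : Num.sqrt 2 * b' * (\sum_(j < 3) M0j r0 (F j) * M1j r0 (F j)) * rnorm s ^+ 2 <= Num.sqrt 2 * b' * (M0 r0 F * M1 r0 F) * rnorm s ^+ 2.
  by apply: ler_wpM2r; [exact: sqr_ge0|apply: ler_wpM2l => //; rewrite mulr_ge0 ?sqrtr_ge0].
rewrite /dist2_ext Re_sum; apply: le_trans (ler_sum _ (fun j _ => each j)).
rewrite sumrB -mulr_suml -mulr_sumr mulrBl; lra.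
Qed.

Lemma dG_real (e : R * R) j : cd0 (F j) (toC e.1, toC e.2) = toC (dGamma0 G e 0 j) /\ cd1 (F j) (toC e.1, toC e.2) = toC (dGamma1 G e 0 j).
Proof.
have he : strip2 r0 ((toC e.1 : C^o), (toC e.2 : C^o)) by apply/in_strip2; rewrite /= normr0.
have h := HF j he.
have D w : 'D_w G e 0 j = 'D_w (fun x => G x 0 j) e.
  by rewrite derive_mx ?mxE//; apply: diff_derivable.
split.
- have aux (a b : C) : a = a * toC 1 + b * toC 0 by rewrite toC1 toC0 mulr1 mulr0 addr0.
  by rewrite /dGamma0 D; exact: etrans (aux _ _) (derive_real (e := e) (1, 0) (Fg j) h).
- have aux (a b : C) : b = a * toC 0 + b * toC 1 by rewrite toC1 toC0 mulr1 mulr0 add0r.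
  by rewrite /dGamma1 D; exact: etrans (aux _ _) (derive_real (e := e) (0, 1) (Fg j) h).
Qed.

(** [csqrt_toC] covers a vanishing distance as well, so the identity needs no restriction on [s]. *)
Lemma kappa_real (x s : R * R) : kappa F (toC x.1, toC x.2) s = toC (Kker G x (x.1 + s.1, x.2 + s.2)).
Proof.
set e := (x.1 + s.1, x.2 + s.2).
have she : cshift (toC x.1, toC x.2) s = (toC e.1, toC e.2) by rewrite /cshift /= -!toCD.
have AE j : shift_diff F j (toC x.1, toC x.2) s = toC (G x 0 j - G e 0 j).
  by rewrite /shift_diff she (Fg j x) (Fg j e) -toCB.
have SE : dist2_ext F (toC x.1, toC x.2) s = toC (dot3 (G x - G e) (G x - G e)).
  rewrite /dist2_ext /dot3 toC_sum; apply: eq_bigr => j _.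
  by rewrite AE -toCX !mxE expr2.
have d0 : 0 <= dot3 (G x - G e) (G x - G e) by apply: sumr_ge0 => j _; rewrite -expr2 sqr_ge0.
have CE j : ccross (fun j => cd0 (F j) (cshift (toC x.1, toC x.2) s)) (fun j => cd1 (F j) (cshift (toC x.1, toC x.2) s)) j =
   toC (cross3 (dGamma0 G e) (dGamma1 G e) 0 j).
  rewrite /ccross she /cross3 mxE.
  have P i := (dG_real e i).1; have Q i := (dG_real e i).2.
  by case: (j == 0); [|case: (j == 1)]; rewrite !P !Q -!toCM -toCB.
have NE : num_ext F (toC x.1, toC x.2) s = toC (dot3 (G x - G e) (cross3 (dGamma0 G e) (dGamma1 G e))).
  rewrite /num_ext /dot3 toC_sum; apply: eq_bigr => j _.
  by rewrite AE CE -toCM !mxE.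
by rewrite /kappa SE NE csqrt_toC// /Kker /vnorm3 -toCX -toCV -!toCM.
Qed.

Lemma kappa_strip_per (z : C^o * C^o) s (k l : int) : strip2 r0 z -> kappa F (z.1 - toC (2 * pi * k%:~R), z.2 - toC (2 * pi * l%:~R)) s = kappa F z s.
Proof.
move=> hz; have hsh := cshift_strip s hz.
set z' : C^o * C^o := (_, _).
have shz : cshift z' s = ((cshift z s).1 - toC (2 * pi * k%:~R), (cshift z s).2 - toC (2 * pi * l%:~R)).
  by rewrite /cshift /z' /= addrAC [z.2 + _ + _]addrAC.
have AE j : shift_diff F j z' s = shift_diff F j z s.
  by rewrite /shift_diff shz (strip_per_int k l (pF j) hsh) /z' (strip_per_int k l (pF j) hz).
have SE : dist2_ext F z' s = dist2_ext F z s by apply: eq_bigr => j _; rewrite AE.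
have PE : (fun i => cd0 (F i) (cshift z' s)) = (fun i => cd0 (F i) (cshift z s)).
  by apply/funext => i; rewrite shz; exact: (strip_per_int k l (p0 i) hsh).
have QE : (fun i => cd1 (F i) (cshift z' s)) = (fun i => cd1 (F i) (cshift z s)).
  by apply/funext => i; rewrite shz; exact: (strip_per_int k l (p1 i) hsh).
have gen (P P' Q Q' A A' : 'I_3 -> C) : (forall j, A j = A' j) -> P = P' -> Q = Q' ->
   \sum_(j < 3) A j * ccross P Q j = \sum_(j < 3) A' j * ccross P' Q' j.
  by move=> h -> ->; apply: eq_bigr => j _; rewrite h.
have NE : num_ext F z' s = num_ext F z s by exact: (gen _ _ _ _ _ _ AE PE QE).
by rewrite /kappa SE NE.
Qed.

Lemma dGamma_biper : biper (dGamma0 G) /\ biper (dGamma1 G).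
Proof.
have st (x : R * R) : strip2 r0 ((toC x.1 : C^o), (toC x.2 : C^o)) by apply/in_strip2; rewrite /= normr0.
have inj (a b : R) : toC a = toC b -> a = b by case.
split=> t; split; apply/rowP => j; apply: inj.
- by rewrite -(dG_real _ j).1 -(dG_real _ j).1 /= toCD; have [-> _] := p0 j (st t).
- by rewrite -(dG_real _ j).1 -(dG_real _ j).1 /= toCD; have [_ ->] := p0 j (st t).
- by rewrite -(dG_real _ j).2 -(dG_real _ j).2 /= toCD; have [-> _] := p1 j (st t).
- by rewrite -(dG_real _ j).2 -(dG_real _ j).2 /= toCD; have [_ ->] := p1 j (st t).
Qed.

Lemma Kker_per1 e : biper (fun t => Kker G t e).
Proof. by move=> t; rewrite /Kker; have [-> ->] := bG t. Qed.
Lemma Kker_per2 t : biper (fun e => Kker G t e).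
Proof.
have [b0 b1] := dGamma_biper.
by move=> e; rewrite /Kker; have [-> ->] := bG e; have [-> ->] := b0 e; have [-> ->] := b1 e.
Qed.

Lemma Kker_meas : measurable_fun (setT : set ((TR * TR) * (TR * TR))) (fun p => Kker G p.1 p.2).
Proof.
have mG j : measurable_fun (setT : set (TR * TR)) (fun x => G x 0 j).
  have := holo2_real_meas r00 (HF j); apply: eq_measurable_fun => x _; by rewrite (Fg j x).
have mP j : measurable_fun (setT : set (TR * TR)) (fun x => dGamma0 G x 0 j).
  have := holo2_real_meas r00 (H0 j); apply: eq_measurable_fun => x _; by rewrite (dG_real x j).1.
have mQ j : measurable_fun (setT : set (TR * TR)) (fun x => dGamma1 G x 0 j).
  have := holo2_real_meas r00 (H1 j); apply: eq_measurable_fun => x _; by rewrite (dG_real x j).2.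
have f1 (g : TR * TR -> R) : measurable_fun setT g -> measurable_fun (setT : set ((TR * TR) * (TR * TR))) (fun p => g p.1).
  by move=> mg; apply: (measurableT_comp mg).
have f2 (g : TR * TR -> R) : measurable_fun setT g -> measurable_fun (setT : set ((TR * TR) * (TR * TR))) (fun p => g p.2).
  by move=> mg; apply: (measurableT_comp mg).
have mD j : measurable_fun (setT : set ((TR * TR) * (TR * TR))) (fun p => (G p.1 - G p.2) 0 j).
  have := measurable_funB (f1 _ (mG j)) (f2 _ (mG j)); apply: eq_measurable_fun => p _; by rewrite !mxE.
have mX j : measurable_fun (setT : set ((TR * TR) * (TR * TR))) (fun p => cross3 (dGamma0 G p.2) (dGamma1 G p.2) 0 j).
  have two i k : measurable_fun (setT : set ((TR * TR) * (TR * TR))) (fun p => dGamma0 G p.2 0 i * dGamma1 G p.2 0 k - dGamma0 G p.2 0 k * dGamma1 G p.2 0 i).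
    exact: (measurable_funB (measurable_funM (f2 _ (mP i)) (f2 _ (mQ k))) (measurable_funM (f2 _ (mP k)) (f2 _ (mQ i)))).
  rewrite (_ : (fun p => _) = (fun p => if j == 0 then dGamma0 G p.2 0 1 * dGamma1 G p.2 0 2 - dGamma0 G p.2 0 2 * dGamma1 G p.2 0 1
     else if j == 1 then dGamma0 G p.2 0 2 * dGamma1 G p.2 0 0 - dGamma0 G p.2 0 0 * dGamma1 G p.2 0 2
     else dGamma0 G p.2 0 0 * dGamma1 G p.2 0 1 - dGamma0 G p.2 0 1 * dGamma1 G p.2 0 0)); last by apply/funext => p; rewrite mxE.
  by case: (j == 0); [|case: (j == 1)]; exact: two.
have m3 (g h : 'I_3 -> (TR * TR) * (TR * TR) -> R) : (forall j, measurable_fun setT (g j)) -> (forall j, measurable_fun setT (h j)) ->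
   measurable_fun setT (fun p => \sum_(j < 3) g j p * h j p).
  by move=> mg mh; apply: measurable_sum => j; apply: measurable_funM.
have ms : measurable_fun [set: R] (@Num.sqrt R).
  by apply: continuous_measurable_fun => x; exact: sqrt_continuous.
apply: measurable_funM; first exact: measurable_cst.
apply: measurable_funM; first exact: m3.
apply: (measurableT_comp (@measurable_invr R)).
apply: measurable_funX; apply: (measurableT_comp ms); exact: m3.
Qed.

Hypothesis cpos : 0 < C0 ^+ 2 - Num.sqrt 2 * b' * (M0 r0 F * M1 r0 F).
Let c := C0 ^+ 2 - Num.sqrt 2 * b' * (M0 r0 F * M1 r0 F).
Let CK := kappa_cst B c.

(* The representative of s in (-pi, pi], on which (A1) bounds the distance from below by C0 |s|. *)
Definition recenter (s : R) : R := if s <= pi then s else s - 2 * pi.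
Definition recenter2 (s : R * R) : R * R := (recenter s.1, recenter s.2).
Definition recenter_shift (s : R) : int := if s <= pi then 0 else 1.
Lemma tlE s : recenter s = s - 2 * pi * (recenter_shift s)%:~R.
Proof. by rewrite /recenter /recenter_shift; case: ifP => _; rewrite ?mulr0 ?subr0 ?mulr1. Qed.

Lemma recenter_abs s : 0 < s < 2 * pi -> [/\ `|recenter s| <= pi, 0 < `|recenter s| & (Num.sqrt `|recenter s|)^-1 <= sing_majorant s].
Proof.
move=> /andP[s0 s2]; rewrite /recenter; case: (lerP s pi) => h.
  rewrite gtr0_norm//; split => //; apply: sing_majorant_lb => //; by left.
rewrite ltr0_norm ?subr_lt0// opprB; split; [lra|lra|].
by apply: sing_majorant_lb; [lra|right].
Qed.

Definition Kmajorant (s : R * R) : R := CK * (sing_majorant s.1 * sing_majorant s.2).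

Lemma CK_ge0 : 0 <= CK. Proof. exact: (kappa_cst_ge0 B0 c). Qed.
Lemma Kmajorant_ge0 s : 0 <= Kmajorant s.
Proof. by rewrite /Kmajorant; apply: mulr_ge0; [exact: CK_ge0|apply: mulr_ge0; exact: sing_majorant_ge0]. Qed.

Lemma rnorm_recenter s : open_cell s -> [/\ sqnorm_pi (recenter2 s), 0 < rnorm (recenter2 s) & CK / rnorm (recenter2 s) <= Kmajorant s].
Proof.
move=> [g1 g2]; have [a1 a2 a3] := recenter_abs g1; have [d1 d2 d3] := recenter_abs g2.
have r2 : `|recenter s.1| * `|recenter s.2| <= rnorm (recenter2 s) ^+ 2.
  rewrite /rnorm cnorm2_sqr !normc_toC /=; have := sqr_ge0 (`|recenter s.1| - `|recenter s.2|); rewrite !expr2; nra.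
have p : 0 < Num.sqrt `|recenter s.1| * Num.sqrt `|recenter s.2| by rewrite mulr_gt0 ?sqrtr_gt0.
have r1 : Num.sqrt `|recenter s.1| * Num.sqrt `|recenter s.2| <= rnorm (recenter2 s).
  have E : rnorm (recenter2 s) = Num.sqrt (rnorm (recenter2 s) ^+ 2) by rewrite sqrtr_sqr ger0_norm ?cnorm2_ge0.
  by rewrite -sqrtrM// E; exact: ler_wsqrtr.
have rp := lt_le_trans p r1.
split => //; rewrite /Kmajorant; apply: ler_wpM2l; first exact: CK_ge0.
apply: (@le_trans _ _ ((Num.sqrt `|recenter s.1|)^-1 * (Num.sqrt `|recenter s.2|)^-1)).
  by rewrite -invfM lef_pV2 ?posrE.
by apply: ler_pM; rewrite ?invr_ge0 ?sqrtr_ge0.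
Qed.

Let RS z s : in_cstrip b' z -> sqnorm_pi s -> c * rnorm s ^+ 2 <= complex.Re (dist2_ext F z s).
Proof. exact: ReS_lb. Qed.

Lemma in_cstrip_real (t : R * R) : in_cstrip b' ((toC t.1 : C), (toC t.2 : C)).
Proof. by move: bp => /andP[b0 _]; split; rewrite /= normr0. Qed.

Lemma K_recenter t s : Kker G t (t.1 + s.1, t.2 + s.2) = Kker G t (t.1 + (recenter2 s).1, t.2 + (recenter2 s).2).
Proof.
by rewrite /recenter2 /= !tlE !addrA; have := biper_int (Kker_per2 t) (t.1 + s.1, t.2 + s.2) (recenter_shift s.1) (recenter_shift s.2).
Qed.

Lemma Kv1_ok t s : open_cell s -> `|Kker G t (t.1 + s.1, t.2 + s.2)| <= Kmajorant s.
Proof.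
move=> hs; have [sp rp le] := rnorm_recenter hs; apply: le_trans le.
rewrite K_recenter -normc_toC -kappa_real.
exact: (kappa_bound HF H0 H1 B0 B1 B2 cpos bp RS (in_cstrip_real t) sp rp).
Qed.

(** Take the first argument t = e + s as base point, so that the second one is t - s; after
    recentring, the bound is symmetric under a change of sign of the shift. *)
Lemma Kv2_ok e s : open_cell s -> `|Kker G (e.1 + s.1, e.2 + s.2) e| <= Kmajorant s.
Proof.
move=> hs; have [sp rp le] := rnorm_recenter hs; apply: le_trans le.
have -> : Kker G (e.1 + s.1, e.2 + s.2) e = Kker G (e.1 + (recenter2 s).1, e.2 + (recenter2 s).2) e.
  by rewrite /recenter2 /= !tlE !addrA; have := biper_int (Kker_per1 e) (e.1 + s.1, e.2 + s.2) (recenter_shift s.1) (recenter_shift s.2).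
pose t := (e.1 + (recenter2 s).1, e.2 + (recenter2 s).2); pose sn := (- (recenter2 s).1, - (recenter2 s).2).
have eE : e = (t.1 + sn.1, t.2 + sn.2) by rewrite /t /sn /= !addrK -surjective_pairing.
have rE : rnorm sn = rnorm (recenter2 s) by rewrite /rnorm /cnorm2 !normc_toC /sn /= !normrN.
rewrite -/t {1}eE -normc_toC -kappa_real -rE.
apply: (kappa_bound HF H0 H1 B0 B1 B2 cpos bp RS (in_cstrip_real t)); last by rewrite rE.
by case: sp => ? ?; split; rewrite /sn /= normrN.
Qed.

Lemma Kmajorant_meas : measurable_fun (setT : set (TR * TR)) Kmajorant.
Proof.
apply: measurable_funM; first exact: measurable_cst.
by apply: measurable_funM; apply: (measurableT_comp (@measurable_sing_majorant R)).
Qed.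

Lemma Kmajorant_int : (\int[mu_per2]_x (Kmajorant x)%:E <= (CK * ((8 * pi) * (8 * pi)))%:E)%E.
Proof.
have mv1 : measurable_fun (setT : set TR) (fun x => (sing_majorant x)%:E) by apply/measurable_EFinP; exact: measurable_sing_majorant.
have v10 (x : TR) : (0 <= (sing_majorant x)%:E)%E by rewrite lee_fin sing_majorant_ge0.
have I0 : (0 <= \int[mu_per]_x (sing_majorant x)%:E)%E by apply: integral_ge0 => x _.
rewrite fubini_tonelli1; first last.
- by move=> x; rewrite lee_fin Kmajorant_ge0.
- by apply/measurable_EFinP; exact: Kmajorant_meas.
rewrite /fubini_F /=.
under eq_integral => x _.
  under eq_integral => y _ do rewrite /Kmajorant /= mulrA EFinM.
  rewrite ge0_integralZl//; last by rewrite lee_fin mulr_ge0 ?CK_ge0 ?sing_majorant_ge0.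
  rewrite EFinM muleAC.
  over.
rewrite /=.
under eq_integral => x _ do rewrite muleC.
rewrite ge0_integralZr//; last by rewrite mule_ge0// lee_fin CK_ge0.
rewrite !EFinM muleCA; apply: lee_pmul => //.
- by rewrite lee_fin CK_ge0.
- by rewrite mule_ge0.
by rewrite -EFinM EFinM; apply: lee_pmul => //; exact: sing_majorant_int.
Qed.

Lemma line_ok (s t : R * R) (e1 e2 : R) : open_cell s -> (e1 = 1 \/ e1 = -1) -> (e2 = 1 \/ e2 = -1) ->
  exists h : C -> C, [/\ forall z, 0 <= complex.Im z <= b' -> cdiffable h z, forall z, 0 <= complex.Im z <= b' -> normc (h z) <= Kmajorant s,
   forall x, h (toC x) = toC (Kker G (t.1 + e1 * x, t.2 + e2 * x) (t.1 + e1 * x + s.1, t.2 + e2 * x + s.2)) &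
   forall y, 0 <= y <= b' -> h (Complex (2 * pi) y) = h (Complex 0 y)].
Proof.
move=> hs he1 he2; have [sp rp le] := rnorm_recenter hs.
have ne (e : R) : (e = 1 \/ e = -1) -> `|e| = 1 by case=> ->; rewrite ?normrN normr1.
(* The minus sign matches [kappa_strip_per], which subtracts multiples of 2 pi: a full period of the
   line parameter moves the base point by plus or minus one period in each coordinate. *)
have ie (e : R) : (e = 1 \/ e = -1) -> exists k : int, e = - k%:~R by case=> ->; [exists (-1); rewrite intrN opprK|exists 1].
pose P z : C^o * C^o := ((toC t.1 : C) + z * toC e1, (toC t.2 : C) + z * toC e2).
have Pin z : 0 <= complex.Im z <= b' -> in_cstrip b' (P z).
  move=> /andP[z0 zb]; have key (e u : R) : (e = 1 \/ e = -1) -> `|complex.Im (toC u + z * toC e)| <= b'.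
    move=> he; have -> : complex.Im (toC u + z * toC e) = complex.Im z * e by rewrite ImD ImM /toC /=; ring.
    by rewrite normrM (ne e he) mulr1 ger0_norm.
  by split; exact: key.
exists (fun z => kappa F (P z) (recenter2 s)); split.
- by move=> z hz; apply: (kappa_cdiffable HF H0 H1 cpos bp RS (t := (toC t.1, toC t.2)) (sg := (toC e1, toC e2)) (Pin z hz) sp rp).
- move=> z hz; apply: le_trans le; exact: (kappa_bound HF H0 H1 B0 B1 B2 cpos bp RS (Pin z hz) sp rp).
- move=> x.
  have -> : P (toC x) = (toC (t.1 + e1 * x, t.2 + e2 * x).1, toC (t.1 + e1 * x, t.2 + e2 * x).2).
    by rewrite /P /= -!toCM -!toCD [x * e1]mulrC [x * e2]mulrC.
  by rewrite kappa_real -K_recenter.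
- move=> y hy; have [k ke] := ie e1 he1; have [l le2] := ie e2 he2.
  have hP : strip2 r0 (P (Complex 0 y)) by apply: (in_cstrip_strip bp); exact: Pin.
  rewrite -(kappa_strip_per (recenter2 s) k l hP); congr kappa; rewrite /P /=.
  rewrite ke le2; congr pair; apply: complexP; rewrite ?(ReD,ImD,ReN,ImN,ReM,ImM) /toC /=; ring.
Qed.
End concrete.

(** * The truncated Galerkin scheme *)

Section bridge.
Variable R : realType.
Local Notation TR := (measurableTypeR R).
Local Notation C := (R[i]).
Local Notation mu_per2 := (@mu_per2 R).
Implicit Types (f phi : R * R -> C).

(* Only the values on I2 matter for the norms and operators at hand, and phi is not assumed measurable elsewhere. *)
Definition zero_ext f : R * R -> C := fun x => if x \in (@I2 R) then f x else 0.

Lemma zero_ext_in f x : @I2 R x -> zero_ext f x = f x. Proof. by move=> hx; rewrite /zero_ext mem_set. Qed.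

Lemma Re_zero_ext f x : (complex.Re (zero_ext f x))%:E = ((fun y => (complex.Re (f y))%:E) \_ (@I2 R)) x.
Proof. by rewrite patchE /zero_ext; case: ifP. Qed.
Lemma Im_zero_ext f x : (complex.Im (zero_ext f x))%:E = ((fun y => (complex.Im (f y))%:E) \_ (@I2 R)) x.
Proof. by rewrite patchE /zero_ext; case: ifP. Qed.

Lemma cint_zero_ext f : cint f = cintg mu_per2 setT (zero_ext f).
Proof.
have key (u w : R * R -> R) : (forall x, (w x)%:E = ((fun y => (u y)%:E) \_ (@I2 R)) x) -> Rintegral (@mu2 R) (@I2 R) u = Rintegral mu_per2 setT w.
  by move=> h; rewrite /Rintegral integral_mu2; congr fine; apply: eq_integral => x _; rewrite h.
by rewrite /cint (key _ _ (Re_zero_ext f)) (key _ _ (Im_zero_ext f)).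
Qed.

Lemma L2norm_zero_ext f : L2norm f = Num.sqrt (sqnorm (zero_ext f)).
Proof.
rewrite /L2norm /sqnorm /Rintegral; congr (Num.sqrt (fine _)); rewrite integral_mu2; apply: eq_integral => x _.
by rewrite patchE /zero_ext; case: ifP => _; rewrite ?cabs2E ?normc0 ?expr0n.
Qed.

Lemma int_cabs2 f : (\int[@mu2 R]_(x in (@I2 R)) (cabs2 (f x))%:E = \int[mu_per2]_x (normc (zero_ext f x) ^+ 2)%:E)%E.
Proof.
rewrite integral_mu2; apply: eq_integral => x _.
by rewrite patchE /zero_ext; case: ifP => _; rewrite ?cabs2E ?normc0 ?expr0n.
Qed.

Lemma zero_ext_meas f : cmeasurable (@I2 R : set (TR * TR)) f -> cmeasurable (setT : set (TR * TR)) (zero_ext f).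
Proof.
have key (g : TR * TR -> R) : measurable_fun (@I2 R : set (TR * TR)) g -> measurable_fun (setT : set (TR * TR)) (fun x => if x \in (@I2 R) then g x else 0).
  move=> mg; have := (measurable_restrictT g (@measurable_I2 R)).1 mg.
  by apply: eq_measurable_fun => x _; rewrite patchE.
move=> [a b]; split.
- by have := key _ a; apply: eq_measurable_fun => x _; rewrite /zero_ext; case: ifP.
- by have := key _ b; apply: eq_measurable_fun => x _; rewrite /zero_ext; case: ifP.
Qed.

Lemma zero_ext_ae f : {ae mu_per2, forall x, zero_ext f x = f x}.
Proof.
by apply: (@filterS _ _ (ae_filter_ringOfSetsType mu_per2) _ _ _ (ae_I2 R)) => x hx; exact: zero_ext_in.
Qed.

Lemma cmeasurable_zero_ext f : cmeasurable (setT : set (TR * TR)) f -> cmeasurable (setT : set (TR * TR)) (zero_ext f).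
Proof. by move=> [a b]; apply: zero_ext_meas; split; apply: measurable_funTS. Qed.

Lemma cintg_zero_ext f : cmeasurable (setT : set (TR * TR)) f -> cintg mu_per2 setT (zero_ext f) = cintg mu_per2 setT f.
Proof.
move=> mf; apply: ae_eq_cintg => //; first exact: cmeasurable_zero_ext.
by rewrite /ae_eq; apply: (@filterS _ _ (ae_filter_ringOfSetsType mu_per2) _ _ _ (zero_ext_ae f)).
Qed.

Lemma sqnorm_nn f g : cmeasurable (setT : set (TR * TR)) f -> cmeasurable (setT : set (TR * TR)) g ->
  {ae mu_per2, forall x, f x = g x} -> sqnorm f = sqnorm g.
Proof.
move=> mf mg fg; rewrite /sqnorm /Rintegral; congr fine; apply: ae_eq_integral => //.
- by apply/measurable_EFinP; apply: measurable_funX; exact: measurable_normc.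
- by apply/measurable_EFinP; apply: measurable_funX; exact: measurable_normc.
- by rewrite /ae_eq; apply: (@filterS _ _ (ae_filter_ringOfSetsType mu_per2) _ _ _ fg) => x -> _.
Qed.

Lemma sqnorm_zero_ext f : cmeasurable (setT : set (TR * TR)) f -> sqnorm (zero_ext f) = sqnorm f.
Proof. by move=> mf; apply: sqnorm_nn => //; [exact: cmeasurable_zero_ext|exact: zero_ext_ae]. Qed.

Lemma inL2_zero_ext f : inL2 f -> inL2m (zero_ext f).
Proof.
move=> [mr mi fin]; have mp : cmeasurable (setT : set (TR * TR)) (zero_ext f) by apply: zero_ext_meas; split.
split => //; apply/integrableP; split.
  by apply/measurable_EFinP; apply: measurable_funX; exact: measurable_normc.
under eq_integral do rewrite /= ger0_norm ?sqr_ge0//.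
by rewrite -int_cabs2.
Qed.

Lemma inL2m_inL2 f : inL2m f -> inL2 f.
Proof.
move=> [[mr mi] iF]; split; try exact: measurable_funTS.
rewrite int_cabs2; apply: (@le_lt_trans _ _ (\int[mu_per2]_x (normc (f x) ^+ 2)%:E)%E); last first.
  by rewrite sqnorm_fin ?ltry.
apply: ge0_le_integral => //; try by move=> x _; rewrite lee_fin sqr_ge0.
- by apply/measurable_EFinP; apply: measurable_funX; apply: measurable_normc; exact: cmeasurable_zero_ext.
- by apply/measurable_EFinP; apply: measurable_funX; apply: measurable_normc.
- by move=> x _; rewrite lee_fin /zero_ext; case: ifP => _ //; rewrite normc0 expr0n sqr_ge0.
Qed.

Lemma pzK f : zero_ext (zero_ext f) = zero_ext f.
Proof. by apply/funext => x; rewrite /zero_ext; case: ifP => // ->. Qed.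

Lemma fcoef_zero_ext f k : fcoef f k = fcoeff (zero_ext f) k.
Proof. by rewrite /fcoef /cinner cint_zero_ext; apply: eq_cintg => x _; rewrite /zero_ext; case: ifP => // _; rewrite mul0r. Qed.

Lemma fcoeff_zero_ext f k : cmeasurable (setT : set (TR * TR)) f -> fcoeff (zero_ext f) k = fcoeff f k.
Proof.
move=> mf; have me := cmeasJ (@cmeasurable_ebasis R k).
apply: ae_eq_cintg => //; try (apply: cmeasM => //; exact: cmeasurable_zero_ext).
by rewrite /ae_eq; apply: (@filterS _ _ (ae_filter_ringOfSetsType mu_per2) _ _ _ (zero_ext_ae f)) => x ->.
Qed.

Lemma L2zero_ae f : cmeasurable (setT : set (TR * TR)) (zero_ext f) -> L2zero f -> {ae mu_per2, forall x, zero_ext f x = 0}.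
Proof.
move=> mf; rewrite /L2zero int_cabs2 => h.
have mn : measurable_fun (setT : set (TR * TR)) (fun x => (normc (zero_ext f x) ^+ 2)%:E).
  by apply/measurable_EFinP; apply: measurable_funX; exact: measurable_normc.
have := (@ae_eq_integral_abs _ _ _ mu_per2 setT measurableT _ mn).1.
rewrite /ae_eq => H; have /H {}H : (\int[mu_per2]_x `|(normc (zero_ext f x) ^+ 2)%:E| = 0)%E.
  by rewrite -[RHS]h; apply: eq_integral => x _; rewrite gee0_abs// lee_fin sqr_ge0.
apply: (@filterS _ _ (ae_filter_ringOfSetsType mu_per2) _ _ _ H) => x /(_ I) /= [] /eqP.
by rewrite sqrf_eq0 normc_eq0 => /eqP.
Qed.

Lemma ae_L2zero f : cmeasurable (setT : set (TR * TR)) (zero_ext f) -> {ae mu_per2, forall x, zero_ext f x = 0} -> L2zero f.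
Proof.
move=> mf h; rewrite /L2zero int_cabs2.
rewrite (ae_eq_integral (cst 0%E)) ?integral0//.
- by apply/measurable_EFinP; apply: measurable_funX; exact: measurable_normc.
- by rewrite /ae_eq; apply: (@filterS _ _ (ae_filter_ringOfSetsType mu_per2) _ _ _ h) => x -> _; rewrite normc0 expr0n.
Qed.

Variable G : R * R -> 'rV[R]_3.
Let K := Kker G.

Lemma Kop_zero_ext phi : Kop G phi = kernel_op K (zero_ext phi).
Proof.
apply/funext => t; rewrite /Kop /intop cint_zero_ext; apply: eq_cintg => e _.
by rewrite /zero_ext; case: ifP => // _; rewrite mulr0.
Qed.

Hypothesis mK : measurable_fun (setT : set ((TR * TR) * (TR * TR))) (fun p => K p.1 p.2).
Hypothesis K1per : forall e, biper (fun t => K t e).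
Variable v : R * R -> R.
Hypothesis v0 : forall s, 0 <= v s.
Hypothesis mv : measurable_fun (setT : set (TR * TR)) v.
Variable V : R.
Hypothesis Vint : (\int[mu_per2]_x (v x)%:E <= V%:E)%E.
Hypothesis Kv2 : forall e s, open_cell s -> `|K (e.1 + s.1, e.2 + s.2) e| <= v s.

Lemma Kop_kernel_op phi : cmeasurable (setT : set (TR * TR)) phi -> Kop G phi = kernel_op K phi.
Proof.
move=> mf; rewrite Kop_zero_ext; apply/funext => t; apply: ae_eq_cintg => //.
- by apply: cmeasM; [exact: (cmeasurable_toC (measurable_kernel2 mK t))|exact: cmeasurable_zero_ext].
- by apply: cmeasM => //; exact: (cmeasurable_toC (measurable_kernel2 mK t)).
by rewrite /ae_eq; apply: (@filterS _ _ (ae_filter_ringOfSetsType mu_per2) _ _ _ (zero_ext_ae phi)) => x ->.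
Qed.

Lemma Kmat_kernel_mx k l : Kmat G k l = kernel_mx K k l.
Proof.
have iK := kernel_op_int mK K1per v0 mv Vint Kv2 (@cint_ebasis R l).
rewrite /Kmat -[LHS]/(fcoef (Kop G (ebasis l)) k) fcoef_zero_ext Kop_kernel_op; last exact: cmeasurable_ebasis.
by rewrite fcoeff_zero_ext//; exact: cintegrable_cmeasurable iK.
Qed.

Lemma Pn_trig_poly n phi : Pn n phi = trig_poly (box n) (fcoef phi).
Proof. by apply/funext => t; rewrite /Pn /trig_poly -sum_box. Qed.

Lemma cmeasurable_trig_poly n (a : int * int -> C) : cmeasurable (setT : set (TR * TR)) (trig_poly (box n) a : R * R -> C).
Proof. by have [] := @inL2m_trig_poly R (box n) a. Qed.

Lemma trig_poly_B n (a b : int * int -> C) t : trig_poly (box n) a t - trig_poly (box n) b t = trig_poly (box n) (fun k => a k - b k) t.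
Proof. by rewrite /trig_poly -sumrB; apply: eq_bigr => k _; rewrite mulrBl. Qed.

Lemma L2norm_trig_poly n (a : int * int -> C) : L2norm (trig_poly (box n) a) = Num.sqrt (\sum_(k <- box n) normc (a k) ^+ 2).
Proof. by rewrite L2norm_zero_ext sqnorm_zero_ext ?sqnorm_trig_poly ?box_uniq//; exact: cmeasurable_trig_poly. Qed.

Variable q : R.
Definition cutoff (n : nat) : R := q * ln ((NN n)%:R : R).

(** Orthonormality: integrating the degenerate kernel against a trigonometric polynomial picks out
    its coefficients, so on the space of the scheme the operator is the truncated matrix. *)
Lemma Ktilde_trig_poly n (a : int * int -> C) : Ktilde G q n (trig_poly (box n) a) = trig_poly (box n) (fun k => \sum_(l <- box n) trunc_mx (kernel_mx K) (cutoff n) k l * a l).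
Proof.
have cexp_up k l : Ktilde_coef G q n k l = trunc_mx (kernel_mx K) (cutoff n) k l.
  by rewrite /Ktilde_coef /trunc_mx Kmat_kernel_mx.
have kE t s : Ktilde_kernel G q n t s = \sum_(k <- box n) \sum_(l <- box n) (trunc_mx (kernel_mx K) (cutoff n) k l * ebasis k t) * conjc (ebasis l s).
  rewrite /Ktilde_kernel -sum_box; apply: eq_bigr => i _; apply: eq_bigr => j _.
  rewrite -sum_box; apply: eq_bigr => i' _; apply: eq_bigr => j' _.
  by rewrite cexp_up.
apply/funext => t; rewrite /Ktilde /intop cint_zero_ext.
have ip l : cintegrable mu_per2 setT (fun s => trig_poly (box n) a s * conjc (ebasis l s)).
  by apply: fcE; apply: inL2m_cintegrable; exact: inL2m_trig_poly.
have iz k l : cintegrable mu_per2 setT (fun s => (trunc_mx (kernel_mx K) (cutoff n) k l * ebasis k t) * (trig_poly (box n) a s * conjc (ebasis l s))).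
  exact: (cintegrableZ measurableT _ (ip l)).
have is_ k : cintegrable mu_per2 setT (fun s => \sum_(l <- box n) (trunc_mx (kernel_mx K) (cutoff n) k l * ebasis k t) * (trig_poly (box n) a s * conjc (ebasis l s))).
  by apply: cintegrable_sum => // l; exact: iz.
have E : (fun s => Ktilde_kernel G q n t s * trig_poly (box n) a s) =
   (fun s => \sum_(k <- box n) \sum_(l <- box n) (trunc_mx (kernel_mx K) (cutoff n) k l * ebasis k t) * (trig_poly (box n) a s * conjc (ebasis l s))).
  apply/funext => s; rewrite kE mulr_suml; apply: eq_bigr => k _; rewrite mulr_suml; apply: eq_bigr => l _.
  by rewrite -[in LHS]mulrA [conjc _ * _]mulrC.
rewrite E cintg_zero_ext; last by apply: cintegrable_cmeasurable; apply: cintegrable_sum => // k; exact: is_.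
rewrite cintg_sum//; apply: eq_big_seq => k kb; rewrite cintg_sum// mulr_suml; apply: eq_big_seq => l lb.
rewrite cIZ// -[cintg mu_per2 setT _]/(fcoeff (trig_poly (box n) a) l) fcoeff_trig_poly ?box_uniq// lb.
by rewrite mulrAC.
Qed.

Lemma inXn_trig_poly n f : inXn n f -> exists a, f = trig_poly (box n) a.
Proof.
move=> [a Ha].
exists (fun k => \sum_(i < Nn n) \sum_(j < Nn n) (if (idx i, idx j) == k then a i j else 0)).
apply/funext => t; rewrite Ha /trig_poly -sum_box; apply: eq_bigr => i _; apply: eq_bigr => j _; congr (_ * _).
rewrite (bigD1 i)//= (bigD1 j)//= eqxx big1 ?addr0; last first.
  by move=> j' hj; rewrite xpair_eqE eqxx /= (inj_eq (@idx_inj n)) (negbTE hj).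
rewrite big1 ?addr0// => i' hi; apply: big1 => j' _.
by rewrite xpair_eqE (inj_eq (@idx_inj n)) (negbTE hi).
Qed.
End bridge.

Section hp.
Variable R : realType.
Local Notation C := (R[i]).

Lemma Hp_weight_ge1 p (k : int * int) : 1 <= Hp_weight R p k.
Proof. by rewrite /Hp_weight exprn_ege1// -addrA lerDl addr_ge0 ?sqr_ge0. Qed.

Lemma Hp_sum_ge p (f : R * R -> C) (s : seq (int * int)) : uniq s ->
  ((\sum_(k <- s) (Hp_weight R p k * normc (fcoef f k) ^+ 2))%:E <= Hp_sum p f)%E.
Proof.
move=> us; apply: esum_ge; exists [set` s].
  by split=> //; exact: finite_seq.
rewrite -fsbig_seq// -sumEFin le_eqVlt; apply/orP; left; apply/eqP.
by apply: eq_bigr => k _; rewrite cabs2E.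
Qed.

(** Outside the box some component has modulus at least n + 1, and N = (2 n + 1)^2 <= 4 (1 + (n +
    1)^2); this is the origin of the 4. *)
Lemma weight_tail p n (k : int * int) : k \notin box n -> ((NN n)%:R / 4) ^+ p <= Hp_weight R p k :> R.
Proof.
move=> hk; rewrite /Hp_weight; apply: lerXn2r; rewrite ?nnegrE ?divr_ge0 ?addr_ge0 ?sqr_ge0//.
have hN : (NN n)%:R <= 4 * (1 + (n%:R + 1) ^+ 2) :> R.
  have -> : (NN n)%:R = (2 * n%:R + 1) ^+ 2 :> R by rewrite /NN /Nn natrX natrD natrM.
  have := ler0n R n; rewrite !expr2; nra.
have key (z : int) : n%:Z < `|z| -> (n%:R + 1) ^+ 2 <= (z%:~R : R) ^+ 2.
  move=> hz; rewrite -[X in _ <= X]real_normK ?num_real// ler_pXn2r ?nnegrE ?addr_ge0//.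
  rewrite -intr_norm (_ : n%:R + 1 = (n%:Z + 1)%:~R :> R); last by rewrite intrD.
  by rewrite ler_int; lia.
move: hk; rewrite mem_box negb_and -!ltNge => /orP[/key h|/key h].
- have := sqr_ge0 (k.2%:~R : R); lra.
- have := sqr_ge0 (k.1%:~R : R); lra.
Qed.
End hp.

(** * Residual of the exact coefficients in the truncated system *)

Section consistency.
Variable R : realType.
Local Notation C := (R[i]).

Lemma seq_unif (T : eqType) (s : seq T) (P : T -> nat -> Prop) :
  (forall k, exists N, forall n, (N <= n)%N -> P k n) ->
  exists N, forall n k, (N <= n)%N -> k \in s -> P k n.
Proof.
move=> h; elim: s => [|x s [N ih]]; first by exists 0%N.
have [M hM] := h x; exists (maxn M N) => n k; rewrite geq_max => /andP[n1 n2].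
by rewrite inE => /orP[/eqP ->|ks]; [exact: hM|exact: ih].
Qed.

Lemma normc_small0 (z : C) : (forall e : R, 0 < e -> normc z <= e) -> z = 0.
Proof.
move=> h; apply/eqP; rewrite -normc_eq0 eq_le normc_ge0 andbT.
by apply/ler_addgt0Pl => e e0; rewrite addr0; exact: h.
Qed.

Lemma sum_box_split (V : nmodType) m n (f : int * int -> V) : (n <= m)%N ->
  \sum_(l <- box m) f l = \sum_(l <- box n) f l + \sum_(l <- [seq l <- box m | l \notin box n]) f l.
Proof.
move=> nm; rewrite (bigID (mem (box n)))/= big_filter; congr (_ + _).
rewrite -big_filter; apply: perm_big; apply: uniq_perm; rewrite ?filter_uniq ?box_uniq// => k.
by rewrite mem_filter; have [kn|] := boolP (k \in box n) => //=; rewrite (box_sub nm kn).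
Qed.

Variables (A : int * int -> int * int -> C) (C0 be b : R).
Hypotheses (C00 : 0 <= C0) (be0 : 0 < be) (b0 : 0 <= b) (bbe : b < be).
Hypothesis hA : forall k l, normc (A k l) <= C0 * exp_wt be (k - l).

(** The residual splits into (A - A_T) r on the box and A applied to the part of r outside it, both
    bounded by Schur's test with constants independent of n and T. The factor 4 comes from squaring
    a sum twice. [D] plays A r, given only as a limit of box sums. *)
Lemma consistency : exists S La : R, forall (n : nat) (T Q t : R) (r D : int * int -> C),
  (\sum_(k <- box n) normc (r k) ^+ 2 <= Q) ->
  (forall m, (n <= m)%N -> \sum_(k <- [seq k <- box m | k \notin box n]) normc (r k) ^+ 2 <= t) ->
  (forall k e, 0 < e -> exists N, forall m, (N <= m)%N -> normc (D k - \sum_(l <- box m) A k l * r l) <= e) ->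
  \sum_(k <- box n) normc (D k - \sum_(l <- box n) trunc_mx A T k l * r l) ^+ 2 <=
    4 * ((S * expR (- (b * T))) ^+ 2 * Q + La ^+ 2 * t).
Proof.
have [S S0 hS] := trunc_mx_tails C00 hA b0 bbe.
have [La La0 hLa] := row_col_bounds C00 be0 hA.
exists S, La => n T Q t r D hQ ht hD.
set tau := S * expR (- (b * T)); set W := 4 * _.
have tau0 : 0 <= tau by rewrite mulr_ge0 ?expR_ge0.
(* The slack [e] absorbs the replacement of [D] by a finite box sum, made uniform over the finitely
   many k of the box; [M] divides it among them. *)
apply/ler_addgt0Pr => e e0.
pose M : R := 2 * (size (box n))%:R + 1.
have M0 : 0 < M by rewrite ltr_wpDl// mulr_ge0.
have d0 : 0 < Num.sqrt (e / M) by rewrite sqrtr_gt0 divr_gt0.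
have [N hN] := seq_unif (box n) (fun k => hD k _ d0).
pose m := maxn n N; have nm : (n <= m)%N := leq_maxl _ _.
pose X k := \sum_(l <- box m) A k l * r l.
pose Y k := \sum_(l <- box n) trunc_mx A T k l * r l.
pose Z1 k := \sum_(l <- box n) (A k l - trunc_mx A T k l) * r l.
pose Z2 k := \sum_(l <- [seq l <- box m | l \notin box n]) A k l * r l.
have XY k : X k - Y k = Z1 k + Z2 k.
  rewrite /X /Y /Z1 /Z2 (sum_box_split _ nm) addrAC -sumrB; congr (_ + _).
  by apply: eq_bigr => l _; rewrite mulrBl.
have s1 : \sum_(k <- box n) normc (Z1 k) ^+ 2 <= tau ^+ 2 * Q.
  apply: (@le_trans _ _ (tau * tau * \sum_(l <- box n) normc (r l) ^+ 2)).
    by apply: schur => // [k _|l _]; have [h1 h2] := hS T _ (box_uniq n); [exact: h1|exact: h2].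
  by rewrite -expr2 ler_wpM2l ?sqr_ge0.
have s2 : \sum_(k <- box n) normc (Z2 k) ^+ 2 <= La ^+ 2 * t.
  apply: (@le_trans _ _ (La * La * \sum_(l <- [seq l <- box m | l \notin box n]) normc (r l) ^+ 2)).
    apply: schur => // [k _|l _]; first by have [h1 _] := hLa _ (filter_uniq [pred l | l \notin box n] (box_uniq m)); exact: h1.
    by have [_ h2] := hLa _ (box_uniq n); exact: h2.
  by rewrite -expr2 ler_wpM2l ?sqr_ge0//; exact: ht.
have each k : k \in box n -> normc (D k - Y k) ^+ 2 <= 2 * (e / M) + (4 * normc (Z1 k) ^+ 2 + 4 * normc (Z2 k) ^+ 2).
  move=> kb.
  have -> : D k - Y k = (D k - X k) + (X k - Y k) by rewrite addrA subrK.
  apply: (le_trans (sqnorm_add _ _)); rewrite XY.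
  have h1 : normc (D k - X k) ^+ 2 <= e / M.
    rewrite -[leRHS]sqr_sqrtr; last by rewrite ltW// divr_gt0.
    by rewrite ler_pXn2r ?nnegrE ?normc_ge0 ?sqrtr_ge0//; apply: hN kb; exact: leq_maxr.
  have h2 := sqnorm_add (Z1 k) (Z2 k).
  move: (normc (D k - X k) ^+ 2) (normc (Z1 k + Z2 k) ^+ 2) (normc (Z1 k) ^+ 2) (normc (Z2 k) ^+ 2) (e / M) h1 h2 => a1 a2 a3 a4 a5; lra.
apply: (@le_trans _ _ (\sum_(k <- box n) (2 * (e / M) + (4 * normc (Z1 k) ^+ 2 + 4 * normc (Z2 k) ^+ 2)))).
  by rewrite big_seq [leRHS]big_seq; apply: ler_sum => k; exact: each.
rewrite !big_split/= big_const_seq count_predT iter_addr_0 -!mulr_sumr.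
have h : (2 * (e / M)) *+ size (box n) <= e.
  rewrite -mulr_natr (_ : 2 * (e / M) * _ = e * (2 * (size (box n))%:R / M)); last by ring.
  by rewrite ler_piMr ?(ltW e0)// ler_pdivrMr// mul1r lerDl.
rewrite /W; move: s1 s2 h.
move: (\sum_(k <- box n) normc (Z1 k) ^+ 2) (\sum_(k <- box n) normc (Z2 k) ^+ 2) (_ *+ _) (tau ^+ 2 * Q) (La ^+ 2 * t) => a1 a2 a3 a4 a5; lra.
Qed.
End consistency.

Section rate.
Variable R : realType.

Lemma NN_gt0 n : (0 < NN n)%N. Proof. by rewrite /NN /Nn expn_gt0 addn1. Qed.

Lemma cutoff_lim (q : R) : 0 < q -> forall x, exists N, forall n, (N <= n)%N -> x <= cutoff q n.
Proof.
move=> q0 x; exists (Num.bound (expR (x / q))) => n hn.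
rewrite /cutoff mulrC -ler_pdivrMr// -[leLHS]expRK ler_ln ?posrE ?expR_gt0 ?ltr0n ?NN_gt0//.
apply: ltW; apply: (lt_le_trans (archi_boundP (expR_ge0 _))); rewrite ler_nat (leq_trans hn)//.
by rewrite /NN /Nn; nia.
Qed.

Lemma rate_sqnorm (p n : nat) : ((NN n)%:R `^ (- (p%:R / 2)) : R) ^+ 2 = ((NN n)%:R ^+ p)^-1.
Proof.
have N0 : 0 < (NN n)%:R :> R by rewrite ltr0n NN_gt0.
rewrite /powR gt_eqF// -expRM_natl (_ : 2%:R * _ = - (p%:R * ln (NN n)%:R)); last by field.
by rewrite expRN expRM_natl lnK.
Qed.

Lemma rate_le (p n : nat) (q b : R) : p%:R / 2 <= q * b -> expR (- (b * cutoff q n)) <= (NN n)%:R `^ (- (p%:R / 2)).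
Proof.
move=> h; have N1 : 1 <= (NN n)%:R :> R by rewrite ler1n NN_gt0.
rewrite /powR gt_eqF ?(lt_le_trans ltr01)// ler_expR mulNr lerN2 /cutoff mulrA [b * q]mulrC.
by rewrite ler_wpM2r// ln_ge0.
Qed.
End rate.

(** * Stability and the error estimate *)

Section galerkin.
Variable R : realType.
Local Notation TR := (measurableTypeR R).
Local Notation C := (R[i]).
Local Notation mu_per2 := (@mu_per2 R).
Variable G : R * R -> 'rV[R]_3.
Let K := Kker G.
Hypothesis mK : measurable_fun (setT : set ((TR * TR) * (TR * TR))) (fun p => K p.1 p.2).
Hypothesis K1per : forall e, biper (fun t => K t e).
Variable v : R * R -> R.
Hypothesis v0 : forall s, 0 <= v s.
Hypothesis mv : measurable_fun (setT : set (TR * TR)) v.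
Variable V : R.
Hypothesis Vint : (\int[mu_per2]_x (v x)%:E <= V%:E)%E.
Hypothesis Kv2 : forall e s, open_cell s -> `|K (e.1 + s.1, e.2 + s.2) e| <= v s.
Variables (be b q : R) (p : nat).
Hypotheses (V0 : 0 <= V) (b0 : 0 < b) (bbe : b < be) (q0 : 0 < q) (pqb : p%:R / 2 <= q * b).
Hypothesis hA : forall k l, normc (kernel_mx K k l) <= V * exp_wt be (k - l).
Hypothesis hRL : forall m e, 0 < e -> exists L, forall l, l \notin box L -> normc (kernel_mx K (l + m) l) <= e.
Hypothesis inj : forall phi, inL2 phi -> L2zero (fun t => phi t - Kop G phi t) -> L2zero phi.

Let be0 : 0 < be. Proof. exact: lt_trans bbe. Qed.

Lemma fcoeff_ae0 (f : R * R -> C) k : cmeasurable (setT : set (TR * TR)) f -> {ae mu_per2, forall x, f x = 0} -> fcoeff f k = 0.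
Proof.
move=> mf h; rewrite -(cI0 mu_per2 (setT : set (TR * TR))); apply: ae_eq_cintg => //.
  by apply: cmeasM => //; exact: (cmeasJ (@cmeasurable_ebasis R k)).
by rewrite /ae_eq; apply: (@filterS _ _ (ae_filter_ringOfSetsType mu_per2) _ _ _ h) => x -> _; rewrite mul0r.
Qed.

(** Riesz-Fischer realizes the sequence as a function. Its residual under I - K has zero
    coefficients, so it vanishes almost everywhere, and injectivity of the operator applies. The
    function is cut to the period cell because the operator only reads it there. *)
Lemma kernel_mx_inj (a : int * int -> C) (M : R) : (forall n, \sum_(k <- box n) normc (a k) ^+ 2 <= M) ->
  (forall k e, 0 < e -> exists N, forall n, (N <= n)%N -> normc (a k - \sum_(l <- box n) kernel_mx K k l * a l) <= e) ->
  forall k, a k = 0.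
Proof.
move=> ha hk; have [w [iw fw _]] := riesz_fischer ha.
pose w' := zero_ext w; have iw' : inL2m w' := inL2_zero_ext (inL2m_inL2 iw).
have fw' k : fcoeff w' k = a k by rewrite fcoeff_zero_ext ?fw//; exact: iw.1.
have ci : cintegrable mu_per2 setT w' := inL2m_cintegrable iw'.
have iK := kernel_op_int mK K1per v0 mv Vint Kv2 ci.
have ih : cintegrable mu_per2 setT (fun x => w' x - kernel_op K w' x) by exact: cintegrableB.
have fh k : fcoeff (fun x => w' x - kernel_op K w' x) k = 0.
  rewrite fcB// fw'; apply: normc_small0 => e e0; have e20 : 0 < e / 2 by rewrite divr_gt0.
  have [N1 h1] := hk k _ e20; have [N2 h2] := fcoeff_kernel_op_lim mK K1per v0 mv Vint Kv2 k iw' e20.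
  have {}h1 := h1 (maxn N1 N2) (leq_maxl _ _); have {}h2 := h2 (maxn N1 N2) (leq_maxr _ _).
  rewrite (eq_bigr (fun l => kernel_mx K k l * a l)) in h2; last by move=> l _; rewrite fw'.
  have aux (x y z : C) : x - y = (x - z) - (y - z) by rewrite opprB addrA subrK.
  rewrite (aux _ _ (\sum_(l <- box (maxn N1 N2)) kernel_mx K k l * a l)).
  by apply: (le_trans (ler_normcB _ _)); rewrite (splitr e); apply: lerD.
have ae0 := fcoeff_eq0_ae ih fh.
have z1 : L2zero (fun t => w' t - Kop G w' t).
  rewrite Kop_zero_ext /w' pzK; apply: ae_L2zero; first exact: (cmeasurable_zero_ext (cintegrable_cmeasurable ih)).
  by apply: (@filterS _ _ (ae_filter_ringOfSetsType mu_per2) _ _ _ ae0) => x hx; rewrite [LHS]/zero_ext; case: ifP.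
have z2 := inj (inL2m_inL2 iw') z1.
have mpp : cmeasurable (setT : set (TR * TR)) (zero_ext w') by rewrite /w' pzK; exact: iw'.1.
have := L2zero_ae mpp z2; rewrite {1}/w' pzK => ae1.
have s0 := sqnorm_ae0 iw' ae1.
move=> k; have := normc_fcoeff_le k iw'; rewrite s0 fw' => h.
by apply/eqP; rewrite -normc_eq0 -sqrf_eq0 eq_le h sqr_ge0.
Qed.

Lemma stability c n : 0 < c -> (forall a : int * int -> C, c * \sum_(k <- box n) normc (a k) ^+ 2 <=
    \sum_(k <- box n) normc (a k - \sum_(l <- box n) trunc_mx (kernel_mx K) (cutoff q n) k l * a l) ^+ 2) ->
  forall phi, Num.sqrt c * L2norm (Pn n phi) <= L2norm (fun t => Pn n phi t - Ktilde G q n (Pn n phi) t).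
Proof.
move=> c0 hc phi; rewrite Pn_trig_poly (Ktilde_trig_poly mK K1per v0 mv Vint Kv2).
have -> : (fun t => trig_poly (box n) (fcoef phi) t - trig_poly (box n) (fun k => \sum_(l <- box n) trunc_mx (kernel_mx K) (cutoff q n) k l * fcoef phi l) t)
  = trig_poly (box n) (fun k => fcoef phi k - \sum_(l <- box n) trunc_mx (kernel_mx K) (cutoff q n) k l * fcoef phi l).
  by apply/funext => t; rewrite trig_poly_B.
by rewrite !L2norm_trig_poly -sqrtrM ?(ltW c0)//; exact: ler_wsqrtr.
Qed.

Lemma L2zero_norm (f : R * R -> C) : L2zero f -> L2norm f = 0.
Proof. by rewrite /L2zero /L2norm /Rintegral => ->; rewrite /= sqrtr0. Qed.

Lemma Hp_tail (rho : R * R -> C) m n : (Hp_sum p rho < +oo)%E ->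
  \sum_(k <- [seq k <- box m | k \notin box n]) normc (fcoeff (zero_ext rho) k) ^+ 2
    <= 4 ^+ p * ((NN n)%:R ^+ p)^-1 * fine (Hp_sum p rho).
Proof.
move=> fin; set s := [seq _ <- _ | _].
have us : uniq s by rewrite filter_uniq ?box_uniq.
have N0 : 0 < (NN n)%:R :> R by rewrite ltr0n NN_gt0.
have H0 : (0 <= Hp_sum p rho)%E by apply: esum_ge0 => k _; rewrite lee_fin mulr_ge0 ?(le_trans ler01 (Hp_weight_ge1 _ _ _))// /cabs2 addr_ge0 ?sqr_ge0.
have h := Hp_sum_ge p rho us.
rewrite -[X in (_ <= X)%E]fineK ?ge0_fin_numE// lee_fin in h.
apply: (@le_trans _ _ (4 ^+ p * ((NN n)%:R ^+ p)^-1 * \sum_(k <- s) (Hp_weight R p k * normc (fcoef rho k) ^+ 2))); last first.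
  by apply: ler_wpM2l => //; rewrite mulr_ge0 ?exprn_ge0// invr_ge0 exprn_ge0// ltW.
rewrite mulr_sumr big_seq [leRHS]big_seq; apply: ler_sum => k.
rewrite mem_filter => /andP[kn _]; have w := @weight_tail R p _ _ kn.
rewrite -fcoef_zero_ext mulrA ler_peMl ?sqr_ge0//.
have P0 : 0 < ((NN n)%:R / 4) ^+ p :> R by rewrite exprn_gt0// divr_gt0.
have -> : 4 ^+ p * ((NN n)%:R ^+ p)^-1 = (((NN n)%:R / 4) ^+ p)^-1 :> R by rewrite expr_div_n invf_div.
by rewrite mulrC ler_pdivlMr// mul1r.
Qed.

Lemma Hp_all (rho : R * R -> C) s : uniq s -> (Hp_sum p rho < +oo)%E ->
  \sum_(k <- s) normc (fcoeff (zero_ext rho) k) ^+ 2 <= fine (Hp_sum p rho).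
Proof.
move=> us fin.
have H0 : (0 <= Hp_sum p rho)%E by apply: esum_ge0 => k _; rewrite lee_fin mulr_ge0 ?(le_trans ler01 (Hp_weight_ge1 _ _ _))// /cabs2 addr_ge0 ?sqr_ge0.
have h := Hp_sum_ge p rho us.
rewrite -[X in (_ <= X)%E]fineK ?ge0_fin_numE// lee_fin in h.
by apply: (le_trans _ h); apply: ler_sum => k _; rewrite -fcoef_zero_ext ler_peMl ?sqr_ge0 ?Hp_weight_ge1.
Qed.

Lemma residual_eq (rho g : R * R -> C) : inL2 rho -> inL2 g -> L2zero (fun t => rho t - Kop G rho t - g t) ->
  forall k, fcoeff (zero_ext rho) k = fcoeff (kernel_op K (zero_ext rho)) k + fcoef g k.
Proof.
move=> /inL2_zero_ext ir /inL2_zero_ext ig hz k.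
have ci := inL2m_cintegrable ir; have cg := inL2m_cintegrable ig.
have iK := kernel_op_int mK K1per v0 mv Vint Kv2 ci.
have ih1 : cintegrable mu_per2 setT (fun x => zero_ext rho x - kernel_op K (zero_ext rho) x) by exact: cintegrableB.
have ih : cintegrable mu_per2 setT (fun x => zero_ext rho x - kernel_op K (zero_ext rho) x - zero_ext g x) by exact: cintegrableB.
have E : zero_ext (fun t => rho t - Kop G rho t - g t) = zero_ext (fun x => zero_ext rho x - kernel_op K (zero_ext rho) x - zero_ext g x).
  by rewrite Kop_zero_ext; apply/funext => x; rewrite /zero_ext; case: ifP.
have mE : cmeasurable (setT : set (TR * TR)) (zero_ext (fun t => rho t - Kop G rho t - g t)).
  by rewrite E; apply: cmeasurable_zero_ext; exact: cintegrable_cmeasurable ih.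
have := fcoeff_ae0 k mE (L2zero_ae mE hz).
rewrite E fcoeff_zero_ext; last exact: cintegrable_cmeasurable ih.
rewrite fcB// fcB// -(fcoef_zero_ext g).
have aux (x y z : C) : x - y - z = 0 -> x = y + z by move/eqP; rewrite -addrA -opprD subr_eq0 => /eqP.
exact: aux.
Qed.

Lemma L2norm_sub_trig_poly (rho : R * R -> C) n (a : int * int -> C) (t : R) : inL2 rho ->
  (forall m, (n <= m)%N -> \sum_(k <- [seq k <- box m | k \notin box n]) normc (fcoeff (zero_ext rho) k) ^+ 2 <= t) ->
  L2norm (fun x => rho x - trig_poly (box n) a x) <= Num.sqrt (t + \sum_(k <- box n) normc (fcoeff (zero_ext rho) k - a k) ^+ 2).
Proof.
move=> /inL2_zero_ext ir ht; rewrite L2norm_zero_ext; apply: ler_wsqrtr.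
have -> : zero_ext (fun x => rho x - trig_poly (box n) a x) = zero_ext (fun x => zero_ext rho x - trig_poly (box n) a x).
  by apply/funext => x; rewrite /zero_ext; case: ifP.
rewrite sqnorm_zero_ext; last by apply: cmeasB; [exact: ir.1|exact: cmeasurable_trig_poly].
rewrite sqnorm_sub_trig_poly ?box_uniq// lerD2r.
apply/ler_addgt0Pr => e e0; have [N hN] := parseval_sum ir e0.
have := hN (maxn n N) (leq_maxr _ _); have := ht (maxn n N) (leq_maxl _ _).
rewrite /box_sq (sum_box_split (fun k => normc (fcoeff (zero_ext rho) k) ^+ 2) (leq_maxl n N)).
lra.
Qed.

(** By Parseval the squared error is the tail of rho outside the box, controlled by the H_p norm,
    plus the squared distance of the coefficients on the box, controlled by stability and
    consistency. Each part is a constant times N^(-p) times the squared H_p norm. *)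
Lemma error_bound c n S La (rho g rhot : R * R -> C) : 0 < c ->
  (forall a : int * int -> C, c * \sum_(k <- box n) normc (a k) ^+ 2 <=
    \sum_(k <- box n) normc (a k - \sum_(l <- box n) trunc_mx (kernel_mx K) (cutoff q n) k l * a l) ^+ 2) ->
  (forall (Q t : R) (r D : int * int -> C), (\sum_(k <- box n) normc (r k) ^+ 2 <= Q) ->
    (forall m, (n <= m)%N -> \sum_(k <- [seq k <- box m | k \notin box n]) normc (r k) ^+ 2 <= t) ->
    (forall k e, 0 < e -> exists N, forall m, (N <= m)%N -> normc (D k - \sum_(l <- box m) kernel_mx K k l * r l) <= e) ->
    \sum_(k <- box n) normc (D k - \sum_(l <- box n) trunc_mx (kernel_mx K) (cutoff q n) k l * r l) ^+ 2 <=
      4 * ((S * expR (- (b * cutoff q n))) ^+ 2 * Q + La ^+ 2 * t)) ->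
  inL2 rho -> inL2 g -> (Hp_sum p rho < +oo)%E -> L2zero (fun t => rho t - Kop G rho t - g t) ->
  inXn n rhot -> L2zero (fun t => rhot t - Ktilde G q n rhot t - Pn n g t) ->
  L2norm (fun t => rho t - rhot t) <=
    Num.sqrt (4 ^+ p + c^-1 * (4 * (S ^+ 2 + La ^+ 2 * 4 ^+ p))) * ((NN n)%:R `^ (- (p%:R / 2))) * Num.sqrt (fine (Hp_sum p rho)).
Proof.
move=> c0 hc hcons ir ig fin hz /inXn_trig_poly [a ->] hz'.
set y := _ `^ _; set H := fine _.
have H0 : 0 <= H by have := Hp_all (s := [::]) isT fin; rewrite big_nil.
have y0 : 0 <= y by exact: powR_ge0.
have y2 : y ^+ 2 = ((NN n)%:R ^+ p)^-1 by exact: rate_sqnorm.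
pose r := fcoeff (zero_ext rho).
have ht m (_ : (n <= m)%N) := @Hp_tail rho m n fin.
rewrite -y2 -/H in ht.
apply: (le_trans (L2norm_sub_trig_poly _ ir ht)).
have hD k e : 0 < e -> exists N, forall m, (N <= m)%N -> normc (fcoeff (kernel_op K (zero_ext rho)) k - \sum_(l <- box m) kernel_mx K k l * r l) <= e.
  by move=> e0; exact: (fcoeff_kernel_op_lim mK K1per v0 mv Vint Kv2 k (inL2_zero_ext ir) e0).
have h1 := hcons H _ r (fcoeff (kernel_op K (zero_ext rho))) (Hp_all (box_uniq n) fin) ht hD.
pose u k := a k - \sum_(l <- box n) trunc_mx (kernel_mx K) (cutoff q n) k l * a l - fcoef g k.
have uE : (fun t => trig_poly (box n) a t - Ktilde G q n (trig_poly (box n) a) t - Pn n g t) = trig_poly (box n) u.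
  by rewrite (Ktilde_trig_poly mK K1per v0 mv Vint Kv2) Pn_trig_poly; apply/funext => t; rewrite !trig_poly_B.
have u0 k : k \in box n -> u k = 0.
  have := L2zero_norm hz'; rewrite uE L2norm_trig_poly => /eqP; rewrite sqrtr_eq0 => s0 kb.
  have := @psumr_eq0 R _ (box n) predT (fun k => normc (u k) ^+ 2) (fun k _ => sqr_ge0 _).
  have -> : (\sum_(k <- box n) normc (u k) ^+ 2 == 0) = true.
    by rewrite eq_le s0 sumr_ge0// => i _; exact: sqr_ge0.
  by move=> /esym/allP/(_ _ kb); rewrite /= sqrf_eq0 normc_eq0 => /eqP.
have h2 := hc (fun k => r k - a k).
(* On the box r = D + g and a - A_T a = g at the level of coefficients. Subtracting, g cancels, and
   (I - A_T)(r - a) becomes the consistency error D - A_T r. *)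
rewrite [leRHS](_ : _ = \sum_(k <- box n) normc (fcoeff (kernel_op K (zero_ext rho)) k - \sum_(l <- box n) trunc_mx (kernel_mx K) (cutoff q n) k l * r l) ^+ 2) in h2; last first.
  apply: eq_big_seq => k kb; congr (normc _ ^+ 2).
  under eq_bigr do rewrite mulrBr.
  rewrite sumrB {1}/r (residual_eq ir ig hz).
  have := u0 _ kb; rewrite /u.
  move: (fcoeff (kernel_op K (zero_ext rho)) k) (fcoef g k) (a k) (\sum_(l <- _) _ * r l) (\sum_(l <- _) _ * a l) => x1 x2 x3 x4 x5 hu.
  have -> : x1 - x4 = x1 - x4 - (x3 - x5 - x2) by rewrite hu subr0.
  by ring.
have T0 : S ^+ 2 * expR (- (b * cutoff q n)) ^+ 2 <= S ^+ 2 * y ^+ 2.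
  apply: ler_wpM2l; first exact: sqr_ge0.
  by apply: lerXn2r; rewrite ?nnegrE ?expR_ge0//; exact: rate_le.
rewrite -/r.
set sg := \sum_(k <- box n) normc (r k - a k) ^+ 2.
have h3 : sg <= c^-1 * (4 * (S ^+ 2 * y ^+ 2 * H + La ^+ 2 * (4 ^+ p * y ^+ 2 * H))).
  rewrite mulrC ler_pdivlMr// mulrC; apply: (le_trans h2); apply: (le_trans h1).
  by rewrite ler_pM2l// lerD2r exprMn ler_wpM2r.
have kc0 : 0 <= 4 ^+ p + c^-1 * (4 * (S ^+ 2 + La ^+ 2 * 4 ^+ p)) :> R.
  by rewrite addr_ge0 ?exprn_ge0// mulr_ge0 ?invr_ge0 ?(ltW c0)// mulr_ge0// addr_ge0 ?sqr_ge0// mulr_ge0 ?sqr_ge0 ?exprn_ge0.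
set kc := _ + c^-1 * _ in kc0 *.
have -> : Num.sqrt kc * y * Num.sqrt H = Num.sqrt (kc * y ^+ 2 * H).
  rewrite sqrtrM; last by rewrite mulr_ge0 ?sqr_ge0.
  by congr (_ * _); rewrite (sqrtrM _ kc0) sqrtr_sqr ger0_norm.
apply: ler_wsqrtr; apply: (le_trans (lerD (lexx _) h3)).
by rewrite le_eqVlt; apply/orP; left; apply/eqP; rewrite /kc; ring.
Qed.

Lemma galerkin (g : R * R -> C) : inL2 g -> exists c1 c2 : R, 0 < c1 /\ 0 < c2 /\
  exists n0 : nat, forall n : nat, (n0 <= n)%N ->
    (forall phi, inHp p phi ->
       c1 * L2norm (Pn n phi)
         <= L2norm (fun t => Pn n phi t - Ktilde G q n (Pn n phi) t)) /\
    (forall rho, inL2 rho -> L2zero (fun t => rho t - Kop G rho t - g t) ->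
     forall rhot, inXn n rhot ->
       L2zero (fun t => rhot t - Ktilde G q n rhot t - Pn n g t) ->
       ((L2norm (fun t => rho t - rhot t))%:E
          <= (c2 * ((NN n)%:R `^ (- (p%:R / 2))) * ln ((NN n)%:R))%:E
             * Hp_norm p rho)%E).
Proof.
move=> ig.
have [c c0 [n1 hn1]] := matrix_lower V0 be0 hA hRL kernel_mx_inj (cutoff_lim q0).
have [S [La hcons]] := consistency V0 be0 (ltW b0) bbe hA.
(* With the parameter 1 the cutoff is ln N itself, so [n2] makes ln N >= 1; this is all that the
   logarithm in the final estimate requires. *)
have [n2 hn2] := cutoff_lim (@ltr01 R) 1.
have k0 : 0 < 4 ^+ p + c^-1 * (4 * (S ^+ 2 + La ^+ 2 * 4 ^+ p)) :> R.
  rewrite ltr_pwDl ?exprn_gt0// mulr_ge0 ?invr_ge0 ?(ltW c0)// mulr_ge0// addr_ge0 ?sqr_ge0// mulr_ge0 ?sqr_ge0 ?exprn_ge0//.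
exists (Num.sqrt c), (Num.sqrt (4 ^+ p + c^-1 * (4 * (S ^+ 2 + La ^+ 2 * 4 ^+ p)))).
rewrite !sqrtr_gt0; split=> //; split=> //; exists (maxn n1 n2) => n; rewrite geq_max => /andP[le1 le2].
split=> [phi _|rho ir hz rhot hX hz']; first by apply: stability => //; exact: hn1.
have lN : 1 <= ln (NN n)%:R :> R by have := hn2 n le2; rewrite /cutoff mul1r.
have y0 : 0 < (NN n)%:R `^ (- (p%:R / 2)) :> R by rewrite powR_gt0// ltr0n NN_gt0.
(* If the H_p norm is infinite, so is the right side, because its real factor is strictly
   positive. *)
rewrite /Hp_norm; case: ifPn => fin; last first.
  by rewrite gt0_muley ?leey// lte_fin !mulr_gt0 ?sqrtr_gt0// (lt_le_trans ltr01).
rewrite -EFinM lee_fin.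
apply: (le_trans (error_bound c0 (hn1 n le1) (hcons n (cutoff q n)) ir ig fin hz hX hz')).
by rewrite ler_wpM2r ?sqrtr_ge0// ler_peMr// mulr_ge0 ?sqrtr_ge0// ltW.
Qed.
End galerkin.

(** [m0] and [mu_per] stand for the constants M0 and M1. The midpoint between b and the minimum of
    the two bounds lies strictly below both, which leaves room for the tail sums above b. *)
Lemma width_exists (R : realType) (C0 R0 b m0 mu_per : R) : 0 < C0 -> 0 < R0 -> 0 < b ->
  b < C0 ^+ 2 / (Num.sqrt 2 * m0 * mu_per) -> b < R0 / 2 -> 0 <= m0 -> 0 <= mu_per ->
  exists be, [/\ b < be, 0 <= be < R0 & 0 < C0 ^+ 2 - Num.sqrt 2 * be * (m0 * mu_per)].
Proof.
move=> c0 r0 b0; set D := Num.sqrt 2 * m0 * mu_per; set X := _ / D => bX bR h0 h1.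
(* A zero denominator would make the quotient 0 by convention, contradicting 0 < b < X. *)
have D0 : 0 < D.
  rewrite lt_neqAle eq_sym mulr_ge0 ?mulr_ge0 ?sqrtr_ge0// andbT; apply/eqP => D0.
  by move: bX; rewrite /X D0 invr0 mulr0; lra.
have : b < Num.min X (R0 / 2) by rewrite lt_min bX bR.
have : Num.min X (R0 / 2) <= X /\ Num.min X (R0 / 2) <= R0 / 2 by rewrite !ge_min !lexx orbT.
set M := Num.min _ _ => -[MX MR] bM.
exists ((b + M) / 2).
have h : (b + M) / 2 < X by lra.
split; [lra|lra|].
move: h; rewrite /X ltr_pdivlMr// subr_gt0 /D.
by rewrite (_ : Num.sqrt 2 * ((b + M) / 2) * (m0 * mu_per) = (b + M) / 2 * (Num.sqrt 2 * m0 * mu_per)); last by ring.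
Qed.

Theorem theorem4 (R : realType) (p : nat) (G : R * R -> 'rV[R]_3)
    (C0 R0 : R) (F : 'I_3 -> (R[i])^o * (R[i])^o -> (R[i])^o)
    (g : R * R -> R[i]) (b q : R) :
  (0 < p)%N ->
  (* standing assumptions on Gamma *)
  biperiodic G ->
  (forall t, differentiable G t) ->
  torus_boundary G ->
  (* (A1) *)
  assumption_A1 G C0 ->
  (* (A2) *)
  0 < R0 ->
  (forall j : 'I_3, analytic_ext R0 (fun x => G x 0 j) (F j)) ->
  (* I - K injective on L_2 *)
  (forall phi, inL2 phi -> L2zero (fun t => phi t - Kop G phi t) -> L2zero phi) ->
  inHp p g ->
  0 < b ->
  b < Num.min (C0 ^+ 2 / (Num.sqrt 2 * M0 R0 F * M1 R0 F)) (R0 / 2) ->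
  0 < q ->
  p%:R / 2 <= q * b ->
  exists c1 c2 : R, 0 < c1 /\ 0 < c2 /\
  exists n0 : nat, forall n : nat, (n0 <= n)%N ->
    (forall phi, inHp p phi ->
       c1 * L2norm (Pn n phi)
         <= L2norm (fun t => Pn n phi t - Ktilde G q n (Pn n phi) t)) /\
    (forall rho, inL2 rho -> L2zero (fun t => rho t - Kop G rho t - g t) ->
     forall rhot, inXn n rhot ->
       L2zero (fun t => rhot t - Ktilde G q n rhot t - Pn n g t) ->
       ((L2norm (fun t => rho t - rhot t))%:E
          <= (c2 * ((NN n)%:R `^ (- (p%:R / 2))) * ln ((NN n)%:R))%:E
             * Hp_norm p rho)%E).
Proof.
move=> p0 bG dG _ A1 R00 ext inj [ig _] b0 bmin q0 pqb.
have bi j : biper (fun x : R * R => G x 0 j) by move=> x; have [-> ->] := bG x.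
have ed j := ext_data R00 (bi j) (ext j).
have HF j : holo2 (F j) (strip2 R0) by have [] := ed j.
have H0 j : holo2 (cd0 (F j)) (strip2 R0) by have [] := ed j.
have H1 j : holo2 (cd1 (F j)) (strip2 R0) by have [] := ed j.
have pF j : strip_per R0 (F j) by have [_ _ _ []] := ed j.
have pd0 j : strip_per R0 (cd0 (F j)) by have [_ _ _ []] := ed j.
have pd1 j : strip_per R0 (cd1 (F j)) by have [_ _ _ []] := ed j.
have /choice[Bf hB] : forall j, exists M : R, [/\ 0 <= M,
   forall z : R[i]^o * R[i]^o, strip2 R0 z -> normc (cd0 (F j) z) <= M /\ normc (cd1 (F j) z) <= M &
   forall z : R[i]^o * R[i]^o, strip2 R0 z -> [/\ normc (cd0 (cd0 (F j)) z) <= M, normc (cd1 (cd0 (F j)) z) <= M,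
     normc (cd0 (cd1 (F j)) z) <= M & normc (cd1 (cd1 (F j)) z) <= M]].
  by move=> j; have [_ _ _ _ [M h0 [h1 h2]]] := ed j; exists M.
pose B := \sum_(j < 3) Bf j.
have Bj j : Bf j <= B.
  by rewrite /B (bigD1 j)//= lerDl sumr_ge0// => i _; have [] := hB i.
have B0 : 0 <= B by apply: sumr_ge0 => j _; have [] := hB j.
have B1 j (z : R[i]^o * R[i]^o) : strip2 R0 z -> normc (cd0 (F j) z) <= B /\ normc (cd1 (F j) z) <= B.
  move=> hz; have [_ h _] := hB j; have [h1 h2] := h z hz.
  by split; [exact: le_trans h1 (Bj j)|exact: le_trans h2 (Bj j)].
have B2 j (z : R[i]^o * R[i]^o) : strip2 R0 z -> [/\ normc (cd0 (cd0 (F j)) z) <= B, normc (cd1 (cd0 (F j)) z) <= B,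
     normc (cd0 (cd1 (F j)) z) <= B & normc (cd1 (cd1 (F j)) z) <= B].
  move=> hz; have [_ _ h] := hB j; have [h1 h2 h3 h4] := h z hz.
  by split; [exact: le_trans h1 (Bj j)|exact: le_trans h2 (Bj j)|exact: le_trans h3 (Bj j)|exact: le_trans h4 (Bj j)].
have Fg j (x : R * R) : F j (toC x.1, toC x.2) = toC (G x 0 j) by have [U [_ _ _ h]] := ext j; exact: h.
have [C00 _] := A1.
move: bmin; rewrite lt_min => /andP[bm bR].
(* [be] is the width b' at which the kernel is continued; [cpos] is the positive lower constant for
   the real part of the squared distance. *)
have [be [bbe bp cpos]] := width_exists C00 R00 b0 bm bR (sqrtr_ge0 _) (sqrtr_ge0 _).
have mK := Kker_meas R00 HF H0 H1 Fg dG.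
have K1 := Kker_per1 bG.
have K2 := Kker_per2 R00 HF pd0 pd1 Fg bG dG.
have v0 := Kmajorant_ge0 C0 R0 F B0 be.
have mv := @Kmajorant_meas R C0 R0 F B be.
have vi := Kmajorant_int C0 R0 F B0 be.
have k1 := Kv1_ok R00 HF H0 H1 pd0 pd1 B0 B1 B2 Fg bG dG A1 bp cpos.
have k2 := Kv2_ok R00 HF H0 H1 B0 B1 B2 Fg bG dG A1 bp cpos.
have ln := @line_ok R G C0 R0 F B R00 HF H0 H1 pF pd0 pd1 B0 B1 B2 Fg bG dG A1 be bp cpos.
have be0 : 0 <= be by have /andP[] := bp.
apply: (galerkin mK K1 v0 mv vi k2 (V_ge0 v0 vi) b0 bbe q0 pqb _ _ inj ig).
- by move=> k l; exact: (kernel_mx_bound mK K1 K2 v0 mv vi k1 be0 ln).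
- by move=> m e e0; exact: (kernel_mx_RL mK K2 v0 mv vi k1).
Qed.
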